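(* Let $\nu>0$, $T>0$, and let $u$ be a Leray--Hopf weak solution of the incompressible Navier--Stokes equations with viscosity $\nu$ on $\mathbb{R}^3\times[0,T]$ which is regular on $[0,T)$. (a) If $u$ experiences Type-I in space blowup, i.e. there is a constant $C$ such that $\sup_{0<t<T}|u(x,t)|\le\frac{C}{|x|}$ for all $x\ne0$, then $u$ satisfies the energy equality on $[0,T]$. (b) If $u$ experiences Type-I in time blowup, i.e. there is a constant $C$ such that $\sup_{x}|u(x,t)|\le\frac{C}{\sqrt{T-t}}$ for $0<t<T$, and if additionally $d<1$, where $d$ denotes the Hausdorff dimension of the singularity set of $u$ at time $T$, then $u$ satisfies the energy equality on $[0,T]$. Here the energy equality on $[0,T]$ means that for all $0\le t_0\le t\le T$, $$\int_{\mathbb{R}^3}|u(x,t)|^2\,dx-\int_{\mathbb{R}^3}|u(x,t_0)|^2\,dx=-2\nu\int_{t_0}^t\int_{\mathbb{R}^3}|\nabla u(x,\tau)|^2\,dx\,d\tau.$$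
   Context: The Navier--Stokes equations are $\partial_t u+u\cdot\nabla u-\nu\Delta u=-\nabla\pi$, $\nabla\cdot u=0$ on $\mathbb{R}^3\times[0,T]$, with velocity $u$ and pressure $\pi$ (given by Riesz transforms of $u\otimes u$). A Leray--Hopf weak solution is a weak (distributional) solution with $u\in C_w([0,T];L^2)\cap L^\infty L^2\cap L^2H^1$ ($C_w$: weak continuity), divergence-free initial datum $u(0)\in L^2$, satisfying $$\int_{\mathbb{R}^3}|u(t)|^2\,dx\le\int_{\mathbb{R}^3}|u(t_0)|^2\,dx-2\nu\int_{t_0}^t\int_{\mathbb{R}^3}|\nabla u|^2\,dx\,d\tau$$ for all $t\in(0,T]$ and a.e. $t_0\in[0,t]$, including $t_0=0$. For an interval $I\subset[0,T]$, $\mathcal{R}(\mathbb{R}^3\times I)$ is the class of $u\in L^3(I;L^3(\mathbb{R}^3))$ with $\lim_{|y|\to0}\frac1{|y|}\int_{\mathbb{R}^3\times I}|u(x+y,t)-u(x,t)|^3\,dx\,dt=0$; for $U\subset\mathbb{R}^3$ open, $\mathcal{R}(U\times I)$ is the class of $u$ with $u\phi\in\mathcal{R}(\mathbb{R}^3\times I)$ for all $\phi\in C_0^\infty(U)$. A point $(x_0,t_0)\in\mathbb{R}^3\times[0,T]$ is Onsager regular if $u\in\mathcal{R}(U\times I)$ for some open $U\subset\mathbb{R}^3$ and relatively open interval $I\subset[0,T]$ with $(x_0,t_0)\in U\times I$, and Onsager singular otherwise. The (postinitial) singularity set $S$ is the set of Onsager singular points $(x,t)$ with $t>0$. ''Regular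 on $[0,T)$'' means that singularities occur only at the final time, i.e. $S\subset\mathbb{R}^3\times\{T\}$; the singularity set at time $T$ is $S$ identified with its spatial slice $\{x:(x,T)\in S\}\subset\mathbb{R}^3$. *)

(* Defs.v *)
From HB Require Import structures.
From mathcomp Require Import all_boot all_order all_algebra.
From mathcomp Require Import all_classical all_reals all_analysis.

Set Implicit Arguments.
Unset Strict Implicit.
Unset Printing Implicit Defensive.

Import Order.TTheory GRing.Theory Num.Theory.
Import numFieldNormedType.Exports.

Local Open Scope classical_set_scope.
Local Open Scope ring_scope.

(* R^3 is an iterated product in order to inherit the product topology, the
   Borel sigma-algebra and the product Lebesgue measure. The library norm `|x|
   on this type is the sup norm; the Euclidean norm is [enorm] below. *)
Notation R3 R := (R * R * R)%type.

Notation leb R := (@lebesgue_measure R).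
Notation leb3 R := (product_measure1
  (product_measure1 (@lebesgue_measure R) (@lebesgue_measure R))
  (@lebesgue_measure R)).
Notation leb3t R := (product_measure1 (leb3 R) (@lebesgue_measure R)).

Section Euclidean.
Context {R : realType}.
Implicit Types x y : R3 R.

Definition comp3 (i : 'I_3) (x : R3 R) : R :=
  tnth [tuple x.1.1; x.1.2; x.2] i.

Definition evec (i : 'I_3) : R3 R :=
  ((i == 0%N :> nat)%:R, (i == 1%N :> nat)%:R, (i == 2%N :> nat)%:R).

Definition dot (x y : R3 R) : R := \sum_(i < 3) comp3 i x * comp3 i y.

Definition enorm (x : R3 R) : R := Num.sqrt (dot x x).

Definition frobenius (A : 'M[R]_3) : R :=
  Num.sqrt (\sum_(i < 3) \sum_(j < 3) A i j ^+ 2).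

End Euclidean.

Section TestFunctions.
Context {R : realType} {V : normedModType R}.

Definition iter_derive (s : seq V) (f : V -> R) : V -> R :=
  foldr (fun v g x => 'D_v g x) f s.

Definition smooth (f : V -> R) : Prop :=
  forall s : seq V, continuous (iter_derive s f) /\
    forall x v, derivable (iter_derive s f) x v.

Definition test_function (A : set V) (f : V -> R) : Prop :=
  smooth f /\
  exists K : set V, [/\ compact K, K `<=` A & forall x, ~ K x -> f x = 0].

End TestFunctions.

Section HausdorffDimension.
Context {R : realType}.
Local Open Scope ereal_scope.

Definition diam (U : set (R3 R)) : \bar R :=
  ereal_sup [set (enorm (z.1 - z.2)%R)%:E | z in U `*` U].

(* The empty set contributes 0, also when s = 0. *)
Definition hausdorff_weight (s : R) (U : set (R3 R)) : \bar R :=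
  if U == set0 then 0 else diam U `^ s.

Definition hausdorff_pre (s delta : R) (A : set (R3 R)) : \bar R :=
  ereal_inf [set \sum_(0 <= k <oo) hausdorff_weight s (U k) |
    U in [set U : (set (R3 R))^nat |
      A `<=` \bigcup_k U k /\ forall k, diam (U k) <= delta%:E]].

Definition hausdorff_measure (s : R) (A : set (R3 R)) : \bar R :=
  ereal_sup [set hausdorff_pre s delta A | delta in [set d : R | (0 < d)%R]].

Definition hausdorff_dim (A : set (R3 R)) : \bar R :=
  ereal_inf [set s%:E | s in
    [set s : R | (0 <= s)%R /\ hausdorff_measure s A = 0]].

End HausdorffDimension.

Section RieszTransforms.
Context {R : realType}.

(* c_3 x_j / |x|^4 with c_3 = Gamma(2) / pi^2; the Fourier symbol of the j-th
   Riesz transform is - i xi_j / |xi|. *)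
Definition riesz_kernel (j : 'I_3) (x : R3 R) : R :=
  (pi ^+ 2)^-1 * comp3 j x / enorm x ^+ 4.

(* g = R_j f, as a principal value almost everywhere. *)
Definition is_riesz (j : 'I_3) (f g : R3 R -> R) : Prop :=
  measurable_fun setT g /\
  {ae leb3 R, forall x,
    (\int[leb3 R]_(y in [set y | e < enorm y]) (riesz_kernel j y * f (x - y)))
      @[e --> 0^'+] --> g x}.

(* p = \sum_(i, j) R_i R_j (v_i v_j). *)
Definition is_pressure (v : R3 R -> R3 R) (p : R3 R -> R) : Prop :=
  exists r q : 'I_3 -> 'I_3 -> R3 R -> R,
    (forall i j, is_riesz j (fun x => comp3 i (v x) * comp3 j (v x)) (r i j) /\
                 is_riesz i (r i j) (q i j)) /\
    {ae leb3 R, forall x, p x = \sum_(i < 3) \sum_(j < 3) q i j x}.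

End RieszTransforms.

Section NavierStokes.
Context {R : realType}.

(* A velocity u, its gradient Du and the pressure p are maps
   (time) -> (space) -> value, with Du t x i j = d_j u_i (x, t). Only times in
   [0, T] matter. Elements of Lebesgue spaces are represented by Borel
   functions. *)
Implicit Types (u w : R -> R3 R -> R3 R) (Du : R -> R3 R -> 'M[R]_3).
Implicit Types (p : R -> R3 R -> R) (nu T : R).

Definition d_x (j : 'I_3) (phi : R3 R * R -> R) (z : R3 R * R) : R :=
  'D_((evec j, 0) : R3 R * R) phi z.
Definition d_t (phi : R3 R * R -> R) (z : R3 R * R) : R :=
  'D_((0, 1) : R3 R * R) phi z.
Definition laplacian (phi : R3 R * R -> R) (z : R3 R * R) : R :=
  \sum_(j < 3) d_x j (d_x j phi) z.

Definition energy u (t : R) : \bar R :=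
  (\int[leb3 R]_x ((enorm (u t x)) ^+ 2)%:E)%E.

Definition dissipation Du (t0 t : R) : \bar R :=
  (\int[leb R]_(s in `[t0, t]) \int[leb3 R]_x ((frobenius (Du s x)) ^+ 2)%:E)%E.

Definition L2_field (v : R3 R -> R3 R) : Prop :=
  measurable_fun setT v /\
  (\int[leb3 R]_x ((enorm (v x)) ^+ 2)%:E < +oo)%E.

Definition divergence_free (v : R3 R -> R3 R) : Prop :=
  forall psi : R3 R -> R, test_function setT psi ->
    \int[leb3 R]_x (\sum_(i < 3) comp3 i (v x) * 'D_(evec i) psi x) = 0.

Definition weak_gradient (v : R3 R -> R3 R) (G : R3 R -> 'M[R]_3) : Prop :=
  forall (i j : 'I_3) (psi : R3 R -> R), test_function setT psi ->
    \int[leb3 R]_x (comp3 i (v x) * 'D_(evec j) psi x) =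
    - \int[leb3 R]_x (G x i j * psi x).

Definition NS_distributional nu T u p : Prop :=
  forall phi : R3 R * R -> R, test_function (setT `*` `]0, T[) phi ->
    (forall i : 'I_3,
      \int[leb3t R]_(z in setT `*` `]0, T[)
        (comp3 i (u z.2 z.1) * d_t phi z
         + \sum_(j < 3) comp3 i (u z.2 z.1) * comp3 j (u z.2 z.1) * d_x j phi z
         + nu * comp3 i (u z.2 z.1) * laplacian phi z
         + p z.2 z.1 * d_x i phi z) = 0) /\
    \int[leb3t R]_(z in setT `*` `]0, T[)
      (\sum_(i < 3) comp3 i (u z.2 z.1) * d_x i phi z) = 0.

Definition weakly_continuous_L2 T u : Prop :=
  (forall t : R, 0 <= t <= T -> L2_field (u t)) /\
  forall v, L2_field v ->
    {within `[0, T], continuous (fun t => \int[leb3 R]_x (dot (u t x) (v x)))}.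

Definition Linfty_L2 T u : Prop :=
  exists M : R, {ae leb R, forall t : R, 0 <= t <= T -> (energy u t <= M%:E)%E}.

(* Together with [Linfty_L2], u in L^2(0, T; H^1) with gradient Du. *)
Definition L2_H1 T u Du : Prop :=
  [/\ forall i j, measurable_fun (setT `*` `[0, T] : set (R3 R * R))
                    (fun z => Du z.2 z.1 i j),
      {ae leb R, forall t : R, 0 <= t <= T -> weak_gradient (u t) (Du t)}
    & (dissipation Du 0 T < +oo)%E].

Definition energy_inequality nu u Du (t0 t : R) : Prop :=
  (energy u t <= energy u t0 - (2 * nu)%:E * dissipation Du t0 t)%E.

Record leray_hopf nu T u Du p : Prop := LerayHopf {
  lh_measurable : measurable_fun (setT `*` `[0, T] : set (R3 R * R))
                    (fun z => u z.2 z.1);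
  lh_measurable_pressure :
    measurable_fun (setT `*` `[0, T] : set (R3 R * R)) (fun z => p z.2 z.1);
  lh_equation : NS_distributional nu T u p;
  lh_pressure :
    {ae leb R, forall t : R, 0 <= t <= T -> is_pressure (u t) (p t)};
  lh_weakly_continuous : weakly_continuous_L2 T u;
  lh_Linfty_L2 : Linfty_L2 T u;
  lh_L2_H1 : L2_H1 T u Du;
  lh_initial : divergence_free (u 0);
  lh_energy : forall t : R, 0 < t <= T ->
    {ae leb R, forall t0 : R, 0 <= t0 <= t -> energy_inequality nu u Du t0 t};
  lh_energy0 : forall t : R, 0 < t <= T -> energy_inequality nu u Du 0 t
}.

Definition onsager_class_global (I : set R) w : Prop :=
  [/\ measurable_fun (setT `*` I : set (R3 R * R)) (fun z => w z.2 z.1),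
      (\int[leb3t R]_(z in setT `*` I) ((enorm (w z.2 z.1)) ^+ 3)%:E < +oo)%E
    & ((enorm y)^-1%:E * \int[leb3t R]_(z in setT `*` I)
         ((enorm (w z.2 (z.1 + y) - w z.2 z.1)) ^+ 3)%:E)%E
        @[y --> (0 : R3 R)^'] --> 0%E].

Definition onsager_class (U : set (R3 R)) (I : set R) u : Prop :=
  forall phi : R3 R -> R, test_function U phi ->
    onsager_class_global I (fun t x => phi x *: u t x).

Definition relatively_open_interval T (I : set R) : Prop :=
  is_interval I /\ exists O : set R, open O /\ I = O `&` `[0, T].

Definition onsager_regular T u (x0 : R3 R) (t0 : R) : Prop :=
  exists (U : set (R3 R)) (I : set R),
    [/\ open U, relatively_open_interval T I, U x0, I t0 & onsager_class U I u].

(* The postinitial singularity set S, in R^3 x (0, T]. *)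
Definition singular_set T u : set (R3 R * R) :=
  [set z | 0 < z.2 <= T /\ ~ onsager_regular T u z.1 z.2].

Definition regular_before T u : Prop :=
  singular_set T u `<=` [set z | z.2 = T].

Definition singular_set_final T u : set (R3 R) :=
  [set x | singular_set T u (x, T)].

(* Since u(t) is an element of L^2, pointwise bounds hold almost everywhere in
   space, for every time. *)
Definition type_I_space T u : Prop :=
  exists C : R, forall t : R, 0 < t < T ->
    {ae leb3 R, forall x, x != 0 -> enorm (u t x) <= C / enorm x}.

Definition type_I_time T u : Prop :=
  exists C : R, forall t : R, 0 < t < T ->
    {ae leb3 R, forall x, enorm (u t x) <= C / Num.sqrt (T - t)}.

Definition energy_equality nu T u Du : Prop :=
  forall t0 t : R, 0 <= t0 -> t0 <= t -> t <= T ->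
    (energy u t - energy u t0 = - ((2 * nu)%:E * dissipation Du t0 t))%E.

End NavierStokes.

(* Main.v *)
(* Mollify u in space at scale e. Testing the equation with
   eta_e(x - y) psi(t) yields, for every e,
     E_e(b) - E_e(a) = 2 int_a^b (flux_e - nu |grad u_e|^2) dt,
   where flux_e is the sum of the integrals of (d_j u_i)_e (u_i u_j)_e. The
   pressure drops out: at almost every time it lies in L^1 + L^2, because a
   double Riesz transform of u_i u_j is the convolution of u . grad u with a
   kernel of size |x|^-2.

   If multiplication by u(t) maps H^1 to L^2, boundedly for a < t < b, then
   flux_e tends to the sum of the integrals of (d_j u_i) u_i u_j, which vanishes
   since u is divergence free, and dominated convergence gives the energy
   equality on [a, b]. For (a), Hardy's inequality makes |u| <= C / |x| such a
   multiplier on all of [0, T]. For (b), |u| <= C / sqrt(T - t) is one on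
   [0, t] for every t < T.

   To reach T in (b), mollify at scale e = sqrt(h) / a on [s, T], where s in
   [T - h, T] has |grad u(s)|^2 at most the average of |grad u|^2 over
   [T - h, T], up to 1. Then |flux_e| <= (c / e) (T - t)^(-1/2) contributes
   O(a), and the energy lost by mollifying u(s) is
   O(e |grad u(s)|) = o(1) / a as h -> 0. Letting h and then a tend to 0,
   E(T) >= E(0) - 2 nu int_0^T |grad u|^2; the energy inequality is the
   converse. *)

Require Import Defs.
From HB Require Import structures.
From mathcomp Require Import all_boot all_order all_algebra.
From mathcomp Require Import all_classical all_reals all_analysis.
From mathcomp Require Import measurable_realfun ring lra.
Import Order.TTheory GRing.Theory Num.Theory.
Import numFieldNormedType.Exports.

Set Implicit Arguments.
Unset Strict Implicit.
Unset Printing Implicit Defensive.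

Local Open Scope classical_set_scope.
Local Open Scope ring_scope.

(** * Integrable and square integrable functions *)

(** The equation is distributional in time, so the energy is never differentiated directly. With x
    fixed, testing with k(x - y) psi(t) shows that the mollified velocity at x has an integrable
    weak derivative in time, and weak continuity fixes its values at every time. The square of an
    indefinite integral comes from Fubini on a triangle, and x is integrated out last. This last
    exchange needs an L^2 bound on the mollified force that is integrable in time, so the L^1 + L^2
    bound on the pressure is quantitative: it is of size |u| |grad u| in L^2 norms, dominated by a
    constant plus a multiple of |grad u|^2. The three Riesz kernels are the partial derivatives of
    one function of size |x|^-2. A single transform of f is then a convolution with a derivative of
    f, and the second transform asks only for the oddness of the kernel, no Calderon-Zygmund theory.
    Near T the flux error asks that e be large against sqrt(h), the mollification error that e be
    small against sqrt(h) divided by the square root of the dissipation on [T - h, T]. Both hold for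
    e = sqrt(h) / a because this dissipation tends to 0. *)

Definition Li d (T : measurableType d) (R : realType)
  (mu : {measure set T -> \bar R}) (f : T -> R) : Prop :=
  mu.-integrable setT (EFin \o f).

Definition L2 d (T : measurableType d) (R : realType)
  (mu : {measure set T -> \bar R}) (f : T -> R) : Prop :=
  measurable_fun setT f /\ Li mu (fun x => f x ^+ 2).

Section integrable_functions.
Context d (T : measurableType d) (R : realType).
Variable mu : {measure set T -> \bar R}.
Implicit Types f g h k : T -> R.

Lemma Li_measurable f : Li mu f -> measurable_fun setT f.
Proof. by move=> /measurable_int /measurable_EFinP. Qed.

Lemma Li_le g f : measurable_fun setT f -> (forall x, `|f x| <= g x) ->
  Li mu g -> Li mu f.
Proof.
move=> mf fg ig; apply: (le_integrable measurableT _ _ ig) => /=.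
  exact/measurable_EFinP.
by move=> x _ /=; rewrite lee_fin (le_trans (fg x))// ler_norm.
Qed.

Lemma eq_Li g f : f =1 g -> Li mu g -> Li mu f.
Proof. by move=> fg; rewrite (_ : f = g)//; apply/funext. Qed.

Lemma LiD f g : Li mu f -> Li mu g -> Li mu (fun x => f x + g x).
Proof. by move=> i j; apply: (integrableD measurableT i j). Qed.

Lemma LiB f g : Li mu f -> Li mu g -> Li mu (fun x => f x - g x).
Proof. by move=> i j; apply: (integrableB measurableT i j). Qed.

Lemma LiN f : Li mu f -> Li mu (fun x => - f x).
Proof. by move=> i; apply: (integrableN i). Qed.

Lemma LiZ c f : Li mu f -> Li mu (fun x => c * f x).
Proof. by move=> i; apply: (integrableZl measurableT c i). Qed.

Lemma LiZr c f : Li mu f -> Li mu (fun x => f x * c).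
Proof. by move=> i; apply: (eq_Li _ (LiZ c i)) => x; rewrite mulrC. Qed.

Lemma Li0 : Li mu (fun _ => 0).
Proof. exact: integrable0. Qed.

Lemma Li_sum (I : Type) (s : seq I) (F : I -> T -> R) :
  (forall i, Li mu (F i)) -> Li mu (fun x => \sum_(i <- s) F i x).
Proof.
move=> iF; elim: s => [|a s IH].
  by apply: (eq_Li _ Li0) => x; rewrite big_nil.
by apply: (eq_Li _ (LiD (iF a) IH)) => x; rewrite big_cons.
Qed.

Lemma Li_norm f : Li mu f -> Li mu (fun x => `|f x|).
Proof. by move=> i; apply: (integrable_norm i). Qed.

Lemma RI_E f : Li mu f -> (\int[mu]_x (f x)%:E = (\int[mu]_x f x)%:E)%E.
Proof. by move=> i; rewrite /Rintegral fineK//; exact: integrable_fin_num. Qed.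

Lemma Li_lty f : measurable_fun setT f -> (\int[mu]_x `|f x|%:E < +oo)%E ->
  Li mu f.
Proof. by move=> mf h; apply/integrableP; split; [exact/measurable_EFinP|]. Qed.

Lemma Li_ltyP f : Li mu f -> (\int[mu]_x `|f x|%:E < +oo)%E.
Proof. by move=> /integrableP[_]. Qed.

Lemma Li_ge0_lty f : measurable_fun setT f -> (forall x, 0 <= f x) ->
  (\int[mu]_x (f x)%:E < +oo)%E -> Li mu f.
Proof.
move=> mf f0 h; apply: Li_lty => //.
by under eq_integral do rewrite (ger0_norm (f0 _)).
Qed.

Lemma RID f g : Li mu f -> Li mu g ->
  \int[mu]_x (f x + g x) = \int[mu]_x f x + \int[mu]_x g x.
Proof. by move=> i j; rewrite RintegralD. Qed.

Lemma RIB f g : Li mu f -> Li mu g ->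
  \int[mu]_x (f x - g x) = \int[mu]_x f x - \int[mu]_x g x.
Proof. by move=> i j; rewrite RintegralB. Qed.

Lemma RIZ c f : Li mu f -> \int[mu]_x (c * f x) = c * \int[mu]_x f x.
Proof. by move=> i; rewrite RintegralZl. Qed.

Lemma RIZr c f : Li mu f -> \int[mu]_x (f x * c) = (\int[mu]_x f x) * c.
Proof. by move=> i; rewrite RintegralZr. Qed.

Lemma RI0 : \int[mu]_x (0 : R) = 0.
Proof. by rewrite /Rintegral integral0. Qed.

Lemma eq_RI f g : f =1 g -> \int[mu]_x f x = \int[mu]_x g x.
Proof. by move=> fg; rewrite (_ : f = g)//; apply/funext. Qed.

Lemma RIN f : Li mu f -> \int[mu]_x (- f x) = - \int[mu]_x f x.
Proof.
by move=> i; rewrite -mulN1r -RIZ//; apply: eq_RI => x; rewrite mulN1r.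
Qed.

Lemma RI_sum (I : Type) (s : seq I) (F : I -> T -> R) :
  (forall i, Li mu (F i)) ->
  \int[mu]_x (\sum_(i <- s) F i x) = \sum_(i <- s) \int[mu]_x F i x.
Proof.
move=> iF; elim: s => [|a s IH].
  by rewrite big_nil (eq_RI (g := fun _ => 0)) ?RI0// => x; rewrite big_nil.
rewrite big_cons -IH -RID//; last exact: Li_sum.
by apply: eq_RI => x; rewrite big_cons.
Qed.

Lemma RI_le f g : Li mu f -> Li mu g -> (forall x, f x <= g x) ->
  \int[mu]_x f x <= \int[mu]_x g x.
Proof. by move=> i j fg; apply: le_Rintegral. Qed.

Lemma RI_ge0 f : (forall x, 0 <= f x) -> 0 <= \int[mu]_x f x.
Proof. by move=> f0; apply: Rintegral_ge0 => x _; exact: f0. Qed.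

Lemma RI_norm f : Li mu f -> `|\int[mu]_x f x| <= \int[mu]_x `|f x|.
Proof. by move=> i; apply: le_normr_Rintegral. Qed.

Lemma RI_norm_le f g : Li mu f -> Li mu g -> (forall x, `|f x| <= g x) ->
  `|\int[mu]_x f x| <= \int[mu]_x g x.
Proof.
by move=> i j fg; rewrite (le_trans (RI_norm i))// RI_le//; exact: Li_norm.
Qed.

Lemma RI_ae f g : Li mu f -> measurable_fun setT g ->
  {ae mu, forall x, f x = g x} -> \int[mu]_x f x = \int[mu]_x g x.
Proof.
move=> i mg fg; rewrite /Rintegral; congr fine; apply: ae_eq_integral => //.
- exact: measurable_int i.
- exact/measurable_EFinP.
- by apply: filterS fg => x /= + _ => ->.
Qed.

Lemma Li_ae f g : Li mu f -> measurable_fun setT g ->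
  {ae mu, forall x, f x = g x} -> Li mu g.
Proof.
move=> i mg fg; apply/integrableP; split; first exact/measurable_EFinP.
move: (i) => /integrableP[_]; congr (_ < _)%E; apply: ae_eq_integral => //.
- by apply: measurableT_comp => //; exact: measurable_int i.
- by apply: measurableT_comp => //; exact/measurable_EFinP.
- by apply: filterS fg => x /= + _ => ->.
Qed.

(** The domination in [Li_le] is pointwise everywhere. The function min(|f|, |g|) is dominated
    everywhere, hence integrable, and it agrees with |f| almost everywhere. *)
Lemma Li_le_ae g f : measurable_fun setT f -> {ae mu, forall x, `|f x| <= g x} ->
  Li mu g -> Li mu f.
Proof.
move=> mf fg ig; have mg := Li_measurable ig.
have ig' := Li_norm ig.
have mm : measurable_fun setT (fun x => Num.min `|f x| `|g x|).
  by apply: measurable_minr; apply: measurableT_comp.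
have im : Li mu (fun x => Num.min `|f x| `|g x|).
  apply: (Li_le mm _ ig') => x; have m0 : 0 <= Num.min `|f x| `|g x| by rewrite le_min !normr_ge0.
  by rewrite (ger0_norm m0) ge_min lexx orbT.
have inf : Li mu (fun x => `|f x|).
  apply: (Li_ae im); first exact: measurableT_comp.
  apply: filterS fg => x /= fx; apply/min_idPl.
  exact: le_trans fx (ler_norm _).
by apply: (Li_le mf _ inf).
Qed.

Lemma RI_le_ae f g : Li mu f -> Li mu g -> {ae mu, forall x, f x <= g x} ->
  \int[mu]_x f x <= \int[mu]_x g x.
Proof.
move=> i j fg.
have mm : measurable_fun setT (fun x => Num.max (f x) (g x)).
  by apply: measurable_maxr; exact: Li_measurable.
have e : {ae mu, forall x, g x = Num.max (f x) (g x)}.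
  by apply: filterS fg => x /= /max_idPr.
rewrite (RI_ae j mm e); apply: RI_le => //; first exact: (Li_ae j).
by move=> x; rewrite le_max lexx.
Qed.

Lemma Li_dct (f_ : nat -> T -> R) f g :
  (forall n, measurable_fun setT (f_ n)) -> measurable_fun setT f ->
  {ae mu, forall x, f_ ^~ x @ \oo --> f x} ->
  Li mu g -> {ae mu, forall x n, `|f_ n x| <= g x} ->
  Li mu f /\ (\int[mu]_x f_ n x @[n --> \oo] --> \int[mu]_x f x).
Proof.
move=> mf_ mf cf ig fg.
have [i _ c] := @dominated_convergence _ _ _ mu setT measurableT
  (fun n x => (f_ n x)%:E) (EFin \o f) (EFin \o g)
  (fun n => proj2 (@measurable_EFinP _ _ _ _ _) (mf_ n))
  (proj2 (@measurable_EFinP _ _ _ _ _) mf)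
  ltac:(by apply: filterS cf => x /= + _; move=> h; apply: cvg_EFin => //; exact: nearW)
  ig ltac:(by apply: filterS fg => x /= + n _; move=> h; rewrite lee_fin; exact: h).
split => //; apply: fine_cvg; rewrite fineK//.
exact: integrable_fin_num.
Qed.

Lemma quadratic_ge0 (a b c : R) : 0 <= c -> (forall t, 0 <= a - 2 * t * b + t ^+ 2 * c) ->
  b ^+ 2 <= a * c.
Proof.
rewrite le_eqVlt => /predU1P[<-|c0] h.
  rewrite mulr0; have [->|b0] := eqVneq b 0; first by rewrite expr0n.
  (* With c = 0 the quadratic is affine in t, and this t gives it the value -1. *)
  have := h ((a + 1) / (2 * b)).
  have -> : a - 2 * ((a + 1) / (2 * b)) * b + ((a + 1) / (2 * b)) ^+ 2 * 0 = - 1.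
    by field.
  by rewrite ler0N1.
have := h (b / c).
have -> : a - 2 * (b / c) * b + (b / c) ^+ 2 * c = (a * c - b ^+ 2) / c.
  by field; lra.
by rewrite pmulr_lge0 ?invr_gt0// subr_ge0.
Qed.

(** Expands the integral of k (f - t g)^2. The weight lets a convolution kernel play the part of the
    measure, as in the proofs of [young2] and [N2_conv_sub]. *)
Lemma weighted_CS k f g : (forall x, 0 <= k x) ->
  Li mu (fun x => k x * f x ^+ 2) -> Li mu (fun x => k x * g x ^+ 2) ->
  Li mu (fun x => k x * (f x * g x)) ->
  (\int[mu]_x (k x * (f x * g x))) ^+ 2 <=
  (\int[mu]_x (k x * f x ^+ 2)) * (\int[mu]_x (k x * g x ^+ 2)).
Proof.
move=> k0 iff' igg ifg; apply: quadratic_ge0.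
  by apply: RI_ge0 => x; rewrite mulr_ge0// sqr_ge0.
move=> t; rewrite -RIZ// -RIZ// -RIB//; last exact: LiZ.
rewrite -RID//; [|by apply: LiB => //; apply: LiZ|exact: LiZ].
apply: RI_ge0 => x.
have -> : k x * f x ^+ 2 - 2 * t * (k x * (f x * g x)) + t ^+ 2 * (k x * g x ^+ 2)
  = k x * (f x - t * g x) ^+ 2 by ring.
by rewrite mulr_ge0// sqr_ge0.
Qed.

Lemma L2_measurable f : L2 mu f -> measurable_fun setT f. Proof. by case. Qed.

Lemma L2_sq f : L2 mu f -> Li mu (fun x => f x ^+ 2). Proof. by case. Qed.

Lemma L2M f g : L2 mu f -> L2 mu g -> Li mu (fun x => f x * g x).
Proof.
move=> [mf f2] [mg g2]; apply: (@Li_le (fun x => f x ^+ 2 + g x ^+ 2)).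
- exact: measurable_funM.
- move=> x; rewrite normrM -(real_normK (num_real (f x))).
  rewrite -(real_normK (num_real (g x))).
  set a := `|f x|; set b := `|g x|.
  have : 0 <= (a - b) ^+ 2 by exact: sqr_ge0.
  have : 0 <= a * b by rewrite mulr_ge0 ?normr_ge0.
  nra.
- exact: LiD.
Qed.

Lemma L2D f g : L2 mu f -> L2 mu g -> L2 mu (fun x => f x + g x).
Proof.
move=> Lf Lg; split.
  by apply: measurable_funD; [case: Lf|case: Lg].
apply: (@eq_Li (fun x => f x ^+ 2 + 2 * (f x * g x) + g x ^+ 2)).
  by move=> x; ring.
apply: LiD; last by case: Lg.
by apply: LiD; [case: Lf|apply: LiZ; exact: L2M].
Qed.

Lemma L2Z c f : L2 mu f -> L2 mu (fun x => c * f x).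
Proof.
move=> Lf; split; first by apply: measurable_funM => //; case: Lf.
apply: (@eq_Li (fun x => c ^+ 2 * f x ^+ 2)); first by move=> x; ring.
by apply: LiZ; case: Lf.
Qed.

Lemma L2N f : L2 mu f -> L2 mu (fun x => - f x).
Proof.
by move=> /(L2Z (-1)); rewrite (_ : (fun x => -1 * f x) = (fun x => - f x))//;
  apply/funext => x; rewrite mulN1r.
Qed.

Lemma L2B f g : L2 mu f -> L2 mu g -> L2 mu (fun x => f x - g x).
Proof. by move=> Lf /L2N Lg; exact: L2D. Qed.

Lemma L2_norm f : L2 mu f -> L2 mu (fun x => `|f x|).
Proof.
move=> [mf Lf]; split; first exact: measurableT_comp.
by apply: (eq_Li _ Lf) => x; rewrite real_normK// num_real.
Qed.

Lemma L2_le g f : measurable_fun setT f -> (forall x, `|f x| <= `|g x|) ->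
  L2 mu g -> L2 mu f.
Proof.
move=> mf fg [mg Lg]; split => //; apply: (Li_le _ _ Lg).
  exact: measurable_funX.
move=> x; rewrite ger0_norm ?sqr_ge0//.
by rewrite -(real_normK (num_real (f x))) -(real_normK (num_real (g x)))
  lerXn2r ?nnegrE.
Qed.

Lemma L2_0 : L2 mu (fun _ => 0).
Proof.
split => //; apply: (eq_Li _ Li0) => x; by rewrite expr0n.
Qed.

Lemma L2_sum (I : Type) (s : seq I) (F : I -> T -> R) :
  (forall i, L2 mu (F i)) -> L2 mu (fun x => \sum_(i <- s) F i x).
Proof.
move=> iF; elim: s => [|a s IH].
  rewrite (_ : (fun _ => _) = (fun _ => 0)); first exact: L2_0.
  by apply/funext => x; rewrite big_nil.
rewrite (_ : (fun _ => _) = (fun x => F a x + \sum_(i <- s) F i x)).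
  exact: L2D.
by apply/funext => x; rewrite big_cons.
Qed.

Lemma CS f g : L2 mu f -> L2 mu g ->
  (\int[mu]_x (f x * g x)) ^+ 2 <=
  (\int[mu]_x (f x ^+ 2)) * (\int[mu]_x (g x ^+ 2)).
Proof.
move=> Lf Lg.
have := @weighted_CS (fun _ => 1) f g (fun _ => ler01).
have e h : (fun x => 1 * h x) = h :> (T -> R).
  by apply/funext => x; rewrite mul1r.
rewrite (e (fun x => f x ^+ 2)) (e (fun x => g x ^+ 2)) (e (fun x => f x * g x)).
by apply; [exact: L2_sq|exact: L2_sq|exact: L2M].
Qed.

(** The real integral reads an infinite value as 0, so a bound on [N2 f] has content only together
    with [L2 f]. For this reason the two are usually stated as a pair. *)
Definition N2 f : R := Num.sqrt (\int[mu]_x (f x ^+ 2)).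

Lemma N2_ge0 f : 0 <= N2 f. Proof. exact: sqrtr_ge0. Qed.

Lemma N2_sqr f : N2 f ^+ 2 = \int[mu]_x (f x ^+ 2).
Proof. by rewrite sqr_sqrtr// RI_ge0// => x; rewrite sqr_ge0. Qed.

Lemma CS_N2 f g : L2 mu f -> L2 mu g ->
  `|\int[mu]_x (f x * g x)| <= N2 f * N2 g.
Proof.
move=> Lf Lg; rewrite -(@ler_pXn2r _ 2)// ?nnegrE ?mulr_ge0 ?N2_ge0//.
rewrite exprMn !N2_sqr real_normK ?num_real//; exact: CS.
Qed.

Lemma CS_N2_abs f g : L2 mu f -> L2 mu g ->
  \int[mu]_x `|f x * g x| <= N2 f * N2 g.
Proof.
move=> Lf Lg; have := CS_N2 (L2_norm Lf) (L2_norm Lg).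
rewrite /N2 (eq_RI (f := fun x => `|f x| ^+ 2) (g := fun x => f x ^+ 2)); last first.
  by move=> x; rewrite real_normK ?num_real.
rewrite (eq_RI (f := fun x => `|g x| ^+ 2) (g := fun x => g x ^+ 2)); last first.
  by move=> x; rewrite real_normK ?num_real.
apply: le_trans; rewrite (eq_RI (g := fun x => `|f x| * `|g x|)) ?ler_norm//.
by move=> x; rewrite normrM.
Qed.

Lemma eq_N2 f g : f =1 g -> N2 f = N2 g.
Proof. by move=> /funext ->. Qed.

Lemma N2Z c f : L2 mu f -> N2 (fun x => c * f x) = `|c| * N2 f.
Proof.
move=> Lf; rewrite /N2 (eq_RI (g := fun x => c ^+ 2 * f x ^+ 2)); last first.
  by move=> x; ring.
by rewrite (RIZ _ (L2_sq Lf)) sqrtrM ?sqr_ge0// sqrtr_sqr.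
Qed.

Lemma N2D f g : L2 mu f -> L2 mu g -> N2 (fun x => f x + g x) <= N2 f + N2 g.
Proof.
move=> Lf Lg; rewrite -(@ler_pXn2r _ 2)// ?nnegrE ?addr_ge0 ?N2_ge0//.
rewrite N2_sqr (eq_RI (g := fun x => f x ^+ 2 + g x ^+ 2 + 2 * (f x * g x))); last first.
  by move=> x; ring.
have i1 := L2_sq Lf; have i2 := L2_sq Lg; have i3 := L2M Lf Lg.
rewrite RID//; [|exact: LiD|exact: LiZ]; rewrite RID// RIZ//.
have := CS_N2 Lf Lg; have := ler_norm (\int[mu]_x (f x * g x)).
by rewrite -!N2_sqr; nra.
Qed.

Lemma N2N f : N2 (fun x => - f x) = N2 f.
Proof. by rewrite /N2; congr Num.sqrt; apply: eq_RI => x; rewrite sqrrN. Qed.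

Lemma N2B f g : L2 mu f -> L2 mu g -> N2 (fun x => f x - g x) <= N2 f + N2 g.
Proof. by move=> Lf Lg; rewrite -(N2N g); apply: N2D => //; exact: L2N. Qed.

Lemma N2_sum (I : Type) (s : seq I) (F : I -> T -> R) :
  (forall i, L2 mu (F i)) ->
  N2 (fun x => \sum_(i <- s) F i x) <= \sum_(i <- s) N2 (F i).
Proof.
move=> iF; elim: s => [|a s IH].
  rewrite big_nil /N2 (eq_RI (g := fun _ => 0)) ?RI0 ?sqrtr0//.
  by move=> x; rewrite big_nil expr0n.
rewrite big_cons (@eq_N2 _ (fun x => F a x + \sum_(i <- s) F i x)); last first.
  by move=> x; rewrite big_cons.
by rewrite (le_trans (N2D _ _))// ?lerD2l//; exact: L2_sum.
Qed.

Lemma N2_le f g : L2 mu f -> L2 mu g -> (forall x, `|f x| <= `|g x|) -> N2 f <= N2 g.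
Proof.
move=> Lf Lg fg; rewrite ler_sqrt; last by apply: RI_ge0 => x; exact: sqr_ge0.
apply: RI_le; [exact: L2_sq|exact: L2_sq|move=> x].
by rewrite -(real_normK (num_real (f x))) -(real_normK (num_real (g x)))
  lerXn2r ?nnegrE.
Qed.

Lemma N2_norm f : N2 (fun x => `|f x|) = N2 f.
Proof.
by rewrite /N2; congr Num.sqrt; apply: eq_RI => x; rewrite real_normK ?num_real.
Qed.

Lemma cvg_L2M (f_ g_ : nat -> T -> R) f g : (forall n, L2 mu (f_ n)) ->
  (forall n, L2 mu (g_ n)) -> L2 mu f -> L2 mu g ->
  N2 (fun x => f_ n x - f x) @[n --> \oo] --> 0 ->
  N2 (fun x => g_ n x - g x) @[n --> \oo] --> 0 ->
  \int[mu]_x `|f_ n x * g_ n x - f x * g x| @[n --> \oo] --> 0.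
Proof.
move=> Lf_ Lg_ Lf Lg cf cg.
apply: (@squeeze_cvgr _ _ _ _ (fun _ => 0)
  (fun n => N2 (fun x => f_ n x - f x) * N2 (fun x => g_ n x - g x) +
     (N2 (fun x => f_ n x - f x) * N2 g + N2 f * N2 (fun x => g_ n x - g x)))).
- apply: nearW => n; apply/andP; split; first by apply: RI_ge0.
  have L1 := L2B (Lf_ n) Lf; have L2' := L2B (Lg_ n) Lg.
  apply: (@le_trans _ _ (\int[mu]_x (`|(f_ n x - f x) * (g_ n x - g x)| +
     (`|(f_ n x - f x) * g x| + `|f x * (g_ n x - g x)|)))).
    apply: RI_le.
    + by apply: Li_norm; apply: LiB; apply: L2M.
    + by apply: LiD; [|apply: LiD]; apply: Li_norm; apply: L2M.
    + move=> x; have -> : f_ n x * g_ n x - f x * g x =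
        (f_ n x - f x) * (g_ n x - g x) + ((f_ n x - f x) * g x + f x * (g_ n x - g x)).
        by ring.
      by rewrite (le_trans (ler_normD _ _))// lerD2l ler_normD.
  rewrite RID; [|by apply: Li_norm; apply: L2M|
     by apply: LiD; apply: Li_norm; apply: L2M].
  rewrite RID; [|by apply: Li_norm; apply: L2M|by apply: Li_norm; apply: L2M].
  by rewrite !lerD// CS_N2_abs.
- exact: cvg_cst.
- have -> : (0 : R) = 0 * 0 + (0 * N2 g + N2 f * 0) by rewrite !mul0r mulr0 !addr0.
  apply: cvgD; first exact: cvgM.
  by apply: cvgD; apply: cvgM => //; exact: cvg_cst.
Qed.

Lemma cvg_RI (f_ : nat -> T -> R) f : (forall n, Li mu (f_ n)) -> Li mu f ->
  \int[mu]_x `|f_ n x - f x| @[n --> \oo] --> 0 ->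
  \int[mu]_x f_ n x @[n --> \oo] --> \int[mu]_x f x.
Proof.
move=> i_ i c; apply/cvgrPdist_le => e e0.
have := c; move=> /cvgr0_norm_le /(_ e e0); apply: filterS => n.
rewrite ger0_norm ?RI_ge0// => /(le_trans _); apply.
rewrite distrC -RIB//; apply: RI_norm_le => //; first exact: LiB.
by apply: Li_norm; exact: LiB.
Qed.

Lemma cvg_N2 (f_ : nat -> T -> R) f : (forall n, L2 mu (f_ n)) -> L2 mu f ->
  N2 (fun x => f_ n x - f x) @[n --> \oo] --> 0 ->
  N2 (f_ n) @[n --> \oo] --> N2 f.
Proof.
move=> i_ i c; apply/cvgrPdist_le => e e0.
have := c; move=> /cvgr0_norm_le /(_ e e0); apply: filterS => n.
rewrite ger0_norm ?N2_ge0// => h.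
have h1 : N2 f <= N2 (f_ n) + N2 (fun x => f_ n x - f x).
  rewrite (@eq_N2 f (fun x => f_ n x - (f_ n x - f x))); last by move=> x; ring.
  by apply: N2B => //; exact: L2B.
have h2 : N2 (f_ n) <= N2 (fun x => f_ n x - f x) + N2 f.
  rewrite (@eq_N2 (f_ n) (fun x => (f_ n x - f x) + f x)); last by move=> x; ring.
  by apply: N2D => //; exact: L2B.
have : - e <= N2 f - N2 (f_ n) <= e by apply/andP; split; lra.
by rewrite -ler_norml.
Qed.

Lemma N2_lty f : measurable_fun setT f ->
  (\int[mu]_x (f x ^+ 2)%:E < +oo)%E -> L2 mu f.
Proof.
move=> mf h; split => //; apply: Li_ge0_lty => //.
- exact: measurable_funX.
- by move=> x; exact: sqr_ge0.
Qed.

End integrable_functions.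

(** * Fubini and Tonelli for real-valued integrals *)

Section fubini_real.
Context d1 d2 (T1 : measurableType d1) (T2 : measurableType d2) (R : realType).
Variable m1 : {sigma_finite_measure set T1 -> \bar R}.
Variable m2 : {sigma_finite_measure set T2 -> \bar R}.
Implicit Types f : T1 * T2 -> R.

Lemma measurable_pair1 f x : measurable_fun setT f ->
  measurable_fun setT (fun y => f (x, y)).
Proof. by move=> mf; apply: measurableT_comp. Qed.

Lemma measurable_pair2 f y : measurable_fun setT f ->
  measurable_fun setT (fun x => f (x, y)).
Proof. by move=> mf; apply: measurableT_comp. Qed.

(** No integrability is assumed: the integrals of the positive and the negative part are measurable
    by Tonelli, and the real integral is [fine] of their difference, whatever that is. *)
Lemma measurable_RI1 f : measurable_fun setT f ->
  measurable_fun setT (fun x => \int[m2]_y f (x, y)).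
Proof.
move=> mf; apply: (measurableT_comp (f := @fine R)) => //.
rewrite (_ : (fun x => _) = (fun x => \int[m2]_y ((EFin \o f)^\+ (x, y))
  - \int[m2]_y ((EFin \o f)^\- (x, y)))%E).
  apply: emeasurable_funB.
    apply: (measurable_fun_fubini_tonelli_F ((EFin \o f)^\+%E)) => //.
    by apply: measurable_funepos; exact/measurable_EFinP.
  apply: (measurable_fun_fubini_tonelli_F ((EFin \o f)^\-%E)) => //.
  by apply: measurable_funeneg; exact/measurable_EFinP.
apply/funext => x; rewrite [LHS]integralE; congr (_ - _)%E; apply: eq_integral => y _; by rewrite ?funeposE ?funenegE.
Qed.

Lemma measurable_RI2 f : measurable_fun setT f ->
  measurable_fun setT (fun y => \int[m1]_x f (x, y)).
Proof.
move=> mf; apply: (measurableT_comp (f := @fine R)) => //.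
rewrite (_ : (fun y => _) = (fun y => \int[m1]_x ((EFin \o f)^\+ (x, y))
  - \int[m1]_x ((EFin \o f)^\- (x, y)))%E).
  apply: emeasurable_funB.
    apply: (measurable_fun_fubini_tonelli_G ((EFin \o f)^\+%E)) => //.
    by apply: measurable_funepos; exact/measurable_EFinP.
  apply: (measurable_fun_fubini_tonelli_G ((EFin \o f)^\-%E)) => //.
  by apply: measurable_funeneg; exact/measurable_EFinP.
apply/funext => x; rewrite [LHS]integralE; congr (_ - _)%E; apply: eq_integral => y _; by rewrite ?funeposE ?funenegE.
Qed.

Lemma RI_fubini12 f : Li (m1 \x m2)%E f ->
  \int[m1]_x \int[m2]_y f (x, y) = \int[(m1 \x m2)%E]_z f z.
Proof.
move=> i; rewrite [in RHS]/Rintegral -(integral12_prod_meas1 i).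
congr fine; apply: ae_eq_integral => //.
- by apply/measurable_EFinP; apply: measurable_RI1; exact: Li_measurable i.
- exact: measurable_fubini_F i.
- have := ae_integrable1 i; apply: filterS => x /= ix _.
  by rewrite /fubini_F /Rintegral fineK//; exact: integrable_fin_num.
Qed.

Lemma RI_fubini21 f : Li (m1 \x m2)%E f ->
  \int[m2]_y \int[m1]_x f (x, y) = \int[(m1 \x m2)%E]_z f z.
Proof.
move=> i; rewrite [in RHS]/Rintegral -(integral21_prod_meas1 i).
congr fine; apply: ae_eq_integral => //.
- by apply/measurable_EFinP; apply: measurable_RI2; exact: Li_measurable i.
- exact: measurable_fubini_G i.
- have := ae_integrable2 i; apply: filterS => x /= ix _.
  by rewrite /fubini_G /Rintegral fineK//; exact: integrable_fin_num.
Qed.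

Lemma RI_fubini f : Li (m1 \x m2)%E f ->
  \int[m1]_x \int[m2]_y f (x, y) = \int[m2]_y \int[m1]_x f (x, y).
Proof. by move=> i; rewrite RI_fubini12// RI_fubini21. Qed.

Lemma Li_RI1 f : Li (m1 \x m2)%E f -> Li m1 (fun x => \int[m2]_y f (x, y)).
Proof.
move=> i; apply: (@Li_ae _ _ _ _ (fun x => fine (fubini_F m2 (EFin \o f) x))).
- have := integrable_fubini_F i => j.
  apply: Li_lty.
    by apply: measurableT_comp => //; exact: measurable_fubini_F i.
  move: j => /integrableP[mj].
  congr (_ < _)%E; apply: ae_eq_integral => //.
  + by apply: measurableT_comp.
  + by apply/measurable_EFinP; do 2 apply: measurableT_comp => //.
  + have := ae_integrable1 i; apply: filterS => x /= ix _.
    rewrite /fubini_F -[in LHS](@fineK _ (\int[m2]_y _)%E)//.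
    exact: integrable_fin_num.
- by apply: measurable_RI1; exact: Li_measurable i.
- by apply: aeW => x; rewrite /fubini_F.
Qed.

Lemma Li_RI2 f : Li (m1 \x m2)%E f -> Li m2 (fun y => \int[m1]_x f (x, y)).
Proof.
move=> i.
have mG : measurable_fun setT (fubini_G m1 (EFin \o f)).
  exact: measurable_fubini_G i.
apply: Li_lty; first by apply: measurable_RI2; exact: Li_measurable i.
apply: (@le_lt_trans _ _ (\int[m2]_y \int[m1]_x `|(f (x, y))%:E|)%E); last first.
  have [h _] := integrable21ltyP m1 m2 (measurable_int _ i); exact: h i.
apply: ge0_le_integral => //.
- apply/measurable_EFinP; apply: measurableT_comp => //.
  by apply: measurable_RI2; exact: Li_measurable i.
- apply: (measurable_fun_fubini_tonelli_G (abse \o (EFin \o f))) => //=.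
  by apply: measurableT_comp => //; exact: measurable_int i.
(* On a section that is not integrable the real integral has a default value, but there the right
   side is infinite and the bound still holds. *)
- move=> y _; have [iy|niy] := pselect (Li m1 (fun x => f (x, y))).
    rewrite (EFin_normr_Rintegral _ iy)//; apply: le_abse_integral => //.
    exact: measurable_int iy.
  suff -> : (\int[m1]_x `|(f (x, y))%:E| = +oo)%E by rewrite leey.
  apply/eqP; rewrite -leye_eq leNgt; apply/negP => h; apply: niy.
  apply: Li_lty => //; apply: measurable_pair2; exact: Li_measurable i.
Qed.

Lemma Li_tonelli1 f : measurable_fun setT f ->
  (forall x, Li m2 (fun y => f (x, y))) ->
  Li m1 (fun x => \int[m2]_y `|f (x, y)|) -> Li (m1 \x m2)%E f.
Proof.
move=> mf i1 i2.
suff : (\int[m1]_x \int[m2]_y `|(f (x, y))%:E| < +oo)%E.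
  by move=> /(integrable12ltyP m1 m2 (proj2 (measurable_EFinP _ _) mf)).
have := Li_ltyP i2; apply: le_lt_trans.
apply: ge0_le_integral => //.
- by move=> x _; exact: integral_ge0.
- apply: (measurable_fun_fubini_tonelli_F (abse \o (EFin \o f))) => //=.
  by apply: measurableT_comp => //; exact/measurable_EFinP.
- apply/measurable_EFinP; apply: measurableT_comp => //.
  by apply: (measurable_RI1 (f := fun z => `|f z|)); apply: measurableT_comp.
- move=> x _; rewrite ger0_norm ?RI_ge0//.
  by rewrite -(RI_E (Li_norm (i1 x))).
Qed.

Lemma Li_tonelli2 f : measurable_fun setT f ->
  (forall y, Li m1 (fun x => f (x, y))) ->
  Li m2 (fun y => \int[m1]_x `|f (x, y)|) -> Li (m1 \x m2)%E f.
Proof.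
move=> mf i1 i2.
suff : (\int[m2]_y \int[m1]_x `|(f (x, y))%:E| < +oo)%E.
  by move=> /(integrable21ltyP m1 m2 (proj2 (measurable_EFinP _ _) mf)).
have := Li_ltyP i2; apply: le_lt_trans.
apply: ge0_le_integral => //.
- by move=> x _; exact: integral_ge0.
- apply: (measurable_fun_fubini_tonelli_G (abse \o (EFin \o f))) => //=.
  by apply: measurableT_comp => //; exact/measurable_EFinP.
- apply/measurable_EFinP; apply: measurableT_comp => //.
  by apply: (measurable_RI2 (f := fun z => `|f z|)); apply: measurableT_comp.
- move=> x _; rewrite ger0_norm ?RI_ge0//.
  by rewrite -(RI_E (Li_norm (i1 x))).
Qed.

Lemma ae_Li1 f : Li (m1 \x m2)%E f -> {ae m1, forall x, Li m2 (fun y => f (x, y))}.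
Proof. by move=> i; have := ae_integrable1 i. Qed.

End fubini_real.

(** * Lebesgue measure on R^3 *)

Definition push d1 d2 (T1 : measurableType d1) (T2 : measurableType d2)
  (R : realType) (m : {measure set T1 -> \bar R}) (f : T1 -> T2)
  (mf : measurable_fun setT f) : {measure set T2 -> \bar R} :=
  measure_function_pushforward__canonical__measure_function_Measure m mf.

Section product_sigma_finite.
Context d1 d2 (T1 : measurableType d1) (T2 : measurableType d2) (R : realType).
Variable m1 : {sigma_finite_measure set T1 -> \bar R}.
Variable m2 : {sigma_finite_measure set T2 -> \bar R}.

Lemma product_measure1_sigma_finite : sigma_finite setT (m1 \x m2)%E.
Proof.
have /sigma_finiteP[F [TF ndF Foo]] := sigma_finiteT m1.
have /sigma_finiteP[G [TG ndG Goo]] := sigma_finiteT m2.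
exists (fun n => F n `*` G n).
  apply/seteqP; split=> // -[x y] _.
  have : (\bigcup_i F i) x by rewrite -TF.
  have : (\bigcup_i G i) y by rewrite -TG.
  move=> [n _ Gny] [k _ Fkx]; exists (maxn n k) => //; split => /=.
    by move: x Fkx; exact/subsetPset/ndF/leq_maxr.
  by move: y Gny; exact/subsetPset/ndG/leq_maxl.
move=> k; have [mF Fk] := Foo k; have [mG Gk] := Goo k.
split; first exact: measurableX.
by rewrite product_measure1E// lte_mul_pinfty// ge0_fin_numE.
Qed.

(* The canonical sigma-finite structure on [m1 \x m2] is only inferred by the
   library for subprobabilities. *)
Definition sigma_finite_prod : {sigma_finite_measure set (T1 * T2)%type -> \bar R} :=
  HB.pack (m1 \x m2)%E
    (Measure_isSigmaFinite.Build _ _ _ (m1 \x m2)%E product_measure1_sigma_finite).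

End product_sigma_finite.

Definition sfleb3 (R : realType) :=
  sigma_finite_prod (sigma_finite_prod (@lebesgue_measure R) (@lebesgue_measure R))
    (@lebesgue_measure R).

(** * Affine changes of variables *)

Section affine_maps.
Local Open Scope ereal_scope.

(** The hypothesis says that [mu] is c times its own push-forward along [F]; the formula is then the
    push-forward rule. *)
Lemma ge0_integral_map d (T : measurableType d) (R : realType)
  (mu : {measure set T -> \bar R}) (F : T -> T) (c : R) (f : T -> R) :
  (0 <= c)%R -> measurable_fun setT F ->
  (forall A, measurable A -> c%:E * mu (F @^-1` A) = mu A) ->
  measurable_fun setT f -> (forall x, (0 <= f x)%R) ->
  \int[mu]_x (f x)%:E = c%:E * \int[mu]_x (f (F x))%:E.
Proof.
move=> c0 mF h mf f0.
have f0' : forall x, 0 <= (f x)%:E by move=> x; rewrite lee_fin.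
transitivity (\int[mscale (NngNum c0) (push mu mF)]_x (f x)%:E).
  by apply: eq_measure_integral => A mA _; rewrite -(h A mA).
rewrite ge0_integral_mscale//; last exact/measurable_EFinP.
congr (_ * _); rewrite ge0_integral_pushforward//.
exact/measurable_EFinP.
Qed.

(** Both sides are measures in [A] that agree on rectangles, and this determines the product
    measure. *)
Lemma product_measure_map d1 d2 (T1 : measurableType d1) (T2 : measurableType d2)
  (R : realType) (m1 : {sigma_finite_measure set T1 -> \bar R})
  (m2 : {sigma_finite_measure set T2 -> \bar R}) (c1 c2 : R)
  (f1 : T1 -> T1) (f2 : T2 -> T2) :
  (0 <= c1)%R -> (0 <= c2)%R -> measurable_fun setT f1 -> measurable_fun setT f2 ->
  (forall A, measurable A -> c1%:E * m1 (f1 @^-1` A) = m1 A) ->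
  (forall A, measurable A -> c2%:E * m2 (f2 @^-1` A) = m2 A) ->
  forall A, measurable A ->
    (c1 * c2)%:E *
      (m1 \x m2) ((fun x => (f1 x.1, f2 x.2)) @^-1` A) = (m1 \x m2) A.
Proof.
move=> c10 c20 mf1 mf2 h1 h2 A mA.
have mF : measurable_fun setT (fun x : T1 * T2 => (f1 x.1, f2 x.2)).
  by apply: measurable_fun_pair; apply: measurableT_comp.
set F := (fun x : T1 * T2 => (f1 x.1, f2 x.2)) in mF *.
pose m' : {measure set (T1 * T2) -> \bar R} :=
  mscale (NngNum (mulr_ge0 c10 c20)) (push (m1 \x m2) mF).
suff E : forall B C, measurable B -> measurable C -> m' (B `*` C) = m1 B * m2 C.
  exact: (esym (product_measure_unique E mA)).
move=> B C mB mC; rewrite /m' /= /mscale /= /pushforward.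
have -> : F @^-1` (B `*` C) = (f1 @^-1` B) `*` (f2 @^-1` C) by [].
rewrite product_measure1E//; last 2 first.
- by rewrite -[X in measurable X]setTI; exact: mf1.
- by rewrite -[X in measurable X]setTI; exact: mf2.
by rewrite -(h1 B)// -(h2 C)// EFinM muleACA.
Qed.

Lemma leb_affine (R : realType) (c a : R) : (c != 0)%R -> forall A : set R,
  measurable A -> `|c|%:E * leb R ((fun x => c * x + a)%R @^-1` A) = leb R A.
Proof.
move=> c0 A mA.
have mF : @measurable_fun _ _ (measurableTypeR R) (measurableTypeR R) setT
    (fun x : R => c * x + a)%R.
  by apply: measurable_funD => //; apply: measurable_funM.
set F := (fun x : R => c * x + a)%R in mF *.
pose m' : {measure set (measurableTypeR R) -> \bar R} :=
  mscale (NngNum (normr_ge0 c)) (push (leb R) mF).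
suff E : forall X, ocitv X -> leb R X = m' X.
  exact: (esym (lebesgue_measure_unique E mA)).
move=> X [[l r] _ <-] /=; rewrite /m' /= /mscale /= /pushforward; symmetry.
(* A negative c reverses the interval: its preimage is closed on the left and open on the right,
   with the same length as its half-open mirror image. *)
move: c0; rewrite neq_lt => /orP[c0|c0].
  have -> : F @^-1` `]l, r] = `[((r - a) / c)%R, ((l - a) / c)%R[%classic.
    apply/seteqP; split => x; rewrite /F /= !in_itv/= ler_ndivrMr// ltr_ndivlMr//;
    by move=> /andP[u v]; apply/andP; split; lra.
  rewrite !lebesgue_measure_itv/= !lte_fin ltr0_norm// ltr_ndivlMr// mulfVK ?lt_eqF//.
  rewrite ltrD2r; case: ifPn => _; last by rewrite mule0.
  by rewrite -!EFinD -EFinM; congr EFin; field; rewrite lt_eqF.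
have -> : F @^-1` `]l, r] = `]((l - a) / c)%R, ((r - a) / c)%R]%classic.
  apply/seteqP; split => x; rewrite /F /= !in_itv/= ler_pdivlMr// ltr_pdivrMr//;
  by move=> /andP[u v]; apply/andP; split; lra.
rewrite !lebesgue_measure_itv/= !lte_fin gtr0_norm// ltr_pdivrMr// mulfVK ?gt_eqF//.
rewrite ltrD2r; case: ifPn => _; last by rewrite mule0.
by rewrite -!EFinD -EFinM; congr EFin; field; rewrite gt_eqF.
Qed.

End affine_maps.

Section space.
Context {R : realType}.
Implicit Types (x y a : R3 R) (c : R).
Local Notation M := (measurableTypeR R).

Lemma measurable_affine3 c a : measurable_fun setT (fun x : R3 R => c *: x + a).
Proof.
have e : (fun x : R3 R => c *: x + a) =
  (fun x => (c * x.1.1 + a.1.1, c * x.1.2 + a.1.2, c * x.2 + a.2)).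
  by apply/funext => -[[? ?] ?]; case: a => -[? ?] ?.
have m1 (i : R3 R -> R) b : measurable_fun setT i -> measurable_fun setT (fun x => c * i x + b).
  by move=> mi; apply: measurable_funD => //; apply: measurable_funM.
rewrite e; apply: measurable_fun_pair; [apply: measurable_fun_pair|].
- by apply: (m1 (fun x => x.1.1)); apply: measurableT_comp.
- by apply: (m1 (fun x => x.1.2)); apply: measurableT_comp.
- by apply: (m1 (fun x => x.2)); exact: measurable_snd.
Qed.

Lemma leb3_affine c a : c != 0 -> forall A : set (M * M * M), measurable A ->
  ((`|c| ^+ 3)%:E * leb3 R ((fun x : R3 R => (c *: x + a)%R) @^-1` A) = leb3 R A)%E.
Proof.
move=> c0 A mA.
have mm b : @measurable_fun _ _ M M setT (fun x : R => c * x + b).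
  by apply: measurable_funD => //; apply: measurable_funM.
have h b := @leb_affine R c b c0.
have h2 := @product_measure_map _ _ _ _ R (leb R) (leb R) `|c| `|c| _ _ (normr_ge0 c) (normr_ge0 c)
  (mm a.1.1) (mm a.1.2) (h a.1.1) (h a.1.2).
have mm2 : @measurable_fun _ _ (M * M)%type (M * M)%type setT (fun x : R * R => (c * x.1 + a.1.1, c * x.2 + a.1.2)).
  by apply: measurable_fun_pair; apply: (measurableT_comp (mm _)).
have := @product_measure_map _ _ _ _ R (sigma_finite_prod (leb R) (leb R)) (leb R) (`|c| * `|c|) `|c| _ _ (mulr_ge0 (normr_ge0 c) (normr_ge0 c)) (normr_ge0 c)
  mm2 (mm a.2) h2 (h a.2) A mA.
move=> <-; congr (_ * _)%E; by congr EFin => /=; ring.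
Qed.

Lemma ge0_integral_affine (f : R3 R -> R) c a : c != 0 -> measurable_fun setT f ->
  (forall x, 0 <= f x) ->
  (\int[leb3 R]_x (f x)%:E = (`|c| ^+ 3)%:E * \int[leb3 R]_x (f (c *: x + a))%:E)%E.
Proof.
move=> c0 mf f0.
by apply: (@ge0_integral_map _ (M * M * M)%type R (leb3 R)
  (fun x : R3 R => c *: x + a) (`|c| ^+ 3) f _ (measurable_affine3 c a)
  (leb3_affine a c0)).
Qed.

Lemma Li_affine (f : R3 R -> R) c a : c != 0 ->
  Li (leb3 R) f -> Li (leb3 R) (fun x => f (c *: x + a)).
Proof.
move=> c0 i; have mf := Li_measurable i.
apply: Li_lty; first exact: (measurableT_comp mf (measurable_affine3 c a)).
have := Li_ltyP i; rewrite (@ge0_integral_affine (fun x => `|f x|) c a)//; last first.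
  exact: measurableT_comp.
have c3 : 0 < `|c| ^+ 3 by rewrite exprn_gt0// normr_gt0.
have : (0 <= \int[leb3 R]_x `|f (c *: x + a)|%:E)%E by apply: integral_ge0.
case: (\int[leb3 R]_x `|f (c *: x + a)|%:E)%E => [r| |] _ //.
  by move=> _; rewrite ltry.
by rewrite gt0_muley ?lte_fin.
Qed.

End space.

Lemma Li_indic d (T : measurableType d) (R : realType)
  (mu : {measure set T -> \bar R}) (A : set T) :
  measurable A -> (mu A < +oo)%E -> Li mu (\1_A : T -> R).
Proof.
move=> mA muA; apply: Li_ge0_lty => //.
by rewrite integral_indic// setIT.
Qed.

Section integral_map.
Context d (T : measurableType d) (R : realType).
Variables (mu : {measure set T -> \bar R}) (F : T -> T).
Hypothesis mF : measurable_fun setT F.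
Hypothesis hF : forall A, measurable A -> mu (F @^-1` A) = mu A.

Lemma Li_map (f : T -> R) : Li mu f -> Li mu (fun x => f (F x)).
Proof.
move=> i; have mf := Li_measurable i.
have e := @ge0_integral_map _ _ _ mu F 1 (fun x => `|f x|) ler01 mF.
apply: Li_lty; first exact: measurableT_comp.
have := Li_ltyP i; rewrite e ?mul1e//; last exact: measurableT_comp.
by move=> A mA; rewrite mul1e hF.
Qed.

Lemma RI_map (f : T -> R) : Li mu f -> \int[mu]_x f (F x) = \int[mu]_x f x.
Proof.
move=> i; have mf := Li_measurable i.
rewrite /Rintegral; congr fine.
transitivity (\int[push mu mF]_x (f x)%:E)%E; last first.
  by apply: eq_measure_integral => A mA _; rewrite -(hF mA).
symmetry; apply: (@integral_pushforward _ _ _ _ _ F mF mu setT (EFin \o f)) => //.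
  exact/measurable_EFinP.
exact: Li_map.
Qed.

End integral_map.

Section space2.
Context {R : realType}.
Implicit Types (x y z a : R3 R) (f g : R3 R -> R).
Local Notation M := (measurableTypeR R).

Let mshift a : @measurable_fun _ _ (M * M * M)%type (M * M * M)%type setT
  (fun x : R3 R => x + a).
Proof.
rewrite (_ : (fun _ => _) = (fun x => 1 *: x + a)).
  exact: measurable_affine3.
by apply/funext => x; rewrite scale1r.
Qed.

Let mrefl a : @measurable_fun _ _ (M * M * M)%type (M * M * M)%type setT
  (fun x : R3 R => a - x).
Proof.
rewrite (_ : (fun _ => _) = (fun x => -1 *: x + a)).
  exact: measurable_affine3.
by apply/funext => x; rewrite scaleN1r addrC.
Qed.

Let shiftE a (A : set (M * M * M)) : measurable A ->
  leb3 R ((fun x : R3 R => (x + a)%R) @^-1` A) = leb3 R A.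
Proof.
move=> mA; have := @leb3_affine R 1 a (oner_neq0 _) A mA.
rewrite normr1 expr1n mul1e => <-; congr (leb3 R _).
by apply/funext => x; rewrite /preimage/= scale1r.
Qed.

Let reflE a (A : set (M * M * M)) : measurable A ->
  leb3 R ((fun x : R3 R => (a - x)%R) @^-1` A) = leb3 R A.
Proof.
move=> mA; have := @leb3_affine R (-1) a _ A mA.
rewrite oppr_eq0 oner_eq0 => /(_ isT); rewrite normrN1 expr1n mul1e => <-.
by congr (leb3 R _); apply/funext => x; rewrite /preimage/= scaleN1r addrC.
Qed.

Lemma Li_shift f a : Li (leb3 R) f -> Li (leb3 R) (fun x => f (x + a)).
Proof. exact: (@Li_map _ _ _ (leb3 R) _ (mshift a) (@shiftE a)). Qed.

Lemma Li_refl f a : Li (leb3 R) f -> Li (leb3 R) (fun x => f (a - x)).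
Proof. exact: (@Li_map _ _ _ (leb3 R) _ (mrefl a) (@reflE a)). Qed.

Lemma RI_shift f a : Li (leb3 R) f ->
  \int[leb3 R]_x f (x + a) = \int[leb3 R]_x f x.
Proof. exact: (@RI_map _ _ _ (leb3 R) _ (mshift a) (@shiftE a)). Qed.

Lemma RI_refl f a : Li (leb3 R) f ->
  \int[leb3 R]_x f (a - x) = \int[leb3 R]_x f x.
Proof. exact: (@RI_map _ _ _ (leb3 R) _ (mrefl a) (@reflE a)). Qed.

Lemma L2_refl f a : L2 (leb3 R) f -> L2 (leb3 R) (fun x => f (a - x)).
Proof.
move=> [mf i]; split; last exact: (@Li_refl (fun x => f x ^+ 2)).
exact: (measurableT_comp mf (mrefl a)).
Qed.

Lemma L2_shift f a : L2 (leb3 R) f -> L2 (leb3 R) (fun x => f (x + a)).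
Proof.
move=> [mf i]; split; last exact: (@Li_shift (fun x => f x ^+ 2)).
exact: (measurableT_comp mf (mshift a)).
Qed.

Lemma measurable_refl f a : measurable_fun setT f ->
  measurable_fun setT (fun x => f (a - x)).
Proof. by move=> mf; exact: (measurableT_comp mf (mrefl a)). Qed.

Lemma measurable_sub3 (f : R3 R -> R) : measurable_fun setT f ->
  measurable_fun setT (fun z : R3 R * R3 R => f (z.1 - z.2)).
Proof.
move=> mf; apply: (measurableT_comp mf).
have e : (fun z : R3 R * R3 R => z.1 - z.2) = (fun z : R3 R * R3 R =>
  (z.1.1.1 - z.2.1.1, z.1.1.2 - z.2.1.2, z.1.2 - z.2.2)).
  by apply/funext => -[[[? ?] ?] [[? ?] ?]].
rewrite e; apply: measurable_fun_pair; [apply: measurable_fun_pair|];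
  apply: measurable_funB; repeat (apply: measurableT_comp => //).
Qed.

Lemma norm3E (x : R3 R) : `|x| = Num.max (Num.max `|x.1.1| `|x.1.2|) `|x.2|.
Proof. by rewrite prod_normE prod_normE. Qed.

Lemma measurable_ball3 (x : R3 R) e : measurable (ball x e).
Proof.
have -> : ball x e = (ball x.1.1 e `*` ball x.1.2 e) `*` ball x.2 e by [].
by apply: measurableX; [apply: measurableX|]; exact: measurable_ball.
Qed.

(** The sigma-algebra is the product one. Balls of the sup norm are boxes, hence measurable, and an
    open set is the countable union of the balls with rational centre and radius that it
    contains. *)
Lemma open_measurable3 (U : set (R3 R)) : open U -> measurable U.
Proof.
move=> oU; pose Q := (rat * rat * rat * rat)%type.
pose B (q : Q) : set (R3 R) :=
  ball ((ratr q.1.1.1, ratr q.1.1.2, ratr q.1.2) : R3 R) (ratr q.2 : R).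
pose G (o : option Q) : set (R3 R) := if o is Some q then
    (if `[< B q `<=` U >] then B q else set0) else set0.
have GU o : G o `<=` U.
  by case: o => [q|] /=; [case: asboolP => // _|]; exact: sub0set.
have mG o : measurable (G o).
  by case: o => [q|] //=; case: asboolP => // _; exact: measurable_ball3.
have -> : U = \bigcup_n G (unpickle n : option Q).
  apply/seteqP; split => [x Ux|x [n _]]; last by move/GU.
  move: oU; rewrite openE => /(_ _ Ux) /nbhs_ballP[e /= e0 xeU].
  (* A radius below e / 2 keeps a rational ball that contains x inside the ball of radius e about
     x. *)
  have [r0 r0e] := @rat_in_itvoo R 0 (e / 2) (divr_gt0 e0 (ltr0Sn _ 1)).
  move: r0e; rewrite in_itv/= => /andP[r00 r0e].
  have q_ (y : R) : exists q : rat, `|ratr q - y| < ratr r0.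
    have [|q] := @rat_in_itvoo R (y - ratr r0) (y + ratr r0); first lra.
    rewrite in_itv/= => /andP[h1 h2]; exists q.
    by rewrite ltr_norml; apply/andP; split; lra.
  have [q1 h1] := q_ x.1.1; have [q2 h2] := q_ x.1.2; have [q3 h3] := q_ x.2.
  pose q : Q := (q1, q2, q3, r0).
  exists (pickle q); first by [].
  rewrite pickleK /G /= ifT.
    by rewrite /B -ball_normE /= norm3E !gt_max /= h1 h2 h3.
  apply/asboolP => y; rewrite /B -ball_normE /= => h.
  apply: xeU; rewrite -ball_normE /=.
  have : `|x - (ratr q1, ratr q2, ratr q3)| < ratr r0.
    by rewrite norm3E !gt_max /= distrC h1 distrC h2 distrC h3.
  move=> h'; have := ler_distD (ratr q1, ratr q2, ratr q3) x y.
  by move=> /le_lt_trans; apply; rewrite (lt_le_trans (ltrD h' h))//; lra.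
by apply: bigcup_measurable => n _; exact: mG.
Qed.

Lemma continuous_measurable3 (f : R3 R -> R) : continuous f -> measurable_fun setT f.
Proof.
move=> cf; apply: (measurability _ (RGenOpens.measurableE R)).
move=> _ [_ [a [b ->] <-]]; rewrite setTI; apply: open_measurable3.
by move/continuousP : cf; apply; exact: interval_open.
Qed.

Definition cube (r : R) : set (R3 R) := [set x | `|x| <= r].

Lemma cubeE r : cube r = (`[- r, r] `*` `[- r, r]) `*` `[- r, r].
Proof.
apply/seteqP; split => -[[x1 x2] x3]; rewrite /cube/= norm3E/= !ge_max !in_itv/= -!ler_norml.
  by move=> /andP[/andP[? ?] ?].
by move=> [[-> ->] ->].
Qed.

Lemma measurable_cube r : measurable (cube r).
Proof. by rewrite cubeE; apply: measurableX; [apply: measurableX|]. Qed.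

Lemma leb3_cube r : 0 <= r -> leb3 R (cube r) = ((2 * r) ^+ 3)%:E.
Proof.
move=> r0; rewrite cubeE product_measure1E//; last exact: measurableX.
rewrite [X in (X * _)%E]product_measure1E//.
have e : leb R `[- r, r] = (2 * r)%:E.
  rewrite lebesgue_measure_itv/= lte_fin; case: ltP => h.
    by rewrite -EFinD; congr EFin; ring.
  by have -> : r = 0; [lra|rewrite mulr0].
transitivity ((leb R `[(- r)%R, r] * leb R `[(- r)%R, r]) * leb R `[(- r)%R, r])%E => //.
by rewrite e -!EFinM; congr EFin; ring.
Qed.

Lemma Li_cube r : Li (leb3 R) (\1_(cube r)).
Proof.
have [r0|r0] := leP 0 r; last first.
  apply: (eq_Li _ (Li0 _)) => x; rewrite indicE memNset// /cube /= => h.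
  by have := normr_ge0 x; lra.
apply: (@Li_indic _ (M * M * M)%type R (leb3 R) (cube r) (@measurable_cube r)).
by apply: (@le_lt_trans _ _ ((2 * r) ^+ 3)%:E); [rewrite -leb3_cube|exact: ltry].
Qed.

Definition Cc f := continuous f /\ exists r, forall x, r < `|x| -> f x = 0.

Lemma compact_cube r : compact (cube r).
Proof.
rewrite cubeE; apply: compact_setX; first apply: compact_setX;
  exact: segment_compact.
Qed.

Lemma Cc_support f : Cc f -> exists r, 0 < r /\ forall x, r < `|x| -> f x = 0.
Proof.
move=> [_ [r hr]]; exists (Num.max r 1); split; first by rewrite lt_max ltr01 orbT.
by move=> x; rewrite gt_max => /andP[h _]; exact: hr.
Qed.

Lemma Cc_bounded f : Cc f -> exists C, 0 < C /\ forall x, `|f x| <= C.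
Proof.
move=> Cf; have [r [r0 hr]] := Cc_support Cf.
have : compact (f @` cube r).
  apply: continuous_compact; last exact: compact_cube.
  by apply: continuous_subspaceT; case: Cf.
move=> /compact_bounded [C [_ hC]]; exists (Num.max C 0 + 1); split.
  by rewrite ltr_pwDr// le_max lexx orbT.
move=> x; have [xr|xr] := leP `|x| r.
  apply: hC; first by rewrite ltr_pwDr// le_max lexx.
  by exists x.
by rewrite hr// normr0 addr_ge0// le_max lexx orbT.
Qed.

Lemma Cc_le_indic f : Cc f -> exists C r, [/\ 0 < C, 0 < r &
  forall x, `|f x| <= C * \1_(cube r) x].
Proof.
move=> Cf; have [r [r0 hr]] := Cc_support Cf; have [C [C0 hC]] := Cc_bounded Cf.
exists C, r; split => // x; rewrite indicE.
have [xr|xr] := boolP (x \in cube r); first by rewrite mulr1.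
by rewrite mulr0 hr ?normr0//; move: xr; rewrite notin_setE /cube /= => /negP; rewrite -ltNge.
Qed.

Lemma Cc_measurable f : Cc f -> measurable_fun setT f.
Proof. by case=> cf _; exact: continuous_measurable3. Qed.

Lemma Cc_Li f : Cc f -> Li (leb3 R) f.
Proof.
move=> Cf; have [C [r [C0 r0 h]]] := Cc_le_indic Cf.
refine (@Li_le _ (M * M * M)%type R (leb3 R) (fun x => C * \1_(cube r) x) f _ h _).
  exact: Cc_measurable.
by apply: LiZ; exact: Li_cube.
Qed.

Lemma CcM f g : continuous f -> Cc g -> Cc (fun x => f x * g x).
Proof.
move=> cf [cg [r hr]]; split; first by move=> x; apply: cvgM; [exact: cf|exact: cg].
by exists r => x /hr ->; rewrite mulr0.
Qed.

Lemma Cc_L2 f : Cc f -> L2 (leb3 R) f.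
Proof.
move=> Cf; split; first exact: Cc_measurable.
apply: Cc_Li; rewrite (_ : (fun _ => _) = (fun x => f x * f x)).
  by apply: CcM => //; case: Cf.
by apply/funext => x; rewrite expr2.
Qed.

End space2.

Section fubini3.
Context {R : realType}.
Local Notation mu := (leb3 R).
Local Notation M3 := (measurableTypeR R * measurableTypeR R * measurableTypeR R)%type.
Local Notation mu2 := (product_measure1 (sfleb3 R) (sfleb3 R)).
Implicit Types f : R3 R * R3 R -> R.

Lemma RI3_measurable f : measurable_fun setT f ->
  measurable_fun setT (fun x => \int[mu]_y f (x, y)).
Proof. exact: (@measurable_RI1 _ _ M3 M3 R (sfleb3 R) f). Qed.

Lemma RI3_fubini f : Li mu2 f ->
  \int[mu]_x \int[mu]_y f (x, y) = \int[mu]_y \int[mu]_x f (x, y).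
Proof. exact: (@RI_fubini _ _ M3 M3 R (sfleb3 R) (sfleb3 R) f). Qed.

Lemma Li3_tonelli1 f : measurable_fun setT f ->
  (forall x, Li mu (fun y => f (x, y))) ->
  Li mu (fun x => \int[mu]_y `|f (x, y)|) -> Li mu2 f.
Proof. exact: (@Li_tonelli1 _ _ M3 M3 R (sfleb3 R) (sfleb3 R) f). Qed.

Lemma Li3_tonelli2 f : measurable_fun setT f ->
  (forall y, Li mu (fun x => f (x, y))) ->
  Li mu (fun y => \int[mu]_x `|f (x, y)|) -> Li mu2 f.
Proof. exact: (@Li_tonelli2 _ _ M3 M3 R (sfleb3 R) (sfleb3 R) f). Qed.

Lemma Li3_RI1 f : Li mu2 f -> Li mu (fun x => \int[mu]_y f (x, y)).
Proof. exact: (@Li_RI1 _ _ M3 M3 R (sfleb3 R) (sfleb3 R) f). Qed.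

Lemma Li3_RI2 f : Li mu2 f -> Li mu (fun y => \int[mu]_x f (x, y)).
Proof. exact: (@Li_RI2 _ _ M3 M3 R (sfleb3 R) (sfleb3 R) f). Qed.

Lemma ae_Li3_1 f : Li mu2 f -> {ae mu, forall x, Li mu (fun y => f (x, y))}.
Proof. exact: (@ae_Li1 _ _ M3 M3 R (sfleb3 R) (sfleb3 R) f). Qed.

End fubini3.

(** * Smooth functions *)

Section smooth_functions.
Context {R : realType}.

Section general.
Context {V : normedModType R}.
Implicit Types f g : V -> R.

(** Coinduction for smoothness: [smooth] speaks of all iterated directional derivatives, but it is
    enough to exhibit a class of continuous derivable functions that is closed under one
    derivative. *)
Lemma smooth_coind (P : (V -> R) -> Prop) :
  (forall f, P f -> continuous f) ->
  (forall f x v, P f -> derivable f x v) ->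
  (forall f v, P f -> P (fun x => 'D_v f x)) ->
  forall f, P f -> smooth f.
Proof.
move=> P1 P2 P3 f Pf s.
have Ps : P (iter_derive s f) by elim: s => //= v s; exact: P3.
by split; [exact: P1|move=> x v; exact: P2].
Qed.

Lemma smooth_continuous f : smooth f -> continuous f.
Proof. by move=> /(_ [::])[]. Qed.

Lemma smooth_derivable f x v : smooth f -> derivable f x v.
Proof. by move=> /(_ [::])[_]; apply. Qed.

Lemma smooth_derive f v : smooth f -> smooth (fun x => 'D_v f x).
Proof.
move=> sf s; have := sf (rcons s v).
by rewrite /iter_derive foldr_rcons.
Qed.

(** The derivative of a product is a sum of products, so neither the sums nor the products of smooth
    functions form a class that suits [smooth_coind] alone. The algebra they generate does. *)
Inductive smooth_alg : (V -> R) -> Prop :=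
| smooth_alg_base f : smooth f -> smooth_alg f
| smooth_alg_add f g : smooth_alg f -> smooth_alg g -> smooth_alg (fun x => f x + g x)
| smooth_alg_mul f g : smooth_alg f -> smooth_alg g -> smooth_alg (fun x => f x * g x).

Lemma smooth_alg_smooth f : smooth_alg f -> smooth f.
Proof.
have H1 h : smooth_alg h -> continuous h.
  elim=> {h} [h sh|h k _ ch _ ck|h k _ ch _ ck].
  - exact: smooth_continuous.
  - by move=> x; apply: cvgD; [exact: ch|exact: ck].
  - by move=> x; apply: cvgM; [exact: ch|exact: ck].
have H2 h : smooth_alg h -> forall x v, derivable h x v.
  elim=> {h} [h sh|h k _ dh _ dk|h k _ dh _ dk] x v.
  - exact: smooth_derivable.
  - exact: (derivableD (dh x v) (dk x v)).
  - exact: (derivableM (dh x v) (dk x v)).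
apply: smooth_coind => [h|h x v sh|h v]; [exact: H1|exact: H2|].
elim=> {h} [h sh|h k sh ih sk ik|h k sh ih sk ik].
- by apply: smooth_alg_base; exact: smooth_derive.
- rewrite (_ : (fun x => _) = (fun x => 'D_v h x + 'D_v k x)).
    exact: smooth_alg_add.
  by apply/funext => x; rewrite (@deriveD _ _ _ h k)//; exact: H2.
- rewrite (_ : (fun x => _) = (fun x => h x * 'D_v k x + k x * 'D_v h x)).
    by apply: smooth_alg_add; exact: smooth_alg_mul.
  by apply/funext => x; rewrite (@deriveM _ _ h k)//; exact: H2.
Qed.

Lemma smoothD f g : smooth f -> smooth g -> smooth (fun x => f x + g x).
Proof.
by move=> sf sg; apply: smooth_alg_smooth; apply: smooth_alg_add;
  exact: smooth_alg_base.
Qed.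

Lemma smoothM f g : smooth f -> smooth g -> smooth (fun x => f x * g x).
Proof.
by move=> sf sg; apply: smooth_alg_smooth; apply: smooth_alg_mul;
  exact: smooth_alg_base.
Qed.

Lemma smooth_cst (c : R) : smooth (fun _ : V => c).
Proof.
apply: (@smooth_coind (fun f => exists c : R, f = fun _ => c)); last by exists c.
- by move=> _ [a ->] x; exact: cvg_cst.
- by move=> _ x v [a ->]; exact: derivable_cst.
- move=> _ v [a ->]; exists 0; apply/funext => x; exact: derive_cst.
Qed.

Lemma smoothZ c f : smooth f -> smooth (fun x => c * f x).
Proof. by move=> sf; exact: (smoothM (smooth_cst c) sf). Qed.

Lemma smooth_sum (I : Type) (s : seq I) (F : I -> V -> R) :
  (forall i, smooth (F i)) -> smooth (fun x => \sum_(i <- s) F i x).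
Proof.
move=> sF; elim: s => [|a s IH].
  by rewrite (_ : (fun _ => _) = (fun _ => 0));
    [exact: smooth_cst|apply/funext => x; rewrite big_nil].
rewrite (_ : (fun _ => _) = (fun x => F a x + \sum_(i <- s) F i x)).
  exact: (smoothD (sF a) IH).
by apply/funext => x; rewrite big_cons.
Qed.

End general.

Section affine.
Context {V W : normedModType R} (A : W -> V) (L : W -> V).
Hypothesis AL : forall x w (h : R), A (h *: w + x) = h *: L w + A x.
Hypothesis cA : continuous A.

Let quotE f x w :
  (fun h : R => h^-1 *: (((f \o A) \o shift x) (h *: w) - (f \o A) x)) =
  (fun h : R => h^-1 *: ((f \o shift (A x)) (h *: L w) - f (A x))) :> (R -> R).
Proof. by apply/funext => h /=; rewrite AL. Qed.

Lemma derivable_affine (f : V -> R) x w :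
  derivable (f \o A) x w <-> derivable f (A x) (L w).
Proof. by rewrite /derivable quotE. Qed.

Lemma derive_affine (f : V -> R) x w : 'D_w (f \o A) x = 'D_(L w) f (A x).
Proof. by rewrite /derive quotE. Qed.

Lemma smooth_affine (f : V -> R) : smooth f -> smooth (f \o A).
Proof.
move=> sf; apply: (@smooth_coind W (fun g => exists2 h, smooth h & g = h \o A)).
- move=> _ [h sh ->] x; apply: continuous_comp; first exact: cA.
  exact: smooth_continuous.
- by move=> _ x v [h sh ->]; apply/derivable_affine; exact: smooth_derivable.
- move=> _ v [h sh ->]; exists (fun x => 'D_(L v) h x); first exact: smooth_derive.
  by apply/funext => x; rewrite derive_affine.
- by exists f.
Qed.

End affine.

Section dimension1.
Implicit Types f g : R -> R.

Lemma is_derive_dir f (v x d : R) : is_derive x (1 : R) f d ->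
  derivable f x v /\ 'D_v f x = v * d.
Proof.
move=> [df fd]; have /derivable1_diffP dff := df.
split; first exact: diff_derivable.
rewrite deriveE// -[v in LHS]mulr1 -[LHS]/('d f x (v *: (1 : R))) linearZ /=.
by rewrite -deriveE// fd.
Qed.

(** On the line the derivative in direction v is v times the derivative. The class given to
    [smooth_coind] therefore consists of the multiples c h with h in [P], whose factor absorbs the
    directions. *)
Lemma smooth1_coind (P : (R -> R) -> Prop) :
  (forall f, P f -> exists2 g, P g & forall x, is_derive x (1 : R) f (g x)) ->
  forall f, P f -> smooth f.
Proof.
move=> P1 f Pf.
have dP h c x v : P h -> exists2 g, P g & derivable (fun x => c * h x) x v /\
    forall x, 'D_v (fun x => c * h x) x = (v * c) * g x.
  move=> /P1[g Pg hg]; exists g => //.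
  have H y := is_derive_dir v (is_deriveZ c (hg y)).
  split; first by case: (H x).
  by move=> y; have [_ e] := H y; rewrite [LHS]e /GRing.scale/= mulrA.
apply: (@smooth_coind R (fun g => exists c h, P h /\ g = fun x => c * h x)).
- move=> _ [c [h [Ph ->]]] x; have [g _ [dg _]] := dP h c x 1 Ph.
  exact/differentiable_continuous/derivable1_diffP.
- by move=> _ x v [c [h [Ph ->]]]; have [g _ []] := dP h c x v Ph.
- move=> _ v [c [h [Ph ->]]]; have [g Pg [_ e]] := dP h c 0 v Ph.
  by exists (v * c), g; split => //; apply/funext.
- by exists 1, f; split => //; apply/funext => x; rewrite mul1r.
Qed.

Lemma smooth_primitive f g : (forall x, is_derive x (1 : R) f (g x)) -> smooth g ->
  smooth f.
Proof.
move=> fg sg; apply: (@smooth1_coind (fun h => smooth h \/ h = f)); last by right.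
move=> h [sh| ->]; last by exists g => //; left.
exists (fun x => 'D_1 h x); first by left; exact: smooth_derive.
by move=> x; apply: DeriveDef => //; exact: smooth_derivable.
Qed.

End dimension1.

(** * A smooth bump and a smooth step on the line *)

Section bump.

(** For p = 1 this is the classical flat function exp(-1/x). The polynomial in 1/x makes the family
    stable under differentiation, which sends p to X^2 (p - p'). *)
Definition flat (p : {poly R}) (x : R) : R :=
  if x <= 0 then 0 else p.[x^-1] * expR (- x^-1).

(** Put y = 1/h >= 1 and n = [size p]. Then |p(y)| is at most the sum of the absolute coefficients
    times y^n, while exp(y) >= y^(n+1) / (n+1)!. The spare power of y is the factor |h|. *)
Lemma flat_bound (p : {poly R}) : exists C : R, 0 <= C /\
  forall h : R, `|h| <= 1 -> `|flat p h| <= C * `|h|.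
Proof.
pose n := size p.
exists ((\sum_(i < n) `|p`_i|) * n.+1`!%:R); split.
  by rewrite mulr_ge0// sumr_ge0.
move=> h h1; rewrite /flat; case: (leP h 0) => h0.
  by rewrite normr0 !mulr_ge0// sumr_ge0.
have hi1 : 1 <= h^-1 by rewrite invf_ge1//; move: h1; rewrite gtr0_norm.
have hi0 : 0 < h^-1 by rewrite invr_gt0.
rewrite normrM (gtr0_norm (expR_gt0 _)) expRN.
rewrite ler_pdivrMr ?expR_gt0//.
have e1 : (h^-1) ^+ n.+1 <= n.+1`!%:R * expR h^-1.
  rewrite mulrC -ler_pdivrMr ?ltr0n ?fact_gt0//.
  by have := @expR_ge1Dxn R h^-1 n (ltW hi0); lra.
have e2 : `|p.[h^-1]| <= (\sum_(i < n) `|p`_i|) * (h^-1) ^+ n.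
  rewrite horner_coef (le_trans (ler_norm_sum _ _ _))// mulr_suml ler_sum// => i _.
  rewrite normrM ler_wpM2l// (ger0_norm (exprn_ge0 _ (ltW hi0))).
  by apply: ler_weXn2l => //; rewrite ltnW.
rewrite (le_trans e2)//.
have -> : (h^-1) ^+ n = h * h^-1 ^+ n.+1.
  by rewrite exprS mulrA mulfV ?mul1r// gt_eqF.
rewrite -!mulrA ler_wpM2l ?sumr_ge0// (gtr0_norm h0) mulrCA ler_wpM2l// ltW//.
Qed.

Lemma is_derive_flat (p : {poly R}) (x : R) :
  is_derive x (1 : R) (flat p) (flat ('X^2 * (p - p^`())) x).
Proof.
have [x0|x0|->] := ltgtP x 0.
- rewrite {2}/flat ltW//.
  have dc : is_derive x (1 : R) (cst 0 : R -> R) 0 by exact: is_derive_cst.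
  apply: near_eq_is_derive dc.
  near=> y; rewrite /flat ifT// ltW//; near: y; exact: lt_nbhsl.
- rewrite {2}/flat leNgt x0 /=.
  have dV : is_derive x (1 : R) (GRing.inv : R -> R) (- x^-2).
    have := @is_deriveV R id x 1 1; rewrite gt_eqF// => /(_ isT).
    by move=> /(_ (is_derive_id _ _)); rewrite /GRing.scale/= mulr1.
  have dp : is_derive x (1 : R) (horner p \o GRing.inv) (p^`().[x^-1] * - x^-2).
    exact: is_derive1_comp.
  have dN : is_derive x (1 : R) (-%R \o GRing.inv) (- - x^-2).
    exact: (is_deriveN dV).
  have de : is_derive x (1 : R) (expR \o (-%R \o GRing.inv)) (expR (- x^-1) * - - x^-2).
    exact: is_derive1_comp.
  apply: near_eq_is_derive (is_derive_eq (is_deriveM dp de) _).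
    near=> y; rewrite /flat ifF//; apply/negbTE; rewrite -ltNge; near: y.
    exact: lt_nbhsr.
  rewrite /GRing.scale /= hornerM hornerXn hornerD hornerN exprVn; ring.
- have -> : flat ('X^2 * (p - p^`())) 0 = 0 by rewrite /flat lexx.
  (* Dividing by h multiplies by 1/h, so the difference quotient of [flat p] at 0 is
     [flat ('X * p)], which tends to 0 by the bound. *)
  have [C [C0 hC]] := flat_bound ('X * p).
  suff c : (fun h : R => h^-1 *: ((flat p \o shift 0) (h *: 1) - flat p 0)) @ 0^' --> (0 : R).
    by apply: DeriveDef; [apply/cvg_ex; exists 0|apply: cvg_lim].
  have e h : h^-1 *: ((flat p \o shift 0) (h *: 1) - flat p 0) = flat ('X * p) h.
    rewrite /= addr0 /GRing.scale /= mulr1 /flat lexx subr0.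
    by case: leP => // h0; rewrite ?mulr0// hornerM hornerX mulrA.
  under eq_fun do rewrite e.
  apply/cvgr0Pnorm_le => eps eps0; near=> h.
  have h1 : `|h| <= 1 by near: h; exact: dnbhs0_le.
  rewrite (le_trans (hC _ h1))//.
  have h2 : `|h| <= eps / (C + 1).
    by near: h; apply: dnbhs0_le; rewrite divr_gt0// ltr_pwDr.
  rewrite (le_trans (ler_wpM2l C0 h2))// mulrA ler_pdivrMr ?ltr_pwDr//.
  by rewrite mulrC ler_pM2l//; lra.
Unshelve. all: by end_near. Qed.

Lemma smooth_flat (p : {poly R}) : smooth (flat p).
Proof.
apply: (@smooth1_coind (fun f => exists p, f = flat p)); last by exists p.
move=> _ [q ->]; exists (flat ('X^2 * (q - q^`()))); first by eexists.
by move=> x; exact: is_derive_flat.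
Qed.

Lemma flat1E x : 0 < x -> flat 1 x = expR (- x^-1).
Proof. by move=> x0; rewrite /flat leNgt x0 /= hornerE mul1r. Qed.

Lemma flat_ge0 x : 0 <= flat 1 x.
Proof.
have [x0|x0] := ltP 0 x; first by rewrite flat1E// expR_ge0.
by rewrite /flat x0.
Qed.

Definition bump0 (x : R) : R := flat 1 (1 + x) * flat 1 (1 - x).

Lemma smooth_affine1 (f : R -> R) (c a : R) :
  smooth f -> smooth (fun x : R => f (c * x + a)).
Proof.
move=> sf; apply: (@smooth_affine R R (fun x : R => c * x + a) (fun w : R => c * w)) => //.
- by move=> x w h /=; rewrite /GRing.scale /=; ring.
- by move=> x; apply: cvgD; [apply: cvgMr; exact: cvg_id|exact: cvg_cst].
Qed.

Lemma smooth_bump0 : smooth bump0.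
Proof.
apply: smoothM.
  have := smooth_affine1 1 1 (smooth_flat 1); congr smooth.
  by apply/funext => x; rewrite mul1r addrC.
have := smooth_affine1 (-1) 1 (smooth_flat 1); congr smooth.
by apply/funext => x; rewrite mulN1r addrC.
Qed.

Lemma bump0_ge0 x : 0 <= bump0 x.
Proof. by rewrite mulr_ge0// flat_ge0. Qed.

Lemma bump0_support x : 1 <= `|x| -> bump0 x = 0.
Proof.
rewrite /bump0 /flat ler_normr => /orP[h|h].
  by rewrite [X in _ * X]ifT ?mulr0//; lra.
by rewrite ifT ?mul0r//; lra.
Qed.

Lemma bump0_continuous : continuous bump0.
Proof. exact: smooth_continuous smooth_bump0. Qed.

(** A lower bound on an interval of length 1 makes the integral of [bump0] positive, so that [bump]
    can be normalised. *)
Lemma bump0_lb x : `|x| <= 2^-1 -> expR (- 4) <= bump0 x.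
Proof.
rewrite ler_norml => /andP[h1 h2]; rewrite /bump0.
have e y : 2^-1 <= y -> expR (- 2) <= flat 1 y.
  move=> y2; rewrite flat1E; last lra.
  by rewrite ler_expR lerN2 invf_ple ?posrE//; lra.
have -> : - 4 = - 2 + - 2 :> R by lra.
by rewrite expRD ler_pM ?expR_ge0// e//; lra.
Qed.

Lemma leb_itv_lty (a b : R) : (leb R `[a, b] < +oo)%E.
Proof.
by rewrite lebesgue_measure_itv/=; case: ifP => // _; rewrite -EFinD ltry.
Qed.

Lemma leb_itvoc_lty (a b : R) : (leb R `]a, b] < +oo)%E.
Proof.
by rewrite lebesgue_measure_itv/=; case: ifP => // _; rewrite -EFinD ltry.
Qed.

Lemma leb_itvcc (a b : R) : a <= b -> leb R `[a, b] = (b - a)%:E.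
Proof.
move=> ab; rewrite lebesgue_measure_itv/= lte_fin; case: ltP => h.
  by rewrite -EFinD.
by have -> : b = a; [lra|rewrite subrr].
Qed.

Lemma bump0_Li : Li (leb R) bump0.
Proof.
have mb : measurable_fun setT bump0 by exact: continuous_measurable_fun bump0_continuous.
have [C hC] : exists C, forall x, `|bump0 x| <= C.
  have : compact (bump0 @` `[-1, 1]).
    apply: continuous_compact; last exact: segment_compact.
    by apply: continuous_subspaceT; exact: bump0_continuous.
  move=> /compact_bounded [C [_ hC]]; exists (Num.max C 0 + 1) => x.
  have [xr|xr] := leP 1 `|x|.
    by rewrite bump0_support// normr0 addr_ge0// le_max lexx orbT.
  apply: hC; first by rewrite ltr_pwDr// le_max lexx.
  by exists x => //=; rewrite in_itv/= -ler_norml ltW.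
refine (@Li_le _ (measurableTypeR R) R (leb R) (fun x => C * \1_(`[-1, 1]) x) bump0 mb _ _).
  move=> x; rewrite indicE; have [|xr] := boolP (x \in `[-1, 1]%classic).
    by rewrite mulr1.
  rewrite mulr0 bump0_support ?normr0// leNgt; apply/negP => h; move: xr.
  by rewrite notin_setE /= in_itv /= -ler_norml ltW.
apply: LiZ; apply: Li_indic => //.
exact: leb_itv_lty.
Qed.

Lemma bump0_int_gt0 : 0 < \int[leb R]_x bump0 x.
Proof.
apply: (@lt_le_trans _ _ (\int[leb R]_x (expR (- 4) * \1_(`[(- 2^-1)%R, 2^-1%R]) x))).
  have i : Li (leb R) (\1_(`[(- 2^-1)%R, 2^-1%R]) : R -> R).
    apply: Li_indic => //.
    exact: leb_itv_lty.
  rewrite RIZ// mulr_gt0 ?expR_gt0// /Rintegral integral_indic// setIT.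
  suff e : leb R `[(- 2^-1)%R, 2^-1%R] = 1%:E by rewrite [X in fine X]e.
  rewrite lebesgue_measure_itv/= lte_fin ifT /=; last lra.
  by rewrite -EFinD; congr EFin; lra.
apply: RI_le; [|exact: bump0_Li|].
  apply: LiZ; apply: Li_indic => //.
  exact: leb_itv_lty.
move=> x; rewrite indicE; have [|xr] := boolP (x \in `[(- 2^-1)%R, 2^-1%R]%classic).
  by rewrite inE /= in_itv /= -ler_norml mulr1 => /bump0_lb.
by rewrite mulr0 bump0_ge0.
Qed.

Definition bump (x : R) : R := (\int[leb R]_x bump0 x)^-1 * bump0 x.

Lemma smooth_bump : smooth bump.
Proof. exact: smoothZ smooth_bump0. Qed.

Lemma bump_ge0 x : 0 <= bump x.
Proof. by rewrite mulr_ge0 ?bump0_ge0// invr_ge0 ltW// bump0_int_gt0. Qed.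

Lemma bump_support x : 1 <= `|x| -> bump x = 0.
Proof. by move=> /bump0_support e; rewrite /bump e mulr0. Qed.

Lemma bump_Li : Li (leb R) bump.
Proof. exact: LiZ bump0_Li. Qed.

Lemma bump_int : \int[leb R]_x bump x = 1.
Proof. by rewrite RIZ ?mulVf ?gt_eqF ?bump0_int_gt0//; exact: bump0_Li. Qed.

Definition step (x : R) : R := \int[leb R]_(t in `]-oo, x]) bump t.

Lemma is_derive_step x : is_derive x (1 : R) step (bump x).
Proof.
have [] := @continuous_FTC1 R bump -oo%O x (x + 1).
- by rewrite ltrDl.
- by apply: integrableS bump_Li.
- by rewrite ltNyr.
- by move=> ?; exact: smooth_continuous smooth_bump _ _.
by move=> d e; apply: DeriveDef; [exact: d|rewrite -derive1E; exact: e].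
Qed.

Lemma smooth_step : smooth step.
Proof. exact: smooth_primitive is_derive_step smooth_bump. Qed.

Lemma step_lt x : x <= -1 -> step x = 0.
Proof.
move=> x1; rewrite /step (@eq_Rintegral _ _ _ (leb R) _ (cst 0)) ?Rintegral_cst ?mul0r//.
move=> t; rewrite inE /= in_itv /= => tx; apply: bump_support.
by rewrite ler_normr; apply/orP; right; lra.
Qed.

Lemma step_gt x : 1 <= x -> step x = 1.
Proof.
move=> x1; rewrite -bump_int /step Rintegral_mkcond; apply: eq_RI => t.
rewrite /patch; case: ifPn => //; rewrite notin_setE /= in_itv /= => /negP; rewrite -ltNge => tx.
by rewrite bump_support// ler_normr; apply/orP; left; lra.
Qed.

Lemma step_range x : 0 <= step x <= 1.
Proof.
apply/andP; split; first by apply: Rintegral_ge0 => t _; exact: bump_ge0.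
rewrite -bump_int /step Rintegral_mkcond; apply: RI_le; last first.
- by move=> t; rewrite /patch; case: ifP => // _; exact: bump_ge0.
- exact: bump_Li.
- rewrite /Li -restrict_EFin.
  by apply/(integrable_mkcond _ _).1 => //; apply: integrableS bump_Li.
Qed.

End bump.

End smooth_functions.

(** * Test functions *)

(** Asking for bounded support, with no compact set in sight, lets the notion make sense on every
    normed space and pass to tensor products. On R^3 these functions are test functions by
    [tst_test]. *)
Definition tst {R : realType} {V : normedModType R} (f : V -> R) :=
  smooth f /\ exists r : R, forall x, r < `|x| -> f x = 0.

Section test_functions_general.
Context {R : realType} {V : normedModType R}.
Implicit Types (f g : V -> R).

Lemma tst_smooth f : tst f -> smooth f. Proof. by case. Qed.

Lemma tst_continuous f : tst f -> continuous f.
Proof. by move=> /tst_smooth /smooth_continuous. Qed.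

Lemma tstM f g : smooth f -> tst g -> tst (fun x => f x * g x).
Proof.
move=> sf [sg [r hr]]; split; first exact: smoothM.
by exists r => x /hr ->; rewrite mulr0.
Qed.

Lemma tstD f g : tst f -> tst g -> tst (fun x => f x + g x).
Proof.
move=> [sf [r hr]] [sg [s hs]]; split; first exact: smoothD.
exists (Num.max r s) => x; rewrite gt_max => /andP[/hr -> /hs ->].
by rewrite addr0.
Qed.

Lemma tstZ c f : tst f -> tst (fun x => c * f x).
Proof. by apply: tstM; exact: smooth_cst. Qed.

Lemma tst0 : tst (fun _ : V => 0 : R).
Proof. by split; [exact: smooth_cst|exists 0]. Qed.

Lemma tst_sum (I : Type) (s : seq I) (F : I -> V -> R) :
  (forall i, tst (F i)) -> tst (fun x => \sum_(i <- s) F i x).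
Proof.
move=> sF; elim: s => [|a s IH].
  by rewrite (_ : (fun _ => _) = (fun _ => 0));
    [exact: tst0|apply/funext => x; rewrite big_nil].
rewrite (_ : (fun _ => _) = (fun x => F a x + \sum_(i <- s) F i x)).
  exact: tstD.
by apply/funext => x; rewrite big_cons.
Qed.

End test_functions_general.

Section test_functions.
Context {R : realType}.
Implicit Types (x y v : R3 R) (f g k : R3 R -> R).

Definition pd (j : 'I_3) f : R3 R -> R := fun x => 'D_(evec j) f x.

Lemma tst_Cc f : tst f -> Cc f.
Proof. by move=> [sf h]; split => //; exact: smooth_continuous. Qed.

Lemma tst_test f : tst f -> test_function setT f.
Proof.
move=> [sf [r hr]]; split => //; exists (cube r); split => //.
  exact: compact_cube.
by move=> x; rewrite /cube /= => /negP; rewrite -ltNge; exact: hr.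
Qed.

Lemma tst_measurable f : tst f -> measurable_fun setT f.
Proof. by move=> /tst_Cc /Cc_measurable. Qed.

Lemma tst_Li f : tst f -> Li (leb3 R) f.
Proof. by move=> /tst_Cc /Cc_Li. Qed.

Lemma tst_L2 f : tst f -> L2 (leb3 R) f.
Proof. by move=> /tst_Cc /Cc_L2. Qed.

Lemma tst_bounded f : tst f -> exists C, 0 < C /\ forall x, `|f x| <= C.
Proof. by move=> /tst_Cc /Cc_bounded. Qed.

Lemma tst_derive f v : tst f -> tst (fun x => 'D_v f x).
Proof.
move=> [sf [r hr]]; split; first exact: smooth_derive.
exists r => x rx; rewrite (@near_eq_derive _ _ _ f (cst 0)) ?derive_cst//.
have c : (fun y : R3 R => `|y|) @ x --> `|x| by apply: norm_continuous.
by near=> y; apply: hr; near: y; exact: (cvgr_gt _ c).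
Unshelve. all: by end_near. Qed.

Lemma tst_pd j f : tst f -> tst (pd j f).
Proof. exact: tst_derive. Qed.

Lemma pdM j f g : smooth f -> smooth g ->
  pd j (fun x => f x * g x) = (fun x => f x * pd j g x + g x * pd j f x).
Proof.
move=> sf sg; apply/funext => x; rewrite /pd.
by rewrite (@deriveM _ _ f g)//; exact: smooth_derivable.
Qed.

Lemma pdD j f g : smooth f -> smooth g ->
  pd j (fun x => f x + g x) = (fun x => pd j f x + pd j g x).
Proof.
move=> sf sg; apply/funext => x; rewrite /pd.
by rewrite (@deriveD _ _ _ f g)//; exact: smooth_derivable.
Qed.

Lemma pd_cst j c : pd j (fun _ => c) = (fun _ => 0).
Proof. by apply/funext => x; exact: derive_cst. Qed.

Lemma pd_sum j (I : Type) (s : seq I) (F : I -> R3 R -> R) :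
  (forall i, smooth (F i)) ->
  pd j (fun x => \sum_(i <- s) F i x) = (fun x => \sum_(i <- s) pd j (F i) x).
Proof.
move=> sF; elim: s => [|a s IH].
  rewrite (_ : (fun _ => _) = (fun _ => 0)).
    by rewrite pd_cst; apply/funext => x; rewrite big_nil.
  by apply/funext => x; rewrite big_nil.
rewrite (_ : (fun _ => _) = (fun x => F a x + \sum_(i <- s) F i x)).
  rewrite pdD ?IH//; last exact: smooth_sum.
  by apply/funext => x; rewrite big_cons.
by apply/funext => x; rewrite big_cons.
Qed.

Lemma pdZ j c f : smooth f -> pd j (fun x => c * f x) = (fun x => c * pd j f x).
Proof.
move=> sf; rewrite (pdM j (smooth_cst c) sf).
by apply/funext => x; rewrite pd_cst mulr0 addr0.
Qed.

Let affE (c : R) a x w (h : R) :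
  c *: (h *: w + x) + a = h *: (c *: w) + (c *: x + a) :> R3 R.
Proof. by rewrite scalerDr !scalerA mulrC addrA. Qed.

Let affC (c : R) (a : R3 R) : continuous (fun x : R3 R => c *: x + a).
Proof.
move=> x; apply: cvgD; last exact: cvg_cst.
by apply: cvgZr; exact: cvg_id.
Qed.

Lemma smooth_aff c a f : smooth f -> smooth (fun x => f (c *: x + a)).
Proof.
exact: (@smooth_affine R (R3 R) (R3 R) (fun x => c *: x + a) (fun w => c *: w)
  (affE c a) (@affC c a) f).
Qed.

Lemma pd_aff j c a f x : pd j (fun x => f (c *: x + a)) x =
  'D_(c *: evec j) f (c *: x + a).
Proof. exact: (derive_affine (L := fun w => c *: w) (affE c a)). Qed.

(** Directional derivatives are limits along a line and carry no linearity in the direction.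
    Homogeneity follows from the chain rule on the line t v + x, where f becomes a function of one
    variable. *)
Lemma derive_dirZ f x v c : smooth f -> 'D_(c *: v) f x = c * 'D_v f x.
Proof.
move=> sf; pose g (t : R) := f (t *: v + x).
have AL t w (h : R) : (h *: w + t) *: v + x = h *: (w *: v) + (t *: v + x) :> R3 R.
  by rewrite scalerDl scalerA addrA.
have E w : 'D_(w *: v) f x = 'D_w g 0.
  have := @derive_affine _ _ _ (fun t : R => t *: v + x) (fun w : R => w *: v) AL f 0 w.
  by rewrite scale0r add0r => <-.
have d1 : is_derive (0 : R) (1 : R) g ('D_v f x).
  apply: DeriveDef; last by rewrite -E scale1r.
  apply/(@derivable_affine _ _ _ (fun t : R => t *: v + x) (fun w : R => w *: v) AL).
  exact: smooth_derivable.
by rewrite E; have [_ ->] := is_derive_dir c d1.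
Qed.

Lemma pd_affine j c a f : smooth f ->
  pd j (fun x => f (c *: x + a)) = (fun x => c * pd j f (c *: x + a)).
Proof. by move=> sf; apply/funext => x; rewrite pd_aff derive_dirZ. Qed.

Lemma tst_aff c a f : c != 0 -> tst f -> tst (fun x => f (c *: x + a)).
Proof.
move=> c0 [sf [r hr]]; split; first exact: smooth_aff.
exists ((r + `|a|) / `|c|) => x; rewrite ltr_pdivrMr ?normr_gt0// => h.
apply: hr; have := ler_normB (c *: x + a) a; rewrite addrK normrZ.
by rewrite mulrC in h; lra.
Qed.

Lemma tst_refl a f : tst f -> tst (fun x => f (a - x)).
Proof.
move=> /(@tst_aff (-1) a); rewrite oppr_eq0 oner_eq0 => /(_ isT); congr tst.
by apply/funext => x; rewrite scaleN1r addrC.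
Qed.

Lemma pd_refl j a f : smooth f ->
  pd j (fun x => f (a - x)) = (fun x => - pd j f (a - x)).
Proof.
move=> sf; have := pd_affine j (-1) a sf.
rewrite (_ : (fun x => f _) = (fun x => f (a - x))); last first.
  by apply/funext => x; rewrite scaleN1r addrC.
move=> ->; apply/funext => x.
by rewrite mulN1r scaleN1r addrC.
Qed.

Lemma tst_shift a f : tst f -> tst (fun x => f (x - a)).
Proof.
move=> /(@tst_aff 1 (- a)); rewrite oner_eq0 => /(_ isT); congr tst.
by apply/funext => x; rewrite scale1r.
Qed.

Lemma pd_shift j a f : smooth f ->
  pd j (fun x => f (x - a)) = (fun x => pd j f (x - a)).
Proof.
move=> sf; have := pd_affine j 1 (- a) sf.
rewrite (_ : (fun x => f _) = (fun x => f (x - a))); last first.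
  by apply/funext => x; rewrite scale1r.
move=> ->; apply/funext => x.
by rewrite mul1r scale1r.
Qed.

Lemma dir_mvt f x v (h : R) : smooth f -> exists2 xi : R, `|xi| <= `|h| &
  f (x + h *: v) - f x = h * 'D_v f (x + xi *: v).
Proof.
move=> sf; pose g (t : R) := f (t *: v + x).
have AL t w (r : R) : (r *: w + t) *: v + x = r *: (w *: v) + (t *: v + x) :> R3 R.
  by rewrite scalerDl scalerA addrA.
have dg (t : R) : is_derive t (1 : R) g ('D_v f (t *: v + x)).
  apply: DeriveDef.
    apply/(@derivable_affine _ _ _ (fun t : R => t *: v + x) (fun w : R => w *: v) AL).
    exact: smooth_derivable.
  have := @derive_affine _ _ _ (fun t : R => t *: v + x) (fun w : R => w *: v) AL f t 1.
  by rewrite scale1r.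
have cg : continuous g.
  by move=> t; apply/differentiable_continuous/derivable1_diffP; case: (dg t).
have e t : g t = f (x + t *: v) by rewrite /g addrC.
have g0 : g 0 = f x by rewrite e scale0r addr0.
have [h0|h0|->] := ltgtP h 0; last by exists 0; rewrite ?scale0r ?addr0 ?subrr ?mul0r.
- have [c ch E] := @MVT _ g _ _ _ h0 (fun t _ => dg t) (continuous_subspaceT cg).
  exists c; first by move: ch; rewrite in_itv/= => /andP[? ?]; rewrite !ltr0_norm//; lra.
  by rewrite -e -g0 -opprB E addrC; ring.
- have [c ch E] := @MVT _ g _ _ _ h0 (fun t _ => dg t) (continuous_subspaceT cg).
  exists c; first by move: ch; rewrite in_itv/= => /andP[? ?]; rewrite !gtr0_norm//; lra.
  by rewrite -e -g0 E addrC; ring.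
Qed.

Lemma tst_lipschitz_dir f v : tst f -> exists2 C, 0 < C &
  forall x (h : R), `|f (x + h *: v) - f x| <= C * `|h|.
Proof.
move=> tf; have [C [C0 hC]] := tst_bounded (tst_derive v tf); exists C => // x h.
have [xi _ ->] := dir_mvt x v h (tst_smooth tf).
by rewrite normrM mulrC ler_wpM2r.
Qed.

Lemma tst_taylor_dir f v : tst f -> exists2 C, 0 < C &
  forall x (h : R), `|f (x + h *: v) - f x - h * 'D_v f x| <= C * h ^+ 2.
Proof.
move=> tf; have [C C0 hC] := tst_lipschitz_dir v (tst_derive v tf); exists C => // x h.
have [xi xih ->] := dir_mvt x v h (tst_smooth tf).
rewrite -mulrBr normrM (le_trans (ler_wpM2l _ (hC _ _)))//.
rewrite -(real_normK (num_real h)) mulrCA ler_wpM2l ?(ltW C0)// expr2.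
by rewrite ler_wpM2l.
Qed.

Lemma evec_decomp x : x = x.1.1 *: evec 0 + x.1.2 *: evec 1 + x.2 *: evec 2%:R.
Proof.
case: x => [[x1 x2] x3].
transitivity ((x1 * 1 + x2 * 0 + x3 * 0, x1 * 0 + x2 * 1 + x3 * 0,
  x1 * 0 + x2 * 0 + x3 * 1) : R3 R); last by [].
by rewrite !mulr0 !mulr1 !addr0 !add0r.
Qed.

(** Goes from y to x in three moves along the coordinate axes, each controlled by the mean value
    theorem. *)
Lemma tst_lipschitz f : tst f -> exists2 C, 0 < C &
  forall x y, `|f x - f y| <= C * `|x - y|.
Proof.
move=> tf; have [C1 C10 h1] := tst_lipschitz_dir (evec 0) tf.
have [C2 C20 h2] := tst_lipschitz_dir (evec 1) tf.
have [C3 C30 h3] := tst_lipschitz_dir (evec 2%:R) tf.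
exists (C1 + C2 + C3); first by rewrite !addr_gt0.
move=> x y; pose z := x - y.
have -> : x = y + z.1.1 *: evec 0 + z.1.2 *: evec 1 + z.2 *: evec 2%:R.
  by rewrite -!addrA [X in _ + X]addrA -evec_decomp /z addrC subrK.
set a := y + _ *: _; set b := a + _ *: _; set c := b + _ *: _.
have -> : c - y = z.
  have -> : c = y + z by rewrite [in RHS](evec_decomp z) /c /b /a !addrA.
  by rewrite addrC addKr.
have n1 : `|z.1.1| <= `|z| by rewrite norm3E !le_max lexx.
have n2 : `|z.1.2| <= `|z| by rewrite norm3E !le_max lexx orbT.
have n3 : `|z.2| <= `|z| by rewrite norm3E !le_max lexx orbT.
have -> : f c - f y = (f c - f b) + (f b - f a) + (f a - f y) by ring.
rewrite (le_trans (ler_normD _ _))// (le_trans (lerD (ler_normD _ _) (lexx _)))//.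
rewrite !mulrDl addrC addrA -addrA addrCA addrC lerD//.
- by rewrite lerD// (le_trans (h1 _ _) (ler_wpM2l (ltW C10) n1), le_trans (h2 _ _) (ler_wpM2l (ltW C20) n2)).
- exact: le_trans (h3 _ _) (ler_wpM2l (ltW C30) n3).
Qed.

End test_functions.

(** * Density of test functions in L^2 *)

Section L2_density.

Lemma N2_indic_le d (T : measurableType d) (R : realType) (mu : {measure set T -> \bar R})
  (A : set T) (e : R) : measurable A -> 0 <= e -> (mu A <= (e ^+ 2)%:E)%E ->
  N2 mu (\1_A : T -> R) <= e.
Proof.
move=> mA e0 h; rewrite -(@ler_pXn2r _ 2)// ?nnegrE ?N2_ge0// N2_sqr.
have E : (fun x => (\1_A x : R) ^+ 2) = \1_A.
  by apply/funext => x; rewrite indicE; case: (_ \in _); rewrite ?expr1n ?expr0n.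
rewrite E -lee_fin -RI_E; first by rewrite integral_indic// setIT.
by apply: Li_indic => //; rewrite (le_lt_trans h)// ltry.
Qed.

Lemma L2_indic d (T : measurableType d) (R : realType) (mu : {measure set T -> \bar R})
  (A : set T) : measurable A -> (mu A < +oo)%E -> L2 mu (\1_A : T -> R).
Proof.
move=> mA muA; split => //; apply: eq_Li (Li_indic mA muA) => x.
by rewrite indicE; case: (_ \in _); rewrite ?expr1n ?expr0n.
Qed.

(** * From a pi-system to all measurable sets *)

Section pi_lambda.
Context d (T : measurableType d) (R : realType) (mu : {measure set T -> \bar R}).
Variables (C : (T -> R) -> Prop) (G : set (set T)) (Q : set T).
Hypothesis C_L2 : forall f, C f -> L2 mu f.
Hypothesis C_D : forall f g, C f -> C g -> C (fun x => f x + g x).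
Hypothesis C_Z : forall c f, C f -> C (fun x => c * f x).
Hypothesis C_0 : C (fun _ => 0).
Hypothesis mQ : measurable Q.
Hypothesis Qoo : (mu Q < +oo)%E.

Definition L2_approx (f : T -> R) :=
  forall e, 0 < e -> exists2 g, C g & N2 mu (fun x => g x - f x) <= e.

Lemma L2_approxD f g : L2 mu f -> L2 mu g -> L2_approx f -> L2_approx g ->
  L2_approx (fun x => f x + g x).
Proof.
move=> Lf Lg af ag e e0; have e2 : 0 < e / 2 by rewrite divr_gt0.
have [f' Cf' hf] := af _ e2; have [g' Cg' hg] := ag _ e2.
exists (fun x => f' x + g' x); first exact: C_D.
rewrite (@eq_N2 _ _ _ _ _ (fun x => (f' x - f x) + (g' x - g x))); last first.
  by move=> x; ring.
have L1 := L2B (C_L2 Cf') Lf; have L2' := L2B (C_L2 Cg') Lg.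
by apply: le_trans (N2D L1 L2') _; lra.
Qed.

Lemma L2_approxZ c f : L2 mu f -> L2_approx f -> L2_approx (fun x => c * f x).
Proof.
move=> Lf af e e0; have c1 : 0 < `|c| + 1 by rewrite ltr_wpDl.
have [f' Cf' hf] := af _ (divr_gt0 e0 c1).
exists (fun x => c * f' x); first exact: C_Z.
rewrite (@eq_N2 _ _ _ _ _ (fun x => c * (f' x - f x))); last by move=> x; ring.
rewrite N2Z; last exact: L2B (C_L2 Cf') Lf.
rewrite (le_trans (ler_wpM2l (normr_ge0 c) hf))// mulrA ler_pdivrMr//.
by rewrite mulrC ler_pM2l//; lra.
Qed.

Lemma L2_approx_lim f : L2 mu f ->
  (forall e, 0 < e -> exists g, [/\ L2 mu g, L2_approx g &
     N2 mu (fun x => g x - f x) <= e]) -> L2_approx f.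
Proof.
move=> Lf h e e0; have e2 : 0 < e / 2 by rewrite divr_gt0.
have [g [Lg ag hg]] := h _ e2; have [k Ck hk] := ag _ e2.
exists k => //; rewrite (@eq_N2 _ _ _ _ _ (fun x => (k x - g x) + (g x - f x))).
  by apply: le_trans (N2D (L2B (C_L2 Ck) Lg) (L2B Lg Lf)) _; lra.
by move=> x; ring.
Qed.

Hypothesis sG : @measurable _ T = <<s G >>.
Hypothesis IG : setI_closed G.
Hypothesis CT : L2_approx (\1_Q).
Hypothesis CG : forall A, G A -> L2_approx (\1_(A `&` Q)).

Let LQ (A : set T) : measurable A -> L2 mu (\1_(A `&` Q) : T -> R).
Proof.
move=> mA; apply: L2_indic; first exact: measurableI.
by apply: le_lt_trans Qoo; apply: le_measure; rewrite ?inE//; apply: measurableI.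
Qed.

(** Dynkin's argument: the sets whose trace on [Q] can be approximated form a lambda-system.
    Intersecting with a set of finite measure keeps all indicators in L^2 and, for a disjoint union,
    makes the measures of the decreasing remainders [B n] tend to 0. *)
Lemma L2_approx_pi_lambda A : measurable A -> L2_approx (\1_(A `&` Q)).
Proof.
move=> mA; have sA : <<s G >> A by rewrite -sG.
move: A sA {mA}; apply: (@dynkin_induction _ T G (fun A => L2_approx (\1_(A `&` Q)))) => //.
- by rewrite setTI.
- move=> A mA aA.
  rewrite (_ : \1_(~` A `&` Q) = (fun x => \1_Q x + (-1) * \1_(A `&` Q) x)); last first.
    apply/funext => x; rewrite !indicE !in_setI in_setC.
    by case: (x \in A); case: (x \in Q); rewrite /=; ring.
  apply: L2_approxD => //.
  + by rewrite -(setTI Q); apply: LQ.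
  + by apply: L2Z; exact: LQ.
  + by apply: L2_approxZ => //; exact: LQ.
- move=> F mF tF aF.
  have mU : measurable (\bigcup_k F k) by exact: bigcupT_measurable.
  apply: L2_approx_lim; first exact: LQ.
  move=> e e0; pose B n := (\bigcup_k F k `\` \big[setU/set0]_(i < n) F i) `&` Q.
  have mS n : measurable (\big[setU/set0]_(i < n) F i) by exact: bigsetU_measurable.
  have mB n : measurable (B n) by apply: measurableI => //; apply: measurableD.
  have Bcv : mu (B n) @[n --> \oo] --> 0%E.
    have -> : 0%E = mu (\bigcap_n B n).
      rewrite (_ : \bigcap_n _ = set0) ?measure0//.
      apply/seteqP; split => // x h; have [[[k _ Fkx] _] _] := h 0%N I.
      have [[_ nk] _] := h k.+1 I; apply: nk.
      by rewrite -bigcup_mkord; exists k => //=.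
    apply: nonincreasing_cvg_mu => //.
    + apply: le_lt_trans Qoo; apply: le_measure; rewrite ?inE//.
      by move=> x [].
    + exact: bigcapT_measurable.
    + move=> m n mn; apply/subsetPset => x [[Ux nx] Qx]; split => //; split => //.
      apply: contra_not nx; rewrite -!bigcup_mkord => -[k /= km Fk].
      by exists k => //=; exact: leq_trans mn.
  have [n hn] : exists n, (mu (B n) <= (e ^+ 2)%:E)%E.
    have /fine_cvgP[fB /cvgr0_norm_le /(_ (e ^+ 2))] := Bcv.
    rewrite exprn_gt0// => /(_ isT) hB.
    have [n _ /(_ n (leqnn n)) [h1 h2]] := filterI fB hB.
    exists n; rewrite -(fineK h1) lee_fin; apply: le_trans h2 => /=; exact: ler_norm.
  exists (\1_((\big[setU/set0]_(i < n) F i) `&` Q)); split; first exact: LQ.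
    elim: n {hn} => [|n IH].
      rewrite big_ord0 set0I => e' e'0; exists (fun _ => 0) => //.
      rewrite (@eq_N2 _ _ _ _ _ (fun _ => 0)); last by move=> x; rewrite indic0 subrr.
      by rewrite /N2 (@eq_RI _ _ _ _ _ (fun _ => 0)) ?RI0 ?sqrtr0 ?ltW// => x; rewrite expr0n.
    rewrite big_ord_recr /=.
    rewrite (_ : \1__ = (fun x => \1_(\big[setU/set0]_(i < n) F i `&` Q) x + \1_(F n `&` Q) x)).
      by apply: L2_approxD => //; exact: LQ.
    apply/funext => x; rewrite !indicE !in_setI in_setU.
    have : ~ (x \in \big[setU/set0]_(i < n) F i /\ x \in F n).
      rewrite !inE -bigcup_mkord => -[[k /= kn Fk] Fn].
      have E : k = n by apply: (tF k n I I); exists x.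
      by move: kn; rewrite E ltnn.
    by case: (x \in \big[_/_]_(_ < _) _); case: (x \in F n); case: (x \in Q) => //= H;
      rewrite ?addr0 ?add0r//; exfalso; exact: H.
  rewrite (@eq_N2 _ _ _ _ _ (fun x => - \1_(B n) x)) ?N2N.
    by apply: N2_indic_le => //; exact: ltW.
  move=> x.
  have EB : (x \in B n) = ((x \in \bigcup_k F k) &&
      (x \notin \big[setU/set0]_(i < n) F i)) && (x \in Q).
    by rewrite /B in_setI in_setD.
  rewrite !indicE EB !in_setI.
  have : x \in \big[setU/set0]_(i < n) F i -> x \in \bigcup_k F k.
    by rewrite !inE -bigcup_mkord => -[k _ ?]; exists k.
  case: (x \in \big[_/_]_(_ < _) _); case: (x \in \bigcup_k F k); case: (x \in Q) => //= H;
    rewrite ?subrr ?subr0 ?sub0r ?oppr0//; by have := H isT.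
Qed.

End pi_lambda.

Section to_functions.
Import HBNNSimple.
Context d (T : measurableType d) (R : realType) (mu : {measure set T -> \bar R}).
Variables (C : (T -> R) -> Prop) (Q : nat -> set T).
Hypothesis C_L2 : forall f, C f -> L2 mu f.
Hypothesis C_D : forall f g, C f -> C g -> C (fun x => f x + g x).
Hypothesis C_Z : forall c f, C f -> C (fun x => c * f x).
Hypothesis C_0 : C (fun _ => 0).
Hypothesis mQ : forall n, measurable (Q n).
Hypothesis Qoo : forall n, (mu (Q n) < +oo)%E.
Hypothesis ndQ : nondecreasing_seq Q.
Hypothesis QT : \bigcup_n Q n = setT.
Hypothesis aQ : forall n A, measurable A -> L2_approx mu C (\1_(A `&` Q n)).

Let approx_ge0 f : L2 mu f -> (forall x, 0 <= f x) -> L2_approx mu C f.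
Proof.
move=> Lf f0; have mf := L2_measurable Lf.
have mEf : measurable_fun setT (EFin \o f) by exact/measurable_EFinP.
pose s n : {nnsfun T >-> R} := nnsfun_approx measurableT mEf n.
(* The simple approximations increase to f; cut off to [Q n], they become finite combinations of the
   indicators that [aQ] covers, and they stay between 0 and f. *)
pose g n x := s n x * \1_(Q n) x.
have sf n x : s n x <= f x.
  rewrite -lee_fin /s nnsfun_approxE; apply: (@le_approx _ _ _ setT (EFin \o f)) => //.
  by move=> y _ /=; rewrite lee_fin.
have cs x : s n x @[n --> \oo] --> f x.
  have := @cvg_nnsfun_approx _ _ _ _ measurableT _ mEf _ x I.
  move=> /(_ (fun y _ => _)) h.
  have : (EFin \o s ^~ x) n @[n --> \oo] --> (f x)%:E.
    by apply: h => y; rewrite lee_fin.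
  by move=> /fine_cvgP[_].
have cg x : g n x @[n --> \oo] --> f x.
  have [N _ QN] : (\bigcup_n Q n) x by rewrite QT.
  have := cs x; apply: cvg_trans; apply: near_eq_cvg; near=> n.
  rewrite /g indicE mem_set ?mulr1//.
  have : (N <= n)%N by near: n; exact: nbhs_infty_ge.
  by move=> /ndQ /subsetPset; apply.
have g0 n x : 0 <= g n x by rewrite mulr_ge0// indicE ler0n.
have gf n x : g n x <= f x.
  rewrite /g indicE; case: (_ \in _); rewrite ?mulr1 ?mulr0//; exact: sf.
have mg n : measurable_fun setT (g n).
  by apply: measurable_funM => //.
have Lg n : L2 mu (g n).
  by apply: (L2_le (mg n) _ Lf) => x; rewrite !ger0_norm.
have ag n : L2_approx mu C (g n).
  have [l E] : exists l : seq R, g n = (fun x => \sum_(y <- l)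
      y * \1_((s n @^-1` [set y]) `&` Q n) x).
    exists (finmap.enum_fset (fset_set (range (s n : T -> R)))); apply/funext => x; rewrite /g (fimfunE (s n) x) fsbig_finite//= mulr_suml.
    by apply: eq_bigr => y _; rewrite indicI /= mulrA.
  rewrite E; elim: l {E} => [|y l IH].
    rewrite (_ : (fun _ => _) = (fun _ => 0)).
      move=> e e0; exists (fun _ => 0) => //.
      rewrite /N2 (@eq_RI _ _ _ _ _ (fun _ => 0)) ?RI0 ?sqrtr0 ?ltW// => x.
      by rewrite subrr expr0n.
    by apply/funext => x; rewrite big_nil.
  rewrite (_ : (fun _ => _) = (fun x => y * \1_((s n @^-1` [set y]) `&` Q n) x +
     \sum_(y <- l) y * \1_((s n @^-1` [set y]) `&` Q n) x)); last first.
    by apply/funext => x; rewrite big_cons.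
  have Li1 z : L2 mu (\1_((s n @^-1` [set z]) `&` Q n) : T -> R).
    apply: L2_indic; first exact: measurableI.
    apply: le_lt_trans (Qoo n); apply: le_measure; rewrite ?inE//.
    exact: measurableI.
  apply: L2_approxD => //.
  - exact: L2Z.
  - by apply: L2_sum => z; exact: L2Z.
  - by apply: L2_approxZ => //; exact: aQ.
apply: L2_approx_lim => // e e0.
have c0 : \int[mu]_x (g n x - f x) ^+ 2 @[n --> \oo] --> 0.
  have [] := @Li_dct _ _ _ mu (fun n x => (g n x - f x) ^+ 2) (fun _ => 0)
    (fun x => f x ^+ 2).
  - by move=> n; apply: measurable_funX; exact: measurable_funB.
  - exact: measurable_cst.
  - apply: aeW => x.
    have h : g n x - f x @[n --> \oo] --> 0.
      by rewrite -[X in _ --> X](subrr (f x)); apply: cvgB; [exact: cg|exact: cvg_cst].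
    rewrite (_ : (fun n => (g n x - f x) ^+ 2) = (fun n => (g n x - f x) * (g n x - f x)))//.
    by rewrite -[X in _ --> X](mulr0 0); exact: (cvgM h h).
  - exact: L2_sq.
  - apply: aeW => x n; rewrite ger0_norm ?sqr_ge0//.
    by have := g0 n x; have := gf n x; nra.
  by rewrite RI0.
have /cvgr0_norm_le /(_ (e ^+ 2)) := c0.
rewrite exprn_gt0// => /(_ isT)[n _ /(_ n (leqnn n)) /= h].
exists (g n); split => //.
rewrite -(@ler_pXn2r _ 2)// ?nnegrE ?N2_ge0// ?(ltW e0)// N2_sqr.
exact: le_trans (ler_norm _) h.
Unshelve. all: by end_near. Qed.

Lemma L2_approx_all f : L2 mu f -> L2_approx mu C f.
Proof.
move=> Lf; have mf := L2_measurable Lf.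
pose p x := Num.max (f x) 0; pose q x := Num.max (- f x) 0.
have mp : measurable_fun setT p by apply: measurable_maxr.
have mq : measurable_fun setT q.
  by apply: measurable_maxr => //; exact: measurableT_comp.
have Lp : L2 mu p.
  apply: (L2_le mp _ Lf) => x; rewrite /p; case: (leP (f x) 0) => h.
    by rewrite normr0.
  by [].
have Lq : L2 mu q.
  apply: (L2_le mq _ Lf) => x; rewrite /q; case: (leP (- f x) 0) => h.
    by rewrite normr0.
  by rewrite normrN.
have -> : f = (fun x => p x + (-1) * q x).
  apply/funext => x; rewrite /p /q; case: (leP (f x) 0); case: (leP (- f x) 0); lra.
apply: L2_approxD => //.
- exact: L2Z.
- by apply: approx_ge0 => // x; rewrite /p le_max lexx orbT.
- by apply: L2_approxZ => //; apply: approx_ge0 => // x; rewrite /q le_max lexx orbT.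
Qed.

End to_functions.

(** * Approximation of tensor products *)

Section tensor.
Context d1 d2 (T1 : measurableType d1) (T2 : measurableType d2) (R : realType).
Variable m1 : {sigma_finite_measure set T1 -> \bar R}.
Variable m2 : {sigma_finite_measure set T2 -> \bar R}.

Lemma Li_tensor (f : T1 -> R) (g : T2 -> R) : Li m1 f -> Li m2 g ->
  Li (m1 \x m2)%E (fun z => f z.1 * g z.2).
Proof.
move=> Lf Lg; have mf := Li_measurable Lf; have mg := Li_measurable Lg.
apply: Li_tonelli1.
- by apply: measurable_funM; apply: measurableT_comp.
- by move=> x; exact: (LiZ (f x) Lg).
- apply: (@eq_Li _ _ _ _ (fun x => `|f x| * \int[m2]_y `|g y|)).
    by move=> x /=; rewrite -RIZ; [apply: eq_RI => y; rewrite normrM|exact: Li_norm].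
  by apply: LiZr; exact: Li_norm.
Qed.

Lemma RI_tensor (f : T1 -> R) (g : T2 -> R) : Li m1 f -> Li m2 g ->
  \int[(m1 \x m2)%E]_z (f z.1 * g z.2) = (\int[m1]_x f x) * \int[m2]_y g y.
Proof.
move=> Lf Lg; rewrite -(RI_fubini12 (Li_tensor Lf Lg)) -RIZr//.
by apply: eq_RI => x /=; rewrite RIZ.
Qed.

Lemma L2_tensor (f : T1 -> R) (g : T2 -> R) : L2 m1 f -> L2 m2 g ->
  L2 (m1 \x m2)%E (fun z => f z.1 * g z.2).
Proof.
move=> [mf Lf] [mg Lg]; split.
  by apply: measurable_funM; apply: measurableT_comp.
apply: (@eq_Li _ _ _ _ (fun z => f z.1 ^+ 2 * g z.2 ^+ 2)).
  by move=> z; rewrite exprMn.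
exact: (@Li_tensor (fun x => f x ^+ 2) (fun x => g x ^+ 2)).
Qed.

Lemma N2_tensor (f : T1 -> R) (g : T2 -> R) : L2 m1 f -> L2 m2 g ->
  N2 (m1 \x m2)%E (fun z => f z.1 * g z.2) = N2 m1 f * N2 m2 g.
Proof.
move=> [mf Lf] [mg Lg]; rewrite /N2 -sqrtrM; last by apply: RI_ge0 => x; exact: sqr_ge0.
rewrite -RI_tensor//; congr Num.sqrt; apply: eq_RI => z.
by rewrite exprMn.
Qed.

Variables (C1 : (T1 -> R) -> Prop) (C2 : (T2 -> R) -> Prop) (C : (T1 * T2 -> R) -> Prop).
Hypothesis C1_L2 : forall f, C1 f -> L2 m1 f.
Hypothesis C2_L2 : forall f, C2 f -> L2 m2 f.
Hypothesis C12 : forall f g, C1 f -> C2 g -> C (fun z => f z.1 * g z.2).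

Lemma L2_approx_tensor f g : L2 m1 f -> L2 m2 g ->
  L2_approx m1 C1 f -> L2_approx m2 C2 g ->
  L2_approx (m1 \x m2)%E C (fun z => f z.1 * g z.2).
Proof.
move=> Lf Lg af ag e e0.
(* From f'g' - fg = (f' - f) g' + f (g' - g). The minimum with 1 bounds the norm of g' by that of g
   plus 1, and [e1] is chosen against this bound; each summand then costs at most e / 2. *)
pose e1 := e / (2 * (N2 m2 g + 1)); pose e2 := Num.min 1 (e / (2 * (N2 m1 f + 1))).
have Nf := N2_ge0 m1 f; have Ng := N2_ge0 m2 g.
have e10 : 0 < e1 by rewrite divr_gt0// mulr_gt0// ltr_wpDl.
have e20 : 0 < e2 by rewrite lt_min ltr01 divr_gt0// mulr_gt0// ltr_wpDl.
have [f' Cf hf] := af _ e10; have [g' Cg hg] := ag _ e20.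
exists (fun z => f' z.1 * g' z.2); first exact: C12.
have Lf' := C1_L2 Cf; have Lg' := C2_L2 Cg.
rewrite (@eq_N2 _ _ _ _ _ (fun z => (f' z.1 - f z.1) * g' z.2 + f z.1 * (g' z.2 - g z.2))); last first.
  by move=> z; ring.
have La := L2B Lf' Lf; have Lb := L2B Lg' Lg.
apply: (le_trans (N2D (L2_tensor La Lg') (L2_tensor Lf Lb))).
rewrite (N2_tensor La Lg') (N2_tensor Lf Lb).
have h1 : N2 m2 g' <= N2 m2 g + 1.
  rewrite (@eq_N2 _ _ _ _ g' (fun z => (g' z - g z) + g z)); last by move=> z; ring.
  apply: (le_trans (N2D Lb Lg)); rewrite addrC lerD2l (le_trans hg)//.
  by rewrite /e2 ge_min lexx.
have h2 : N2 m2 (fun x => g' x - g x) <= e / (2 * (N2 m1 f + 1)).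
  by rewrite (le_trans hg)// /e2 ge_min lexx orbT.
have h3 : N2 m1 (fun x => f' x - f x) * N2 m2 g' <= e / 2.
  apply: (le_trans (ler_pM (N2_ge0 _ _) (N2_ge0 _ _) hf h1)).
  suff -> : e1 * (N2 m2 g + 1) = e / 2 by [].
  by rewrite /e1; field; rewrite gt_eqF// ltr_wpDl.
have h4 : N2 m1 f * N2 m2 (fun x => g' x - g x) <= e / 2.
  apply: (le_trans (ler_wpM2l Nf h2)).
  rewrite mulrA ler_pdivrMr; last by rewrite mulr_gt0// ltr_wpDl.
  by nra.
lra.
Qed.

End tensor.

End L2_density.

Section test_functions_dense.
Context {R : realType}.

Lemma tst_tensor (V W : normedModType R) (f : V -> R) (g : W -> R) :
  tst f -> tst g -> tst (fun z : V * W => f z.1 * g z.2).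
Proof.
move=> [sf [r hr]] [sg [s hs]]; split.
  apply: smoothM.
    apply: (@smooth_affine R V (V * W)%type fst fst) => //.
    by move=> z; exact: cvg_fst.
  apply: (@smooth_affine R W (V * W)%type snd snd) => //.
  by move=> z; exact: cvg_snd.
exists (Num.max r s) => z; rewrite prod_normE gt_max.
case: (leP `|z.1| `|z.2|) => _ /andP[h1 h2]; first by rewrite hs ?mulr0.
by rewrite hr ?mul0r.
Qed.

Lemma tst1_L2 (f : R -> R) : tst f -> L2 (leb R) f.
Proof.
move=> tf; have cf := tst_continuous tf; have [_ [r hr]] := tf.
have mf : measurable_fun setT f by exact: continuous_measurable_fun.
have [C hC] : exists C, forall x, `|f x| <= C.
  have : compact (f @` `[- r, r]).
    apply: continuous_compact; last exact: segment_compact.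
    exact: continuous_subspaceT.
  move=> /compact_bounded [C [_ hC]]; exists (Num.max C 0 + 1) => x.
  have [xr|xr] := ltP r `|x|.
    by rewrite hr// normr0 addr_ge0// le_max lexx orbT.
  apply: hC; first by rewrite ltr_pwDr// le_max lexx.
  by exists x => //=; rewrite in_itv/= -ler_norml.
refine (@L2_le _ (measurableTypeR R) R (leb R) (fun x => C * \1_(`[(- r)%R, r]) x) f mf _ _).
  move=> x; rewrite indicE; have [|xr] := boolP (x \in `[(- r)%R, r]%classic).
    by rewrite mulr1 (le_trans (hC x))// ler_norm.
  rewrite mulr0 hr ?normr0// ltNge; apply/negP => h; move: xr.
  by rewrite notin_setE /= in_itv /= -ler_norml.
by apply: L2Z; apply: L2_indic => //; exact: leb_itv_lty.
Qed.

Lemma L2_approx_itv (a b : R) : a <= b -> L2_approx (leb R) tst (\1_(`]a, b]) : R -> R).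
Proof.
(* The smoothed indicator differs from the indicator only within d of a or of b. Each of these two
   intervals has length 2 d = (e / 2)^2, so its indicator has norm e / 2. *)
move=> ab e e0; pose d := e ^+ 2 / 8.
have d0 : 0 < d by rewrite divr_gt0// exprn_gt0.
pose f (x : R) := step (d^-1 * x + - (d^-1 * a)) * step (- d^-1 * x + d^-1 * b).
have fl x : x <= a - d -> f x = 0.
  move=> h; rewrite /f step_lt ?mul0r// -mulrBr mulrC ler_pdivrMr//; lra.
have fr x : b + d <= x -> f x = 0.
  move=> h; rewrite /f [X in _ * X]step_lt ?mulr0// mulNr addrC -mulrBr mulrC ler_pdivrMr//; lra.
have fm x : a + d <= x -> x <= b - d -> f x = 1.
  move=> h1 h2; rewrite /f !step_gt ?mulr1//.
    by rewrite mulNr addrC -mulrBr mulrC ler_pdivlMr//; lra.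
  by rewrite -mulrBr mulrC ler_pdivlMr//; lra.
have f01 x : 0 <= f x <= 1.
  rewrite /f; have /andP[? ?] := step_range (d^-1 * x + - (d^-1 * a)).
  have /andP[? ?] := step_range (- d^-1 * x + d^-1 * b).
  by rewrite mulr_ge0//= mulr_ile1.
have tf : tst f.
  split; first by apply: smoothM; apply: smooth_affine1; exact: smooth_step.
  exists (Num.max (`|a| + d) (`|b| + d)) => x; rewrite gt_max => /andP[h1 h2].
  have [x0|x0] := leP 0 x; [apply: fr|apply: fl].
    by rewrite (ger0_norm x0) in h2; have := ler_norm b; lra.
  by rewrite (ltr0_norm x0) in h1; have := ler_norm (- a); rewrite normrN; lra.
exists f => //.
have hI (c : R) : N2 (leb R) (\1_(`[(c - d)%R, (c + d)%R]) : R -> R) <= e / 2.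
  apply: N2_indic_le => //; first lra.
  have cd : c - d <= c + d by lra.
  by rewrite [X in (X <= _)%E](leb_itvcc cd) lee_fin /d; lra.
have LI (c : R) : L2 (leb R) (\1_(`[(c - d)%R, (c + d)%R]) : R -> R).
  by apply: L2_indic => //; exact: leb_itv_lty.
apply: (@le_trans _ _ (N2 (leb R) (fun x => \1_(`[(a - d)%R, (a + d)%R]) x + \1_(`[(b - d)%R, (b + d)%R]) x))).
  apply: N2_le; [|exact: L2D|].
    apply: L2B; first exact: tst1_L2.
    by apply: L2_indic => //; exact: leb_itvoc_lty.
  move=> x; rewrite [leRHS]ger0_norm ?addr_ge0// !indicE.
  have [xa|xa] := boolP (x \in `[(a - d)%R, (a + d)%R]%classic).
    have /andP[? ?] := f01 x; rewrite ler_norml; case: (_ \in _); case: (_ \in _) => /=; lra.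
  have [xb|xb] := boolP (x \in `[(b - d)%R, (b + d)%R]%classic).
    have /andP[? ?] := f01 x; rewrite ler_norml; case: (_ \in _) => /=; lra.
  move: xa xb; rewrite !notin_setE /= !in_itv /= => /negP xa /negP xb.
  have [h|h] := leP x (a - d).
    rewrite fl// memNset ?subrr ?normr0// /= in_itv /= => /andP[]; lra.
  have xa' : a + d < x by move: xa; rewrite (ltW h)/= -ltNge.
  have [h'|h'] := leP (b + d) x.
    rewrite fr// memNset ?subrr ?normr0// /= in_itv /= => /andP[]; lra.
  have xb' : x < b - d by move: xb; rewrite (ltW h') andbT -ltNge.
  have xi : x \in `]a, b]%classic by rewrite inE /= in_itv /=; apply/andP; split; lra.
  have fx : f x = 1 by apply: fm; exact: ltW.
  by rewrite fx xi /= mulr1n subrr normr0 addr0.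
by apply: (le_trans (N2D (LI a) (LI b))); rewrite (splitr e) lerD.
Qed.

Let I (n : nat) : set R := `](- n%:R)%R, n%:R%R].

Let mI n : measurable (I n). Proof. exact: measurable_itv. Qed.

Let Ioo n : (leb R (I n) < +oo)%E.
Proof. exact: leb_itvoc_lty. Qed.

Let ndI : nondecreasing_seq I.
Proof.
move=> m n mn; apply/subsetPset => x; rewrite /I /= !in_itv /= => /andP[h1 h2].
have : m%:R <= n%:R :> R by rewrite ler_nat.
by move=> ?; apply/andP; split; lra.
Qed.

Let IT (x : R) : exists n, I n x.
Proof.
have [n hn] : exists n : nat, `|x| < n%:R.
  by exists (Num.bound `|x|); exact: archi_boundP.
by exists n; rewrite /I /= in_itv /=; move: hn; rewrite ltr_norml => /andP[-> /ltW ->].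
Qed.

Lemma L2_approx_1d n (A : set (measurableTypeR R)) : measurable A ->
  L2_approx (leb R) tst (\1_(A `&` I n) : R -> R).
Proof.
apply: (@L2_approx_pi_lambda _ (measurableTypeR R) R (leb R) (@tst R R) (@ocitv R) (I n)) => //.
- exact: tst1_L2.
- exact: tstD.
- by move=> c f; exact: tstZ.
- exact: tst0.
- exact: mI.
- exact: Ioo.
- exact: ocitvI.
- by apply: L2_approx_itv; rewrite (@le_trans _ _ 0)// oppr_le0.
- move=> B oB; have oI : ocitv (I n) by exists (- n%:R, n%:R).
  have /ocitvP[->|[[a b] /= ab ->]] := ocitvI oB oI.
    move=> e e0; exists (fun _ => 0); first exact: tst0.
    rewrite /N2 (@eq_RI _ _ _ _ _ (fun _ => 0)) ?RI0 ?sqrtr0 ?ltW// => x.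
    by rewrite indic0 subrr expr0n.
  by apply: L2_approx_itv; exact: ltW.
Qed.

Local Notation M := (measurableTypeR R).
Local Notation leb2 := (product_measure1 (leb R) (leb R)).

(** In the intermediate dimension two, square integrability is made part of the class; for R and R^3
    it is proved from the support. *)
Definition tst2 (f : R * R -> R) := tst f /\ L2 leb2 f.

Let tst2_D f g : tst2 f -> tst2 g -> tst2 (fun x => f x + g x).
Proof. by move=> [tf Lf] [tg Lg]; split; [exact: tstD|exact: L2D]. Qed.

Let tst2_Z c f : tst2 f -> tst2 (fun x => c * f x).
Proof. by move=> [tf Lf]; split; [exact: tstZ|exact: L2Z]. Qed.

Let tst2_0 : tst2 (fun _ => 0).
Proof. by split; [exact: tst0|exact: L2_0]. Qed.

Let LI n (A : set M) : measurable A -> L2 (leb R) (\1_(A `&` I n) : R -> R).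
Proof.
move=> mA; apply: L2_indic; first by apply: measurableI => //; exact: mI.
apply: le_lt_trans (Ioo n); apply: le_measure; rewrite ?inE//; last exact: mI.
by apply: measurableI => //; exact: mI.
Qed.

Let I2oo n : (leb2 (I n `*` I n) < +oo)%E.
Proof.
rewrite product_measure1E; [|exact: mI|exact: mI].
rewrite lte_mul_pinfty ?measure_ge0//; last exact: Ioo.
by rewrite ge0_fin_numE ?measure_ge0//; exact: Ioo.
Qed.

Let mI2 n : measurable (I n `*` I n : set (M * M)).
Proof. by apply: measurableX; exact: mI. Qed.

Lemma L2_approx_2d n (A : set (M * M)) : measurable A ->
  L2_approx leb2 tst2 (\1_(A `&` (I n `*` I n)) : R * R -> R).
Proof.
have T (B C : set M) : measurable B -> measurable C ->
    L2_approx leb2 tst2 (\1_((B `*` C) `&` (I n `*` I n)) : R * R -> R).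
  move=> mB mC.
  rewrite (_ : \1_(_) = (fun z : R * R => \1_(B `&` I n) z.1 * \1_(C `&` I n) z.2)).
    apply: (@L2_approx_tensor _ _ M M R (leb R) (leb R) (@tst R R) (@tst R R)).
    - exact: tst1_L2.
    - exact: tst1_L2.
    - move=> f g tf tg; split; first exact: tst_tensor.
      by apply: (@L2_tensor _ _ M M R (leb R) (leb R)); exact: tst1_L2.
    - exact: LI.
    - exact: LI.
    - exact: L2_approx_1d.
    - exact: L2_approx_1d.
  apply/funext => -[x y]; by rewrite -setXI !indicE in_setX /= -natrM mulnb.
apply: (@L2_approx_pi_lambda _ (M * M)%type R leb2 tst2
  [set B `*` C | B in measurable & C in measurable] (I n `*` I n)).
- by move=> f [].
- exact: tst2_D.
- exact: tst2_Z.
- exact: tst2_0.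
- exact: mI2.
- exact: I2oo.
- exact: measurable_prod_measurableType.
- move=> _ _ [B mB [C mC <-]] [B' mB' [C' mC' <-]]; rewrite -setXI.
  by exists (B `&` B'); [exact: measurableI|exists (C `&` C') => //; exact: measurableI].
- rewrite (_ : I n `*` I n = (setT `*` setT) `&` (I n `*` I n)); last first.
    by rewrite setXTT setTI.
  by apply: T.
- by move=> _ [B mB [C mC <-]]; exact: T.
Qed.

Let L2I2 n (A : set (M * M)) : measurable A ->
  L2 leb2 (\1_(A `&` (I n `*` I n)) : R * R -> R).
Proof.
move=> mA; apply: L2_indic; first by apply: measurableI => //; exact: mI2.
apply: le_lt_trans (I2oo n); apply: le_measure; rewrite ?inE.
- by apply: measurableI => //; exact: mI2.
- exact: mI2.
- by move=> x [].
Qed.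

Let I3 n : set (M * M * M) := (I n `*` I n) `*` I n.

Let mI3 n : measurable (I3 n).
Proof. by apply: measurableX; [exact: mI2|exact: mI]. Qed.

Let I3oo n : (leb3 R (I3 n) < +oo)%E.
Proof.
rewrite /I3 product_measure1E; [|exact: mI2|exact: mI].
rewrite lte_mul_pinfty ?measure_ge0//; last exact: Ioo.
by rewrite ge0_fin_numE ?measure_ge0//; exact: I2oo.
Qed.

Lemma L2_approx_3d n (A : set (M * M * M)) : measurable A ->
  L2_approx (leb3 R) (@tst R (R3 R)) (\1_(A `&` I3 n) : R3 R -> R).
Proof.
have T (B : set (M * M)) (C : set M) : measurable B -> measurable C ->
    L2_approx (leb3 R) (@tst R (R3 R)) (\1_((B `*` C) `&` I3 n) : R3 R -> R).
  move=> mB mC.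
  rewrite (_ : \1_(_) = (fun z : R3 R => \1_(B `&` (I n `*` I n)) z.1 * \1_(C `&` I n) z.2)).
    apply: (@L2_approx_tensor _ _ (M * M)%type M R (sigma_finite_prod (leb R) (leb R)) (leb R)
      tst2 (@tst R R)).
    - by move=> f [].
    - exact: tst1_L2.
    - by move=> f g [tf _] tg; exact: tst_tensor.
    - exact: L2I2.
    - exact: LI.
    - exact: L2_approx_2d.
    - exact: L2_approx_1d.
  apply/funext => -[x y]; by rewrite /I3 -setXI !indicE in_setX /= -natrM mulnb.
apply: (@L2_approx_pi_lambda _ (M * M * M)%type R (leb3 R) (@tst R (R3 R))
  [set B `*` C | B in measurable & C in measurable] (I3 n)).
- exact: tst_L2.
- exact: tstD.
- by move=> c f; exact: tstZ.
- exact: tst0.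
- exact: mI3.
- exact: I3oo.
- exact: measurable_prod_measurableType.
- move=> _ _ [B mB [C mC <-]] [B' mB' [C' mC' <-]]; rewrite -setXI.
  by exists (B `&` B'); [exact: measurableI|exists (C `&` C') => //; exact: measurableI].
- rewrite (_ : I3 n = (setT `*` setT) `&` I3 n); last by rewrite setXTT setTI.
  by apply: T.
- by move=> _ [B mB [C mC <-]]; exact: T.
Qed.

Lemma tst_dense (f : R3 R -> R) e : L2 (leb3 R) f -> 0 < e ->
  exists2 g, tst g & N2 (leb3 R) (fun x => g x - f x) <= e.
Proof.
move=> Lf; move: e.
apply: (@L2_approx_all _ (M * M * M)%type R (leb3 R) (@tst R (R3 R)) I3) => //.
- exact: tst_L2.
- exact: tstD.
- by move=> c g; exact: tstZ.
- exact: tst0.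
- move=> m n mn; have /subsetPset h := ndI mn; apply/subsetPset => -[[x y] z] [[hx hy] hz].
  by split; [split|]; exact: h.
- apply/seteqP; split => // -[[x y] z] _.
  have [n1 h1] := IT x; have [n2 h2] := IT y; have [n3 h3] := IT z.
  have k m n w : (m <= n)%N -> I m w -> I n w by move=> /ndI /subsetPset; apply.
  exists (maxn (maxn n1 n2) n3) => //; split; first split => /=.
  + by apply: k h1; rewrite (leq_trans _ (leq_maxl _ _))// leq_maxl.
  + by apply: k h2; rewrite (leq_trans _ (leq_maxl _ _))// leq_maxr.
  + by apply: k h3; rewrite leq_maxr.
- by move=> n A mA; exact: L2_approx_3d.
Qed.

End test_functions_dense.

(** * Integration by parts, mollifiers and cut-offs *)

Section integration_by_parts.
Context {R : realType}.
Implicit Types (x y v : R3 R) (f g k G : R3 R -> R).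
Local Notation mu := (leb3 R).

Lemma norm_evec (j : 'I_3) : `|evec j : R3 R| = 1.
Proof.
rewrite norm3E /evec /=; case: j => -[|[|[|//]]] ? /=;
  by rewrite ?normr1 ?normr0 /Order.max !(ltr10, ltr01, ltxx).
Qed.

(* Translation invariance makes the integrals of all difference quotients
   vanish. *)
Lemma RI_diff_quotient (j : 'I_3) f G (C r : R) : measurable_fun setT f ->
  measurable_fun setT G -> (forall x, r < `|x| -> f x = 0) -> Li mu f ->
  (forall x (h : R), `|f (x + h *: evec j) - f x| <= C * `|h|) ->
  {ae mu, forall x,
    n.+1%:R * (f (x + n.+1%:R^-1 *: evec j) - f x) @[n --> \oo] --> G x} ->
  Li mu G /\ \int[mu]_x G x = 0.
Proof.
move=> mf mG fr Lf lip cv.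
pose F n x := n.+1%:R * (f (x + n.+1%:R^-1 *: evec j) - f x).
have LF n : Li mu (F n) by apply: LiZ; apply: LiB => //; exact: Li_shift.
have F0 n : \int[mu]_x F n x = 0.
  by rewrite RIZ ?RIB ?RI_shift ?subrr ?mulr0//; [exact: Li_shift|apply: LiB => //; exact: Li_shift].
have [LG cG] : Li mu G /\ \int[mu]_x F n x @[n --> \oo] --> \int[mu]_x G x.
  (* All increments have length at most 1, so every difference quotient vanishes outside the cube of
     half-width r + 1 and is bounded there by the Lipschitz constant. *)
  apply: (@Li_dct _ _ _ mu F G (fun x => C * \1_(cube (r + 1)) x)) => //.
  - by move=> n; exact: Li_measurable (LF n).
  - by apply: LiZ; exact: Li_cube.
  - apply: nearW => x n; rewrite indicE.
    have i1 : n.+1%:R^-1 <= 1 :> R by rewrite invf_le1 ?ltr0n// ler1n.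
    have nn : `|n.+1%:R^-1 : R| = n.+1%:R^-1 by rewrite ger0_norm.
    have [xr|xr] := boolP (x \in cube (r + 1)).
      rewrite mulr1 /F normrM ger0_norm// mulrC -ler_pdivlMr ?ltr0n//.
      by rewrite (le_trans (lip _ _))// nn.
    have {}xr : r + 1 < `|x| by rewrite ltNge; apply/negP => h; move: xr; rewrite notin_setE.
    rewrite /F !fr ?subrr ?mulr0 ?normr0//; first by lra.
    have : `|x| <= `|x + n.+1%:R^-1 *: evec j| + `|n.+1%:R^-1 *: evec j : R3 R|.
      by rewrite -{1}(addrK (n.+1%:R^-1 *: evec j) x) ler_normB.
    rewrite normrZ norm_evec mulr1 nn => h.
    by rewrite -(ltrD2r 1) (lt_le_trans xr)// (le_trans h)// lerD2l.
split => //; apply/esym/(@cvg_unique _ _ _ _ _ _ _ cG) => //.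
by rewrite (_ : (fun _ => _) = fun _ => 0); [exact: cvg_cst|apply/funext].
Qed.

Lemma derive_quotient_cvg f x v : derivable f x v ->
  n.+1%:R * (f (x + n.+1%:R^-1 *: v) - f x) @[n --> \oo] --> 'D_v f x.
Proof.
move=> df.
have h : n.+1%:R^-1 @[n --> \oo] --> (0 : R)^'.
  move=> A [e /= e0 he]; have := @cvg_harmonic R; move/cvgr0Pnorm_lt => /(_ e e0).
  apply: filterS => n /= hn; apply: he; last by rewrite invr_eq0 pnatr_eq0.
  by rewrite /ball /= sub0r normrN.
have c := cvg_comp _ _ h df.
rewrite (_ : (fun n : nat => n.+1%:R * _) = (fun h0 : R =>
  h0^-1 *: ((f \o shift x) (h0 *: v) - f x)) \o (fun n : nat => n.+1%:R^-1)) //.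
by apply/funext => n /=; rewrite invrK [_ *: v + x]addrC.
Qed.

Lemma tst_RI_pd j f : tst f -> \int[mu]_x pd j f x = 0.
Proof.
move=> tf; have [C C0 hC] := tst_lipschitz_dir (evec j) tf; have [_ [r hr]] := tf.
have [] // := @RI_diff_quotient j f (pd j f) C r.
- exact: tst_measurable.
- by apply: tst_measurable; exact: tst_pd.
- exact: tst_Li.
- apply: nearW => x; apply: derive_quotient_cvg.
  by apply: smooth_derivable; exact: tst_smooth.
Qed.

Lemma tst_ibp j f g : smooth f -> tst g ->
  \int[mu]_x (f x * pd j g x) = - \int[mu]_x (pd j f x * g x).
Proof.
move=> sf tg; have := tst_RI_pd j (tstM sf tg).
have sg := tst_smooth tg.
rewrite pdM// RID; last 2 first.
- exact: tst_Li (tstM sf (tst_pd j tg)).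
- apply: tst_Li; rewrite (_ : (fun _ => _) = (fun x => pd j f x * g x)).
    exact: (tstM (smooth_derive (evec j) sf) tg).
  by apply/funext => x; rewrite mulrC.
move/eqP; rewrite addr_eq0 => /eqP ->; congr (- _); apply: eq_RI => x; exact: mulrC.
Qed.

End integration_by_parts.

Section mollifier.
Context {R : realType}.
Implicit Types (x y v : R3 R) (f g k : R3 R -> R) (e r : R).
Local Notation mu := (leb3 R).

Lemma RI_affine_ge0 f c a : c != 0 -> Li mu f -> (forall x, 0 <= f x) ->
  \int[mu]_x f x = `|c| ^+ 3 * \int[mu]_x f (c *: x + a).
Proof.
move=> c0 Lf f0; apply: EFin_inj; rewrite EFinM -RI_E// -RI_E; last exact: Li_affine.
by rewrite (ge0_integral_affine a c0)//; exact: Li_measurable Lf.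
Qed.

Definition eta0 x : R := bump x.1.1 * bump x.1.2 * bump x.2.

Lemma tst_bump : tst (@bump R).
Proof.
by split; [exact: smooth_bump|exists 1 => x /ltW; exact: bump_support].
Qed.

Lemma tst_eta0 : tst eta0.
Proof.
exact: (@tst_tensor R (R * R)%type R _ _ (tst_tensor tst_bump tst_bump) tst_bump).
Qed.

Lemma eta0_ge0 x : 0 <= eta0 x.
Proof. by apply: mulr_ge0; [apply: mulr_ge0|]; exact: bump_ge0. Qed.

Lemma eta0_support x : 1 < `|x| -> eta0 x = 0.
Proof.
rewrite norm3E !lt_max /eta0 => /orP[/orP[]|] /ltW h; rewrite (bump_support h);
  by rewrite ?mulr0 ?mul0r.
Qed.

Lemma eta0_int : \int[mu]_x eta0 x = 1.
Proof.
have b := @bump_Li R.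
have Lb2 : Li (product_measure1 (leb R) (leb R)) (fun z => bump z.1 * bump z.2).
  exact: (@Li_tensor _ _ _ _ R (leb R) (leb R)).
have := @RI_tensor _ _ _ _ R (sigma_finite_prod (leb R) (leb R)) (leb R) _ _ Lb2 b.
rewrite (@RI_tensor _ _ _ _ R (leb R) (leb R) _ _ b b) !bump_int !mulr1 => <-.
by [].
Qed.

Definition eta e x : R := e^-1 ^+ 3 * eta0 (e^-1 *: x).

Lemma etaE e : eta e = (fun x => e^-1 ^+ 3 * eta0 (e^-1 *: x + 0)).
Proof. by apply/funext => x; rewrite addr0. Qed.

Lemma tst_eta e : 0 < e -> tst (eta e).
Proof.
move=> e0; rewrite etaE; apply: tstZ; apply: tst_aff; last exact: tst_eta0.
by rewrite invr_eq0 gt_eqF.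
Qed.

Lemma eta_ge0 e x : 0 < e -> 0 <= eta e x.
Proof. by move=> e0; rewrite mulr_ge0 ?eta0_ge0// exprn_ge0// invr_ge0 ltW. Qed.

Lemma eta_support e x : 0 < e -> e < `|x| -> eta e x = 0.
Proof.
move=> e0 ex; rewrite /eta eta0_support ?mulr0// normrZ gtr0_norm ?invr_gt0//.
by rewrite mulrC ltr_pdivlMr// mul1r.
Qed.

Lemma eta_int e : 0 < e -> \int[mu]_x eta e x = 1.
Proof.
move=> e0; have e1 : e^-1 != 0 by rewrite invr_eq0 gt_eqF.
rewrite etaE RIZ; last by apply: (Li_affine 0 e1); exact: tst_Li tst_eta0.
have := RI_affine_ge0 0 e1 (tst_Li tst_eta0) eta0_ge0.
by rewrite eta0_int gtr0_norm ?invr_gt0// => <-.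
Qed.

(** By scaling, a derivative costs one factor 1/e in L^1. This is where the factor 1/e in the flux
    bound near the blowup time comes from. *)
Lemma eta_pd_L1 : exists2 C, 0 <= C & forall (j : 'I_3) e, 0 < e ->
  \int[mu]_x `|pd j (eta e) x| <= C / e.
Proof.
exists (\sum_(j < 3) \int[mu]_x `|pd j eta0 x|).
  by apply: sumr_ge0 => j _; apply: RI_ge0.
move=> j e e0; have e1 : e^-1 != 0 by rewrite invr_eq0 gt_eqF.
have Ln : Li mu (fun x => `|pd j eta0 x|).
  by apply: Li_norm; apply: tst_Li; apply: tst_pd; exact: tst_eta0.
have s0 : smooth eta0 by have [] := tst_eta0.
have -> : \int[mu]_x `|pd j (eta e) x| =
    \int[mu]_x (e^-1 * (`|e^-1| ^+ 3 * `|pd j eta0 (e^-1 *: x + 0)|)).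
  have pE : pd j (eta e) = fun x => e^-1 ^+ 3 * (e^-1 * pd j eta0 (e^-1 *: x + 0)).
    rewrite etaE (pdZ j _ (smooth_aff e^-1 0 s0)); apply/funext => x; congr (_ * _).
    exact: (congr1 (fun q : R3 R -> R => q x) (pd_affine j e^-1 0 s0)).
  apply: eq_RI => x; rewrite pE.
  by rewrite !normrM [`|e^-1|]gtr0_norm ?invr_gt0//; ring.
  rewrite RIZ; last by apply: LiZ; exact: (Li_affine 0 e1 Ln).
rewrite RIZ; last exact: (Li_affine 0 e1 Ln).
rewrite -(@RI_affine_ge0 (fun x => `|pd j eta0 x|) _ 0 e1 Ln)// mulrC ler_wpM2r ?invr_ge0 ?(ltW e0)//.
by rewrite (bigD1 j)//= lerDl; apply: sumr_ge0 => i _; apply: RI_ge0.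
Qed.

Definition hat (t : R) : R := step (2 * t + 3) * step ((-2) * t + 3).

Lemma tst_hat : tst hat.
Proof.
split; first by apply: smoothM; apply: smooth_affine1; exact: smooth_step.
exists 2 => t; rewrite ltr_normr /hat => /orP[h|h].
  by rewrite [X in _ * X]step_lt ?mulr0//; lra.
by rewrite step_lt ?mul0r//; lra.
Qed.

Lemma hat_range t : 0 <= hat t <= 1.
Proof.
rewrite /hat; have /andP[? ?] := step_range (2 * t + 3).
have /andP[? ?] := step_range ((-2) * t + 3).
by rewrite mulr_ge0//= mulr_ile1.
Qed.

Lemma hat1 t : `|t| <= 1 -> hat t = 1.
Proof. by rewrite ler_norml => /andP[? ?]; rewrite /hat !step_gt ?mulr1//; lra. Qed.

Definition chi0 x : R := hat x.1.1 * hat x.1.2 * hat x.2.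

Lemma tst_chi0 : tst chi0.
Proof.
exact: (@tst_tensor R (R * R)%type R _ _ (tst_tensor tst_hat tst_hat) tst_hat).
Qed.

Lemma chi0_range x : 0 <= chi0 x <= 1.
Proof.
have /andP[? ?] := hat_range x.1.1; have /andP[? ?] := hat_range x.1.2.
have /andP[? ?] := hat_range x.2.
have ? : 0 <= hat x.1.1 * hat x.1.2 by exact: mulr_ge0.
by apply/andP; split; [exact: mulr_ge0|rewrite mulr_ile1// mulr_ile1].
Qed.

Lemma chi0_1 x : `|x| <= 1 -> chi0 x = 1.
Proof. by rewrite norm3E !ge_max => /andP[/andP[? ?] ?]; rewrite /chi0 !hat1 ?mulr1. Qed.

Definition chi (n : nat) x : R := chi0 (n.+1%:R^-1 *: x + 0).

Lemma tst_chi n : tst (chi n).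
Proof. by apply: tst_aff; [rewrite invr_eq0 pnatr_eq0|exact: tst_chi0]. Qed.

Lemma chi_range n x : 0 <= chi n x <= 1.
Proof. exact: chi0_range. Qed.

Lemma chi_cvg x : chi n x @[n --> \oo] --> (1 : R).
Proof.
apply: cvg_near_cst; exists (Num.bound `|x|) => // n /= hn; apply: chi0_1.
rewrite addr0 normrZ gtr0_norm// mulrC ler_pdivrMr ?ltr0n// mul1r.
have h := archi_boundP (normr_ge0 x); rewrite (le_trans (ltW h))// ler_nat.
exact: leqW.
Qed.

Lemma chi_pd : exists2 C, 0 <= C & forall (j : 'I_3) n x, `|pd j (chi n) x| <= C / n.+1%:R.
Proof.
have b (j : 'I_3) := tst_bounded (tst_pd j tst_chi0).
have [C hC] : exists C : 'I_3 -> R, forall j, 0 < C j /\ forall x, `|pd j chi0 x| <= C j.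
  by have [C hC] := choice b; exists C.
exists (\sum_j C j); first by apply: sumr_ge0 => j _; have [/ltW] := hC j.
move=> j n x; rewrite pd_affine; last by have [] := tst_chi0.
rewrite normrM gtr0_norm// mulrC ler_wpM2r// (le_trans ((hC j).2 _))//.
by rewrite (bigD1 j)//= lerDl; apply: sumr_ge0 => i _; have [/ltW] := hC i.
Qed.

End mollifier.

(** * Convolution *)

Section almost_everywhere.
Context d (T : measurableType d) (R : realType) (mu : {measure set T -> \bar R}).

Lemma ae_imp (P Q : T -> Prop) : {ae mu, forall x, P x} ->
  (forall x, P x -> Q x) -> {ae mu, forall x, Q x}.
Proof. by move=> h PQ; apply: filterS h. Qed.

Lemma ae_imp2 (P Q S : T -> Prop) : {ae mu, forall x, P x} ->
  {ae mu, forall x, Q x} -> (forall x, P x -> Q x -> S x) -> {ae mu, forall x, S x}.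
Proof. by move=> h k PQ; apply: filterS2 h k. Qed.

Lemma ae_all (I : finType) (P : I -> T -> Prop) :
  (forall i, {ae mu, forall x, P i x}) -> {ae mu, forall x, forall i, P i x}.
Proof. by move=> h; apply: filter_forall. Qed.

Lemma ae_true (P : T -> Prop) : (forall x, P x) -> {ae mu, forall x, P x}.
Proof. by move=> h; apply: nearW. Qed.

End almost_everywhere.

Section convolution.
Context {R : realType}.
Implicit Types (x y v : R3 R) (a b f g k : R3 R -> R) (e r : R).
Local Notation mu := (leb3 R).

Definition conv k f x : R := \int[mu]_y (k (x - y) * f y).

(** A common home for L^1, L^2 and their sum, in which the convolution with a compactly supported
    continuous kernel is an absolutely convergent integral at every point. *)
Definition Lloc f := measurable_fun setT f /\
  forall r, Li mu (fun x => \1_(cube r) x * f x).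

Lemma Li_Lloc f : Li mu f -> Lloc f.
Proof.
move=> Lf; have mf := Li_measurable Lf; split=> // r.
apply: (Li_le _ _ (Li_norm Lf)).
  by apply: measurable_funM => //; exact: Li_measurable (Li_cube r).
by move=> x; rewrite normrM ler_piMl// indicE; case: (_ \in _); rewrite ?normr1 ?normr0 ?ler01.
Qed.

Lemma L2_Lloc f : L2 mu f -> Lloc f.
Proof.
move=> Lf; split=> [|r]; first by case: Lf.
apply: L2M => //; rewrite /L2; have Lc := Li_cube (R := R) r.
split; first exact: Li_measurable Lc.
apply: (eq_Li _ Lc) => x; rewrite indicE; case: (_ \in _); by rewrite ?expr1n ?expr0n.
Qed.

Lemma LlocD f g : Lloc f -> Lloc g -> Lloc (fun x => f x + g x).
Proof.
move=> [mf Lf] [mg Lg]; split=> [|r]; first exact: measurable_funD.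
by apply: (eq_Li _ (LiD (Lf r) (Lg r))) => x; rewrite mulrDr.
Qed.

Lemma Lloc_norm f : Lloc f -> Lloc (fun x => `|f x|).
Proof.
move=> [mf Lf]; split=> [|r]; first exact: measurableT_comp.
apply: (eq_Li _ (Li_norm (Lf r))) => x; rewrite normrM; congr (_ * _).
by rewrite indicE ger0_norm.
Qed.

Lemma conv_Li k f x : Cc k -> Lloc f -> Li mu (fun y => k (x - y) * f y).
Proof.
move=> Ck [mf Lf]; have [C [r [C0 r0 hk]]] := Cc_le_indic Ck.
apply: (@Li_le _ _ R mu (fun y => C * `|\1_(cube (r + `|x|)) y * f y|)).
- by apply: measurable_funM => //; apply: measurable_refl; exact: Cc_measurable.
- move=> y; rewrite !normrM mulrA ler_wpM2r// (le_trans (hk _))// ler_wpM2l ?(ltW C0)//.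
  rewrite !indicE; have [xy|_] := boolP (x - y \in _); last exact: normr_ge0.
  rewrite mem_set ?normr1//; move: xy; rewrite inE /cube /= => xy.
  by rewrite -[y](subKr x) (le_trans (ler_normB _ _))// addrC lerD2r.
- by apply: LiZ; apply: Li_norm.
Qed.

Lemma measurable_conv k f : measurable_fun setT k -> measurable_fun setT f ->
  measurable_fun setT (conv k f).
Proof.
move=> mk mf; apply: (@RI3_measurable R (fun z => k (z.1 - z.2) * f z.2)).
apply: measurable_funM; first exact: measurable_sub3.
exact: measurableT_comp.
Qed.

Lemma convB k f g : Cc k -> Lloc f -> Lloc g ->
  conv k (fun x => f x - g x) = (fun x => conv k f x - conv k g x).
Proof.
move=> Ck Lf Lg; apply/funext => x; rewrite /conv -RIB; [|exact: conv_Li|exact: conv_Li].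
by apply: eq_RI => y; rewrite mulrBr.
Qed.

Lemma conv_le k f g x : Cc k -> Lloc f -> Lloc g -> (forall y, `|f y| <= g y) ->
  `|conv k f x| <= conv (fun y => `|k y|) g x.
Proof.
move=> Ck Lf Lg fg; apply: RI_norm_le; first exact: conv_Li.
- apply: (eq_Li _ (Li_norm (conv_Li x Ck Lg))) => y; rewrite normrM [`|g y|]ger0_norm//.
  exact: le_trans (fg y).
- by move=> y; rewrite normrM ler_wpM2l.
Qed.

Lemma conv_Li1 k f : tst k -> Li mu f -> forall x, Li mu (fun y => k (x - y) * f y).
Proof. by move=> tk Lf x; apply: conv_Li; [exact: tst_Cc|exact: Li_Lloc]. Qed.

(** Differentiation under the integral sign in quantitative form: the Taylor remainder of k is
    O(h^2) uniformly in space, and integrating it against f costs the L^1 norm of f. *)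
Lemma conv_taylor k f v : tst k -> Li mu f -> exists2 C, 0 <= C & forall x (h : R),
  `|conv k f (x + h *: v) - conv k f x - h * conv (fun z => 'D_v k z) f x| <= C * h ^+ 2.
Proof.
move=> tk Lf; have [C C0 hC] := tst_taylor_dir v tk.
exists (C * \int[mu]_y `|f y|); first by rewrite mulr_ge0 ?(ltW C0)// RI_ge0.
move=> x h; have L := @conv_Li1 _ f tk Lf; have Lv := @conv_Li1 _ f (tst_derive v tk) Lf.
have -> : conv k f (x + h *: v) - conv k f x - h * conv (fun z => 'D_v k z) f x =
    \int[mu]_y ((k (x - y + h *: v) - k (x - y) - h * 'D_v k (x - y)) * f y).
  rewrite /conv -RIB// -RIZ// -RIB//; [|exact: LiB|exact: LiZ].
  by apply: eq_RI => y; rewrite (addrAC x); ring.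
rewrite mulrAC -RIZ; last exact: Li_norm.
apply: RI_norm_le; last 2 first.
- by apply: LiZ; exact: Li_norm.
- by move=> y; rewrite normrM ler_wpM2r.
apply: (eq_Li _ (LiB (LiB (L (x + h *: v)) (L x)) (LiZ h (Lv x)))) => y.
by rewrite /= (addrAC x); ring.
Qed.

Lemma conv_lipschitz k f : tst k -> Li mu f -> exists2 C, 0 <= C & forall x y,
  `|conv k f x - conv k f y| <= C * `|x - y|.
Proof.
move=> tk Lf; have [C C0 hC] := tst_lipschitz tk.
exists (C * \int[mu]_y `|f y|); first by rewrite mulr_ge0 ?(ltW C0)// RI_ge0.
move=> x y; have L := @conv_Li1 _ f tk Lf.
rewrite /conv -RIB// mulrAC -RIZ; last exact: Li_norm.
apply: RI_norm_le; [exact: LiB|by apply: LiZ; exact: Li_norm|].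
move=> z; rewrite -mulrBl normrM ler_wpM2r// (le_trans (hC _ _))//.
by rewrite opprB addrA subrK.
Qed.

Lemma is_derive_conv k f x v : tst k -> Li mu f ->
  is_derive x v (conv k f) (conv (fun z => 'D_v k z) f x).
Proof.
move=> tk Lf; have [C C0 hC] := conv_taylor v tk Lf.
suff : h^-1 *: ((conv k f \o shift x) (h *: v) - conv k f x) @[h --> (0 : R)^'] -->
    conv (fun z => 'D_v k z) f x.
  by move=> c; apply: DeriveDef; [apply/cvg_ex; eexists; exact: c|exact: cvg_lim c].
apply/cvgrPdist_le => e e0; exists (e / (C + 1)) => /=.
  by rewrite divr_gt0// ltr_wpDl.
move=> h; rewrite /ball /= sub0r normrN => he h0.
rewrite -normrN opprB; have -> : h^-1 *: (conv k f (h *: v + x) - conv k f x) -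
    conv (fun z => 'D_v k z) f x = h^-1 * (conv k f (x + h *: v) - conv k f x -
    h * conv (fun z => 'D_v k z) f x).
  by rewrite [_ *: _ + x]addrC mulrBr mulKf.
rewrite normrM normfV ler_pdivrMl ?normr_gt0// (le_trans (hC _ _))//.
rewrite -(real_normK (num_real h)) expr2 mulrCA ler_wpM2l//.
move: he; rewrite ltr_pdivlMr ?ltr_wpDl// => he; rewrite (le_trans _ (ltW he))// mulrDr mulr1 mulrC.
by rewrite lerDl.
Qed.

Lemma smooth_conv k f : tst k -> Li mu f -> smooth (conv k f).
Proof.
move=> tk Lf; apply: (@smooth_coind R (R3 R) (fun h => exists2 k, tst k & h = conv k f)).
- move=> _ [k' tk' ->] x; have [C C0 hC] := conv_lipschitz tk' Lf.
  apply/cvgrPdist_le => e e0.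
  have d0 : 0 < e / (C + 1) by rewrite divr_gt0// ltr_wpDl.
  apply: filterS (nbhsx_ballx x _ d0) => y.
  rewrite -ball_normE /= ltr_pdivlMr ?ltr_wpDl// => he.
  by rewrite (le_trans (hC _ _))// (le_trans _ (ltW he))// mulrDr mulr1 mulrC lerDl.
- by move=> _ x v [k' tk' ->]; have [] := is_derive_conv x v tk' Lf.
- move=> _ v [k' tk' ->]; exists (fun z => 'D_v k' z); first exact: tst_derive.
  by apply/funext => x; have [_] := is_derive_conv x v tk' Lf.
- by exists k.
Qed.

Lemma pd_conv j k f : tst k -> Li mu f -> pd j (conv k f) = conv (pd j k) f.
Proof.
by move=> tk Lf; apply/funext => x; have [_] := is_derive_conv x (evec j) tk Lf.
Qed.

Lemma tst_conv k f r : tst k -> Li mu f -> (forall x, r < `|x| -> f x = 0) ->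
  tst (conv k f).
Proof.
move=> tk Lf fr; split; first exact: smooth_conv.
have [_ [s hs]] := tk; exists (s + r) => x hx.
rewrite /conv (_ : (fun y => _) = fun=> 0) ?RI0//; apply/funext => y.
have [ry|ry] := ltP r `|y|; first by rewrite fr ?mulr0.
rewrite hs ?mul0r//; have := ler_normD (x - y) y; rewrite subrK => h.
by rewrite -(ltrD2r `|y|) (lt_le_trans _ h)// (le_lt_trans _ hx)// lerD2l.
Qed.

Lemma Li_mul_sub a g : Li mu a -> Li mu g ->
  Li (product_measure1 (sfleb3 R) (sfleb3 R)) (fun z => a (z.1 - z.2) * g z.2).
Proof.
move=> La Lg; have ma := Li_measurable La; have mg := Li_measurable Lg.
apply: Li3_tonelli2.
- by apply: measurable_funM; [exact: measurable_sub3|exact: measurableT_comp].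
- by move=> y /=; apply: LiZr; exact: Li_shift.
- apply: (eq_Li _ (LiZ (\int[mu]_x `|a x|) (Li_norm Lg))) => y /=.
  rewrite -(RI_shift (- y) (Li_norm La)) -RIZr; last exact: (Li_shift _ (Li_norm La)).
  by apply: eq_RI => x; rewrite normrM.
Qed.

Lemma young1 a g : Li mu a -> Li mu g -> Li mu (conv a g) /\
  \int[mu]_x `|conv a g x| <= (\int[mu]_x `|a x|) * \int[mu]_x `|g x|.
Proof.
move=> La Lg; have L2' := Li_mul_sub La Lg; have Lc := Li3_RI1 L2'; split=> //.
have Ln := Li_mul_sub (Li_norm La) (Li_norm Lg).
have aeL := ae_Li3_1 L2'.
apply: (@le_trans _ _ (\int[mu]_x \int[mu]_y (`|a (x - y)| * `|g y|))).
  apply: RI_le_ae; [exact: Li_norm|exact: (Li3_RI1 Ln)|].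
  apply: (ae_imp aeL) => x /= h; rewrite (le_trans (RI_norm h))//.
  by rewrite le_eqVlt; apply/orP; left; apply/eqP; apply: eq_RI => y; rewrite normrM.
rewrite (RI3_fubini Ln) /= -RIZ; last exact: Li_norm.
rewrite le_eqVlt; apply/orP; left; apply/eqP; apply: eq_RI => y.
rewrite RIZr; last exact: (Li_shift _ (Li_norm La)).
by rewrite (RI_shift (- y) (Li_norm La)).
Qed.

Lemma young2 a b : Li mu a -> L2 mu b -> [/\ L2 mu (conv a b),
  N2 mu (conv a b) <= (\int[mu]_x `|a x|) * N2 mu b &
  {ae mu, forall x, Li mu (fun y => a (x - y) * b y)}].
Proof.
move=> La Lb; have ma := Li_measurable La; have mb := L2_measurable Lb.
have Ln := Li_mul_sub (Li_norm La) (L2_sq Lb).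
have aeL := ae_Li3_1 Ln; set A := \int[mu]_x `|a x|.
have mc : measurable_fun setT (conv a b) by exact: measurable_conv.
have LA x : Li mu (fun y => `|a (x - y)|) by apply: Li_norm; exact: Li_refl.
have AE x : \int[mu]_y `|a (x - y)| = A by exact: (RI_refl x (Li_norm La)).
have A0 : 0 <= A by exact: RI_ge0.
have aeLb : {ae mu, forall x, Li mu (fun y => a (x - y) * b y)}.
  apply: (ae_imp aeL) => x /= h.
  apply: (Li_le _ _ (LiD (LA x) h)).
    by apply: measurable_funM => //; exact: measurable_refl.
  move=> y; rewrite normrM -[X in _ <= X + _]mulr1 -mulrDr ler_wpM2l//.
  rewrite -(real_normK (num_real (b y))); have := sqr_ge0 (`|b y| - 1).
  by have := normr_ge0 (b y); nra.
have bd : {ae mu, forall x, `|conv a b x ^+ 2| <= A * \int[mu]_y (`|a (x - y)| * b y ^+ 2)}.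
  apply: (ae_imp2 aeL aeLb) => x /= h hb; rewrite ger0_norm ?sqr_ge0//.
  have W := @weighted_CS _ _ _ mu (fun y => `|a (x - y)|) (fun y => `|b y|) (fun _ => 1).
  apply: (@le_trans _ _ ((\int[mu]_y (`|a (x - y)| * (`|b y| * 1))) ^+ 2)).
    rewrite -(real_normK (num_real (conv a b x))) ler_pXn2r ?nnegrE ?RI_ge0//.
    by rewrite (le_trans (RI_norm hb))// le_eqVlt; apply/orP; left; apply/eqP; apply: eq_RI => y; rewrite normrM mulr1.
  apply: (le_trans (W _ _ _ _)) => //.
  - by apply: (eq_Li _ h) => y; rewrite real_normK// num_real.
  - by apply: (eq_Li _ (LA x)) => y; rewrite expr1n mulr1.
  - by apply: (eq_Li _ (Li_norm hb)) => y; rewrite normrM mulr1.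
  rewrite mulrC le_eqVlt; apply/orP; left; apply/eqP; congr (_ * _).
    by rewrite -(AE x); apply: eq_RI => y; rewrite expr1n mulr1.
  by apply: eq_RI => y; rewrite real_normK// num_real.
have LF := LiZ A (Li3_RI1 Ln).
have Lc2 : Li mu (fun x => conv a b x ^+ 2).
  by apply: (Li_le_ae _ bd LF); exact: measurable_funX.
split => //.
rewrite -(@ler_pXn2r _ 2)// ?nnegrE ?mulr_ge0 ?N2_ge0// exprMn !N2_sqr.
apply: (@le_trans _ _ (\int[mu]_x (A * \int[mu]_y (`|a (x - y)| * b y ^+ 2)))).
  apply: RI_le_ae => //; apply: (ae_imp bd) => x; exact: le_trans (ler_norm _).
rewrite RIZ; last exact: (Li3_RI1 Ln).
rewrite expr2 -mulrA ler_wpM2l// (RI3_fubini Ln) /= -RIZ; last exact: L2_sq.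
rewrite le_eqVlt; apply/orP; left; apply/eqP; apply: eq_RI => y.
rewrite RIZr; last exact: (Li_shift _ (Li_norm La)).
by rewrite (RI_shift (- y) (Li_norm La)).
Qed.

Lemma conv_C k f x : Li mu (fun y => k y * f (x - y)) -> conv k f x = conv f k x.
Proof.
move=> L; transitivity (\int[mu]_y (k (x - y) * f (x - (x - y)))).
  by apply: eq_RI => y; rewrite subKr.
by rewrite (RI_refl x L); apply: eq_RI => y; rewrite mulrC.
Qed.

End convolution.

Lemma sum3 (V : nmodType) (F : 'I_3 -> V) : \sum_(j < 3) F j = F 0 + F 1 + F 2%:R.
Proof.
rewrite !big_ord_recr big_ord0 /= add0r.
by congr (F _ + F _ + F _); apply: val_inj.
Qed.

(** * The mollification error in L^2 *)

Section mollification.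
Context {R : realType}.
Implicit Types (x y v w a : R3 R) (b f g k : R3 R -> R) (e r d : R).
Local Notation mu := (leb3 R).

Lemma N2_shift f a : L2 mu f -> N2 mu (fun x => f (x + a)) = N2 mu f.
Proof.
by move=> [mf Lf]; rewrite /N2; congr Num.sqrt; exact: (@RI_shift R (fun x => f x ^+ 2)).
Qed.

Lemma L2_shiftB f a : L2 mu f -> L2 mu (fun x => f (x + a) - f x).
Proof. by move=> Lf; apply: L2B => //; exact: L2_shift. Qed.

Lemma N2_shiftD f v w : L2 mu f ->
  N2 mu (fun x => f (x + (v + w)) - f x) <=
  N2 mu (fun x => f (x + v) - f x) + N2 mu (fun x => f (x + w) - f x).
Proof.
move=> Lf.
have -> : N2 mu (fun x => f (x + (v + w)) - f x) =
    N2 mu (fun x => (f (x + w + v) - f (x + w)) + (f (x + w) - f x)).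
  by apply: eq_N2 => x; rewrite -[x + w + v]addrA [w + v]addrC; ring.
have := N2_shift w (L2_shiftB v Lf) => /= <-.
by apply: N2D; [exact: (L2_shift w (L2_shiftB v Lf))|exact: L2_shiftB].
Qed.

Lemma N2_0 : N2 mu (fun _ => 0) = 0.
Proof.
rewrite /N2; have -> : \int[mu]_x ((0 : R) ^+ 2) = \int[mu]_x (0 : R).
  by apply: eq_RI => x; rewrite expr0n.
by rewrite RI0 sqrtr0.
Qed.

Lemma N2_shift_nat f w n : L2 mu f ->
  N2 mu (fun x => f (x + n%:R *: w) - f x) <= n%:R * N2 mu (fun x => f (x + w) - f x).
Proof.
move=> Lf; elim: n => [|n IH].
  rewrite mul0r; have -> : N2 mu (fun x => f (x + 0 *: w) - f x) = N2 mu (fun _ => 0).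
    by apply: eq_N2 => x; rewrite scale0r addr0 subrr.
  by rewrite N2_0.
rewrite -natr1 scalerDl scale1r mulrDl mul1r.
by rewrite (le_trans (N2_shiftD _ _ Lf))// lerD2r.
Qed.

Lemma N2_taylor f v : tst f -> exists2 K, 0 <= K & forall h : R, `|h| <= 1 ->
  N2 mu (fun x => f (x + h *: v) - f x) <= `|h| * N2 mu (fun x => 'D_v f x) + K * h ^+ 2.
Proof.
move=> tf; have [C C0 hC] := tst_taylor_dir v tf; have Lf := tst_L2 tf; have tD := tst_derive v tf; have LD := tst_L2 tD.
have [r hf hD] : exists2 r, (forall x, r < `|x| -> f x = 0) &
    forall x, r < `|x| -> 'D_v f x = 0.
  have [_ [r hr]] := tf; have [_ [s hs]] := tD.
  by exists (Num.max r s) => x; rewrite gt_max => /andP[? ?]; [exact: hr|exact: hs].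
have LI : L2 mu (\1_(cube (r + `|v|)) : R3 R -> R).
  have L := Li_cube (R := R) (r + `|v|); split; first exact: Li_measurable L.
  by apply: (eq_Li _ L) => x; rewrite indicE; case: (_ \in _); rewrite ?expr1n ?expr0n.
exists (C * N2 mu (\1_(cube (r + `|v|)) : R3 R -> R)).
  by rewrite mulr_ge0 ?(ltW C0)// N2_ge0.
move=> h h1; have Lh := L2_shiftB (h *: v) Lf; have LhD := L2Z h LD.
have -> : N2 mu (fun x => f (x + h *: v) - f x) =
    N2 mu (fun x => h * 'D_v f x + (f (x + h *: v) - f x - h * 'D_v f x)).
  by apply: eq_N2 => x; ring.
rewrite (le_trans (N2D LhD (L2B Lh LhD)))// N2Z// lerD2l.
have -> : C * N2 mu (\1_(cube (r + `|v|)) : R3 R -> R) * h ^+ 2 = `|C * h ^+ 2| * N2 mu (\1_(cube (r + `|v|)) : R3 R -> R).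
  by rewrite mulrAC ger0_norm// mulr_ge0 ?sqr_ge0// ltW.
rewrite -N2Z//; apply: N2_le; [exact: L2B|exact: L2Z|].
move=> x; rewrite indicE; have [_|] := boolP (x \in _).
  by rewrite mulr1 (le_trans (hC _ _))// ler_norm.
rewrite notin_setE /cube /= => /negP; rewrite -ltNge => xr.
have xr' : r < `|x| by rewrite (le_lt_trans _ xr)// lerDl.
rewrite mulr0 normr0 hD// hf ?[X in _ - X - _]hf// ?mulr0 ?subrr ?normr0//.
have : `|x| <= `|x + h *: v| + `|h *: v|.
  by rewrite -{1}(addrK (h *: v) x) ler_normB.
rewrite normrZ => hx; rewrite -(ltrD2r `|v|) (lt_le_trans xr)// (le_trans hx)// lerD2l.
by rewrite ler_piMl.
Qed.

(** The quadratic error in [N2_taylor] is removed by subdivision: n translations by h/n accumulate a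
    total error of K h^2 / n, which can be made smaller than any e. *)
Lemma N2_shift_dir f v (h : R) : tst f ->
  N2 mu (fun x => f (x + h *: v) - f x) <= `|h| * N2 mu (fun x => 'D_v f x).
Proof.
move=> tf; have [K K0 hK] := N2_taylor v tf; have Lf := tst_L2 tf.
set D := N2 mu (fun x => 'D_v f x).
apply/ler_addgt0Pr => e e0.
pose n := (Num.bound (`|h| + K * h ^+ 2 / e)).+1.
have n0 : 0 < n%:R :> R by rewrite ltr0n.
have Kh : 0 <= K * h ^+ 2 / e by apply: divr_ge0; [apply: mulr_ge0 => //; exact: sqr_ge0|exact: ltW].
have hn : `|h| + K * h ^+ 2 / e <= n%:R.
  have a : 0 <= `|h| + K * h ^+ 2 / e by rewrite addr_ge0.
  by rewrite (le_trans (ltW (archi_boundP a)))// ler_nat /n.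
have hn1 : `|h| <= n%:R by rewrite (le_trans _ hn)// lerDl.
have hn2 : K * h ^+ 2 / e <= n%:R by rewrite (le_trans _ hn)// lerDr.
have := N2_shift_nat ((h / n%:R) *: v) n Lf.
rewrite scalerA mulrC divfK ?gt_eqF// => H; rewrite (le_trans H)// mulrC.
have hh : `|h / n%:R| <= 1 by rewrite normrM normfV (gtr0_norm n0) ler_pdivrMr// mul1r.
rewrite (le_trans (ler_wpM2r (ltW n0) (hK _ hh)))// mulrDl -/D.
rewrite normrM normfV (gtr0_norm n0) expr_div_n.
have -> : `|h| / n%:R * D * n%:R = `|h| * D by field; rewrite gt_eqF.
have -> : K * (h ^+ 2 / n%:R ^+ 2) * n%:R = K * h ^+ 2 / n%:R.
  by field; rewrite gt_eqF.
by rewrite lerD2l ler_pdivrMr// [e * _]mulrC -ler_pdivrMr.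
Qed.

Lemma N2_shift_tst f y : tst f ->
  N2 mu (fun x => f (x + y) - f x) <= `|y| * \sum_(j < 3) N2 mu (pd j f).
Proof.
move=> tf; have Lf := tst_L2 tf.
have n1 : `|y.1.1| <= `|y| by rewrite norm3E !le_max lexx.
have n2 : `|y.1.2| <= `|y| by rewrite norm3E !le_max lexx orbT.
have n3 : `|y.2| <= `|y| by rewrite norm3E !le_max lexx orbT.
have H (j : 'I_3) (c : R) : `|c| <= `|y| ->
    N2 mu (fun x => f (x + c *: evec j) - f x) <= `|y| * N2 mu (pd j f).
  by move=> cy; apply: (le_trans (N2_shift_dir _ _ tf)); rewrite ler_wpM2r// N2_ge0.
rewrite sum3.
rewrite !mulrDr; have := evec_decomp y.
move: (H 0 _ n1) (H 1 _ n2) (H 2%:R _ n3).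
set w1 := _ *: evec 0; set w2 := _ *: evec 1; set w3 := _ *: evec 2%:R.
clearbody w1 w2 w3 => h1 h2 h3 yE.
have -> : N2 mu (fun x => f (x + y) - f x) = N2 mu (fun x => f (x + (w1 + w2 + w3)) - f x).
  by rewrite -yE.
have s1 := N2_shiftD (w1 + w2) w3 Lf; have s2 := N2_shiftD w1 w2 Lf.
exact: le_trans s1 (lerD (le_trans s2 (lerD h1 h2)) h3).
Qed.

(** Jensen's inequality for the probability density k: the square of [conv k f x - f x] is at most
    the k-average of (f(x - y) - f(x))^2. Integrating in x first turns each y into the translation
    error, which is at most D on the support of k. *)
Lemma N2_conv_sub k f e D : tst k -> (forall x, 0 <= k x) -> \int[mu]_x k x = 1 ->
  (forall x, e < `|x| -> k x = 0) -> L2 mu f ->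
  (forall y, `|y| <= e -> N2 mu (fun x => f (x + y) - f x) <= D) -> 0 <= D ->
  L2 mu (conv k f) /\ N2 mu (fun x => conv k f x - f x) <= D.
Proof.
move=> tk k0 k1 ks Lf hD D0; have mf := L2_measurable Lf.
have Lk := tst_Li tk; have mk := tst_measurable tk.
have [Lc _ _] := young2 Lk Lf; split => //.
have [B [B0 hB]] := tst_bounded tk.
have LkB x : Li mu (fun y => k y * (f (x - y) - f x) ^+ 2).
  apply: (@Li_le _ _ _ mu (fun y => 2 * B * f (x - y) ^+ 2 + 2 * f x ^+ 2 * k y)).
  - apply: measurable_funM => //; apply: measurable_funX; apply: measurable_funB => //.
    exact: measurable_refl.
  - move=> y; have kB : k y <= B by rewrite (le_trans _ (hB y))// ler_norm.
    rewrite ger0_norm; last by apply: mulr_ge0 => //; exact: sqr_ge0.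
    have h1 : (f (x - y) - f x) ^+ 2 <= 2 * f (x - y) ^+ 2 + 2 * f x ^+ 2.
      by have := sqr_ge0 (f (x - y) + f x); lra.
    rewrite (le_trans (ler_wpM2l (k0 y) h1))// mulrDr lerD//; last by rewrite mulrC.
    by rewrite mulrA [2 * B]mulrC ler_wpM2r ?sqr_ge0// ler_wpM2r.
  - apply: LiD; last exact: LiZ.
    by apply: LiZ; exact: (Li_refl x (L2_sq Lf)).
have mF : measurable_fun setT (fun z : R3 R * R3 R => k z.2 * (f (z.1 - z.2) - f z.1) ^+ 2).
  apply: measurable_funM; first exact: measurableT_comp.
  by apply: measurable_funX; apply: measurable_funB; [exact: measurable_sub3|exact: measurableT_comp].
have int_x y : \int[mu]_x (k y * (f (x - y) - f x) ^+ 2) =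
    k y * N2 mu (fun x => f (x + - y) - f x) ^+ 2.
  by rewrite N2_sqr -RIZ//; exact: L2_sq (L2_shiftB (- y) Lf).
have le_y y : k y * N2 mu (fun x => f (x + - y) - f x) ^+ 2 <= D ^+ 2 * k y.
  rewrite mulrC; have [ye|ye] := leP `|y| e; last by rewrite ks// !mulr0.
  by rewrite ler_wpM2r// ler_pXn2r ?nnegrE ?N2_ge0// hD// normrN.
have LF : Li (product_measure1 (sfleb3 R) (sfleb3 R))
    (fun z => k z.2 * (f (z.1 - z.2) - f z.1) ^+ 2).
  apply: Li3_tonelli2 => //.
    by move=> y /=; apply: LiZ; exact: L2_sq (L2_shiftB (- y) Lf).
  apply: (@Li_le _ _ _ mu (fun y => D ^+ 2 * k y)); last exact: LiZ.
    apply: (@RI3_measurable R (fun z => `|k z.1 * (f (z.2 - z.1) - f z.2) ^+ 2|)).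
    apply: measurableT_comp => //.
    exact: (measurableT_comp mF (@measurable_swap _ _ _ _)).
  move=> y; rewrite ger0_norm ?RI_ge0// (le_trans _ (le_y y))// -int_x.
  rewrite le_eqVlt; apply/orP; left; apply/eqP; apply: eq_RI => x.
  by rewrite ger0_norm//; apply: mulr_ge0 => //; exact: sqr_ge0.
have pw x : (conv k f x - f x) ^+ 2 <= \int[mu]_y (k y * (f (x - y) - f x) ^+ 2).
  have Lkf : Li mu (fun y => k y * f (x - y)).
    have := Li_refl x (conv_Li x (tst_Cc tk) (L2_Lloc Lf)).
    by apply: eq_Li => y; rewrite subKr.
  have -> : conv k f x - f x = \int[mu]_y (k y * ((f (x - y) - f x) * 1)).
    transitivity (\int[mu]_y (k y * f (x - y) - f x * k y)).
      rewrite RIB ?RIZ//; last exact: LiZ.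
      by rewrite k1 mulr1 (conv_C Lkf); congr (_ - _); apply: eq_RI => y; rewrite mulrC.
    by apply: eq_RI => y; ring.
  apply: (le_trans (weighted_CS _ _ _ _)) => //.
  - by apply: (eq_Li _ Lk) => y; rewrite expr1n mulr1.
  - by apply: (eq_Li _ (LiB Lkf (LiZ (f x) Lk))) => y; ring.
  have -> : \int[mu]_y (k y * 1 ^+ 2) = 1.
    by rewrite -[RHS]k1; apply: eq_RI => y; rewrite expr1n mulr1.
  by rewrite mulr1.
rewrite -(@ler_pXn2r _ 2)// ?nnegrE ?N2_ge0// N2_sqr.
have LcB := L2_sq (L2B Lc Lf).
apply: (le_trans (RI_le LcB (Li3_RI1 LF) pw)).
rewrite (RI3_fubini LF) /=.
apply: (@le_trans _ _ (\int[mu]_y (D ^+ 2 * k y))).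
  apply: RI_le; [exact: (Li3_RI2 LF)|exact: LiZ|].
  by move=> y /=; rewrite int_x.
by rewrite RIZ// k1 mulr1.
Qed.

Lemma eta_L1 e : 0 < e -> \int[mu]_x `|eta e x| = 1.
Proof.
by move=> e0; rewrite -(eta_int e0); apply: eq_RI => x; rewrite ger0_norm// eta_ge0.
Qed.

Lemma conv_eta_L2 e f : 0 < e -> L2 mu f ->
  L2 mu (conv (eta e) f) /\ N2 mu (conv (eta e) f) <= N2 mu f.
Proof.
move=> e0 Lf; have [L h _] := young2 (tst_Li (tst_eta e0)) Lf; split=> //.
by move: h; rewrite eta_L1// mul1r.
Qed.

Lemma conv_eta_tst e f : 0 < e -> tst f ->
  N2 mu (fun x => conv (eta e) f x - f x) <= e * \sum_(j < 3) N2 mu (pd j f).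
Proof.
move=> e0 tf.
have S0 : 0 <= \sum_(j < 3) N2 mu (pd j f) by apply: sumr_ge0 => j _; exact: N2_ge0.
have D0 : 0 <= e * \sum_(j < 3) N2 mu (pd j f) by rewrite mulr_ge0// ltW.
have hy y : `|y| <= e ->
    N2 mu (fun x => f (x + y) - f x) <= e * \sum_(j < 3) N2 mu (pd j f).
  by move=> ye; rewrite (le_trans (N2_shift_tst _ tf))// ler_wpM2r.
exact: (N2_conv_sub (tst_eta e0) (fun x => eta_ge0 x e0) (eta_int e0)
  (fun x => @eta_support R e x e0) (tst_L2 tf) hy D0).2.
Qed.

(** Mollification is a contraction on L^2, so f - g contributes once as it stands and once
    mollified, and the mollification error of g remains. *)
Lemma conv_eta_approx e f g : 0 < e -> L2 mu f -> L2 mu g ->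
  N2 mu (fun x => conv (eta e) f x - f x) <=
  2 * N2 mu (fun x => g x - f x) + N2 mu (fun x => conv (eta e) g x - g x).
Proof.
move=> e0 Lf Lg; have Ck := tst_Cc (tst_eta e0).
have Lfg := L2B Lf Lg; have [Lc hc] := conv_eta_L2 e0 Lfg.
have [Lcg _] := conv_eta_L2 e0 Lg.
have Lgf := L2B Lg Lf.
have -> : N2 mu (fun x => conv (eta e) f x - f x) = N2 mu (fun x =>
    (conv (eta e) (fun x => f x - g x) x + (g x - f x)) + (conv (eta e) g x - g x)).
  by apply: eq_N2 => x; rewrite convB//; [ring|exact: L2_Lloc|exact: L2_Lloc].
rewrite (le_trans (N2D (L2D Lc Lgf) (L2B Lcg Lg)))// lerD2r.
rewrite (le_trans (N2D Lc Lgf))//.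
have e1 : N2 mu (fun x => f x - g x) = N2 mu (fun x => g x - f x).
  by rewrite -N2N; apply: eq_N2 => x; rewrite opprB.
by rewrite e1 in hc; rewrite mulrDl mul1r lerD2r.
Qed.

Lemma conv_eta_cvg f d : L2 mu f -> 0 < d -> exists2 e0, 0 < e0 &
  forall e, 0 < e <= e0 -> N2 mu (fun x => conv (eta e) f x - f x) <= d.
Proof.
move=> Lf d0; have d4 : 0 < d / 4 by rewrite divr_gt0.
have [g tg hg] := tst_dense Lf d4.
set S := \sum_(j < 3) N2 mu (pd j g).
have S0 : 0 <= S by apply: sumr_ge0 => j _; exact: N2_ge0.
exists (d / 2 / (S + 1)); first by rewrite !divr_gt0// ltr_wpDl.
move=> e /andP[e0 eS]; rewrite (le_trans (conv_eta_approx e0 Lf (tst_L2 tg)))//.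
have h := conv_eta_tst e0 tg; rewrite -/S in h.
have : e * (S + 1) <= d / 2 by rewrite -ler_pdivlMr// ltr_wpDl.
by rewrite mulrDr mulr1 => h2; lra.
Qed.

End mollification.

(** * Weak derivatives *)

Section dominated_L2.
Context d (T : measurableType d) (R : realType) (mu : {measure set T -> \bar R}).
Implicit Types (f g : T -> R).

Lemma cvg_N2_0 (f_ : nat -> T -> R) :
  \int[mu]_x (f_ n x ^+ 2) @[n --> \oo] --> 0 -> N2 mu (f_ n) @[n --> \oo] --> 0.
Proof.
move=> h; rewrite -[X in _ --> X](@sqrtr0 R).
by apply: (cvg_comp _ _ h); exact: sqrt_continuous.
Qed.

Lemma L2_dct (f_ : nat -> T -> R) f g : (forall n, measurable_fun setT (f_ n)) ->
  measurable_fun setT f -> {ae mu, forall x, f_ ^~ x @ \oo --> f x} ->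
  L2 mu g -> {ae mu, forall x n, `|f_ n x| <= g x} ->
  [/\ forall n, L2 mu (f_ n), L2 mu f & N2 mu (fun x => f_ n x - f x) @[n --> \oo] --> 0].
Proof.
move=> mf_ mf cf Lg fg.
have sq n x : `|f_ n x| <= g x -> `|f_ n x ^+ 2| <= g x ^+ 2.
  move=> h; rewrite normrX ler_pXn2r ?nnegrE//; exact: le_trans h.
have Ln n : L2 mu (f_ n).
  split=> //; apply: (Li_le_ae (measurable_funX 2 (mf_ n)) _ (L2_sq Lg)).
  by apply: filterS fg => x /(_ n) /sq.
have fl : {ae mu, forall x, `|f x| <= g x}.
  apply: filterS2 cf fg => x /= c h.
  have cn : `|f_ n x| @[n --> \oo] --> `|f x| by exact: cvg_norm.
  by apply: (cvgr_to_le cn); exact: nearW.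
have Lf : L2 mu f.
  split=> //; apply: (Li_le_ae (measurable_funX 2 mf) _ (L2_sq Lg)).
  apply: filterS fl => x h; rewrite normrX ler_pXn2r ?nnegrE//; exact: le_trans h.
split=> //; apply: cvg_N2_0.
have sqc : {ae mu, forall x, (f_ n x - f x) ^+ 2 @[n --> \oo] --> (0 : R)}.
  apply: filterS cf => x /= c.
  have c0 : f_ n x - f x @[n --> \oo] --> 0.
    by rewrite -(subrr (f x)); apply: cvgB; [exact: c|exact: cvg_cst].
  by rewrite -[X in _ --> X](mulr0 0); exact: (cvgM c0 c0).
have [_] := @Li_dct _ _ _ mu (fun n x => (f_ n x - f x) ^+ 2) (fun _ => 0) (fun x => 4 * g x ^+ 2)
  (fun n => measurable_funX 2 (measurable_funB (mf_ n) mf)) (measurable_cst _)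
  sqc
  (LiZ 4 (L2_sq Lg))
  ltac:(apply: filterS2 fl fg => x /= h1 h2 n; have h3 := h2 n;
    rewrite ger0_norm ?sqr_ge0//; move: h1 h3; rewrite !ler_norml => /andP[? ?] /andP[? ?]; nra).
by rewrite RI0.
Qed.

End dominated_L2.

Lemma cvg0_le (R : realType) (u : nat -> R) d : u n @[n --> \oo] --> 0 -> 0 < d ->
  \forall n \near \oo, u n <= d.
Proof.
move=> uc d0; have h : \forall n \near \oo, `|u n| <= d by exact: cvgr0_norm_le uc _ d0.
by apply: filterS h => n; exact: le_trans (ler_norm _).
Qed.

Section weak_derivatives.
Context {R : realType}.
Implicit Types (x y : R3 R) (a v w f g k psi : R3 R -> R) (G : 'I_3 -> R3 R -> R) (e r d : R).
Local Notation mu := (leb3 R).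

Definition H1 v G := [/\ L2 mu v, forall j, L2 mu (G j) &
  forall j psi, tst psi ->
    \int[mu]_x (v x * pd j psi x) = - \int[mu]_x (G j x * psi x)].

Lemma tst_mul_L2 a f : tst a -> L2 mu f -> L2 mu (fun x => a x * f x).
Proof.
move=> ta Lf; have [C [C0 hC]] := tst_bounded ta; apply: (@L2_le _ _ R mu (fun x => C * f x)).
- by apply: measurable_funM; [exact: tst_measurable|case: Lf].
- by move=> x; rewrite !normrM ler_wpM2r// (le_trans (hC x))// ler_norm.
- exact: L2Z.
Qed.

Lemma tst_H1 f : tst f -> H1 f (fun j => pd j f).
Proof.
move=> tf; split; first exact: tst_L2.
  by move=> j; apply: tst_L2; exact: tst_pd.
by move=> j psi tpsi; apply: tst_ibp => //; exact: tst_smooth.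
Qed.

(** The weak gradient of v is tested with y -> k(x - y); the sign from the reflection cancels the
    one from integration by parts. *)
Lemma conv_pd j k v G : tst k -> H1 v G -> conv (pd j k) v = conv k (G j).
Proof.
move=> tk [Lv LG vG]; apply/funext => x.
have := vG j (fun y => k (x - y)) (tst_refl x tk).
rewrite pd_refl; last exact: tst_smooth.
move=> h; have Lc := conv_Li x (tst_Cc (tst_pd j tk)) (L2_Lloc Lv).
rewrite /conv; apply: oppr_inj; rewrite -RIN//.
have -> : \int[mu]_y (- (pd j k (x - y) * v y)) = \int[mu]_y (v y * - pd j k (x - y)).
  by apply: eq_RI => y; rewrite mulrN mulrC.
by rewrite h; congr (- _); apply: eq_RI => y; rewrite mulrC.
Qed.

Lemma H1_mul a v G : tst a -> H1 v G ->
  H1 (fun x => a x * v x) (fun j x => a x * G j x + pd j a x * v x).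
Proof.
move=> ta [Lv LG vG]; split; first exact: tst_mul_L2.
  by move=> j; apply: L2D; apply: tst_mul_L2 => //; exact: tst_pd.
move=> j psi tpsi; have tap := tstM (tst_smooth ta) tpsi.
have tpa : tst (fun x => psi x * pd j a x).
  by apply: tstM; [exact: tst_smooth|exact: tst_pd].
have := vG j _ tap; rewrite pdM; [|exact: tst_smooth|exact: tst_smooth] => h.
have L1 : Li mu (fun x => v x * (a x * pd j psi x)).
  by apply: L2M => //; apply: tst_L2; apply: tstM; [exact: tst_smooth|exact: tst_pd].
have L2' : Li mu (fun x => v x * (psi x * pd j a x)).
  by apply: L2M => //; exact: tst_L2.
have L3 : Li mu (fun x => G j x * (a x * psi x)) by apply: L2M => //; exact: tst_L2.
have h1 : \int[mu]_x (v x * (a x * pd j psi x)) + \int[mu]_x (v x * (psi x * pd j a x))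
   = - \int[mu]_x (G j x * (a x * psi x)).
  by rewrite -h -RID//; apply: eq_RI => x; rewrite mulrDr.
have -> : \int[mu]_x (a x * v x * pd j psi x) = \int[mu]_x (v x * (a x * pd j psi x)).
  by apply: eq_RI => x; ring.
have -> : \int[mu]_x ((a x * G j x + pd j a x * v x) * psi x) =
    \int[mu]_x (G j x * (a x * psi x)) + \int[mu]_x (v x * (psi x * pd j a x)).
  by rewrite -RID//; apply: eq_RI => x; ring.
by rewrite opprD -h1 addrK.
Qed.

Lemma N2_chi_cvg f : L2 mu f -> N2 mu (fun x => chi n x * f x - f x) @[n --> \oo] --> 0.
Proof.
move=> Lf; have mf := L2_measurable Lf.
have [//||||//] := @L2_dct _ _ _ mu (fun n x => chi n x * f x) f (fun x => `|f x|) _ mf.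
- by move=> n; exact: L2_measurable (tst_mul_L2 (tst_chi n) Lf).
- apply: ae_true => x /=; rewrite -[X in _ --> X](mul1r (f x)).
  by apply: cvgM; [exact: chi_cvg|exact: cvg_cst].
- exact: L2_norm.
- apply: ae_true => x n; have /andP[c0 c1] := chi_range n x.
  by rewrite normrM ger0_norm// ler_piMl.
Qed.

(** Cut off with [chi N], then mollify. The cut-off adds to the gradient the term v grad [chi N],
    which is O(1/N); the mollification scale is chosen after N, small enough for the function and
    its three derivatives at once. *)
Lemma H1_dense v G d : H1 v G -> 0 < d -> exists2 w, tst w &
  N2 mu (fun x => w x - v x) <= d /\ forall j, N2 mu (fun x => pd j w x - G j x) <= d.
Proof.
move=> vG d0; have [Lv LG _] := vG; have d2 : 0 < d / 4 by rewrite divr_gt0.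
have [Ca Ca0 hCa] := @chi_pd R.
have LcG j n : L2 mu (fun x => chi n x * G j x) by apply: tst_mul_L2 => //; exact: tst_chi.
have Lcv n : L2 mu (fun x => chi n x * v x) by apply: tst_mul_L2 => //; exact: tst_chi.
have Lpc j n : L2 mu (fun x => pd j (chi n) x * v x).
  by apply: tst_mul_L2 => //; apply: tst_pd; exact: tst_chi.
have near1 : \forall n \near \oo, [/\ N2 mu (fun x => chi n x * v x - v x) <= d / 4,
    forall j, N2 mu (fun x => chi n x * G j x - G j x) <= d / 4 &
    Ca / n.+1%:R * N2 mu v <= d / 4].
  have c1 := cvg0_le (N2_chi_cvg Lv) d2.
  have c2 : \forall n \near \oo, forall j, N2 mu (fun x => chi n x * G j x - G j x) <= d / 4.
    by apply: filter_forall => j; exact: cvg0_le (N2_chi_cvg (LG j)) d2.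
  have c3 : Ca / n.+1%:R * N2 mu v @[n --> \oo] --> 0.
    rewrite -[X in _ --> X](mul0r (N2 mu v)) -[X in X * _](mulr0 Ca).
    by apply: cvgM; [apply: cvgM; [exact: cvg_cst|exact: cvg_harmonic]|exact: cvg_cst].
  have {}c3 := cvg0_le c3 d2.
  by near=> n; split; near: n.
have [N _ /(_ N (leqnn N)) [hv hG hc]] := near1.
have vG' := H1_mul (tst_chi N) vG; set v' := fun x => _ * v x in vG'.
set G' := (fun j x => _ + _) in vG'; have [Lv' LG' _] := vG'.
have [e1 e10 he1] := conv_eta_cvg Lv' d2.
have hj j : exists2 e0, 0 < e0 & forall e, 0 < e <= e0 ->
  N2 mu (fun x => conv (eta e) (G' j) x - G' j x) <= d / 4 by exact: conv_eta_cvg.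
have [e20 e200 he20] := hj 0; have [e21 e210 he21] := hj 1.
have [e22 e220 he22] := hj 2%:R.
pose e := Num.min (Num.min e1 e20) (Num.min e21 e22).
have e0 : 0 < e by rewrite !lt_min e10 e200 e210.
have [h1 h2 h3 h4] : [/\ e <= e1, e <= e20, e <= e21 & e <= e22].
  by split; rewrite !ge_min lexx ?orbT.
have te := tst_eta e0.
have Li' : Li mu v'.
  by apply: L2M => //; apply: tst_L2; exact: tst_chi.
exists (conv (eta e) v').
  have [_ [r hr]] := @tst_chi R N.
  by apply: (@tst_conv R _ _ r) => // x /hr; rewrite /v' => ->; rewrite mul0r.
split.
  have -> : N2 mu (fun x => conv (eta e) v' x - v x) =
     N2 mu (fun x => (conv (eta e) v' x - v' x) + (v' x - v x)).
    by apply: eq_N2 => x; ring.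
  have [Lc _] := conv_eta_L2 e0 Lv'.
  apply: (le_trans (N2D (L2B Lc Lv') (L2B Lv' Lv))).
  have e1' : 0 < e <= e1 by rewrite e0 h1.
  by apply: (le_trans (lerD (he1 e e1') hv)); move: d0; clear; lra.
move=> j; rewrite pd_conv// (conv_pd j te vG').
have hG' : N2 mu (fun x => conv (eta e) (G' j) x - G' j x) <= d / 4.
  have : j = 0 \/ j = 1 \/ j = 2%:R.
    by case: j => -[|[|[|//]]] ?; [left|right;left|right;right]; apply: val_inj.
  by case=> [->|[->|->]]; [apply: he20|apply: he21|apply: he22]; rewrite e0 ?h2 ?h3 ?h4.
have -> : N2 mu (fun x => conv (eta e) (G' j) x - G j x) =
   N2 mu (fun x => (conv (eta e) (G' j) x - G' j x) + ((chi N x * G j x - G j x) + pd j (chi N) x * v x)).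
  by apply: eq_N2 => x; rewrite /G'; ring.
have [Lc _] := conv_eta_L2 e0 (LG' j).
have LB := L2B (LcG j N) (LG j).
apply: (le_trans (N2D (L2B Lc (LG' j)) (L2D LB (Lpc j N)))).
have := N2D LB (Lpc j N) => h5.
have h6 : N2 mu (fun x => pd j (chi N) x * v x) <= d / 4.
  rewrite (le_trans _ hc)// -[X in X * _]ger0_norm ?divr_ge0// -N2Z//.
  apply: N2_le => //; first exact: L2Z.
  by move=> x; rewrite [leLHS]normrM [leRHS]normrM ler_wpM2r// (le_trans (hCa j N x))// ler_norm.
by apply: (le_trans (lerD hG' (le_trans h5 (lerD (hG j) h6)))); move: d0; clear; lra.
Unshelve. all: by end_near. Qed.

(** The linear rate in e, with the gradient norm as constant, is what balances the flux near the
    blowup time. It passes from test functions to v by density, where an approximation error d'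
    costs (2 + 3 e) d'. *)
Lemma H1_conv_eta v G e : 0 < e -> H1 v G ->
  N2 mu (fun x => conv (eta e) v x - v x) <= e * \sum_(j < 3) N2 mu (G j).
Proof.
move=> e0 vG; have [Lv LG _] := vG; apply/ler_addgt0Pr => d d0.
have k0 : 0 < 2 + 3 * e by rewrite addr_gt0// mulr_gt0.
pose d' := d / (2 + 3 * e); have d'0 : 0 < d' by rewrite divr_gt0.
have [w tw [hw hGw]] := H1_dense vG d'0.
rewrite (le_trans (conv_eta_approx e0 Lv (tst_L2 tw)))//.
have h1 := conv_eta_tst e0 tw.
have h2 j : N2 mu (pd j w) <= N2 mu (G j) + d'.
  have -> : N2 mu (pd j w) = N2 mu (fun x => G j x + (pd j w x - G j x)).
    by apply: eq_N2 => x; ring.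
  have Lp := tst_L2 (tst_pd j tw).
  by rewrite (le_trans (N2D (LG j) (L2B Lp (LG j))))// lerD2l.
have h3 : \sum_(j < 3) N2 mu (pd j w) <= \sum_(j < 3) N2 mu (G j) + 3 * d'.
  apply: (le_trans (ler_sum _ (fun j _ => h2 j))).
  by rewrite big_split /= sumr_const card_ord mulr_natl.
have h4 := ler_wpM2l (ltW e0) h3.
have -> : d = 2 * d' + e * (3 * d') by rewrite /d'; field; rewrite gt_eqF.
apply: (le_trans (lerD (ler_wpM2l (ler0n _ 2) hw) (le_trans h1 h4))).
by rewrite mulrDr addrCA.
Qed.

End weak_derivatives.

(** * Hardy's inequality *)

Section smooth_inverse.
Context {R : realType} {V : normedModType R}.
Implicit Types f g : V -> R.

(** The quotients g / f^n with g smooth are closed under directional derivatives, with n raised by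
    one each time. *)
Lemma smoothV f : smooth f -> (forall x, f x != 0) -> smooth (fun x => (f x)^-1).
Proof.
move=> sf f0.
have dV x v : derivable (fun y => (f y)^-1) x v.
  by apply: derivableV => //; exact: smooth_derivable.
have dX n x v : derivable ((fun y => (f y)^-1) ^+ n) x v by exact: derivableX.
have XE n : (fun y => (f y)^-1) ^+ n = (fun y => (f y)^-1 ^+ n).
  by apply/funext => y; elim: n => [|n IH]; rewrite ?expr0// !exprS -IH.
have GE g n : (fun x => g x * (f x)^-1 ^+ n) = (fun x => g x * ((fun y => (f y)^-1) ^+ n) x).
  by rewrite XE.
apply: (@smooth_coind R V (fun h => exists g n, smooth g /\ h = fun x => g x * (f x)^-1 ^+ n)).
- move=> _ [g [n [sg ->]]] x; apply: cvgM; first exact: smooth_continuous.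
  apply: (@continuous_comp _ _ _ (fun y => (f y)^-1) (fun t : R => t ^+ n)).
    by apply: cvgV => //; exact: smooth_continuous.
  exact: exprn_continuous.
- move=> _ x v [g [n [sg ->]]]; rewrite GE.
  by apply: derivableM => //; exact: smooth_derivable.
- move=> _ v [g [n [sg ->]]].
  exists (fun x => 'D_v g x * f x + (- n%:R) * (g x * 'D_v f x)), n.+1; split.
    exact: (smoothD (smoothM (smooth_derive v sg) sf)
      (smoothZ (- n%:R) (smoothM sg (smooth_derive v sf)))).
  rewrite GE; apply/funext => x; rewrite (@deriveM _ _ g)//; last exact: smooth_derivable.
  rewrite deriveX// deriveV//; last exact: smooth_derivable.
  rewrite XE /GRing.scale /=.
  case: n => [|n]; rewrite ?mulr0n ?expr0 ?expr1 ?mul0r ?mulr0 ?add0r.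
    by rewrite mul1r oppr0 mul0r addr0 mulfK.
  rewrite /= -exprVn !exprS expr0 mulr1; move: ((f x)^-1 ^+ n) => p.
  move: (n.+1%:R : R) => N; field; exact: f0.
- by exists (fun=> 1), 1%N; split; [exact: smooth_cst|apply/funext => x; rewrite mul1r expr1].
Qed.

End smooth_inverse.

Section coordinates.
Context {R : realType}.
Implicit Types (x y : R3 R) (i j : 'I_3).

Lemma comp3_lin i (h : R) (x y : R3 R) : comp3 i (h *: x + y) = h * comp3 i x + comp3 i y.
Proof. by case: i => -[|[|[|//]]] ?. Qed.

Lemma comp3_evec i j : comp3 i (evec j : R3 R) = (i == j)%:R.
Proof. by case: i => -[|[|[|//]]] ?; case: j => -[|[|[|//]]] ?. Qed.

Lemma comp3_continuous i : continuous (@comp3 R i).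
Proof.
case: i => -[|[|[|//]]] ? x; rewrite /comp3 /tnth /=.
- by apply: cvg_comp; [exact: cvg_fst|exact: cvg_fst].
- by apply: cvg_comp; [exact: cvg_fst|exact: cvg_snd].
- exact: cvg_snd.
Qed.

Lemma smooth_id : smooth (fun t : R => t).
Proof.
apply: (@smooth_primitive R _ (fun=> 1)); last exact: smooth_cst.
Qed.

Lemma smooth_comp3 i : smooth (@comp3 R i).
Proof.
apply: (@smooth_affine R R (R3 R) (@comp3 R i) (@comp3 R i) _ _ (fun t => t) smooth_id).
- by move=> x w h; rewrite comp3_lin.
- exact: comp3_continuous.
Qed.

Lemma pd_comp3 i j : pd j (@comp3 R i) = fun=> (i == j)%:R.
Proof.
apply/funext => x; rewrite /pd.
have := @derive_affine R R (R3 R) (@comp3 R i) (@comp3 R i) _ (fun t => t) x (evec j).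
rewrite /comp => ->; last by move=> *; rewrite comp3_lin.
by rewrite comp3_evec; exact: derive_id.
Qed.

Definition nsq x : R := dot x x.

Lemma nsqE x : nsq x = \sum_(i < 3) comp3 i x ^+ 2.
Proof. by []. Qed.

Lemma nsq_ge0 x : 0 <= nsq x.
Proof. by apply: sumr_ge0 => i _; exact: sqr_ge0. Qed.

Lemma enorm_sqr x : enorm x ^+ 2 = nsq x.
Proof. by rewrite sqr_sqrtr// nsq_ge0. Qed.

Lemma smooth_nsq : smooth nsq.
Proof. by apply: smooth_sum => i; apply: smoothM; exact: smooth_comp3. Qed.

Lemma pd_nsq j : pd j nsq = fun x => 2 * comp3 j x.
Proof.
have sc i := smooth_comp3 i.
rewrite /nsq /dot pd_sum; last by move=> i; exact: smoothM.
apply/funext => x; rewrite (bigD1 j)//= big1 => [|i ij]; rewrite pdM// pd_comp3.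
  by rewrite eqxx mulr1 addr0; ring.
by rewrite (negPf ij) mulr0 addr0.
Qed.

End coordinates.

Section hardy.
Context {R : realType}.
Implicit Types (x y : R3 R) (v f g k psi : R3 R -> R) (d : R).
Local Notation mu := (leb3 R).

(* Integrate the divergence of [x / (|x|^2 + d)] against [v^2]. *)
Lemma hardy v d : 0 < d -> tst v ->
  \int[mu]_x (v x ^+ 2 / (nsq x + d)) <= 4 * \sum_(j < 3) \int[mu]_x (pd j v x ^+ 2).
Proof.
move=> d0 tv; have sv := tst_smooth tv.
have N0 x : 0 < nsq x + d by rewrite ltr_wpDl// nsq_ge0.
have sN : smooth (fun x => nsq x + d) by apply: smoothD; [exact: smooth_nsq|exact: smooth_cst].
pose q x := (nsq x + d)^-1.
have sq : smooth q by apply: smoothV => // x; rewrite gt_eqF.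
have qE x : (nsq x + d) * q x = 1 by rewrite divff// gt_eqF.
have q0 x : 0 < q x by rewrite invr_gt0.
have pq j : pd j q = fun x => - (q x ^+ 2 * (2 * comp3 j x)).
  apply/funext => x.
  have : pd j (fun x => (nsq x + d) * q x) = fun=> 0.
    by rewrite -(pd_cst j (1 : R)); congr pd; apply/funext.
  rewrite pdM// pdD; [|exact: smooth_nsq|exact: smooth_cst].
  rewrite pd_nsq pd_cst => /(congr1 (fun h => q x * h x)) /=.
  rewrite addr0 mulr0 mulrDr [q x * (_ * pd j q x)]mulrA [q x * (nsq x + d)]mulrC qE mul1r => /eqP.
  by rewrite addr_eq0 => /eqP ->; rewrite expr2 -!mulrA.
pose X j x := comp3 j x * q x.
have sX j : smooth (X j) by exact: (smoothM (smooth_comp3 j) sq).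
have pX j : pd j (X j) = fun x => q x - 2 * comp3 j x ^+ 2 * q x ^+ 2.
  rewrite (pdM j (smooth_comp3 j) sq).
  by rewrite pq pd_comp3; apply/funext => x; rewrite eqxx /= mulr1; move: (q x) (comp3 j x) => a c; ring.
have tv2 : tst (fun x => v x * v x) by exact: tstM.
have tq : tst (fun x => v x * v x * q x).
  have := tstM sq tv2; congr tst; apply/funext => x; exact: mulrC.
have LD j : Li mu (fun x => pd j v x ^+ 2) by apply: L2_sq; apply: tst_L2; exact: tst_pd.
have L j : Li mu (fun x => pd j (X j) x * (v x * v x)).
  exact: tst_Li (tstM (smooth_derive (evec j) (sX j)) tv2).
have key : \int[mu]_x (\sum_j (pd j (X j) x * (v x * v x))) <=
  \int[mu]_x (2^-1 * (v x * v x * q x) + \sum_j 2 * pd j v x ^+ 2).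
  have L' j : Li mu (fun x => - (X j x * pd j (fun y => v y * v y) x)).
    exact: LiN (tst_Li (tstM (sX j) (tst_pd j tv2))).
  have -> : \int[mu]_x (\sum_j (pd j (X j) x * (v x * v x))) =
      \int[mu]_x (\sum_j - (X j x * pd j (fun y => v y * v y) x)).
    rewrite !RI_sum//; apply: eq_bigr => j _; rewrite RIN; last first.
      exact: tst_Li (tstM (sX j) (tst_pd j tv2)).
    by rewrite (tst_ibp j (sX j) tv2) opprK.
  apply: RI_le.
  - exact: Li_sum.
  - apply: LiD; first by apply: LiZ; exact: tst_Li tq.
    by apply: Li_sum => j; exact: LiZ.
  move=> x; apply: (@le_trans _ _ (\sum_j (2^-1 * (v x * v x * X j x ^+ 2) + 2 * pd j v x ^+ 2))).
    apply: ler_sum => j _; rewrite pdM//.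
    by have := sqr_ge0 (v x * X j x + 2 * pd j v x); lra.
  rewrite big_split /= lerD2r -mulr_sumr ler_wpM2l// -mulr_sumr ler_wpM2l//.
    by rewrite -expr2 sqr_ge0.
  have -> : \sum_(i < 3) X i x ^+ 2 = nsq x * q x * q x.
    by rewrite nsqE !mulr_suml; apply: eq_bigr => i _; rewrite /X; ring.
  rewrite -[leRHS]mul1r ler_wpM2r ?(ltW (q0 x))//.
  by rewrite -(qE x) ler_wpM2r ?(ltW (q0 x))// lerDl ltW.
set A := \int[mu]_x (v x ^+ 2 / (nsq x + d)).
have AE : \int[mu]_x (v x * v x * q x) = A by apply: eq_RI => x; rewrite expr2.
have LDs : Li mu (fun x => \sum_j 2 * pd j v x ^+ 2) by apply: Li_sum => j; exact: LiZ.
(* The divergence of [X] is 3 q - 2 |x|^2 q^2 >= q because |x|^2 q <= 1. With [key], whose right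
   side is A / 2 plus twice the gradient integral, this reads A <= A / 2 + 2 D and gives the
   constant 4. *)
have key2 : A <= \int[mu]_x (\sum_j (pd j (X j) x * (v x * v x))).
  rewrite -AE; apply: RI_le; first exact: tst_Li tq.
    exact: Li_sum.
  move=> x; rewrite -mulr_suml mulrC ler_wpM2r -?expr2 ?sqr_ge0//.
  under eq_bigr do rewrite pX.
  rewrite big_split /= sumr_const card_ord sumrN -mulr_suml -mulr_sumr -nsqE.
  have : nsq x * q x <= 1 by rewrite -(qE x) ler_wpM2r ?(ltW (q0 x))// lerDl ltW.
  have := q0 x; move: (nsq x) (q x) => n p p0 np.
  have : n * p * p <= p by rewrite ler_piMl// ltW.
  rewrite expr2 -mulr_natr; lra.
move: (le_trans key2 key); rewrite RID//; last by apply: LiZ; exact: tst_Li tq.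
rewrite RIZ ?AE; last exact: tst_Li tq.
rewrite RI_sum; last by move=> j; exact: LiZ.
have -> : \sum_(i < 3) \int[mu]_x (2 * pd i v x ^+ 2) = 2 * \sum_(i < 3) \int[mu]_x (pd i v x ^+ 2).
  by rewrite mulr_sumr; apply: eq_bigr => j _; rewrite RIZ.
by clearbody A; move: (\sum_(i < 3) _) => b h; clear -h; lra.
Qed.

End hardy.

(** * Multipliers and the cancellation of the flux *)

Section fatou_real.
Context d (T : measurableType d) (R : realType) (mu : {measure set T -> \bar R}).
Implicit Types (f g : T -> R).

Lemma RI_fatou (f_ : nat -> T -> R) f C : (forall n, Li mu (f_ n)) ->
  measurable_fun setT f -> (forall n x, 0 <= f_ n x) ->
  (forall x, f_ ^~ x @ \oo --> f x) -> (forall n, \int[mu]_x f_ n x <= C) ->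
  Li mu f /\ \int[mu]_x f x <= C.
Proof.
move=> Lf mf f0 cf fC.
have f0x x : 0 <= f x by apply: (cvgr_to_ge (cf x)); exact: nearW.
have mE n : measurable_fun setT (fun x => (f_ n x)%:E).
  by apply/measurable_EFinP; exact: Li_measurable (Lf n).
have F := @fatou _ _ _ mu setT measurableT (fun n x => (f_ n x)%:E) mE
  (fun n x _ => f0 n x).
have le1 : (\int[mu]_x (f x)%:E <= C%:E)%E.
  have -> : (\int[mu]_x (f x)%:E = \int[mu]_x limn_einf (fun n => (f_ n x)%:E))%E.
    apply: eq_integral => x _.
    have c : (f_ n x)%:E @[n --> \oo] --> (f x)%:E by apply: cvg_EFin; [exact: nearW|exact: cf].
    by rewrite (cvg_limn_einf_sup c).1.
  apply: (le_trans F); rewrite limn_einf_lim; apply: lime_le; first exact: is_cvg_einfs.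
  apply: nearW => n; apply: (@le_trans _ _ (\int[mu]_x (f_ n x)%:E)%E).
    by apply: ereal_inf_lbound; exists n => /=.
  by rewrite (RI_E (Lf n)) lee_fin.
have Lif : Li mu f by apply: Li_ge0_lty => //; rewrite (le_lt_trans le1)// ltry.
by split => //; rewrite -lee_fin -RI_E.
Qed.

Lemma N2_le_ae f g : L2 mu f -> L2 mu g -> {ae mu, forall x, `|f x| <= `|g x|} ->
  N2 mu f <= N2 mu g.
Proof.
move=> Lf Lg fg; rewrite ler_sqrt; last by apply: RI_ge0 => x; exact: sqr_ge0.
apply: RI_le_ae; [exact: L2_sq|exact: L2_sq|].
apply: filterS fg => x h; rewrite -(real_normK (num_real (f x))) -(real_normK (num_real (g x))).
by rewrite ler_pXn2r ?nnegrE.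
Qed.

Lemma L2_le_ae g f : measurable_fun setT f -> {ae mu, forall x, `|f x| <= `|g x|} ->
  L2 mu g -> L2 mu f.
Proof.
move=> mf fg Lg; split => //; apply: (Li_le_ae _ _ (L2_sq Lg)).
  exact: measurable_funX.
apply: filterS fg => x h; rewrite normrX -(real_normK (num_real (g x))).
by rewrite ler_pXn2r ?nnegrE.
Qed.

End fatou_real.

Section sequences_real.
Context {R : realType}.

Lemma squeeze0 (u b : nat -> R) : (forall n, 0 <= u n <= b n) ->
  b n @[n --> \oo] --> 0 -> u n @[n --> \oo] --> 0.
Proof.
move=> ub cb; apply: (@squeeze_cvgr _ _ _ _ (fun=> 0) b) => //; last exact: cvg_cst.
by apply: nearW => n; exact: ub.
Qed.

Lemma sum3_sqr (a : 'I_3 -> R) : (forall j, 0 <= a j) ->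
  \sum_(j < 3) a j ^+ 2 <= (\sum_(j < 3) a j) ^+ 2.
Proof.
move=> a0; rewrite !sum3; move: (a0 0) (a0 1) (a0 2%:R).
move: (a 0) (a 1) (a 2%:R) => p q r p0 q0 r0.
by have := mulr_ge0 p0 q0; have := mulr_ge0 p0 r0; have := mulr_ge0 q0 r0; nra.
Qed.

Lemma cvg_sum3 (u : 'I_3 -> nat -> R) (l : 'I_3 -> R) :
  (forall j, u j n @[n --> \oo] --> l j) ->
  \sum_(j < 3) u j n @[n --> \oo] --> \sum_(j < 3) l j.
Proof.
move=> c; rewrite sum3.
rewrite (_ : (fun n => _) = (fun n => u 0 n + u 1 n + u 2%:R n)).
  by apply: cvgD; [apply: cvgD|]; exact: c.
by apply/funext => n; rewrite sum3.
Qed.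

End sequences_real.

Section multipliers.
Context {R : realType}.
Implicit Types (a u v w f g k psi : R3 R -> R) (G : 'I_3 -> R3 R -> R) (M d : R).
Local Notation mu := (leb3 R).

(** Multiplication by u maps H^1 to L^2 with norm at most M. It is stated on test functions, where a
    pointwise bound or Hardy's inequality verifies it; [mult_H1] extends it by density. *)
Definition mult M u := forall phi, tst phi ->
  N2 mu (fun x => u x * phi x) <= M * (N2 mu phi + \sum_(j < 3) N2 mu (pd j phi)).

Definition trunc (N : R) (t : R) : R := Num.max (- N) (Num.min t N).

Lemma trunc_le N t : 0 <= N -> `|trunc N t| <= N.
Proof.
move=> N0; rewrite ler_norml /trunc; apply/andP; split; first by rewrite le_max lexx.
by rewrite ge_max ge_min lexx orbT andbT; lra.
Qed.

Lemma trunc_le_norm N t : 0 <= N -> `|trunc N t| <= `|t|.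
Proof.
move=> N0; rewrite ler_norml /trunc; apply/andP; split.
  rewrite le_max le_min; apply/orP; right; apply/andP; split.
    by rewrite lerNl -normrN ler_norm.
  by rewrite (le_trans _ N0)// oppr_le0.
by rewrite ge_max ge_min ler_norm/= andbT (le_trans _ (normr_ge0 t))// oppr_le0.
Qed.

Lemma trunc_id N t : `|t| <= N -> trunc N t = t.
Proof.
rewrite ler_norml => /andP[h1 h2]; rewrite /trunc.
by rewrite (min_idPl h2) (max_idPr h1).
Qed.

Lemma measurable_trunc dT (T : measurableType dT) N (f : T -> R) :
  measurable_fun setT f -> measurable_fun setT (fun x => trunc N (f x)).
Proof.
by move=> mf; apply: measurable_maxr => //; apply: measurable_minr.
Qed.

(** The product u v is not known to be in L^2, and u times an approximation error of v is out of
    control. Truncating u at height n makes it bounded without enlarging |u w| for test functions w;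
    the bound is then independent of n, and Fatou's lemma removes the truncation. *)
Lemma mult_H1 M u v G : 0 <= M -> L2 mu u -> mult M u -> H1 v G ->
  L2 mu (fun x => u x * v x) /\
  N2 mu (fun x => u x * v x) <= M * (N2 mu v + \sum_(j < 3) N2 mu (G j)).
Proof.
move=> M0 Lu mu_ vG; have [Lv LG _] := vG.
have mu' := L2_measurable Lu; have mv := L2_measurable Lv.
set S := N2 mu v + _.
have LT n : L2 mu (fun x => trunc n%:R (u x) * v x).
  apply: (@L2_le _ _ R mu (fun x => n%:R * v x)); last exact: L2Z.
    by apply: measurable_funM => //; exact: measurable_trunc.
  by move=> x; rewrite !normrM ler_wpM2r// (ger0_norm (ler0n _ n)) trunc_le.
have bound n : N2 mu (fun x => trunc n%:R (u x) * v x) <= M * S.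
  apply/ler_addgt0Pr => e e0.
  have k0 : 0 < n%:R + M * 4 + 1 by rewrite ltr_wpDl// addr_ge0// mulr_ge0.
  (* An approximation error d enters as n d through the truncated factor and as 4 M d through the
     multiplier bound, once for v and three times for its derivatives. *)
  have d0 : 0 < e / (n%:R + M * 4 + 1) by rewrite divr_gt0.
  set d := e / _ in d0; have [w tw [hw hG]] := H1_dense vG d0.
  have Lw := tst_L2 tw; have mw := L2_measurable Lw.
  have LTw : L2 mu (fun x => trunc n%:R (u x) * w x).
    apply: (@L2_le _ _ R mu (fun x => n%:R * w x)); last exact: L2Z.
      by apply: measurable_funM => //; exact: measurable_trunc.
    by move=> x; rewrite !normrM ler_wpM2r// (ger0_norm (ler0n _ n)) trunc_le.
  have Luw : L2 mu (fun x => u x * w x).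
    have := tst_mul_L2 tw Lu; congr (L2 _ _); apply/funext => x; exact: mulrC.
  have LB := L2B LTw (LT n).
  have s1 : N2 mu (fun x => trunc n%:R (u x) * w x - trunc n%:R (u x) * v x) <= n%:R * d.
    apply: (@le_trans _ _ (N2 mu (fun x => n%:R * (w x - v x)))).
      apply: N2_le => //; first by apply: L2Z; exact: L2B.
      by move=> x; rewrite -mulrBr !normrM ler_wpM2r// (ger0_norm (ler0n _ n)) trunc_le.
    rewrite N2Z; last exact: L2B.
    by rewrite ger0_norm// ler_wpM2l.
  have s2 : N2 mu (fun x => trunc n%:R (u x) * w x) <= M * (S + 4 * d).
    apply: (@le_trans _ _ (N2 mu (fun x => u x * w x))).
      by apply: N2_le => // x; rewrite !normrM ler_wpM2r// trunc_le_norm.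
    apply: (le_trans (mu_ _ tw)); apply: ler_wpM2l => //.
    have t1 : N2 mu w <= N2 mu v + d.
      have -> : N2 mu w = N2 mu (fun x => v x + (w x - v x)) by apply: eq_N2 => x; ring.
      by apply: (le_trans (N2D Lv (L2B Lw Lv))); rewrite lerD2l.
    have t2 j : N2 mu (pd j w) <= N2 mu (G j) + d.
      have Lp := tst_L2 (tst_pd j tw).
      have -> : N2 mu (pd j w) = N2 mu (fun x => G j x + (pd j w x - G j x)).
        by apply: eq_N2 => x; ring.
      by apply: (le_trans (N2D (LG j) (L2B Lp (LG j)))); rewrite lerD2l.
    apply: (le_trans (lerD t1 (ler_sum _ (fun j _ => t2 j)))).
    rewrite big_split /= sumr_const card_ord /S.
    by rewrite -mulr_natl le_eqVlt; apply/orP; left; apply/eqP;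
      move: (N2 mu v) (\sum_(j < 3) _) => p q; ring.
  have -> : N2 mu (fun x => trunc n%:R (u x) * v x) = N2 mu (fun x =>
      trunc n%:R (u x) * w x - (trunc n%:R (u x) * w x - trunc n%:R (u x) * v x)).
    by apply: eq_N2 => x; ring.
  apply: (le_trans (N2B LTw LB)); apply: (le_trans (lerD s2 s1)).
  rewrite mulrDr -addrA lerD2l.
  have -> : e = (n%:R + M * 4 + 1) * d by rewrite /d mulrCA divff ?mulr1// gt_eqF.
  rewrite mulrA -mulrDl ler_wpM2r ?(ltW d0)//.
  by rewrite [M * 4 + _]addrC lerDl.
have S0 : 0 <= S by rewrite addr_ge0 ?N2_ge0// sumr_ge0// => j _; exact: N2_ge0.
have MS0 : 0 <= M * S by rewrite mulr_ge0.
have [L h] := @RI_fatou _ _ R mu (fun n x => (trunc n%:R (u x) * v x) ^+ 2)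
  (fun x => (u x * v x) ^+ 2) ((M * S) ^+ 2) (fun n => L2_sq (LT n))
  (measurable_funX 2 (measurable_funM mu' mv)) (fun n x => sqr_ge0 _)
  ltac:(by move=> x; apply: cvg_near_cst; exists (Num.bound `|u x|) => // n /= hn;
        rewrite trunc_id// (le_trans (ltW (archi_boundP (normr_ge0 (u x)))))// ler_nat)
  ltac:(by move=> n; rewrite -N2_sqr ler_pXn2r ?nnegrE ?N2_ge0).
split; first by split => //; exact: measurable_funM.
by rewrite -(@ler_pXn2r _ 2)// ?nnegrE ?N2_ge0// N2_sqr.
Qed.

Lemma H1B v w G F : H1 v G -> H1 w F -> H1 (fun x => v x - w x) (fun j x => G j x - F j x).
Proof.
move=> [Lv LG hG] [Lw LF hF]; split; first exact: L2B.
  by move=> j; exact: L2B.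
move=> j psi tpsi; have Lp := tst_L2 tpsi; have Lpd := tst_L2 (tst_pd j tpsi).
have -> : \int[mu]_x ((v x - w x) * pd j psi x) =
    \int[mu]_x (v x * pd j psi x) - \int[mu]_x (w x * pd j psi x).
  by rewrite -RIB; [apply: eq_RI => x; rewrite mulrBl|exact: L2M|exact: L2M].
have -> : \int[mu]_x ((G j x - F j x) * psi x) =
    \int[mu]_x (G j x * psi x) - \int[mu]_x (F j x * psi x).
  by rewrite -RIB; [apply: eq_RI => x; rewrite mulrBl|exact: L2M|exact: L2M].
by rewrite hG// hF// opprB opprK addrC.
Qed.

Lemma H1_sequence v G : H1 v G -> exists w_ : nat -> R3 R -> R,
  [/\ forall n, tst (w_ n), N2 mu (fun x => w_ n x - v x) @[n --> \oo] --> 0 &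
      forall j, N2 mu (fun x => pd j (w_ n) x - G j x) @[n --> \oo] --> 0].
Proof.
move=> vG.
have /choice [w_ hw] : forall n : nat, exists w, [/\ tst w,
    N2 mu (fun x => w x - v x) <= n.+1%:R^-1 &
    forall j, N2 mu (fun x => pd j w x - G j x) <= n.+1%:R^-1].
  move=> n; have n0 : 0 < n.+1%:R^-1 :> R by [].
  by have [w tw [h1 h2]] := H1_dense vG n0; exists w.
exists w_; split; first by move=> n; have [] := hw n.
  by apply: (squeeze0 _ cvg_harmonic) => n; rewrite N2_ge0; have [_ + _] := hw n.
by move=> j; apply: (squeeze0 _ cvg_harmonic) => n; rewrite N2_ge0; have [_ _ ->] := hw n.
Qed.

Lemma mult_cvg M u v G (w_ : nat -> R3 R -> R) : 0 <= M -> L2 mu u -> mult M u ->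
  H1 v G -> (forall n, tst (w_ n)) -> N2 mu (fun x => w_ n x - v x) @[n --> \oo] --> 0 ->
  (forall j, N2 mu (fun x => pd j (w_ n) x - G j x) @[n --> \oo] --> 0) ->
  N2 mu (fun x => u x * w_ n x - u x * v x) @[n --> \oo] --> 0.
Proof.
move=> M0 Lu mu_ vG tw cw cG.
have b n : N2 mu (fun x => u x * w_ n x - u x * v x) <= M *
    (N2 mu (fun x => w_ n x - v x) + \sum_(j < 3) N2 mu (fun x => pd j (w_ n) x - G j x)).
  have [_] := mult_H1 M0 Lu mu_ (H1B (tst_H1 (tw n)) vG).
  apply: le_trans; rewrite le_eqVlt; apply/orP; left; apply/eqP.
  by apply: eq_N2 => x; rewrite mulrBr.
have c0 : M * (N2 mu (fun x => w_ n x - v x) + \sum_(j < 3) N2 mu (fun x => pd j (w_ n) x - G j x))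
    @[n --> \oo] --> 0.
  have c1 := cvg_sum3 cG; rewrite big1// in c1.
  rewrite -[X in _ --> X](mulr0 M).
  apply: cvgM; first exact: cvg_cst.
  by rewrite -[X in _ --> X](addr0 0); exact: cvgD.
by apply: (squeeze0 _ c0) => n; rewrite N2_ge0 b.
Qed.

(** Formally the sum is the integral of u . grad(|u|^2 / 2), but |u|^2 is no test function. The
    divergence is tested with the sum of the w_i^2, where the test functions w_i tend to u_i in H^1.
    The multiplier property makes u_j w_i tend to u_j u_i in L^2, and this is what lets each term
    converge. *)
Lemma cancellation M (u : 'I_3 -> R3 R -> R) (G : 'I_3 -> 'I_3 -> R3 R -> R) : 0 <= M ->
  (forall j, mult M (u j)) -> (forall i, H1 (u i) (G i)) ->
  (forall psi, tst psi -> \int[mu]_x (\sum_(i < 3) u i x * pd i psi x) = 0) ->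
  (forall i j, L2 mu (fun x => u i x * u j x)) /\
  \sum_(i < 3) \sum_(j < 3) \int[mu]_x (G i j x * (u i x * u j x)) = 0.
Proof.
move=> M0 mu_ uG udiv.
have Lu i : L2 mu (u i) by have [] := uG i.
have LG i j : L2 mu (G i j) by have [_ + _] := uG i.
have Luu i j : L2 mu (fun x => u i x * u j x) by have [] := mult_H1 M0 (Lu i) (mu_ i) (uG j).
split => //.
have /choice [w_ hw] := fun i => H1_sequence (uG i).
have tw i n : tst (w_ i n) by have [] := hw i.
have cw i : N2 mu (fun x => w_ i n x - u i x) @[n --> \oo] --> 0 by have [] := hw i.
have cG i j : N2 mu (fun x => pd j (w_ i n) x - G i j x) @[n --> \oo] --> 0.
  by have [_ _] := hw i.
have Luw i j n : L2 mu (fun x => u j x * w_ i n x).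
  have := tst_mul_L2 (tw i n) (Lu j); congr (L2 _ _); apply/funext => x; exact: mulrC.
have c i j : \int[mu]_x (pd j (w_ i n) x * (u j x * w_ i n x)) @[n --> \oo] -->
    \int[mu]_x (G i j x * (u j x * u i x)).
  apply: (@cvg_RI _ _ R mu (fun n x => pd j (w_ i n) x * (u j x * w_ i n x))
    (fun x => G i j x * (u j x * u i x))).
  - by move=> n; apply: L2M; [apply: tst_L2; exact: tst_pd|exact: Luw].
  - exact: L2M.
  exact: (@cvg_L2M _ _ R mu (fun n => pd j (w_ i n)) (fun n x => u j x * w_ i n x)
    (G i j) (fun x => u j x * u i x) (fun n => tst_L2 (tst_pd j (tw i n))) (Luw i j)
    (LG i j) (Luu j i) (cG i j) (mult_cvg M0 (Lu j) (mu_ j) (uG i) (tw i) (cw i) (cG i))).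
have z n : \sum_(i < 3) \sum_(j < 3) \int[mu]_x (pd j (w_ i n) x * (u j x * w_ i n x)) = 0.
  have tpsi : tst (fun x => \sum_(i < 3) w_ i n x * w_ i n x).
    by apply: tst_sum => i; apply: tstM => //; exact: tst_smooth.
  have LL i j : Li mu (fun x => pd j (w_ i n) x * (u j x * w_ i n x)).
    by apply: L2M; [apply: tst_L2; exact: tst_pd|exact: Luw].
  have := udiv _ tpsi.
  have -> : \int[mu]_x (\sum_(i < 3) u i x * pd i (fun x => \sum_(i < 3) w_ i n x * w_ i n x) x) =
     \int[mu]_x (2 * \sum_(i < 3) \sum_(j < 3) pd j (w_ i n) x * (u j x * w_ i n x)).
    apply: eq_RI => x; rewrite exchange_big /= mulr_sumr; apply: eq_bigr => j _.
    rewrite pd_sum; last by move=> i; apply: smoothM; exact: tst_smooth.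
    rewrite !mulr_sumr; apply: eq_bigr => i _; rewrite pdM; [|exact: tst_smooth|exact: tst_smooth].
    by move: (u j x) (w_ i n x) (pd j (w_ i n) x) => p q r; ring.
  have Ls i : Li mu (fun x => \sum_(j < 3) pd j (w_ i n) x * (u j x * w_ i n x)) by exact: Li_sum.
  rewrite RIZ; last exact: Li_sum.
  rewrite RI_sum//; under eq_bigr do rewrite RI_sum//.
  by move/eqP; rewrite mulf_eq0 pnatr_eq0 /= => /eqP.
have C : \sum_(i < 3) \sum_(j < 3) \int[mu]_x (pd j (w_ i n) x * (u j x * w_ i n x)) @[n --> \oo]
    --> \sum_(i < 3) \sum_(j < 3) \int[mu]_x (G i j x * (u j x * u i x)).
  by apply: cvg_sum3 => i; apply: cvg_sum3 => j; exact: c.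
transitivity (\sum_(i < 3) \sum_(j < 3) \int[mu]_x (G i j x * (u j x * u i x))).
  by apply: eq_bigr => i _; apply: eq_bigr => j _; apply: eq_RI => x; rewrite [u i x * _]mulrC.
rewrite -(cvg_lim _ C)// (_ : (fun n => _) = fun=> 0); first exact: lim_cst.
by apply/funext => n; exact: z.
Qed.

Lemma mult_bounded B u : 0 <= B -> L2 mu u -> {ae mu, forall x, `|u x| <= B} -> mult B u.
Proof.
move=> B0 Lu uB phi tphi; have Lp := tst_L2 tphi.
have Lup : L2 mu (fun x => u x * phi x).
  have := tst_mul_L2 tphi Lu; congr (L2 _ _); apply/funext => x; exact: mulrC.
apply: (@le_trans _ _ (N2 mu (fun x => B * phi x))).
  apply: N2_le_ae => //; first exact: L2Z.
  by apply: (ae_imp uB) => x h; rewrite !normrM ler_wpM2r// (ger0_norm B0).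
rewrite N2Z// ger0_norm// ler_wpM2l// lerDl.
by apply: sumr_ge0 => j _; exact: N2_ge0.
Qed.

Lemma ae_neq0 : {ae mu, forall x : R3 R, x != 0}.
Proof.
exists (cube 0); split; first exact: measurable_cube.
  by rewrite leb3_cube// mulr0 expr0n.
by move=> x /= /negP; rewrite negbK => /eqP ->; rewrite /cube /= normr0.
Qed.

(** The bound on u gives (u phi)^2 <= C^2 phi^2 / |x|^2. Since [hardy] has |x|^2 + d in the
    denominator, the left side is multiplied by |x|^2 / (|x|^2 + d), and d tends to 0 by dominated
    convergence. The factor 2 is the square root of Hardy's constant 4. *)
Lemma mult_hardy C u : 0 <= C -> L2 mu u ->
  {ae mu, forall x : R3 R, x != 0 -> `|u x| <= C / enorm x} -> mult (2 * C) u.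
Proof.
move=> C0 Lu uC phi tphi; have Lp := tst_L2 tphi.
have Lup : L2 mu (fun x => u x * phi x).
  have := tst_mul_L2 tphi Lu; congr (L2 _ _); apply/funext => x; exact: mulrC.
pose D := \sum_(j < 3) \int[mu]_x (pd j phi x ^+ 2).
have D0 : 0 <= D by apply: sumr_ge0 => j _; apply: RI_ge0 => x; exact: sqr_ge0.
have nsq_gt0 x : x != 0 :> R3 R -> 0 < nsq x.
  move=> x0; rewrite lt_neqAle nsq_ge0 andbT eq_sym; apply: contra x0.
  rewrite nsqE psumr_eq0 => [/allP h|i _]; last exact: sqr_ge0.
  have c i : comp3 i x = 0 by apply/eqP; have := h i (mem_index_enum i); rewrite sqrf_eq0.
  have := evec_decomp x; have := c 0; have := c 1; have := c 2%:R.
  rewrite /comp3 /tnth /= => -> -> -> ->; rewrite !scale0r !addr0.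
  by [].
have mn : measurable_fun setT (@nsq R) by apply: continuous_measurable3; apply: smooth_continuous; exact: smooth_nsq.
pose dn (n : nat) : R := n.+1%:R^-1.
have dn0 n : 0 < dn n by rewrite /dn invr_gt0.
have N0 n x : 0 < nsq x + dn n by rewrite ltr_wpDl// nsq_ge0.
have mF n : measurable_fun setT (fun x => (u x * phi x) ^+ 2 * (nsq x / (nsq x + dn n))).
  apply: measurable_funM; first by apply: measurable_funX; case: Lup.
  apply: measurable_funM => //; apply: continuous_measurable3 => x.
  apply: cvgV; first by rewrite gt_eqF.
  by apply: cvgD; [apply: smooth_continuous; exact: smooth_nsq|exact: cvg_cst].
have F1 n x : 0 <= nsq x / (nsq x + dn n) <= 1.
  by rewrite divr_ge0 ?nsq_ge0 ?(ltW (N0 n x))//= ler_pdivrMr// mul1r lerDl ltW.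
have bF n : \int[mu]_x ((u x * phi x) ^+ 2 * (nsq x / (nsq x + dn n))) <= C ^+ 2 * (4 * D).
  have LF : Li mu (fun x => (u x * phi x) ^+ 2 * (nsq x / (nsq x + dn n))).
    apply: (@Li_le _ _ R mu (fun x => (u x * phi x) ^+ 2)); [exact: mF| |exact: L2_sq].
    move=> x; have /andP[? ?] := F1 n x.
    by rewrite normrM !ger0_norm ?sqr_ge0// ler_piMr ?sqr_ge0.
  have LH : Li mu (fun x => phi x ^+ 2 / (nsq x + dn n)).
    apply: (@Li_le _ _ R mu (fun x => (dn n)^-1 * phi x ^+ 2)).
    - apply: measurable_funM; first by apply: measurable_funX; case: Lp.
      apply: continuous_measurable3 => x.
      apply: cvgV; first by rewrite gt_eqF.
      by apply: cvgD; [apply: smooth_continuous; exact: smooth_nsq|exact: cvg_cst].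
    - move=> x; rewrite ger0_norm; last by rewrite divr_ge0 ?sqr_ge0// ltW.
      by rewrite mulrC ler_wpM2r ?sqr_ge0// lef_pV2 ?posrE// lerDr nsq_ge0.
    - by apply: LiZ; exact: L2_sq.
  apply: (le_trans _ (ler_wpM2l (sqr_ge0 C) (hardy (dn0 n) tphi))).
  rewrite -RIZ//; apply: RI_le_ae => //; first exact: LiZ.
  apply: (ae_imp2 uC ae_neq0) => x /= h x0; have {}h := h x0.
  have e0 : 0 < enorm x by rewrite sqrtr_gt0 nsq_gt0.
  have h2 : u x ^+ 2 * nsq x <= C ^+ 2.
    rewrite -(real_normK (num_real (u x))) -enorm_sqr -exprMn ler_pXn2r ?nnegrE ?mulr_ge0//.
      by rewrite -ler_pdivlMr.
    exact: ltW.
  have -> : (u x * phi x) ^+ 2 * (nsq x / (nsq x + dn n)) =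
    (u x ^+ 2 * nsq x) * (phi x ^+ 2 / (nsq x + dn n)).
    by rewrite exprMn; move: ((nsq x + dn n)^-1) => p; ring.
  by rewrite ler_wpM2r// divr_ge0 ?sqr_ge0// ltW.
have [_ cv] := @Li_dct _ _ _ mu (fun n x => (u x * phi x) ^+ 2 * (nsq x / (nsq x + dn n)))
  (fun x => (u x * phi x) ^+ 2) (fun x => (u x * phi x) ^+ 2) mF
  (measurable_funX 2 (L2_measurable Lup))
  ltac:(apply: (ae_imp ae_neq0) => x x0 /=; rewrite -[X in _ --> X]mulr1;
        apply: cvgM; [exact: cvg_cst|]; rewrite -(divff (lt0r_neq0 (nsq_gt0 x x0)));
        apply: cvgM; [exact: cvg_cst|]; apply: cvgV; [exact: lt0r_neq0 (nsq_gt0 x x0)|];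
        rewrite -[X in _ --> X]addr0; apply: cvgD; [exact: cvg_cst|exact: cvg_harmonic])
  (L2_sq Lup)
  ltac:(apply: ae_true => x n; have /andP[? ?] := F1 n x;
        rewrite normrM !ger0_norm ?sqr_ge0// ler_piMr ?sqr_ge0//).
have fin : \int[mu]_x ((u x * phi x) ^+ 2) <= C ^+ 2 * (4 * D).
  by apply: (cvgr_to_le cv); exact: nearW.
have S0 : 0 <= \sum_(j < 3) N2 mu (pd j phi) by apply: sumr_ge0 => j _; exact: N2_ge0.
apply: (@le_trans _ _ (2 * C * \sum_(j < 3) N2 mu (pd j phi))); last first.
  by rewrite ler_wpM2l ?mulr_ge0// lerDr N2_ge0.
rewrite -(@ler_pXn2r _ 2)// ?nnegrE ?N2_ge0 ?mulr_ge0// N2_sqr (le_trans fin)//.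
have -> : C ^+ 2 * (4 * D) = (2 * C) ^+ 2 * D by ring.
rewrite [leRHS]exprMn; apply: ler_wpM2l; first exact: sqr_ge0.
have -> : D = \sum_(j < 3) N2 mu (pd j phi) ^+ 2 by apply: eq_bigr => j _; rewrite N2_sqr.
by apply: sum3_sqr => j; exact: N2_ge0.
Qed.

End multipliers.

(** * Riesz transforms and the pressure *)

Section measurable_inverse.
Context d (T : measurableType d) (R : realType).
Implicit Types f : T -> R.

Lemma measurable_cvg (f_ : nat -> T -> R) f : (forall n, measurable_fun setT (f_ n)) ->
  (forall x, f_ ^~ x @ \oo --> f x) -> measurable_fun setT f.
Proof.
move=> mf cf; apply/measurable_EFinP.
apply: (emeasurable_fun_cvg (fun n x => (f_ n x)%:E)).
  by move=> n; apply/measurable_EFinP; exact: mf.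
by move=> x _; apply: cvg_EFin; [exact: nearW|exact: cf].
Qed.

(** Inversion is discontinuous at 0, where its value is 0. The continuous functions t / (t^2 + 1/n)
    converge to it at every point, including 0. *)
Lemma measurable_inv f : measurable_fun setT f -> measurable_fun setT (fun x => (f x)^-1).
Proof.
move=> mf; apply: (@measurable_cvg (fun n x => f x * (f x ^+ 2 + n.+1%:R^-1)^-1)).
  move=> n; apply: (@measurableT_comp _ _ _ _ _ _ (fun t : R => t * (t ^+ 2 + n.+1%:R^-1)^-1)) => //.
  apply: continuous_measurable_fun => t; apply: cvgM; first exact: cvg_id.
  apply: cvgV; first by rewrite gt_eqF// ltr_wpDl ?sqr_ge0.
  by apply: cvgD; [exact: exprn_continuous|exact: cvg_cst].
move=> x; have [f0|f0] := eqVneq (f x) 0.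
  by rewrite f0 invr0; under eq_fun do rewrite mul0r; exact: cvg_cst.
have -> : (f x)^-1 = f x * (f x ^+ 2 + 0)^-1 by rewrite addr0; field.
apply: cvgM; first exact: cvg_cst.
apply: cvgV; first by rewrite addr0 sqrf_eq0.
by apply: cvgD; [exact: cvg_cst|exact: cvg_harmonic].
Qed.

End measurable_inverse.

(** * Integrability of inverse powers of the norm *)

Section inverse_powers.
Context {R : realType}.
Implicit Types (x y z w : R3 R) (r e : R) (m : nat).
Local Notation mu := (leb3 R).
Local Notation M := (measurableTypeR R).

(* The sup norm, with the value 0 at [z = 0]. *)
Definition ip m z : R := `|z|^-1 ^+ m.
Definition inb r z : R := (`|z| < r)%R%:R.
Definition near_ip m r z : R := inb r z * ip m z.
Definition far_ip m r z : R := (1 - inb r z) * ip m z.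

Lemma inbE r : inb r = \1_(ball (0 : R3 R) r).
Proof.
apply/funext => z; rewrite indicE /inb; congr (nat_of_bool _)%:R.
by apply/idP/idP; rewrite inE -ball_normE /= sub0r normrN.
Qed.

Lemma measurable_inb r : @measurable_fun _ _ (M * M * M)%type R setT (inb r).
Proof. rewrite inbE; apply: measurable_indic; exact: measurable_ball3. Qed.

Lemma measurable_ip m : @measurable_fun _ _ (M * M * M)%type R setT (ip m).
Proof.
apply: measurable_funX; apply: measurable_inv.
exact: (@continuous_measurable3 R (fun z => `|z|) (@norm_continuous _ _)).
Qed.

Lemma measurable_near m r : @measurable_fun _ _ (M * M * M)%type R setT (near_ip m r).
Proof. by apply: measurable_funM; [exact: measurable_inb|exact: measurable_ip]. Qed.

Lemma measurable_far m r : @measurable_fun _ _ (M * M * M)%type R setT (far_ip m r).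
Proof.
apply: measurable_funM; last exact: measurable_ip.
by apply: measurable_funB => //; exact: measurable_inb.
Qed.

Lemma ip_ge0 m z : 0 <= ip m z.
Proof. by rewrite exprn_ge0// invr_ge0. Qed.

Lemma inb_range r z : 0 <= inb r z <= 1.
Proof. by rewrite /inb; case: (_ < _); rewrite /= ?lexx ler01. Qed.

Lemma near_ge0 m r z : 0 <= near_ip m r z.
Proof. by rewrite mulr_ge0 ?ip_ge0//; have /andP[] := inb_range r z. Qed.

Lemma far_ge0 m r z : 0 <= far_ip m r z.
Proof. by rewrite mulr_ge0 ?ip_ge0// subr_ge0; have /andP[] := inb_range r z. Qed.

Lemma ip_scale m (c : R) z : 0 < c -> ip m (c *: z) = c^-1 ^+ m * ip m z.
Proof. by move=> c0; rewrite /ip normrZ gtr0_norm// invfM exprMn. Qed.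

Lemma inb_scale r (c : R) z : 0 < c -> inb r (c *: z) = inb (r / c) z.
Proof. by move=> c0; rewrite /inb normrZ gtr0_norm// ltr_pdivlMr// mulrC. Qed.

Lemma Li_inb r : Li mu (inb r).
Proof.
apply: (@Li_le _ _ R mu (\1_(cube r))); [exact: measurable_inb| |exact: Li_cube].
move=> z; rewrite indicE /inb; case: ltP => h; last by rewrite normr0.
by rewrite normr1 mem_set//; exact: ltW.
Qed.

Lemma RI_cube r : 0 <= r -> \int[mu]_x \1_(cube r) x = (2 * r) ^+ 3.
Proof.
move=> r0; apply: EFin_inj; rewrite -leb3_cube// -RI_E; last exact: Li_cube.
by rewrite integral_indic ?setIT//; exact: measurable_cube.
Qed.

(* Self-similarity: rescaling by 1/2 bounds the truncated integral A by
   32 + A / 2. *)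
Lemma Li_near1 : Li mu (near_ip 2 1) /\ \int[mu]_x near_ip 2 1 x <= 64.
Proof.
(* Truncation at height n makes the integral finite, so that half of it may be absorbed into the
   left side; Fatou's lemma then lets n tend to infinity. *)
pose f (n : nat) z := inb 1 z * Num.min (ip 2 z) n%:R.
have m0 n z : 0 <= Num.min (ip 2 z) n%:R by rewrite le_min ip_ge0 ler0n.
have f0 n z : 0 <= f n z.
  by rewrite mulr_ge0//; have /andP[] := inb_range 1 z.
have mm n : @measurable_fun _ _ (M * M * M)%type R setT (fun z => Num.min (ip 2 z) n%:R).
  by apply: measurable_minr => //; exact: measurable_ip.
have mf n : @measurable_fun _ _ (M * M * M)%type R setT (f n).
  by apply: measurable_funM; [exact: measurable_inb|exact: mm].
have Lf n : Li mu (f n).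
  apply: (@Li_le _ _ R mu (fun z => n%:R * inb 1 z)); [exact: mf| |by apply: LiZ; exact: Li_inb].
  move=> z; rewrite ger0_norm// mulrC; have /andP[? ?] := inb_range 1 z.
  by apply: ler_wpM2l => //; rewrite ge_min lexx orbT.
pose h n z := inb 2^-1 z * Num.min (ip 2 z) n%:R.
have h0 n z : 0 <= h n z.
  by rewrite mulr_ge0//; have /andP[] := inb_range 2^-1 z.
have hf n z : h n z <= f n z.
  apply: ler_wpM2r => //; rewrite /inb; case: ltP => //= a.
  by rewrite (lt_trans a)// invf_lt1// ltr1n.
have Lh n : Li mu (h n).
  apply: (@Li_le _ _ R mu (f n)) => //; last by move=> z; rewrite ger0_norm.
  by apply: measurable_funM; [exact: measurable_inb|exact: mm].
have hE n : \int[mu]_z h n z <= 2^-1 * \int[mu]_z f n z.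
  have c0 : 0 < 2^-1 :> R by [].
  rewrite (RI_affine_ge0 0 (lt0r_neq0 c0) (Lh n) (h0 n)) (gtr0_norm c0).
  have -> : 2^-1 * \int[mu]_z f n z = 2^-1 ^+ 3 * \int[mu]_z (4 * f n z).
    by rewrite RIZ//; move: (\int[mu]_z f n z) => A; field.
  rewrite ler_wpM2l ?exprn_ge0 ?(ltW c0)//; apply: RI_le.
  - exact: (Li_affine 0 (lt0r_neq0 c0) (Lh n)).
  - exact: LiZ.
  move=> z; rewrite addr0 /h /f inb_scale// divff// mulrCA.
  have /andP[i0 _] := inb_range 1 z; apply: ler_wpM2l => //.
  rewrite ip_scale// invrK; have -> : 2 ^+ 2 = 4 :> R by ring.
  rewrite ge_min; have [a|a] := leP (ip 2 z) n%:R; first by rewrite lexx.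
  by apply/orP; right; rewrite ler_peMl// ler1n.
have bound n : \int[mu]_z f n z <= 64.
  have : \int[mu]_z f n z <= \int[mu]_z (4 * \1_(cube 1) z + h n z).
    apply: RI_le => //; first by apply: LiD => //; apply: LiZ; exact: Li_cube.
    move=> z; rewrite /f /h indicE /inb; have [a|a] := ltP `|z| 2^-1.
      rewrite mem_set; last by rewrite /cube /= (le_trans (ltW a))// invf_le1// ler1n.
      by rewrite (lt_trans a) ?invf_lt1 ?ltr1n//= mulr1 lerDr.
    have [b|b] := ltP `|z| 1; last by rewrite !mul0r addr0 mulr_ge0.
    rewrite mem_set; last exact: ltW.
    rewrite mul1r mul0r addr0 mulr1 ge_min; apply/orP; left; rewrite /ip.
    have -> : 4 = 2 ^+ 2 :> R by ring.
    by rewrite ler_pXn2r ?nnegrE ?invr_ge0// invf_ple ?posrE// (lt_le_trans _ a).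
  rewrite RID//; last by apply: LiZ; exact: Li_cube.
  rewrite RIZ ?RI_cube//; last exact: Li_cube.
  by move: (hE n); move: (\int[mu]_z f n z) (\int[mu]_z h n z) => A B; clear; lra.
have [L b] := @RI_fatou _ _ R mu f (near_ip 2 1) 64 Lf (measurable_near 2 1) f0
  ltac:(move=> z; apply: cvgM; [exact: cvg_cst|apply: cvg_near_cst;
    exists (Num.bound (ip 2 z)) => // n /= hn; apply/min_idPl;
    rewrite (le_trans (ltW (archi_boundP (ip_ge0 2 z))))// ler_nat//]) bound.
by [].
Qed.

(** The mirror image at infinity: rescaling by 2 multiplies the integral by 2^(3 - m) <= 1/2, and
    the shell 1 <= |z| < 2 lies in a cube of volume 64 where the integrand is at most 1. Hence A <=
    64 + A / 2, applied to the integral over |z| < n, which is finite. *)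
Lemma Li_far1 m : (4 <= m)%N -> Li mu (far_ip m 1) /\ \int[mu]_x far_ip m 1 x <= 128.
Proof.
move=> m4.
pose f (n : nat) z := inb n%:R z * far_ip m 1 z.
have f0 n z : 0 <= f n z.
  by rewrite mulr_ge0 ?far_ge0//; have /andP[] := inb_range n%:R z.
have far_le1 r z : 1 <= r -> far_ip m r z <= 1.
  move=> r1; rewrite /far_ip /inb; case: ltP => a; first by rewrite subrr mul0r ler01.
  rewrite subr0 mul1r /ip exprn_ile1 ?invr_ge0//.
  by rewrite invf_le1 ?(le_trans r1 a)// (lt_le_trans _ (le_trans r1 a)).
have mf n : @measurable_fun _ _ (M * M * M)%type R setT (f n).
  by apply: measurable_funM; [exact: measurable_inb|exact: measurable_far].
have Lf n : Li mu (f n).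
  apply: (@Li_le _ _ R mu (fun z => inb n%:R z)); [exact: mf| |exact: Li_inb].
  move=> z; rewrite ger0_norm//; have /andP[? ?] := inb_range n%:R z.
  by rewrite ler_piMr// far_le1.
pose h n z := inb n%:R z * far_ip m 2 z.
have h0 n z : 0 <= h n z.
  by rewrite mulr_ge0 ?far_ge0//; have /andP[] := inb_range n%:R z.
have hf n z : h n z <= f n z.
  have /andP[? ?] := inb_range n%:R z; apply: ler_wpM2l => //.
  rewrite ler_wpM2r ?ip_ge0// lerD2l lerN2 /inb; case: ltP => //= a.
  by rewrite (lt_trans a)// ltr1n.
have Lh n : Li mu (h n).
  apply: (@Li_le _ _ R mu (f n)) => //; last by move=> z; rewrite ger0_norm.
  by apply: measurable_funM; [exact: measurable_inb|exact: measurable_far].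
have hE n : \int[mu]_z h n z <= 2^-1 * \int[mu]_z f n z.
  have c0 : 0 < 2 :> R by [].
  rewrite (RI_affine_ge0 0 (lt0r_neq0 c0) (Lh n) (h0 n)) (gtr0_norm c0).
  have -> : 2^-1 * \int[mu]_z f n z = 2 ^+ 3 * \int[mu]_z (2^-1 ^+ 4 * f n z).
    by rewrite RIZ//; move: (\int[mu]_z f n z) => A; field.
  rewrite ler_wpM2l//; apply: RI_le.
  - exact: (Li_affine 0 (lt0r_neq0 c0) (Lh n)).
  - exact: LiZ.
  move=> z; rewrite addr0 /h /f /far_ip !inb_scale// divff// ip_scale//.
  have -> : inb (n%:R / 2) z * ((1 - inb 1 z) * (2^-1 ^+ m * ip m z)) =
    inb (n%:R / 2) z * ((1 - inb 1 z) * ip m z) * 2^-1 ^+ m by ring.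
  rewrite [leRHS]mulrC; have F := far_ge0 m 1 z; rewrite /far_ip in F.
  have /andP[? _] := inb_range (n%:R / 2) z; have /andP[? _] := inb_range n%:R z.
  apply: ler_pM; rewrite ?exprn_ge0 ?invr_ge0//; first exact: mulr_ge0.
    apply: ler_wpM2r => //; rewrite /inb; case: ltP => //= a.
    by rewrite (lt_le_trans a)// ler_pdivrMr// ler_peMr// ler1n.
  by apply: ler_wiXn2l => //; rewrite ?invr_ge0// invf_le1// ler1n.
have bound n : \int[mu]_z f n z <= 128.
  have : \int[mu]_z f n z <= \int[mu]_z (\1_(cube 2) z + h n z).
    apply: RI_le => //; first by apply: LiD => //; exact: Li_cube.
    move=> z; have [a|a] := ltP `|z| 2.
      rewrite indicE mem_set; last exact: ltW.
      have /andP[? ?] := inb_range n%:R z.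
      rewrite (@le_trans _ _ 1) ?lerDl// /f mulr_ile1 ?far_ge0//; exact: far_le1.
    rewrite (@le_trans _ _ (h n z)) ?lerDr// /h /f /far_ip /inb.
    by rewrite [`|z| < 2]ltNge a /= [`|z| < 1]ltNge (le_trans _ a)//= ler1n.
  rewrite RID//; last exact: Li_cube.
  rewrite RI_cube//.
  by move: (hE n); move: (\int[mu]_z f n z) (\int[mu]_z h n z) => A B; clear; lra.
have [L b] := @RI_fatou _ _ R mu f (far_ip m 1) 128 Lf (measurable_far m 1) f0
  ltac:(move=> z; rewrite -[X in _ --> X]mul1r; apply: cvgM; [apply: cvg_near_cst;
    exists (Num.bound `|z|) => // n /= hn; rewrite /inb
      (lt_le_trans (archi_boundP (normr_ge0 z)))// ler_nat//|exact: cvg_cst]) bound.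
by [].
Qed.

Lemma Li_near r : 0 < r -> Li mu (near_ip 2 r) /\ \int[mu]_x near_ip 2 r x <= 64 * r.
Proof.
move=> r0; have [L1 b1] := Li_near1; have r1 : r^-1 != 0 by rewrite invr_eq0 gt_eqF.
have ri0 : 0 < r^-1 by rewrite invr_gt0.
have E z : near_ip 2 r z = r^-1 ^+ 2 * near_ip 2 1 (r^-1 *: z + 0).
  rewrite addr0 /near_ip inb_scale// invrK mul1r ip_scale// invrK.
  have : r != 0 by rewrite gt_eqF.
  by move: (inb r z) (ip 2 z) => a b rn0; field.
have L : Li mu (near_ip 2 r).
  by apply: (@eq_Li _ _ R mu _ _ E); apply: LiZ; exact: (Li_affine 0 r1 L1).
split=> //; have -> : \int[mu]_z near_ip 2 r z = r * \int[mu]_z near_ip 2 1 z.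
  rewrite (RI_affine_ge0 0 r1 L1 (near_ge0 2 1)) (gtr0_norm ri0).
  have -> : \int[mu]_z near_ip 2 r z = \int[mu]_z (r^-1 ^+ 2 * near_ip 2 1 (r^-1 *: z + 0)).
    exact: eq_RI.
  rewrite RIZ; last exact: (Li_affine 0 r1 L1).
  have : r != 0 by rewrite gt_eqF.
  by move: (\int[mu]_z near_ip 2 1 _) => A rn0; field.
by rewrite mulrC ler_wpM2r// ltW.
Qed.

Lemma Li_far5 r : 0 < r -> Li mu (far_ip 5 r) /\ \int[mu]_x far_ip 5 r x <= 128 * r^-1 ^+ 2.
Proof.
move=> r0; have [L1 b1] := @Li_far1 5 isT; have r1 : r^-1 != 0 by rewrite invr_eq0 gt_eqF.
have ri0 : 0 < r^-1 by rewrite invr_gt0.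
have E z : far_ip 5 r z = r^-1 ^+ 5 * far_ip 5 1 (r^-1 *: z + 0).
  rewrite addr0 /far_ip inb_scale// invrK mul1r ip_scale// invrK.
  have : r != 0 by rewrite gt_eqF.
  by move: (inb r z) (ip 5 z) => a b rn0; field.
have L : Li mu (far_ip 5 r).
  by apply: (@eq_Li _ _ R mu _ _ E); apply: LiZ; exact: (Li_affine 0 r1 L1).
split=> //; have -> : \int[mu]_z far_ip 5 r z = r^-1 ^+ 2 * \int[mu]_z far_ip 5 1 z.
  rewrite (RI_affine_ge0 0 r1 L1 (far_ge0 5 1)) (gtr0_norm ri0).
  have -> : \int[mu]_z far_ip 5 r z = \int[mu]_z (r^-1 ^+ 5 * far_ip 5 1 (r^-1 *: z + 0)).
    exact: eq_RI.
  rewrite RIZ; last exact: (Li_affine 0 r1 L1).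
  have : r != 0 by rewrite gt_eqF.
  by move: (\int[mu]_z far_ip 5 1 _) => A rn0; field.
by rewrite mulrC ler_wpM2r// exprn_ge0// ltW.
Qed.

Lemma L2_far : L2 mu (far_ip 2 1) /\ N2 mu (far_ip 2 1) <= 12.
Proof.
have [L b] := @Li_far1 4 isT.
have E z : far_ip 2 1 z ^+ 2 = far_ip 4 1 z.
  rewrite /far_ip exprMn /ip -exprM; congr (_ * _).
  by rewrite /inb; case: (_ < _); rewrite ?subrr ?subr0 ?expr1n ?expr0n.
have L' : L2 mu (far_ip 2 1).
  by split; [exact: measurable_far|apply: (@eq_Li _ _ R mu _ _ E)].
split=> //; rewrite -(@ler_pXn2r _ 2)// ?nnegrE ?N2_ge0// N2_sqr.
have -> : \int[mu]_x (far_ip 2 1 x ^+ 2) = \int[mu]_x far_ip 4 1 x by exact: eq_RI.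
by rewrite (le_trans b)// expr2 -natrM ler_nat.
Qed.

Lemma ip_split m z : ip m z = near_ip m 1 z + far_ip m 1 z.
Proof. by rewrite /near_ip /far_ip; move: (inb 1 z) (ip m z) => a b; ring. Qed.

End inverse_powers.

(** * The Riesz kernels and their potential *)

Section riesz_kernels.
Context {R : realType}.
Implicit Types (x y z w : R3 R) (r e : R) (j : 'I_3).
Local Notation mu := (leb3 R).
Local Notation M := (measurableTypeR R).
Local Notation c := ((pi ^+ 2)^-1 : R).
Local Notation mfun3 f := (@measurable_fun _ _ (M * M * M)%type R setT f).

Let c_gt0 : 0 < c.
Proof. by rewrite invr_gt0 exprn_gt0// pi_gt0. Qed.

Lemma comp3_le j x : `|comp3 j x| <= `|x|.
Proof.
by rewrite norm3E; case: j => -[|[|[|//]]] ?; rewrite /comp3 /tnth /= !le_max lexx ?orbT.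
Qed.

Lemma nsq_ub x : nsq x <= 3 * `|x| ^+ 2.
Proof.
rewrite nsqE; apply: (@le_trans _ _ (\sum_(i < 3) `|x| ^+ 2)).
  by apply: ler_sum => i _; rewrite -(real_normK (num_real (comp3 i x))) ler_pXn2r ?nnegrE// comp3_le.
by rewrite sumr_const card_ord mulr_natl.
Qed.

Lemma nsq_lb x : `|x| ^+ 2 <= nsq x.
Proof.
have H j : `|x| = `|comp3 j x| -> `|x| ^+ 2 <= nsq x.
  move=> ->; rewrite real_normK ?num_real// nsqE (bigD1 j)//= lerDl.
  by apply: sumr_ge0 => i _; exact: sqr_ge0.
have : `|x| = `|comp3 0 x| \/ `|x| = `|comp3 1 x| \/ `|x| = `|comp3 2%:R x|.
  rewrite norm3E /comp3 /tnth /=; case: (leP `|x.1.1| `|x.1.2|) => _;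
    case: leP => _; by [left|right; left|right; right].
by case=> [/H|[/H|/H]].
Qed.

Lemma nsqN x : nsq (- x) = nsq x.
Proof.
rewrite !nsqE; apply: eq_bigr => i _.
by have := comp3_lin i (-1) x 0; rewrite addr0 scaleN1r => ->;
  case: i => -[|[|[|//]]] ?; rewrite /comp3 /tnth /= addr0 mulN1r sqrrN.
Qed.

Lemma comp3N j x : comp3 j (- x) = - comp3 j x.
Proof. by case: j => -[|[|[|//]]] ?. Qed.

Lemma comp3D j x y : comp3 j (x + y) = comp3 j x + comp3 j y.
Proof. by have := comp3_lin j 1 x y; rewrite scale1r mul1r. Qed.

Lemma nsq0_eq0 x : x != 0 -> 0 < nsq x.
Proof. by move=> x0; rewrite (lt_le_trans _ (nsq_lb x))// exprn_gt0// normr_gt0. Qed.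

Lemma nsq_polar w y : nsq (w + y) - nsq (w - y) = 4 * dot w y.
Proof.
rewrite !nsqE /dot !sum3 !comp3D !comp3N.
move: (comp3 0 w) (comp3 1 w) (comp3 2%:R w) (comp3 0 y) (comp3 1 y) (comp3 2%:R y).
by move=> *; ring.
Qed.

Lemma dot_le w y : `|dot w y| <= 3 * (`|w| * `|y|).
Proof.
rewrite /dot (le_trans (ler_norm_sum _ _ _))//.
apply: (@le_trans _ _ (\sum_(i < 3) `|w| * `|y|)).
  by apply: ler_sum => i _; rewrite normrM ler_pM// comp3_le.
by rewrite sumr_const card_ord mulr_natl.
Qed.

Definition rk j y : R := riesz_kernel j y.
(** A common potential of the Riesz kernels: its j-th partial derivative is [rk j]. A Riesz
    transform thus becomes the convolution of [kk] with a derivative of the argument, and the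
    principal value disappears. *)
Definition kk y : R := - (c / 2) / nsq y.
Definition out e y : R := (e < enorm y)%R%:R.

Lemma enorm4 y : enorm y ^+ 4 = nsq y ^+ 2.
Proof. by rewrite -enorm_sqr -exprM. Qed.

Lemma rkE j y : rk j y = c * comp3 j y / nsq y ^+ 2.
Proof. by rewrite /rk /riesz_kernel enorm4. Qed.

Lemma rkN j y : rk j (- y) = - rk j y.
Proof. by rewrite !rkE nsqN comp3N mulrN mulNr. Qed.

Lemma enormE y : enorm y = Num.sqrt (nsq y).
Proof. by []. Qed.

Lemma outN e y : out e (- y) = out e y.
Proof. by rewrite /out !enormE nsqN. Qed.

Lemma nsq_inv_le y : (nsq y)^-1 <= ip 2 y.
Proof.
have [->|y0] := eqVneq y 0.
  rewrite /ip normr0 invr0 expr0n /=.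
  have -> : nsq (0 : R3 R) = 0.
    by apply/eqP; rewrite eq_le nsq_ge0 andbT (le_trans (nsq_ub _))// normr0 expr0n mulr0.
  by rewrite invr0.
rewrite /ip exprVn lef_pV2 ?posrE ?exprn_gt0 ?normr_gt0 ?nsq0_eq0//.
exact: nsq_lb.
Qed.

Lemma kk_le y : `|kk y| <= c / 2 * ip 2 y.
Proof.
have c2 : 0 <= c / 2 by rewrite divr_ge0// ltW.
rewrite /kk normrM normrN (ger0_norm c2) ler_wpM2l//.
by rewrite ger0_norm ?invr_ge0 ?nsq_ge0// nsq_inv_le.
Qed.

Lemma rk_le j y : `|rk j y| <= c * ip 3 y.
Proof.
rewrite rkE normrM normrM (ger0_norm (ltW c_gt0)) -mulrA ler_wpM2l ?(ltW c_gt0)//.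
have [->|y0] := eqVneq y 0.
  have -> : comp3 j (0 : R3 R) = 0.
    by apply/eqP; rewrite -normr_le0 (le_trans (comp3_le _ _))// normr0.
  by rewrite normr0 mul0r ip_ge0.
have n0 : 0 < `|y| by rewrite normr_gt0.
have h : `|(nsq y ^+ 2)^-1| <= ip 4 y.
  rewrite ger0_norm ?invr_ge0 ?exprn_ge0 ?nsq_ge0// -exprVn.
  have -> : ip 4 y = ip 2 y ^+ 2 by rewrite /ip -exprM.
  by rewrite ler_pXn2r ?nnegrE ?ip_ge0 ?invr_ge0 ?nsq_ge0// nsq_inv_le.
apply: (le_trans (ler_pM _ _ (comp3_le j y) h)) => //.
by rewrite /ip exprS mulrA divff ?mul1r// gt_eqF.
Qed.

Lemma out_range e y : 0 <= out e y <= 1.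
Proof. by rewrite /out; case: (_ < _); rewrite /= ?lexx ler01. Qed.

(** The truncation uses the Euclidean norm, the estimates the sup norm; the former is at most sqrt 3
    <= 2 times the latter. *)
Lemma out_lt e y : 0 < e -> ~~ (e < 2 * `|y|) -> out e y = 0.
Proof.
move=> e0; rewrite -leNgt /out => h; rewrite ltNge (le_trans _ h)//.
rewrite enormE -[leRHS]ger0_norm; last by rewrite mulr_ge0.
rewrite -sqrtr_sqr ler_sqrt ?sqr_ge0// (le_trans (nsq_ub y))// exprMn ler_wpM2r ?sqr_ge0//.
by rewrite -natrX ler_nat.
Qed.

Lemma ip_le m r y : 0 < r -> r <= `|y| -> ip m y <= r^-1 ^+ m.
Proof.
move=> r0 ry; rewrite /ip; have y0 : 0 < `|y| by exact: lt_le_trans ry.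
case: m => [|m]; first by rewrite !expr0.
by rewrite ler_pXn2r ?nnegrE ?invr_ge0 ?(ltW r0)// lef_pV2 ?posrE.
Qed.

Definition rke j e y : R := out e y * rk j y.

Lemma rkeN j e y : rke j e (- y) = - rke j e y.
Proof. by rewrite /rke outN rkN mulrN. Qed.

Lemma rke_le j e y : 0 < e -> `|rke j e y| <= c * (e / 2)^-1 ^+ 3.
Proof.
move=> e0; have e20 : 0 < e / 2 by rewrite divr_gt0.
rewrite /rke; have [h|h] := boolP (e < 2 * `|y|); last first.
  by rewrite out_lt// mul0r normr0 mulr_ge0 ?(ltW c_gt0)// exprn_ge0// invr_ge0 ltW.
have /andP[q0 q1] := out_range e y; rewrite normrM (ger0_norm q0).
apply: (@le_trans _ _ (`|rk j y|)); first by rewrite ler_piMl.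
rewrite (le_trans (rk_le j y))// ler_wpM2l ?(ltW c_gt0)// ip_le//.
by rewrite ler_pdivrMr// mulrC ltW.
Qed.

Lemma measurable_nsq : mfun3 nsq.
Proof. by apply: continuous_measurable3; apply: smooth_continuous; exact: smooth_nsq. Qed.

Lemma measurable_rk j : mfun3 (rk j).
Proof.
have -> : rk j = fun y => c * comp3 j y * (nsq y ^+ 2)^-1 by apply/funext => y; rewrite rkE.
apply: measurable_funM.
  by apply: measurable_funM => //; apply: continuous_measurable3; exact: comp3_continuous.
by apply: measurable_inv; apply: measurable_funX; exact: measurable_nsq.
Qed.

Lemma measurable_kk : mfun3 kk.
Proof. by apply: measurable_funM => //; apply: measurable_inv; exact: measurable_nsq. Qed.

Lemma measurable_enorm : mfun3 enorm.
Proof.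
apply: continuous_measurable3 => x.
apply: (@continuous_comp _ _ _ nsq Num.sqrt); last exact: sqrt_continuous.
by apply: smooth_continuous; exact: smooth_nsq.
Qed.

Lemma outE e : out e = \1_[set y | e < enorm y].
Proof.
apply/funext => y; rewrite indicE /out; congr (nat_of_bool _)%:R.
by apply/idP/idP; rewrite inE.
Qed.

Lemma measurable_out_set e : @measurable _ (M * M * M)%type [set y | e < enorm y].
Proof.
have := measurable_enorm; move=> /(_ measurableT _ (measurable_itv `]e, +oo[)).
rewrite setTI; congr (measurable _); apply/seteqP.
by split => y /=; rewrite in_itv /= andbT.
Qed.

Lemma measurable_out e : mfun3 (out e).
Proof. by rewrite outE; apply: measurable_indic; exact: measurable_out_set. Qed.

Lemma measurable_rke j e : mfun3 (rke j e).
Proof. by apply: measurable_funM; [exact: measurable_out|exact: measurable_rk]. Qed.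

(** A majorant of |y|^-3 |w - y|^-2 on |y| >= r. Within r of w the first factor is at most r^-3;
    elsewhere the product is at most the fifth power of the larger of the two inverse norms. *)
Definition dom r w y : R :=
  r^-1 ^+ 3 * near_ip 2 r (w - y) + far_ip 5 r y + far_ip 5 r (w - y).

Lemma dom_le r w y : 0 < r -> r <= `|y| -> ip 3 y * ip 2 (w - y) <= dom r w y.
Proof.
move=> r0 ry; rewrite /dom /near_ip /far_ip {2}/inb ltNge ry /= subr0 mul1r.
rewrite /inb; case: ltP => h; rewrite ?subrr ?subr0 !(mul1r, mul0r) ?mulr0 ?add0r ?addr0.
  rewrite (@le_trans _ _ (r^-1 ^+ 3 * ip 2 (w - y))) ?lerDl ?ip_ge0//.
  by rewrite ler_wpM2r ?ip_ge0// ip_le.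
rewrite /ip; have a0 : 0 <= `|y|^-1 by rewrite invr_ge0.
have b0 : 0 <= `|w - y|^-1 by rewrite invr_ge0.
move: `|y|^-1 `|w - y|^-1 a0 b0 => a b a0 b0.
have [ab|ba] := leP a b.
  rewrite (@le_trans _ _ (b ^+ 5)) ?lerDr ?exprn_ge0//.
  rewrite (exprD b 3 2) ler_wpM2r ?exprn_ge0//.
  by rewrite ler_pXn2r ?nnegrE.
rewrite (@le_trans _ _ (a ^+ 5)) ?lerDl ?exprn_ge0//.
rewrite (exprD a 3 2) ler_wpM2l ?exprn_ge0//.
by rewrite ler_pXn2r ?nnegrE// ltW.
Qed.

(** The constant is 64 for the near term and 128 for each of the two far terms. *)
Lemma Li_dom r w : 0 < r -> Li mu (dom r w) /\ \int[mu]_y dom r w y <= 320 * r^-1 ^+ 2.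
Proof.
move=> r0; have [L1 b1] := Li_near r0; have [L2' b2] := Li_far5 r0.
have LA := LiZ (r^-1 ^+ 3) (Li_refl w L1); have LB := Li_refl w L2'.
split; first by apply: LiD => //; exact: LiD.
rewrite /dom RID//; last exact: LiD.
rewrite RID// RIZ; last exact: Li_refl.
rewrite (RI_refl w L1) (RI_refl w L2').
have r3 : 0 <= r^-1 ^+ 3 by rewrite exprn_ge0// invr_ge0 ltW.
apply: (le_trans (lerD (lerD (ler_wpM2l r3 b1) b2) b2)).
by rewrite le_eqVlt; apply/orP; left; apply/eqP; field; rewrite gt_eqF.
Qed.

Lemma dom_ge0 r w y : 0 < r -> 0 <= dom r w y.
Proof.
by move=> r0; rewrite !addr_ge0 ?far_ge0// mulr_ge0 ?near_ge0// exprn_ge0// invr_ge0 ltW.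
Qed.

Lemma rke_kk_le j e r w y : 0 < r -> r <= `|y| ->
  `|rke j e y * kk (w - y)| <= c ^+ 2 / 2 * dom r w y.
Proof.
move=> r0 ry; have /andP[q0 q1] := out_range e y.
rewrite /rke normrM; apply: (@le_trans _ _ (`|rk j y| * `|kk (w - y)|)).
  by apply: ler_wpM2r => //; rewrite normrM (ger0_norm q0) ler_piMl.
have c2 : 0 <= c / 2 by rewrite divr_ge0// ltW.
apply: (le_trans (ler_pM _ _ (rk_le j y) (kk_le (w - y)))) => //.
have -> : c * ip 3 y * (c / 2 * ip 2 (w - y)) = c ^+ 2 / 2 * (ip 3 y * ip 2 (w - y)).
  by move: (ip 3 y) (ip 2 _) => a b; move: c_gt0; move: (c) => d d0; field.
by apply: ler_wpM2l; [rewrite divr_ge0// exprn_ge0// ltW|exact: dom_le].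
Qed.

(** This bound degenerates as e tends to 0 and serves to justify Fubini's theorem for a fixed
    truncation; [rke_kk_bound] is the one that is uniform in e. *)
Lemma Li_rke_kk j e w : 0 < e -> Li mu (fun y => rke j e y * kk (w - y)) /\
  \int[mu]_y `|rke j e y * kk (w - y)| <= c ^+ 2 / 2 * (320 * (e / 2)^-1 ^+ 2).
Proof.
move=> e0; have e20 : 0 < e / 2 by rewrite divr_gt0.
have [Ld bd] := Li_dom w e20.
have c2 : 0 <= c ^+ 2 / 2 by rewrite divr_ge0// exprn_ge0// ltW.
have le y : `|rke j e y * kk (w - y)| <= c ^+ 2 / 2 * dom (e / 2) w y.
  have [h|h] := boolP (e < 2 * `|y|).
    by apply: rke_kk_le => //; rewrite ler_pdivrMr// mulrC ltW.
  by rewrite /rke out_lt// !mul0r normr0 mulr_ge0// dom_ge0.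
have m : mfun3 (fun y => rke j e y * kk (w - y)).
  by apply: measurable_funM; [exact: measurable_rke|apply: measurable_refl; exact: measurable_kk].
have L : Li mu (fun y => rke j e y * kk (w - y)).
  by apply: (@Li_le _ _ R mu (fun y => c ^+ 2 / 2 * dom (e / 2) w y)) => //; exact: LiZ.
split=> //; apply: (@le_trans _ _ (\int[mu]_y (c ^+ 2 / 2 * dom (e / 2) w y))).
  by apply: RI_le => //; [exact: Li_norm|exact: LiZ].
by rewrite RIZ// ler_wpM2l.
Qed.

(* The contribution of |y| < |w| / 2 is small because the Riesz kernel is odd. *)
Lemma rke_kk_bound j e w : 0 < e -> w != 0 ->
  `|\int[mu]_y (rke j e y * kk (w - y))| <= c ^+ 2 * 4000 * ip 2 w.
Proof.
move=> e0 w0; pose r := `|w| / 2; have nw0 : 0 < `|w| by rewrite normr_gt0.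
have r0 : 0 < r by rewrite divr_gt0.
have wr : `|w| = 2 * r by rewrite /r mulrCA divff ?mulr1// pnatr_eq0.
have [LH _] := Li_rke_kk j w e0; have [Ld bd] := Li_dom w r0.
have [Ln bn] := Li_near r0.
pose F y := inb r y * (rke j e y * kk (w - y)).
have LF : Li mu F.
  apply: (@Li_le _ _ R mu (fun y => `|rke j e y * kk (w - y)|)); last exact: Li_norm.
    by apply: measurable_funM; [exact: measurable_inb|exact: Li_measurable LH].
  by move=> y; rewrite normrM; have /andP[i0 i1] := inb_range r y; rewrite (ger0_norm i0) ler_piMl.
have inbN y : inb r (- y) = inb r y by rewrite /inb normrN.
have c2 : 0 <= c ^+ 2 / 2 by rewrite divr_ge0// exprn_ge0// ltW.
have far : `|\int[mu]_y (rke j e y * kk (w - y) - F y)| <= c ^+ 2 / 2 * (320 * r^-1 ^+ 2).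
  apply: (@le_trans _ _ (\int[mu]_y (c ^+ 2 / 2 * dom r w y))); last first.
    by rewrite RIZ// ler_wpM2l.
  apply: RI_norm_le; [exact: LiB|exact: LiZ|].
  move=> y; rewrite /F /inb; case: ltP => h; last by rewrite mul0r subr0 rke_kk_le.
  by rewrite mul1r subrr normr0 mulr_ge0// dom_ge0.
have near : `|\int[mu]_y F y| <= c ^+ 2 * (12 * 64) * r^-1 ^+ 2.
  have LFN : Li mu (fun y => F (0 - y)) by exact: Li_refl.
  have FE : \int[mu]_y F y = 2^-1 * \int[mu]_y (F y + F (0 - y)).
    by rewrite RID// (RI_refl 0 LF); move: (\int[mu]_y F y) => A; field.
  have b y : `|F y + F (0 - y)| <= c ^+ 2 * 24 * r^-1 ^+ 3 * near_ip 2 r y.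
    rewrite sub0r /F inbN rkeN opprK mulNr mulrN -mulrBr -mulrBr /near_ip /inb.
    case: ltP => h; last by rewrite !mul0r normr0 mulr0.
    rewrite !mul1r normrM.
    have /andP[q0 q1] := out_range e y.
    have k1 : `|rke j e y| <= c * ip 3 y.
      rewrite /rke normrM (ger0_norm q0) (le_trans _ (rk_le j y))//.
      by rewrite ler_piMl.
    have wy1 : r <= `|w - y|.
      by have := ler_normD (w - y) y; rewrite subrK wr; have := h; lra.
    have wy2 : r <= `|w + y|.
      by have := ler_normB (w + y) y; rewrite addrK wr; have := h; lra.
    have n1 : 0 < nsq (w - y) by rewrite nsq0_eq0// -normr_gt0 (lt_le_trans r0).
    have n2 : 0 < nsq (w + y) by rewrite nsq0_eq0// -normr_gt0 (lt_le_trans r0).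
    (* The difference of the potentials at w - y and w + y carries a factor |w| |y|, which lowers
       the singularity of the Riesz kernel from |y|^-3 to the integrable |y|^-2. *)
    have kE : kk (w - y) - kk (w + y) = - (c / 2) * ((4 * dot w y) * ((nsq (w - y))^-1 * (nsq (w + y))^-1)).
      rewrite /kk -nsq_polar; move: (nsq (w - y)) (nsq (w + y)) n1 n2 (c) => p q p0 p1 d.
      by field; rewrite !gt_eqF.
    have k2 : `|kk (w - y) - kk (w + y)| <= c / 2 * (4 * (3 * (2 * r * `|y|)) * (r^-1 ^+ 2 * r^-1 ^+ 2)).
      have c20 : 0 <= c / 2 by rewrite divr_ge0// ltW.
      rewrite kE normrM normrN (ger0_norm c20); apply: ler_wpM2l => //.
      rewrite normrM; apply: ler_pM => //.
        by rewrite normrM (ger0_norm (ler0n R 4)) ler_wpM2l// -wr dot_le.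
      rewrite ger0_norm; last by rewrite mulr_ge0 ?invr_ge0 ?nsq_ge0.
      apply: ler_pM; rewrite ?invr_ge0 ?nsq_ge0//.
        by rewrite (le_trans (nsq_inv_le _))// ip_le.
      by rewrite (le_trans (nsq_inv_le _))// ip_le.
    apply: (le_trans (ler_pM _ _ k1 k2)) => //.
    have yE : ip 3 y * `|y| <= ip 2 y.
      have [->|y0] := eqVneq y 0; first by rewrite normr0 mulr0 ip_ge0.
      by rewrite /ip exprSr -mulrA mulVf ?mulr1// normr_eq0.
    have -> : c * ip 3 y * (c / 2 * (4 * (3 * (2 * r * `|y|)) * (r^-1 ^+ 2 * r^-1 ^+ 2))) =
      c ^+ 2 * 12 * r^-1 ^+ 3 * (ip 3 y * `|y|).
      have rn0 : r != 0 by rewrite gt_eqF.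
      move: (ip 3 y) `|y| (c) (r) rn0 => a b d s s0; field; exact: s0.
    have r3 : 0 <= r^-1 ^+ 3 by rewrite exprn_ge0// invr_ge0 ltW.
    have cc : 0 <= c ^+ 2 by exact: sqr_ge0.
    apply: (le_trans (ler_wpM2l (mulr_ge0 (mulr_ge0 cc (ler0n _ 12)) r3) yE)).
    by rewrite ler_wpM2r ?ip_ge0// ler_wpM2r// ler_wpM2l// ler_nat.
  have cr : 0 <= c ^+ 2 * 24 * r^-1 ^+ 3.
    apply: mulr_ge0; last by rewrite exprn_ge0// invr_ge0 ltW.
    by apply: mulr_ge0 => //; exact: sqr_ge0.
  rewrite FE normrM ger0_norm// -ler_pdivlMl//.
  apply: (@le_trans _ _ (\int[mu]_y (c ^+ 2 * 24 * r^-1 ^+ 3 * near_ip 2 r y))).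
    by apply: RI_norm_le => //; [exact: LiD|exact: LiZ].
  rewrite RIZ// (le_trans (ler_wpM2l cr bn))//.
  rewrite le_eqVlt; apply/orP; left; apply/eqP.
  by move: (c) => d; field; rewrite gt_eqF.
have -> : \int[mu]_y (rke j e y * kk (w - y)) =
    \int[mu]_y F y + \int[mu]_y (rke j e y * kk (w - y) - F y).
  by rewrite -RID//; [apply: eq_RI => y; rewrite [RHS]addrC subrK//|exact: LiB].
apply: (le_trans (ler_normD _ _)); apply: (le_trans (lerD near far)).
(* The two parts give 768 + 160 multiples of r^-2, and r^-2 = 4 |w|^-2; in all 3712, rounded up to
   4000. *)
have -> : ip 2 w = (2^-1 * r^-1) ^+ 2 by rewrite /ip wr invfM.
have cc : 0 <= c ^+ 2 by exact: sqr_ge0.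
have rr : 0 <= r^-1 ^+ 2 by exact: sqr_ge0.
have := mulr_ge0 cc rr; rewrite exprMn.
move: (c ^+ 2) (r^-1 ^+ 2) => p q; clear; lra.
Qed.

End riesz_kernels.

(** * Integration by parts for the truncated kernel *)

Section truncated_kernel.
Context {R : realType}.
Implicit Types (x y z w : R3 R) (r e : R) (j : 'I_3) (f g : R3 R -> R).
Local Notation mu := (leb3 R).
Local Notation M := (measurableTypeR R).
Local Notation c := ((pi ^+ 2)^-1 : R).
Local Notation mfun3 f := (@measurable_fun _ _ (M * M * M)%type R setT f).

Let c_gt0 : 0 < c.
Proof. by rewrite invr_gt0 exprn_gt0// pi_gt0. Qed.

Let c2_gt0 : 0 < c / 2.
Proof. by rewrite divr_gt0. Qed.

Lemma max_lipschitz (a b d : R) : `|Num.max a d - Num.max b d| <= `|a - b|.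
Proof.
have h1 := ler_norm (a - b); have h2 := ler_norm (b - a); rewrite distrC in h2.
have h0 := normr_ge0 (a - b); move: `|a - b| h0 h1 h2 => N h0 h1 h2.
by rewrite ler_norml; apply/andP; split; case: (leP a d) => ?; case: (leP b d) => ?; lra.
Qed.

(** The potential [kk], made constant inside the sphere of radius e. It is bounded and Lipschitz,
    and off the sphere its derivatives are the truncated Riesz kernels [rke]; being continuous
    across the sphere, it produces no boundary term. *)
Definition ke e y : R := - (c / 2) / Num.max (nsq y) (e ^+ 2).

Lemma max_gt0 e y : 0 < e -> 0 < Num.max (nsq y) (e ^+ 2).
Proof. by move=> e0; rewrite lt_max exprn_gt0// orbT. Qed.

Lemma ke_bound e y : 0 < e -> `|ke e y| <= c / 2 * (e ^+ 2)^-1.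
Proof.
move=> e0; rewrite /ke normrM normrN (gtr0_norm c2_gt0) ler_wpM2l ?(ltW c2_gt0)//.
have m0 := max_gt0 y e0; have e20 : 0 < e ^+ 2 by rewrite exprn_gt0.
by rewrite gtr0_norm ?invr_gt0// lef_pV2 ?posrE// le_max lexx orbT.
Qed.

Lemma ke_le e y : 0 < e -> y != 0 -> `|ke e y| <= c / 2 * ip 2 y.
Proof.
move=> e0 y0; rewrite /ke normrM normrN (gtr0_norm c2_gt0) ler_wpM2l ?(ltW c2_gt0)//.
rewrite gtr0_norm ?invr_gt0 ?max_gt0// (le_trans _ (nsq_inv_le y))//.
by rewrite lef_pV2 ?posrE ?max_gt0 ?nsq0_eq0// le_max lexx.
Qed.

Lemma measurable_ke e : mfun3 (ke e).
Proof.
apply: measurable_funM => //; apply: measurable_inv.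
by apply: measurable_maxr => //; exact: measurable_nsq.
Qed.

Lemma comp3_le_max j e y : 0 < e -> `|comp3 j y| * e <= Num.max (nsq y) (e ^+ 2).
Proof.
move=> e0; have [h|h] := leP `|comp3 j y| e.
  by rewrite le_max; apply/orP; right; rewrite expr2 ler_wpM2r// ltW.
rewrite le_max; apply/orP; left.
apply: (@le_trans _ _ (`|comp3 j y| ^+ 2)).
  by rewrite expr2 ler_wpM2l// ltW.
rewrite real_normK ?num_real// nsqE (bigD1 j)//= lerDl.
by apply: sumr_ge0 => i _; exact: sqr_ge0.
Qed.

Lemma nsq_shift j y (h : R) :
  nsq (y + h *: evec j) - nsq y = h * (comp3 j y + comp3 j (y + h *: evec j)).
Proof.
rewrite ![y + _]addrC comp3_lin comp3_evec eqxx mulr1.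
rewrite !nsqE (bigD1 j)//= [in X in _ - X](bigD1 j)//= comp3_lin comp3_evec eqxx mulr1.
rewrite (eq_bigr (fun i => comp3 i y ^+ 2)); first by move: (\sum_(_ < _ | _) _) => S; ring.
by move=> i ij; rewrite comp3_lin comp3_evec (negPf ij) mulr0 add0r.
Qed.

Lemma ke_lipschitz j e y (h : R) : 0 < e ->
  `|ke e (y + h *: evec j) - ke e y| <= c / e ^+ 3 * `|h|.
Proof.
move=> e0; set y' := y + _.
have A0 := max_gt0 y' e0; have B0 := max_gt0 y e0.
have hA := comp3_le_max j y' e0; have hB := comp3_le_max j y e0.
have d := max_lipschitz (nsq y') (nsq y) (e ^+ 2); rewrite nsq_shift -/y' in d.
have Ae : e ^+ 2 <= Num.max (nsq y') (e ^+ 2) by rewrite le_max lexx orbT.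
have Be : e ^+ 2 <= Num.max (nsq y) (e ^+ 2) by rewrite le_max lexx orbT.
rewrite /ke; move: (Num.max (nsq y') _) (Num.max (nsq y) _) A0 B0 hA hB d Ae Be => A B A0 B0 hA hB d Ae Be.
have -> : - (c / 2) / A - - (c / 2) / B = c / 2 * ((A - B) / (A * B)).
  by move: (c) => k; field; rewrite !gt_eqF.
rewrite normrM (gtr0_norm c2_gt0).
have -> : c / e ^+ 3 * `|h| = c / 2 * (`|h| * (2 / e ^+ 3)).
  by move: (c) => k; field; rewrite gt_eqF.
rewrite ler_wpM2l ?(ltW c2_gt0)// normrM normfV [`|A * B|]gtr0_norm ?mulr_gt0//.
rewrite ler_pdivrMr ?mulr_gt0// (le_trans d)// normrM -mulrA ler_wpM2l//.
rewrite (le_trans (ler_normD _ _))// mulrAC ler_pdivlMr ?exprn_gt0//.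
have e2 : 0 < e ^+ 2 by rewrite exprn_gt0.
have -> : e ^+ 3 = e * e ^+ 2 by ring.
rewrite mulrA mulrDl.
apply: (@le_trans _ _ ((B + A) * e ^+ 2)).
  by rewrite ler_wpM2r ?(ltW e2)// lerD.
have h1 : B * e ^+ 2 <= B * A by rewrite ler_wpM2l// ltW.
have h2 : A * e ^+ 2 <= A * B by rewrite ler_wpM2l// ltW.
by rewrite mulrDl; move: h1 h2; rewrite [B * A]mulrC; lra.
Qed.

(** Once the first two coordinates are fixed, at most two values of the third put the point on the
    sphere. *)
Lemma null_sphere e : {ae mu, forall y, nsq y != e ^+ 2}.
Proof.
pose A : set (M * M * M) := [set y | nsq y = e ^+ 2].
have mA : measurable A.
  have := @measurable_nsq R; move=> /(_ measurableT _ (measurable_set1 (e ^+ 2))).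
  by rewrite setTI.
exists A; split => //; last by move=> y /= /negP; rewrite negbK => /eqP.
rewrite [LHS](_ : _ = \int[product_measure1 (leb R) (leb R)]_x (leb R (xsection A x)))%E//.
apply: integral0_eq => -[x1 x2] _ /=; apply: countable_lebesgue_measure0.
pose s := Num.sqrt (e ^+ 2 - x1 ^+ 2 - x2 ^+ 2).
apply: (@sub_countable _ _ _ [set s; - s]); last exact/finite_set_countable/finite_set2.
apply: subset_card_le => t; rewrite /xsection /= inE /A /= nsqE sum3 /comp3 /tnth /= => h.
have : t ^+ 2 = s ^+ 2.
  rewrite /s sqr_sqrtr -?h; first by ring.
  by rewrite (_ : _ - _ = t ^+ 2) ?sqr_ge0//; ring.
by move/eqP; rewrite eqf_sqr => /orP[] /eqP ->; [left|right].
Qed.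

Lemma kk_derive j y : y != 0 -> derivable kk y (evec j) /\ 'D_(evec j) kk y = rk j y.
Proof.
move=> y0; have n0 : nsq y != 0 by rewrite gt_eqF// nsq0_eq0.
have dn : derivable (@nsq R) y (evec j) by apply: smooth_derivable; exact: smooth_nsq.
have dV : derivable (fun z => (nsq z)^-1) y (evec j) := derivableV n0 dn.
have dc : derivable (fun=> - (c / 2) : R) y (evec j) by exact: derivable_cst.
split; first exact: (derivableM dc dV).
apply: (etrans (deriveM dc dV)).
rewrite derive_cst (deriveV n0 dn) -/(pd j nsq y) pd_nsq rkE /GRing.scale /= mulr0 addr0.
by move: (c) => k; field.
Qed.

(** The product of [ke e] and f(x - y) is Lipschitz with bounded support and differentiable off the
    null sphere, so [RI_diff_quotient] shows that the integral of its derivative vanishes. The two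
    terms of the product rule are the two sides. *)
Lemma kernel_ibp j e f x : 0 < e -> tst f ->
  \int[mu]_y (rke j e y * f (x - y)) = \int[mu]_y (ke e y * pd j f (x - y)).
Proof.
move=> e0 tf; have tfx := tst_refl x tf; have sf := tst_smooth tf.
pose fx y := f (x - y); pose F y := ke e y * fx y.
have pfx : pd j fx = fun y => - pd j f (x - y) by exact: pd_refl.
have tpx := tst_refl x (tst_pd j tf).
pose G y := rke j e y * f (x - y) - ke e y * pd j f (x - y).
have [B [B0 hB]] := tst_bounded tfx.
have [K K0 hK] := tst_lipschitz_dir (evec j) tfx.
have [r hr] := tfx.2.
have ceb y := ke_bound y e0.
have mF : mfun3 F by apply: measurable_funM; [exact: measurable_ke|exact: tst_measurable].
have LkG g : tst g -> Li mu (fun y => ke e y * g y).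
  move=> tg; apply: (@Li_le _ _ R mu (fun y => c / 2 * (e ^+ 2)^-1 * `|g y|)).
  - by apply: measurable_funM; [exact: measurable_ke|exact: tst_measurable].
  - by move=> y; rewrite normrM ler_wpM2r.
  - by apply: LiZ; apply: Li_norm; exact: tst_Li.
have LrG : Li mu (fun y => rke j e y * f (x - y)).
  apply: (@Li_le _ _ R mu (fun y => c * (e / 2)^-1 ^+ 3 * `|fx y|)).
  - by apply: measurable_funM; [exact: measurable_rke|exact: (tst_measurable tfx)].
  - by move=> y; rewrite normrM ler_wpM2r// rke_le.
  - by apply: LiZ; apply: Li_norm; exact: (tst_Li tfx).
have LF : Li mu F by exact: LkG.
have lip y (h : R) : `|F (y + h *: evec j) - F y| <=
    (c / e ^+ 3 * B + c / 2 * (e ^+ 2)^-1 * K) * `|h|.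
  rewrite /F; set y' := y + _.
  have := ke_lipschitz j y h e0; have := ceb y; have := hK y h; have := hB y'.
  rewrite -/y' -/(fx y') -/(fx y); move: (ke e y') (ke e y) (fx y') (fx y) => k' k a' a ha hd hk hl.
  have -> : k' * a' - k * a = (k' - k) * a' + k * (a' - a) by ring.
  rewrite (le_trans (ler_normD _ _))// !normrM mulrDl.
  apply: lerD; last by rewrite -mulrA; apply: ler_pM.
  by rewrite mulrAC; apply: ler_pM.
have sfx := tst_smooth tfx.
have isd y : is_derive y (evec j) fx (pd j fx y).
  by apply: DeriveDef => //; exact: smooth_derivable.
have cn : continuous (@nsq R) by apply: smooth_continuous; exact: smooth_nsq.
have der : {ae mu, forall y, derivable F y (evec j) /\ 'D_(evec j) F y = G y}.
  apply: (ae_imp (null_sphere e)) => y; rewrite neq_lt => /orP[h|h].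
    have nf : \forall z \near y, - (c / 2) / e ^+ 2 * fx z = F z.
      have : \forall z \near y, nsq z < e ^+ 2 by apply: (cvgr_lt _ (cn y)).
      by apply: filterS => z hz; rewrite /F /ke (max_idPr (ltW hz)).
    have [] := near_eq_is_derive nf (is_deriveZ (- (c / 2) / e ^+ 2) (isd y)).
    move=> d1 d2; split => //; rewrite d2 /G /rke.
    have -> : out e y = 0.
      have en : enorm y < e.
        by rewrite enormE -[ltRHS](gtr0_norm e0) -sqrtr_sqr ltr_sqrt// exprn_gt0.
      by rewrite /out ltNge (ltW en).
    rewrite !mul0r sub0r pfx /ke (max_idPr (ltW h)) /GRing.scale /= mulrN.
    by [].
  have y0 : y != 0.
    apply: contraTneq h => ->; rewrite -leNgt.
    by rewrite (le_trans (nsq_ub _))// normr0 expr0n mulr0 sqr_ge0.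
  have nf : \forall z \near y, kk z * fx z = F z.
    have : \forall z \near y, e ^+ 2 < nsq z by apply: (cvgr_gt _ (cn y)).
    by apply: filterS => z hz; rewrite /F /ke (max_idPl (ltW hz)).
  have [dk Dk] := kk_derive j y0.
  have [] := near_eq_is_derive nf (is_deriveM (DeriveDef dk Dk) (isd y)).
  move=> d1 d2; split => //; rewrite d2 /G /rke.
  have -> : out e y = 1.
    have en : e < enorm y.
      by rewrite enormE -[ltLHS](gtr0_norm e0) -sqrtr_sqr ltr_sqrt// (lt_trans _ h)// exprn_gt0.
    by rewrite /out en.
  have -> : ke e y = kk y by rewrite /ke (max_idPl (ltW h)).
  rewrite mul1r pfx /GRing.scale /= mulrN addrC [fx y * _]mulrC.
  by [].
have [] := @RI_diff_quotient R j F G _ r mF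
  (Li_measurable (LiB LrG (LkG _ tpx))) ltac:(by move=> y /hr; rewrite /F /fx => ->; rewrite mulr0) LF lip.
  apply: (ae_imp der) => y [d <-]; exact: derive_quotient_cvg.
move=> _; rewrite RIB// => [/eqP|]; last exact: LkG.
by rewrite subr_eq0 => /eqP.
Qed.

End truncated_kernel.

(** * Single and double Riesz transforms *)

Section riesz_transforms.
Context {R : realType}.
Implicit Types (x y z : R3 R) (e : R) (i j : 'I_3) (f g k v w r q : R3 R -> R).
Local Notation mu := (leb3 R).
Local Notation M := (measurableTypeR R).
Local Notation c := ((pi ^+ 2)^-1 : R).
Local Notation mfun3 f := (@measurable_fun _ _ (M * M * M)%type R setT f).

Let c_gt0 : 0 < c.
Proof. by rewrite invr_gt0 exprn_gt0// pi_gt0. Qed.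

Lemma far_le1 m z : far_ip m 1 z <= 1 :> R.
Proof.
rewrite /far_ip /inb; case: ltP => a; first by rewrite subrr mul0r ler01.
by rewrite subr0 mul1r /ip exprn_ile1 ?invr_ge0// invf_le1// (lt_le_trans _ a).
Qed.

(** Split at |z| = 1, the kernel |z|^-2 is the sum of an integrable and a square integrable
    function. Young's inequality then places the potential of an L^1 density in L^1 + L^2. *)
Lemma riesz_potential g : Li mu g -> (forall x, 0 <= g x) ->
  [/\ Li mu (conv (near_ip 2 1) g),
      \int[mu]_x `|conv (near_ip 2 1) g x| <= 64 * \int[mu]_x g x,
      L2 mu (conv (far_ip 2 1) g),
      N2 mu (conv (far_ip 2 1) g) <= 12 * \int[mu]_x g x &
      {ae mu, forall x, Li mu (fun y => ip 2 (x - y) * g y) /\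
         conv (ip 2) g x = conv (near_ip 2 1) g x + conv (far_ip 2 1) g x}].
Proof.
move=> Lg g0; have mg := Li_measurable Lg.
have [Ln bn] := @Li_near1 R; have [Lf bf] := @L2_far R.
have gE : \int[mu]_x `|g x| = \int[mu]_x g x by apply: eq_RI => x; rewrite ger0_norm.
have gi0 : 0 <= \int[mu]_x g x by exact: RI_ge0.
have [Lc1 h1] := young1 Ln Lg; have [Lc2 h2 _] := young2 Lg Lf.
have Lfar x : Li mu (fun y => far_ip 2 1 (x - y) * g y).
  apply: (@Li_le _ _ R mu g) => //.
    by apply: measurable_funM => //; apply: measurable_refl; exact: measurable_far.
  move=> y; rewrite normrM (ger0_norm (g0 y)) (ger0_norm (far_ge0 2 1 _)).
  by rewrite ler_piMl// far_le1.
have cE : conv g (far_ip 2 1) = conv (far_ip 2 1) g.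
  apply/funext => x; apply: conv_C; apply: (eq_Li _ (Lfar x)) => y; exact: mulrC.
rewrite cE in Lc2 h2.
split => //.
- rewrite gE in h1; apply: (le_trans h1); rewrite ler_wpM2r//.
  have -> : \int[mu]_x `|near_ip 2 1 x| = \int[mu]_x near_ip 2 1 x.
    by apply: eq_RI => x; rewrite ger0_norm// near_ge0.
  exact: bn.
- by rewrite gE in h2; rewrite (le_trans h2)// mulrC ler_wpM2r.
apply: (ae_imp (ae_Li3_1 (Li_mul_sub Ln Lg))) => x /= Lx.
have E y : ip 2 (x - y) * g y = near_ip 2 1 (x - y) * g y + far_ip 2 1 (x - y) * g y.
  by rewrite [ip 2 _]ip_split mulrDl.
split; first by apply: (@eq_Li _ _ R mu _ _ E); exact: LiD.
rewrite /conv -RID//; exact: eq_RI.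
Qed.

(** The derivative is meant in the strong sense, as an L^1 limit along test functions, because in
    this form [kernel_ibp] passes to the limit against the bounded kernels [rke] and [ke]. *)
Definition W11 j f g := [/\ Li mu f, Li mu g & exists f_ : nat -> R3 R -> R,
  [/\ forall n, tst (f_ n), \int[mu]_x `|f_ n x - f x| @[n --> \oo] --> 0 &
      \int[mu]_x `|pd j (f_ n) x - g x| @[n --> \oo] --> 0]].

Lemma W11_mul j v w (G F : 'I_3 -> R3 R -> R) : H1 v G -> H1 w F ->
  W11 j (fun x => v x * w x) (fun x => G j x * w x + v x * F j x).
Proof.
move=> vG wF; have [Lv LG _] := vG; have [Lw LF _] := wF.
have [v_ [tv cv cG]] := H1_sequence vG; have [w_ [tw cw cF]] := H1_sequence wF.
have L1 : Li mu (fun x => G j x * w x) by exact: L2M.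
have L2' : Li mu (fun x => v x * F j x) by exact: L2M.
split; [exact: L2M|exact: LiD|].
have sv n := tst_smooth (tv n); have sw n := tst_smooth (tw n).
have Lvn n := tst_L2 (tv n); have Lwn n := tst_L2 (tw n).
have Lpv n := tst_L2 (tst_pd j (tv n)); have Lpw n := tst_L2 (tst_pd j (tw n)).
exists (fun n x => v_ n x * w_ n x); split.
- by move=> n; exact: tstM.
- exact: (cvg_L2M Lvn Lwn Lv Lw cv cw).
have c1 := cvg_L2M Lpv Lwn (LG j) Lw (cG j) cw.
have c2 := cvg_L2M Lvn Lpw Lv (LF j) cv (cF j).
have c3 : \int[mu]_x `|pd j (v_ n) x * w_ n x - G j x * w x| +
    \int[mu]_x `|v_ n x * pd j (w_ n) x - v x * F j x| @[n --> \oo] --> 0.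
  by rewrite -[X in _ --> X](addr0 0); apply: cvgD; [exact: c1|exact: c2].
apply: (squeeze0 _ c3) => n; rewrite RI_ge0//=.
have La : Li mu (fun x => pd j (v_ n) x * w_ n x) by exact: L2M.
have Lb : Li mu (fun x => v_ n x * pd j (w_ n) x) by exact: L2M.
rewrite -RID; [|by apply: Li_norm; exact: LiB|by apply: Li_norm; exact: LiB].
apply: RI_le.
- apply: Li_norm; rewrite pdM//; apply: LiB; last exact: LiD.
  by apply: LiD => //; apply: (eq_Li _ La) => x; exact: mulrC.
- by apply: LiD; apply: Li_norm; exact: LiB.
move=> x; rewrite pdM// (le_trans _ (ler_normD _ _))//.
rewrite le_eqVlt; apply/orP; left; apply/eqP; congr `|_|.
by move: (v_ n x) (w_ n x) (pd j (v_ n) x) (pd j (w_ n) x) (v x) (w x) (G j x) (F j x) => *; ring.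
Qed.

Lemma cvg_RI_bounded k (f_ : nat -> R3 R -> R) f B x : mfun3 k -> (forall y, `|k y| <= B) ->
  (forall n, Li mu (f_ n)) -> Li mu f -> \int[mu]_x `|f_ n x - f x| @[n --> \oo] --> 0 ->
  \int[mu]_y (k y * f_ n (x - y)) @[n --> \oo] --> \int[mu]_y (k y * f (x - y)).
Proof.
move=> mk kB Lf_ Lf cf.
have L g : Li mu g -> Li mu (fun y => k y * g (x - y)).
  move=> Lg; have Lgx := Li_refl x Lg.
  apply: (@Li_le _ _ R mu (fun y => B * `|g (x - y)|)).
  - by apply: measurable_funM => //; exact: Li_measurable Lgx.
  - by move=> y; rewrite normrM ler_wpM2r.
  - by apply: LiZ; exact: Li_norm.
have LB n : Li mu (fun y => f_ n y - f y) by exact: LiB.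
apply: (@cvg_RI _ _ R mu (fun n y => k y * f_ n (x - y)) (fun y => k y * f (x - y))).
- by move=> n; exact: L.
- exact: L.
have cB : B * \int[mu]_x `|f_ n x - f x| @[n --> \oo] --> 0.
  by rewrite -[X in _ --> X](mulr0 B); apply: cvgM; [exact: cvg_cst|].
apply: (squeeze0 _ cB) => n; rewrite RI_ge0//=.
have Ln := Li_norm (LB n).
rewrite -(RI_refl x Ln) -RIZ; last exact: (Li_refl x Ln).
apply: RI_le.
- by apply: Li_norm; apply: LiB; exact: L.
- by apply: LiZ; exact: (Li_refl x Ln).
by move=> y; rewrite -mulrBr normrM ler_wpM2r.
Qed.

Lemma kernel_ibp_W11 j f g e x : 0 < e -> W11 j f g ->
  \int[mu]_y (rke j e y * f (x - y)) = \int[mu]_y (ke e y * g (x - y)).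
Proof.
move=> e0 [Lf Lg [f_ [tf cf cg]]].
have Lfn n := tst_Li (tf n); have Lpn n := tst_Li (tst_pd j (tf n)).
have c1 := @cvg_RI_bounded _ _ _ _ x (measurable_rke j e) (fun y => rke_le j y e0) Lfn Lf cf.
have c2 := @cvg_RI_bounded _ _ _ _ x (measurable_ke e) (fun y => ke_bound y e0) Lpn Lg cg.
apply: (@cvg_unique _ (@norm_hausdorff _ _) _ _ _ _ c1).
rewrite (_ : (fun n => _) = (fun n => \int[mu]_y (ke e y * pd j (f_ n) (x - y)))) //.
by apply/funext => n; exact: kernel_ibp.
Qed.

Lemma truncated_integral j e f x :
  \int[mu]_(y in [set y | e < enorm y]) (riesz_kernel j y * f (x - y)) =
  \int[mu]_y (rke j e y * f (x - y)).
Proof.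
rewrite Rintegral_mkcond; apply: eq_RI => y; rewrite /patch /rke /out.
have [|] := boolP (y \in _).
  by rewrite inE /= => ->; rewrite mul1r.
by rewrite notin_setE /= => /negP/negbTE ->; rewrite !mul0r.
Qed.

Lemma cvg_harmonic_right : n.+1%:R^-1 @[n --> \oo] --> (0 : R)^'+.
Proof.
move=> A [e /= e0 he]; have h := cvg0_le (@cvg_harmonic R) (divr_gt0 e0 (ltr0n _ 2)).
apply: filterS h => n /= hn; apply: he => //=.
rewrite sub0r normrN gtr0_norm//.
by rewrite (le_lt_trans hn)// ltr_pdivrMr// ltr_pMr// ltr1n.
Qed.

Lemma riesz_sequence j f r : is_riesz j f r ->
  {ae mu, forall x, \int[mu]_y (rke j n.+1%:R^-1 y * f (x - y)) @[n --> \oo] --> r x}.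
Proof.
move=> [_ h]; apply: (ae_imp h) => x hx.
have cc := cvg_comp _ _ cvg_harmonic_right hx.
rewrite (_ : (fun n => _) = (fun e => \int[mu]_(y in [set y | e < enorm y])
  (riesz_kernel j y * f (x - y))) \o (fun n : nat => n.+1%:R^-1)) //.
by apply/funext => n /=; rewrite truncated_integral.
Qed.

(** After integration by parts the truncated integrals have the kernel [ke], which agrees with [kk]
    at each y different from 0 once the radius is small and is dominated by a multiple of |y|^-2
    throughout. *)
Lemma riesz_first j f g r : is_riesz j f r -> W11 j f g ->
  {ae mu, forall x, r x = conv kk g x}.
Proof.
move=> fr fg; have [_ Lg _] := fg; have mg := Li_measurable Lg.
have [_ _ _ _ ap] := riesz_potential (Li_norm Lg) (fun x => normr_ge0 _).
apply: (ae_imp2 (riesz_sequence fr) ap) => x cx [Lx _].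
have Lrx : Li mu (fun y => ip 2 y * `|g (x - y)|).
  by have := Li_refl x Lx; apply: eq_Li => y; rewrite subKr.
have Lk : Li mu (fun y => kk y * g (x - y)).
  apply: (@Li_le _ _ R mu (fun y => c / 2 * (ip 2 y * `|g (x - y)|))).
  - by apply: measurable_funM; [exact: measurable_kk|exact: measurable_refl].
  - by move=> y; rewrite normrM mulrA ler_wpM2r// kk_le.
  - exact: LiZ.
have -> : conv kk g x = \int[mu]_y (kk y * g (x - y)).
  by rewrite -(RI_refl x Lk); apply: eq_RI => y; rewrite subKr.
apply: (@cvg_unique _ (@norm_hausdorff _ _) _ _ _ _ cx).
rewrite (_ : (fun n => _) = (fun n => \int[mu]_y (ke n.+1%:R^-1 y * g (x - y)))); last first.
  by apply/funext => n; apply: kernel_ibp_W11.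
have [] // := @Li_dct _ _ R mu (fun n y => ke n.+1%:R^-1 y * g (x - y))
  (fun y => kk y * g (x - y)) (fun y => c / 2 * (ip 2 y * `|g (x - y)|)).
- by move=> n; apply: measurable_funM; [exact: measurable_ke|exact: measurable_refl].
- exact: Li_measurable Lk.
- apply: (ae_imp (@ae_neq0 R)) => y y0; apply: cvgM; last exact: cvg_cst.
  have n0 := nsq0_eq0 y0.
  have h := cvg0_le (@cvg_harmonic R) n0.
  have h1 := cvg0_le (@cvg_harmonic R) (@ltr01 R).
  apply: cvg_near_cst; apply: filterS2 h h1 => n /= hn hn1.
  rewrite /ke /kk (max_idPl _)// expr2 (le_trans _ hn)//.
  by rewrite ler_piMl// invr_ge0.
- exact: LiZ.
- apply: (ae_imp (@ae_neq0 R)) => y y0 n; rewrite normrM mulrA ler_wpM2r//.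
  exact: ke_le.
Qed.

Lemma ae_refl (P : R3 R -> Prop) x : {ae mu, forall y, P y} -> {ae mu, forall y, P (x - y)}.
Proof.
move=> [N [mN N0 sN]]; have m1 : (-1 : R) != 0 by rewrite oppr_eq0 oner_eq0.
have E : (fun y : R3 R => x - y) @^-1` N = (fun y : R3 R => -1 *: y + x) @^-1` N.
  by apply/seteqP; split => y /=; rewrite scaleN1r addrC.
exists ((fun y : R3 R => x - y) @^-1` N); split.
- have := measurable_affine3 (-1) x; move=> /(_ measurableT N mN); rewrite setTI.
  by rewrite E.
- rewrite E; have := @leb3_affine R (-1) x m1 N mN; rewrite N0 normrN1 expr1n mul1e.
  by [].
- by move=> y /= h; apply: sN.
Qed.

Lemma measurable_add3 f : measurable_fun setT f ->
  measurable_fun setT (fun z : R3 R * R3 R => f (z.1 + z.2)).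
Proof.
move=> mf; apply: (measurableT_comp mf).
have e : (fun z : R3 R * R3 R => z.1 + z.2) = (fun z : R3 R * R3 R =>
  (z.1.1.1 + z.2.1.1, z.1.1.2 + z.2.1.2, z.1.2 + z.2.2)).
  by apply/funext => -[[[? ?] ?] [[? ?] ?]].
rewrite e; apply: measurable_fun_pair; [apply: measurable_fun_pair|];
  apply: measurable_funD; repeat (apply: measurableT_comp => //).
Qed.

(** Since r is the convolution of [kk] with g, Fubini's theorem lets the truncated kernel act on
    [kk] instead of on r. There [rke_kk_bound] gives |x - z|^-2 uniformly in e, and g is merely
    integrated against it. *)
Lemma riesz_second i r g e x : 0 < e -> measurable_fun setT r -> Li mu g ->
  {ae mu, forall x, r x = conv kk g x} -> Li mu (fun y => ip 2 (x - y) * `|g y|) ->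
  `|\int[mu]_y (rke i e y * r (x - y))| <= c ^+ 2 * 4000 * conv (ip 2) (fun y => `|g y|) x.
Proof.
move=> e0 mr Lg rE Lx; have mg := Li_measurable Lg.
pose C := c ^+ 2 / 2 * (320 * (e / 2)^-1 ^+ 2).
pose Phi (z : R3 R * R3 R) := rke i e z.1 * (kk (x - (z.1 + z.2)) * g z.2).
have mPhi : measurable_fun setT Phi.
  apply: measurable_funM; first by apply: measurableT_comp => //; exact: measurable_rke.
  apply: measurable_funM; last exact: measurableT_comp.
  by apply: (@measurable_add3 (fun a => kk (x - a))); apply: measurable_refl; exact: measurable_kk.
have E y z : Phi (y, z) = g z * (rke i e y * kk (x - z - y)).
  by rewrite /Phi /= -addrA -opprD [z + y]addrC; move: (kk _) (rke i e y) => a b; ring.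
have LP : Li (product_measure1 (sfleb3 R) (sfleb3 R)) Phi.
  apply: Li3_tonelli2 => //.
    move=> z; apply: (@eq_Li _ _ R mu _ _ (fun y => E y z)); apply: LiZ.
    by have [] := Li_rke_kk i (x - z) e0.
  apply: (@Li_le _ _ R mu (fun z => C * `|g z|)); last by apply: LiZ; exact: Li_norm.
    have mS : measurable_fun setT (fun z : R3 R * R3 R => `|Phi z|) by exact: measurableT_comp.
    exact: (@measurable_RI2 _ _ _ _ R (sfleb3 R) (fun a => `|Phi a|) mS).
  move=> z; rewrite ger0_norm ?RI_ge0//.
  have [L b] := Li_rke_kk i (x - z) e0.
  have -> : \int[mu]_y `|Phi (y, z)| = `|g z| * \int[mu]_y `|rke i e y * kk (x - z - y)|.
    by rewrite -RIZ; [apply: eq_RI => y; rewrite E normrM|exact: Li_norm].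
  by rewrite mulrC ler_wpM2r.
(* Where the convolution at x - y diverges, a constant may not be pulled out of the integral; [Lk]
   shows that such y form a null set. *)
have P1 y : \int[mu]_z Phi (y, z) = rke i e y * conv kk g (x - y) \/ ~ Li mu (fun z => kk (x - y - z) * g z).
  have [h|h] := pselect (Li mu (fun z => kk (x - y - z) * g z)); [left|by right].
  by rewrite /conv -RIZ//; apply: eq_RI => z; rewrite /Phi /= opprD addrA.
have [_ _ _ _ ap] := riesz_potential (Li_norm Lg) (fun x => normr_ge0 _).
have Lk : {ae mu, forall y, Li mu (fun z => kk (x - y - z) * g z)}.
  have := @ae_refl (fun a : R3 R => Li mu (fun z => kk (a - z) * g z)) x; apply.
  apply: (ae_imp ap) => w [Lw _].
  apply: (@Li_le _ _ R mu (fun y => c / 2 * (ip 2 (w - y) * `|g y|))).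
  - by apply: measurable_funM => //; apply: measurable_refl; exact: measurable_kk.
  - by move=> y; rewrite normrM mulrA ler_wpM2r// kk_le.
  - exact: LiZ.
have -> : \int[mu]_y (rke i e y * r (x - y)) = \int[mu]_y \int[mu]_z Phi (y, z).
  apply/esym/RI_ae; first exact: (Li3_RI1 LP).
    by apply: measurable_funM; [exact: measurable_rke|exact: measurable_refl].
  apply: (ae_imp2 Lk (ae_refl x rE)) => y Ly ->.
  by have [|] := P1 y.
rewrite (RI3_fubini LP).
have -> : \int[mu]_z \int[mu]_y Phi (y, z) = \int[mu]_z (g z * \int[mu]_y (rke i e y * kk (x - z - y))).
  apply: eq_RI => z; have [L _] := Li_rke_kk i (x - z) e0.
  by rewrite -RIZ//; apply: eq_RI => y; exact: E.
have LF : Li mu (fun z => g z * \int[mu]_y (rke i e y * kk (x - z - y))).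
  apply: (eq_Li _ (Li3_RI2 LP)) => z; have [L _] := Li_rke_kk i (x - z) e0.
  by rewrite -RIZ//; apply: eq_RI => y; rewrite E.
apply: (le_trans (RI_norm LF)); rewrite /conv -RIZ//.
apply: RI_le_ae; [exact: Li_norm|exact: LiZ|].
apply: (ae_imp (ae_refl x (@ae_neq0 R))) => z z0.
rewrite normrM [leRHS]mulrA mulrC ler_wpM2r//; exact: rke_kk_bound.
Qed.

Lemma double_riesz i j f g r q : is_riesz j f r -> is_riesz i r q -> W11 j f g ->
  {ae mu, forall x, `|q x| <= c ^+ 2 * 4000 * conv (ip 2) (fun y => `|g y|) x}.
Proof.
move=> fr rq fg; have [_ Lg _] := fg; have [mr _] := fr.
have rE := riesz_first fr fg.
have [_ _ _ _ ap] := riesz_potential (Li_norm Lg) (fun x => normr_ge0 _).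
apply: (ae_imp2 (riesz_sequence rq) ap) => x cx [Lx _].
have cn : `|\int[mu]_y (rke i n.+1%:R^-1 y * r (x - y))| @[n --> \oo] --> `|q x| by exact: cvg_norm.
apply: (cvgr_to_le cn); apply: nearW => n.
exact: riesz_second.
Qed.

End riesz_transforms.

(** * The sum of L^1 and L^2 *)

Section sum_space.
Context {R : realType}.
Implicit Types (x y : R3 R) (e : R) (i j : 'I_3) (b f g k v w : R3 R -> R).
Local Notation mu := (leb3 R).

(** The function is dominated by |b1| + |b2| and not decomposed, since the pressure is controlled
    through a pointwise bound by a potential. The majorants are named because their norms enter the
    later estimates. *)
Definition L12 b b1 b2 := [/\ measurable_fun setT b, Li mu b1, L2 mu b2 &
  {ae mu, forall x, `|b x| <= `|b1 x| + `|b2 x|}].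

Lemma Li_L12 b : Li mu b -> L12 b b (fun=> 0).
Proof.
move=> Lb; split => //; first exact: Li_measurable Lb.
  exact: L2_0.
by apply: ae_true => x; rewrite normr0 addr0.
Qed.

Lemma L2_L12 b : L2 mu b -> L12 b (fun=> 0) b.
Proof.
move=> Lb; split => //; [by case: Lb|exact: Li0|].
by apply: ae_true => x; rewrite normr0 add0r.
Qed.

Lemma L12_norm b b1 b2 : L12 b b1 b2 -> L12 (fun x => `|b x|) b1 b2.
Proof.
move=> [mb L1 L2' h]; split => //; first exact: measurableT_comp.
by apply: (ae_imp h) => x; rewrite normr_id.
Qed.

Lemma L12_Lloc b b1 b2 : L12 b b1 b2 -> Lloc b.
Proof.
move=> [mb L1 L2' h]; split => // r.
have [_ /(_ r) Ls] := LlocD (Lloc_norm (Li_Lloc L1)) (Lloc_norm (L2_Lloc L2')).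
apply: (Li_le_ae _ _ Ls).
  by apply: measurable_funM => //; exact: Li_measurable (Li_cube r).
apply: (ae_imp h) => x hx; rewrite normrM ger0_norm ?indicE//.
by rewrite ler_wpM2l.
Qed.

Lemma Cc_norm k : Cc k -> Cc (fun x => `|k x|).
Proof.
move=> [ck [r hr]]; split; first by move=> x; apply: cvg_norm; exact: ck.
by exists r => x /hr ->; rewrite normr0.
Qed.

Lemma L12_conv k b b1 b2 : Cc k -> L12 b b1 b2 -> L2 mu (conv k b) /\
  N2 mu (conv k b) <= N2 mu k * \int[mu]_x `|b1 x| + (\int[mu]_x `|k x|) * N2 mu b2.
Proof.
move=> Ck Lb; have [mb L1 L2' h] := Lb.
have Ckn := Cc_norm Ck; have Ln1 := Li_norm L1; have Ln2 := L2_norm L2'.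
have Lk := Cc_Li Ckn; have L2k := Cc_L2 Ckn.
have [La Na _] := young2 Ln1 L2k; have [Lc Nc _] := young2 Lk Ln2.
have cE : conv (fun x => `|b1 x|) (fun x => `|k x|) = conv (fun x => `|k x|) (fun x => `|b1 x|).
  apply/funext => x; apply: conv_C.
  apply: (eq_Li _ (conv_Li x Ckn (Li_Lloc Ln1))) => y; exact: mulrC.
rewrite cE in La Na.
have Llb := Lloc_norm (L12_Lloc Lb).
have pw x : `|conv k b x| <= conv (fun x => `|k x|) (fun x => `|b1 x|) x +
    conv (fun x => `|k x|) (fun x => `|b2 x|) x.
  apply: (@le_trans _ _ (conv (fun x => `|k x|) (fun x => `|b x|) x)).
    by apply: conv_le => //; exact: L12_Lloc Lb.
  have A1 := conv_Li x Ckn (Li_Lloc Ln1); have A2 := conv_Li x Ckn (L2_Lloc Ln2).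
  rewrite /conv -RID//; apply: RI_le_ae; [exact: (conv_Li x Ckn Llb)|exact: LiD|].
  by apply: (ae_imp h) => y hy; rewrite -mulrDr ler_wpM2l.
have cge0 f g x : (forall y, 0 <= f y) -> (forall y, 0 <= g y) -> 0 <= conv f g x.
  by move=> f0 g0; apply: RI_ge0 => y; exact: mulr_ge0.
have LS := L2D La Lc.
have pw' x : `|conv k b x| <= `|conv (fun x => `|k x|) (fun x => `|b1 x|) x +
    conv (fun x => `|k x|) (fun x => `|b2 x|) x|.
  by rewrite (le_trans (pw x))// ler_norm.
have Lk' : L2 mu (conv k b).
  apply: (@L2_le _ _ R mu (fun x => conv (fun x => `|k x|) (fun x => `|b1 x|) x +
    conv (fun x => `|k x|) (fun x => `|b2 x|) x)); [|exact: pw'|exact: LS].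
  by apply: measurable_conv => //; exact: Cc_measurable.
split => //; apply: (le_trans (N2_le Lk' LS pw')).
apply: (le_trans (N2D La Lc)); apply: lerD.
  have E1 : \int[mu]_x `| `|b1 x| | = \int[mu]_x `|b1 x| by apply: eq_RI => x; rewrite normr_id.
  by move: Na; rewrite E1 N2_norm mulrC.
have E1 : \int[mu]_x `| `|k x| | = \int[mu]_x `|k x| by apply: eq_RI => x; rewrite normr_id.
by move: Nc; rewrite E1 N2_norm.
Qed.

Lemma conv_fubini A k b b1 b2 : L2 mu A -> Cc k -> L12 b b1 b2 ->
  Li mu (fun z => b z * \int[mu]_x (A x * k (x - z))) /\
  \int[mu]_x (A x * conv k b x) = \int[mu]_z (b z * \int[mu]_x (A x * k (x - z))).
Proof.
move=> LA Ck Lb; have [mb _ _ _] := Lb; have mA := L2_measurable LA.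
have mk := Cc_measurable Ck; have Llb := L12_Lloc Lb.
pose Phi (a : R3 R * R3 R) := A a.1 * (k (a.1 - a.2) * b a.2).
have mPhi : measurable_fun setT Phi.
  apply: measurable_funM; first exact: measurableT_comp.
  by apply: measurable_funM; [exact: measurable_sub3|exact: measurableT_comp].
have LP : Li (product_measure1 (sfleb3 R) (sfleb3 R)) Phi.
  apply: Li3_tonelli1 => //.
    by move=> x; exact: (LiZ (A x) (conv_Li x Ck Llb)).
  have [Lc _] := L12_conv (Cc_norm Ck) (L12_norm Lb).
  apply: (eq_Li _ (L2M (L2_norm LA) Lc)) => x.
  rewrite /conv -RIZ; last exact: (conv_Li x (Cc_norm Ck) (Lloc_norm Llb)).
  by apply: eq_RI => y; rewrite /Phi /= !normrM.
have E z : b z * \int[mu]_x (A x * k (x - z)) = \int[mu]_x Phi (x, z).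
  have LAk : Li mu (fun x => A x * k (x - z)).
    by apply: L2M => //; exact: (L2_shift (- z) (Cc_L2 Ck)).
  rewrite -RIZ//; apply: eq_RI => x; rewrite /Phi /=.
  by move: (A x) (k (x - z)) (b z) => p q r; ring.
split.
  by apply: (@eq_Li _ _ R mu _ _ E); exact: (Li3_RI2 LP).
transitivity (\int[mu]_x \int[mu]_z Phi (x, z)).
  by apply: eq_RI => x; rewrite /conv -RIZ//; exact: conv_Li.
by rewrite (RI3_fubini LP); apply: eq_RI => z; rewrite E.
Qed.

(** No regularity of b is involved: Fubini's theorem moves the kernel to the side of A, and for each
    z the weak gradient of A is tested with the translate of k by z. *)
Lemma H1_conv_ibp A DA k b b1 b2 j : H1 A DA -> tst k -> L12 b b1 b2 ->
  \int[mu]_x (A x * conv (pd j k) b x) = - \int[mu]_x (DA j x * conv k b x).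
Proof.
move=> [LA LDA hA] tk Lb; have tpk := tst_pd j tk.
have [_ ->] := conv_fubini LA (tst_Cc tpk) Lb.
have [Lz ->] := conv_fubini (LDA j) (tst_Cc tk) Lb.
rewrite -RIN//; apply: eq_RI => z; rewrite -mulrN; congr (_ * _).
have := hA j _ (tst_shift z tk); rewrite pd_shift; last exact: tst_smooth.
exact.
Qed.

(** Convolution with k is adjoint to convolution with its reflection, which maps test functions to
    test functions and commutes with derivatives. *)
Lemma H1_conv k v (G : 'I_3 -> R3 R -> R) : tst k -> H1 v G ->
  H1 (conv k v) (fun j => conv k (G j)).
Proof.
move=> tk vG; have [Lv LG hG] := vG; have Ck := tst_Cc tk.
have [Lc _] := L12_conv Ck (L2_L12 Lv).
split => //; first by move=> j; have [] := L12_conv Ck (L2_L12 (LG j)).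
move=> j psi tpsi; have Lp := tst_L2 tpsi; have tpp := tst_pd j tpsi.
have Lpp := tst_L2 tpp.
have tkm : tst (fun x => k (- x)).
  by have := tst_refl 0 tk; congr tst; apply/funext => x; rewrite sub0r.
have tc : tst (conv (fun x => k (- x)) psi).
  have [r hr] := tpsi.2; apply: (tst_conv tkm _ hr); exact: tst_Li.
have pc : pd j (conv (fun x => k (- x)) psi) = conv (fun x => k (- x)) (pd j psi).
  rewrite pd_conv//; last exact: tst_Li.
  exact: (conv_pd j tkm (tst_H1 tpsi)).
have adj f h : L2 mu f -> tst h -> \int[mu]_x (conv k f x * h x) =
    \int[mu]_x (f x * conv (fun x => k (- x)) h x).
  move=> Lf th; transitivity (\int[mu]_x (h x * conv k f x)).
    by apply: eq_RI => x; rewrite mulrC.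
  have [_ ->] := conv_fubini (tst_L2 th) Ck (L2_L12 Lf).
  apply: eq_RI => z; congr (_ * _); apply: eq_RI => x.
  by rewrite mulrC opprB.
rewrite adj// -pc hG// -(adj _ _ (LG j) tpsi)//.
Qed.

End sum_space.

(** * A quantitative bound on the pressure *)

Section pressure.
Context {R : realType}.
Implicit Types (x y : R3 R) (i j : 'I_3).
Local Notation mu := (leb3 R).

(** Each of the nine double Riesz transforms is bounded by the |x|^-2 potential of a derivative of
    u_i u_j, and all of these derivatives by their sum [h]. By Cauchy-Schwarz the L^1 norm of [h] is
    a product of one velocity norm and one gradient norm, so the bound is integrable in time. *)
Lemma pressure_bound : exists2 C : R, 0 <= C &
  forall (v : R3 R -> R3 R) (G : 'I_3 -> 'I_3 -> R3 R -> R) (p : R3 R -> R),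
  (forall i, H1 (fun x => comp3 i (v x)) (G i)) -> measurable_fun setT p -> is_pressure v p ->
  exists p1 p2, L12 p p1 p2 /\
   let S := (\sum_i N2 mu (fun x => comp3 i (v x))) * (\sum_i \sum_j N2 mu (G i j)) in
   \int[mu]_x `|p1 x| <= C * S /\ N2 mu p2 <= C * S.
Proof.
have [c0 c00 c0E] : exists2 c0 : R, 0 <= c0 & (pi ^+ 2)^-1 ^+ 2 * 4000 = c0.
  eexists; last reflexivity.
  exact: mulr_ge0 (sqr_ge0 _) (ler0n _ 4000).
have c9 : 0 <= 9 * c0 by exact: (mulr_ge0 (ler0n _ 9) c00).
(* Nine transforms of constant [c0]; 64 for the near part of the potential, which also covers the 12
   of the far part; and 18 S for the integral of [h], two products for each of nine pairs. *)
exists (9 * c0 * 64 * 18); first exact: mulr_ge0 (mulr_ge0 c9 (ler0n _ 64)) (ler0n _ 18).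
move=> v G p vG mp [r [q [hrq pE]]].
pose u i x := comp3 i (v x).
have Lu i : L2 mu (u i) by have [] := vG i.
have LG i j : L2 mu (G i j) by have [_ + _] := vG i.
pose g i j x := G i j x * u j x + u i x * G j j x.
have W i j : W11 j (fun x => u i x * u j x) (g i j) by exact: (W11_mul j (vG i) (vG j)).
have Lg i j : Li mu (g i j) by have [] := W i j.
pose h x := \sum_i \sum_j `|g i j x|.
have Lh : Li mu h by apply: Li_sum => i; apply: Li_sum => j; exact: Li_norm.
have h0 x : 0 <= h x by apply: sumr_ge0 => i _; apply: sumr_ge0 => j _.
have gh i j x : `|g i j x| <= h x.
  rewrite /h (bigD1 i)//= (bigD1 j)//= -addrA lerDl.
  by apply: addr_ge0; apply: sumr_ge0 => k _ //; apply: sumr_ge0.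
have [L1 b1 L2' b2 ap] := riesz_potential Lh h0.
have pw : {ae mu, forall x, `|p x| <= 9 * c0 * (conv (near_ip 2 1) h x + conv (far_ip 2 1) h x)}.
  have aq i j : {ae mu, forall x, `|q i j x| <= c0 * conv (ip 2) (fun y => `|g i j y|) x}.
    by rewrite -c0E; have [h1 h2] := hrq i j; exact: (double_riesz h1 h2 (W i j)).
  have aq' := ae_all (fun i => ae_all (aq i)).
  have alg i j : {ae mu, forall x, Li mu (fun y => ip 2 (x - y) * `|g i j y|)}.
    have [_ _ _ _ ap'] := riesz_potential (Li_norm (Lg i j)) (fun x => normr_ge0 _).
    by apply: (ae_imp ap') => x [].
  have alg' := ae_all (fun i => ae_all (alg i)).
  have a2 := ae_imp2 aq' alg' (fun x (a : _) (b : _) => conj a b).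
  have a3 := ae_imp2 pE ap (fun x (a : _) (b : _) => conj a b).
  apply: (ae_imp2 a2 a3) => x [ha hb] [-> [hL hE]].
  apply: (@le_trans _ _ (\sum_(i < 3) \sum_(j < 3) c0 * conv (ip 2) h x)); last first.
    under eq_bigr do rewrite sumr_const card_ord.
    rewrite sumr_const card_ord -mulrnA -hE -[leLHS]mulr_natl mulrA.
    by rewrite lexx.
  rewrite (le_trans (ler_norm_sum _ _ _))//; apply: ler_sum => i _.
  rewrite (le_trans (ler_norm_sum _ _ _))//; apply: ler_sum => j _.
  rewrite (le_trans (ha i j))// ler_wpM2l//; apply: RI_le => // y.
  by rewrite ler_wpM2l ?ip_ge0.
set S := _ * _.
have S0 : 0 <= S.
  apply: mulr_ge0; apply: sumr_ge0 => i _; first exact: N2_ge0.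
  by apply: sumr_ge0 => j _; exact: N2_ge0.
have gS i j : \int[mu]_x `|g i j x| <= 2 * S.
  have A1 := CS_N2_abs (LG i j) (Lu j); have A2 := CS_N2_abs (Lu i) (LG j j).
  have La := L2M (LG i j) (Lu j); have Lb := L2M (Lu i) (LG j j).
  have lu i' : N2 mu (u i') <= \sum_i N2 mu (u i).
    by rewrite (bigD1 i')//= lerDl; apply: sumr_ge0 => k _; exact: N2_ge0.
  have lG i' j' : N2 mu (G i' j') <= \sum_i \sum_j N2 mu (G i j).
    rewrite (bigD1 i')//= (bigD1 j')//= -addrA lerDl.
    apply: addr_ge0; apply: sumr_ge0 => k _; first exact: N2_ge0.
    by apply: sumr_ge0 => l _; exact: N2_ge0.
  apply: (@le_trans _ _ (\int[mu]_x (`|G i j x * u j x| + `|u i x * G j j x|))).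
    apply: RI_le; [exact: Li_norm|by apply: LiD; exact: Li_norm|].
    by move=> x; exact: ler_normD.
  rewrite RID; [|exact: Li_norm|exact: Li_norm].
  have -> : 2 * S = S + S by rewrite mulrDl mul1r.
  apply: lerD; [apply: (le_trans A1)|apply: (le_trans A2)].
    by rewrite mulrC; apply: ler_pM; rewrite ?N2_ge0.
  by apply: ler_pM; rewrite ?N2_ge0.
clearbody S.
have hS : \int[mu]_x h x <= 18 * S.
  rewrite /h RI_sum; last by move=> i; apply: Li_sum => j; exact: Li_norm.
  apply: (@le_trans _ _ (\sum_(i < 3) \sum_(j < 3) (2 * S))).
    apply: ler_sum => i _; rewrite RI_sum; last by move=> j; exact: Li_norm.
    by apply: ler_sum => j _; exact: gS.
  by rewrite !sum3 le_eqVlt; apply/orP; left; apply/eqP; ring.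
exists (fun x => 9 * c0 * conv (near_ip 2 1) h x), (fun x => 9 * c0 * conv (far_ip 2 1) h x).
split.
  split => //; [exact: LiZ|exact: L2Z|].
  apply: (ae_imp pw) => x hx; rewrite (le_trans hx)// mulrDr.
  by apply: lerD; exact: ler_norm.
move=> S'; have -> : S' = S by [].
split.
  have -> : \int[mu]_x `|9 * c0 * conv (near_ip 2 1) h x| = 9 * c0 * \int[mu]_x `|conv (near_ip 2 1) h x|.
    by rewrite -RIZ; [apply: eq_RI => x; rewrite normrM ger0_norm|exact: Li_norm].
  rewrite -!mulrA; do 2 apply: ler_wpM2l => //.
  by rewrite (le_trans b1)// ler_wpM2l.
rewrite N2Z// (ger0_norm c9) -!mulrA; do 2 apply: ler_wpM2l => //.
rewrite (le_trans b2)//.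
apply: (@le_trans _ _ (12 * (18 * S))); first by rewrite ler_wpM2l.
by rewrite ler_wpM2r ?mulr_ge0// ler_nat.
Qed.

End pressure.

(** * The mollified equation *)

Lemma sum3_bound (R : realType) (f : 'I_3 -> R) : (forall j, 0 <= f j) ->
  exists a, [/\ 0 <= a, \sum_(j < 3) f j = a & forall j, f j <= a].
Proof.
move=> f0; exists (\sum_(j < 3) f j); split => //; first exact: sumr_ge0.
by move=> j; rewrite (bigD1 j)//= lerDl; exact: sumr_ge0.
Qed.

(** The algebra of [mollified_balance]: X is the transport term, Y the viscous term and Z the
    pressure term, each followed by its form after integration by parts. The sum of the Z' is the
    pairing of the pressure with the divergence. *)
Lemma sum3_balance (R : comPzRingType) (nu : R) (X X' Y Y' : 'I_3 -> 'I_3 -> R)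
    (Z Z' W : 'I_3 -> R) :
  (forall i, W i = - (\sum_(j < 3) X i j) + nu * (\sum_(j < 3) Y i j) - Z i) ->
  (forall i j, X i j = - X' i j) -> (forall i j, Y i j = - Y' i j) ->
  (forall i, Z i = - Z' i) -> \sum_(i < 3) Z' i = 0 ->
  \sum_(i < 3) W i =
  \sum_(i < 3) \sum_(j < 3) X' i j - nu * (\sum_(i < 3) \sum_(j < 3) Y' i j).
Proof.
move=> E EX EY EZ Z0; rewrite -[RHS]addr0 -[X in _ + X]Z0 mulr_sumr -sumrB -big_split /=.
apply: eq_bigr => i _; rewrite E EZ opprK.
rewrite (eq_bigr _ (fun j _ => EX i j)) (eq_bigr _ (fun j _ => EY i j)).
by rewrite !sumrN opprK mulrN.
Qed.

Lemma RI_combination d (U : measurableType d) (R : realType)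
    (m : {measure set U -> \bar R}) (c : R) (f g : 'I_3 -> U -> R) (h : U -> R) :
  (forall j, Li m (f j)) -> (forall j, Li m (g j)) -> Li m h ->
  (\int[m]_x (- (\sum_(j < 3) f j x) + c * (\sum_(j < 3) g j x) - h x))%R =
  - (\sum_(j < 3) (\int[m]_x f j x)%R) + c * (\sum_(j < 3) (\int[m]_x g j x)%R) - (\int[m]_x h x)%R.
Proof.
move=> Lf Lg Lh.
have S1 : Li m (fun x => \sum_(j < 3) f j x) by exact: Li_sum.
have S2 : Li m (fun x => \sum_(j < 3) g j x) by exact: Li_sum.
rewrite RIB//; last by apply: LiD; [exact: LiN|exact: LiZ].
rewrite RID; [|exact: LiN|exact: LiZ].
by rewrite RIN// RIZ// !RI_sum.
Qed.

Section mollified_equation.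
Context {R : realType}.
Implicit Types (x y : R3 R) (i j : 'I_3) (k p : R3 R -> R) (u : 'I_3 -> R3 R -> R)
  (G : 'I_3 -> 'I_3 -> R3 R -> R) (nu : R).
Local Notation mu := (leb3 R).

(* The time derivative of [conv k (u i)] for a solution [u] with pressure [p]. *)
Definition force nu k u p i x : R :=
  - (\sum_(j < 3) conv (pd j k) (fun y => u i y * u j y) x)
  + nu * (\sum_(j < 3) conv (pd j (pd j k)) (u i) x) - conv (pd i k) p x.

Definition flux k u G : R :=
  \sum_(i < 3) \sum_(j < 3) \int[mu]_x (conv k (G i j) x * conv k (fun y => u i y * u j y) x).

Definition enstrophy k G : R :=
  \sum_(i < 3) \sum_(j < 3) \int[mu]_x (conv k (G i j) x ^+ 2).

Lemma tst_conv_L2 k f : tst k -> L2 mu f -> L2 mu (conv k f) /\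
  N2 mu (conv k f) <= (\int[mu]_x `|k x|) * N2 mu f.
Proof. by move=> tk Lf; have [? ? _] := young2 (tst_Li tk) Lf. Qed.

Lemma tst_conv_L1 k f : tst k -> Li mu f -> L2 mu (conv k f) /\
  N2 mu (conv k f) <= N2 mu k * \int[mu]_x `|f x|.
Proof.
move=> tk Lf; have [L h] := L12_conv (tst_Cc tk) (Li_L12 Lf).
by split => //; move: h; rewrite N2_0 mulr0 addr0.
Qed.

(** The constant K depends on the kernel and on nu alone, so the bound can be used at all times at
    once, with A fixed and B varying in time. *)
Lemma force_bound nu k : tst k -> exists2 K : R, 0 <= K & forall u p p1 p2 (A B : R) i,
  (forall j, L2 mu (u j)) -> L12 p p1 p2 -> 0 <= A -> 0 <= B ->
  (forall j, N2 mu (u j) <= A) -> \int[mu]_x `|p1 x| <= B -> N2 mu p2 <= B ->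
  L2 mu (force nu k u p i) /\ N2 mu (force nu k u p i) <= K * (A ^+ 2 + A + B).
Proof.
move=> tk; have tp j := tst_pd j tk; have tpp j := tst_pd j (tp j).
have [a [a0 aE aj]] : exists a, [/\ 0 <= a, \sum_(j < 3) N2 mu (pd j k) = a &
    forall j, N2 mu (pd j k) <= a].
  by apply: sum3_bound => j; exact: N2_ge0.
have [b [b0 bE _]] : exists b, [/\ 0 <= b,
    \sum_(j < 3) \int[mu]_x `|pd j (pd j k) x| = b &
    forall j, \int[mu]_x `|pd j (pd j k) x| <= b].
  by apply: sum3_bound => j; exact: RI_ge0.
have [c [c0 _ cj]] : exists c, [/\ 0 <= c, \sum_(j < 3) \int[mu]_x `|pd j k x| = c &
    forall j, \int[mu]_x `|pd j k x| <= c].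
  by apply: sum3_bound => j; exact: RI_ge0.
exists (a + `|nu| * b + c).
  by apply: addr_ge0 => //; apply: addr_ge0 => //; exact: mulr_ge0.
move=> u p p1 p2 A B i Lu Lp A0 B0 uA p1B p2B.
have Luu j : Li mu (fun y => u i y * u j y) by exact: L2M.
have iA j : \int[mu]_x `|u i x * u j x| <= A ^+ 2.
  by rewrite (le_trans (CS_N2_abs (Lu i) (Lu j)))// expr2; apply: ler_pM => //; exact: N2_ge0.
have L1 : L2 mu (fun x => \sum_(j < 3) conv (pd j k) (fun y => u i y * u j y) x).
  by apply: L2_sum => j; have [] := tst_conv_L1 (tp j) (Luu j).
have L2' : L2 mu (fun x => \sum_(j < 3) conv (pd j (pd j k)) (u i) x).
  by apply: L2_sum => j; have [] := tst_conv_L2 (tpp j) (Lu i).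
have [L3 N3] := L12_conv (tst_Cc (tp i)) Lp.
have L1n := L2N L1; have L2n := L2Z nu L2'.
split; first by apply: L2B => //; exact: L2D.
apply: (le_trans (N2B (L2D L1n L2n) L3)).
apply: (le_trans (lerD (N2D L1n L2n) (lexx _))).
rewrite N2N N2Z//.
have b1 : N2 mu (fun x => \sum_(j < 3) conv (pd j k) (fun y => u i y * u j y) x) <= a * A ^+ 2.
  apply: (le_trans (N2_sum _ _)) => [j|]; first by have [] := tst_conv_L1 (tp j) (Luu j).
  rewrite -aE mulr_suml; apply: ler_sum => j _.
  have [_ h] := tst_conv_L1 (tp j) (Luu j).
  by rewrite (le_trans h)// ler_wpM2l// N2_ge0.
have b2 : N2 mu (fun x => \sum_(j < 3) conv (pd j (pd j k)) (u i) x) <= b * A.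
  apply: (le_trans (N2_sum _ _)) => [j|]; first by have [] := tst_conv_L2 (tpp j) (Lu i).
  rewrite -bE mulr_suml; apply: ler_sum => j _.
  have [_ h] := tst_conv_L2 (tpp j) (Lu i).
  by rewrite (le_trans h)// ler_wpM2l// RI_ge0.
have b3 : N2 mu (conv (pd i k) p) <= (a + c) * B.
  rewrite (le_trans N3)// mulrDl; apply: lerD.
    by apply: ler_pM => //; [exact: N2_ge0|exact: RI_ge0].
  by apply: ler_pM => //; [exact: RI_ge0|exact: N2_ge0].
have b2' := ler_wpM2l (normr_ge0 nu) b2.
apply: (le_trans (lerD (lerD b1 b2') b3)).
clear -a0 b0 c0 A0 B0.
have n0 := normr_ge0 nu; move: `|nu| n0 => n n0; have nb := mulr_ge0 n0 b0.
have A2 := sqr_ge0 A; move: (A ^+ 2) A2 => S S0.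
rewrite mulrA -subr_ge0.
have -> : (a + n * b + c) * (S + A + B) - (a * S + n * b * A + (a + c) * B) =
  a * A + n * b * S + n * b * B + c * S + c * A by ring.
by rewrite !addr_ge0// mulr_ge0.
Qed.

Lemma mollified_balance nu k u G p p1 p2 : tst k -> (forall i, H1 (u i) (G i)) ->
  (forall psi, tst psi -> \int[mu]_x (\sum_(i < 3) u i x * pd i psi x) = 0) ->
  L12 p p1 p2 ->
  \sum_(i < 3) \int[mu]_x (conv k (u i) x * force nu k u p i x) =
  flux k u G - nu * enstrophy k G.
Proof.
move=> tk uG udiv Lp; have tp j := tst_pd j tk; have tpp j := tst_pd j (tp j).
have Lu i : L2 mu (u i) by have [] := uG i.
have LG i j : L2 mu (G i j) by have [_ + _] := uG i.
have Luu i j : Li mu (fun y => u i y * u j y) by exact: L2M.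
have Hc i := H1_conv tk (uG i).
have Lw i : L2 mu (conv k (u i)) by have [] := Hc i.
have LcG i j : L2 mu (conv k (G i j)) by have [_ + _] := Hc i.
have pE i j : conv (pd j k) (u i) = conv k (G i j) by exact: (conv_pd j tk (uG i)).
have Lc1 i j : L2 mu (conv (pd j k) (fun y => u i y * u j y)) by have [] := tst_conv_L1 (tp j) (Luu i j).
have Lc2 i j : L2 mu (conv (pd j (pd j k)) (u i)) by have [] := tst_conv_L2 (tpp j) (Lu i).
have Lc3 i : L2 mu (conv (pd i k) p) by have [] := L12_conv (tst_Cc (tp i)) Lp.
have Lp0 : L2 mu (conv k p) by have [] := L12_conv (tst_Cc tk) Lp.
have I1 i j : \int[mu]_x (conv k (u i) x * conv (pd j k) (fun y => u i y * u j y) x) =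
    - \int[mu]_x (conv k (G i j) x * conv k (fun y => u i y * u j y) x).
  exact: (H1_conv_ibp j (Hc i) tk (Li_L12 (Luu i j))).
have I2 i j : \int[mu]_x (conv k (u i) x * conv (pd j (pd j k)) (u i) x) =
    - \int[mu]_x (conv k (G i j) x ^+ 2).
  apply: (etrans (H1_conv_ibp j (Hc i) (tp j) (L2_L12 (Lu i)))); apply: (congr1 -%R).
  by apply: eq_RI => x; rewrite pE expr2.
have I3 i : \int[mu]_x (conv k (u i) x * conv (pd i k) p x) =
    - \int[mu]_x (conv k (G i i) x * conv k p x).
  exact: (H1_conv_ibp i (Hc i) tk Lp).
(* The mollified field is divergence free at every point: the divergence condition is tested with y
   -> k(x - y). *)
have div0 x : \sum_(i < 3) conv k (G i i) x = 0.
  have := udiv _ (tst_refl x tk) => h.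
  have Lx i : Li mu (fun y => pd i k (x - y) * u i y).
    by apply: conv_Li; [exact: tst_Cc|exact: L2_Lloc].
  under eq_bigr do rewrite -pE; rewrite /conv -RI_sum//.
  apply: oppr_inj; rewrite oppr0 -[RHS]h -RIN; last exact: Li_sum.
  apply: eq_RI => y; rewrite -sumrN; apply: eq_bigr => i _.
  rewrite pd_refl; last exact: tst_smooth.
  by rewrite mulrN mulrC.
have P0 : \sum_(i < 3) \int[mu]_x (conv k (G i i) x * conv k p x) = 0.
  rewrite -RI_sum; last by move=> i; exact: L2M.
  rewrite -[RHS](@RI0 _ _ R mu); apply: eq_RI => x.
  by rewrite -mulr_suml div0 mul0r.
have E i : \int[mu]_x (conv k (u i) x * force nu k u p i x) =
    - (\sum_(j < 3) \int[mu]_x (conv k (u i) x * conv (pd j k) (fun y => u i y * u j y) x))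
    + nu * (\sum_(j < 3) \int[mu]_x (conv k (u i) x * conv (pd j (pd j k)) (u i) x))
    - \int[mu]_x (conv k (u i) x * conv (pd i k) p x).
  have M1 j : Li mu (fun x => conv k (u i) x * conv (pd j k) (fun y => u i y * u j y) x) by exact: L2M.
  have M2 j : Li mu (fun x => conv k (u i) x * conv (pd j (pd j k)) (u i) x) by exact: L2M.
  have M3 : Li mu (fun x => conv k (u i) x * conv (pd i k) p x) by exact: L2M.
  apply: etrans (RI_combination nu M1 M2 M3); apply: eq_RI => x; rewrite /force -!mulr_sumr.
  move: (conv k (u i) x) (\sum_(j < 3) _) (\sum_(j < 3) _) (conv (pd i k) p x) => q r s t; ring.
exact: (sum3_balance E I1 I2 I3 P0).
Qed.

End mollified_equation.

(** * Weak differential equations in time *)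

Section weak_ode.
Context {R : realType}.
Implicit Types (s t a b c d e : R) (w F f : R -> R).
Local Notation M := (measurableTypeR R).
Local Notation mfun1 f := (@measurable_fun _ _ M R setT f).
Local Notation oo a b := (\1_(`]a, b[%classic) : R -> R).

(* The kernel d^-1 bump((s - c) / d) is an approximate identity at c. *)
Definition delta_bump c d s : R := d^-1 * bump (d^-1 * s + - (d^-1 * c)).

Lemma delta_bump_ge0 c d s : 0 < d -> 0 <= delta_bump c d s.
Proof. by move=> d0; rewrite mulr_ge0 ?bump_ge0// invr_ge0 ltW. Qed.

Lemma measurable_affine1 d c : @measurable_fun _ _ M M setT (fun s : R => d * s + c).
Proof.
have h : measurable_fun setT (fun s : R => d * s + c).
  by apply: measurable_funD => //; exact: measurable_funM.
exact: h.
Qed.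

Lemma bump_measurable : mfun1 bump.
Proof. exact: Li_measurable bump_Li. Qed.

Lemma delta_bump_int c d : 0 < d -> Li (leb R) (delta_bump c d) /\
  \int[leb R]_s delta_bump c d s = 1.
Proof.
move=> d0; have di0 : 0 < d^-1 by rewrite invr_gt0.
have dn0 : d^-1 != 0 by rewrite gt_eqF.
have mm : mfun1 (delta_bump c d).
  apply: measurable_funM => //.
  exact: (measurableT_comp bump_measurable (measurable_affine1 d^-1 (- (d^-1 * c)))).
have E : (\int[leb R]_s (delta_bump c d s)%:E = 1%:E)%E.
  rewrite -bump_int -RI_E; last exact: bump_Li.
  have dE := @ge0_integral_map _ M R (leb R) (fun s : R => d^-1 * s + - (d^-1 * c)) d^-1 bump
    (ltW di0) (measurable_affine1 _ _).
  rewrite dE//; last 3 first.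
  - by move=> A mA; have := @leb_affine R d^-1 (- (d^-1 * c)) dn0 A mA; rewrite gtr0_norm.
  - exact: bump_measurable.
  - exact: bump_ge0.
  rewrite -ge0_integralZl//.
  - by apply/measurable_EFinP; exact: (measurableT_comp bump_measurable (measurable_affine1 _ _)).
  - by move=> s _; rewrite lee_fin bump_ge0.
  - by rewrite lee_fin ltW.
have L : Li (leb R) (delta_bump c d).
  apply: Li_ge0_lty => //; last by rewrite E ltry.
  by move=> s; exact: delta_bump_ge0.
by split => //; apply: EFin_inj; rewrite -RI_E.
Qed.

Lemma delta_bump_support c d s : 0 < d -> delta_bump c d s != 0 -> `|s - c| < d.
Proof.
move=> d0; apply: contraNT; rewrite -leNgt => h; rewrite /delta_bump bump_support ?mulr0//.
by rewrite -mulrBr normrM gtr0_norm ?invr_gt0// mulrC ler_pdivlMr// mul1r.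
Qed.

Lemma delta_bump_avg c d w l e : 0 < d -> mfun1 w ->
  (forall s, `|s - c| < d -> `|w s - l| <= e) ->
  Li (leb R) (fun s => delta_bump c d s * w s) /\
  `|\int[leb R]_s (delta_bump c d s * w s) - l| <= e.
Proof.
move=> d0 mw hw; have [L I] := delta_bump_int c d0; have mL := Li_measurable L.
have pw s : `|delta_bump c d s * (w s - l)| <= e * delta_bump c d s.
  have [->|h] := eqVneq (delta_bump c d s) 0; first by rewrite mul0r mulr0 normr0.
  rewrite normrM (ger0_norm (delta_bump_ge0 c s d0)) mulrC ler_wpM2r ?delta_bump_ge0//.
  by apply: hw; exact: delta_bump_support h.
have L1 : Li (leb R) (fun s => delta_bump c d s * (w s - l)).
  apply: (@Li_le _ _ R (leb R) (fun s => e * delta_bump c d s)) => //; last exact: LiZ.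
  by apply: measurable_funM => //; exact: measurable_funB.
have E s : delta_bump c d s * w s = delta_bump c d s * (w s - l) + l * delta_bump c d s.
  by move: (delta_bump c d s) (w s) => p q; ring.
have L2' : Li (leb R) (fun s => delta_bump c d s * w s).
  by apply: (@eq_Li _ _ R (leb R) _ _ E); apply: LiD => //; exact: LiZ.
split => //; have -> : \int[leb R]_s (delta_bump c d s * w s) - l =
    \int[leb R]_s (delta_bump c d s * (w s - l)).
  rewrite (@eq_RI _ _ R (leb R) _ _ E) RID//; last exact: LiZ.
  by rewrite RIZ// I mulr1 addrK.
apply: (le_trans (RI_norm_le L1 (LiZ e L) pw)).
by rewrite RIZ// I mulr1.
Qed.

(** A smooth plateau inside [a, b]. The transitions are centred at a + 2 d and b - 2 d and have
    half-width d, so the support stays at distance d from the endpoints and the derivative is a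
    difference of two approximate identities. *)
Definition cutoff a b d s : R :=
  step (d^-1 * s + - (d^-1 * (a + 2 * d))) - step (d^-1 * s + - (d^-1 * (b - 2 * d))).

Lemma smooth_cutoff a b d : smooth (cutoff a b d).
Proof.
have -> : cutoff a b d = (fun s => step (d^-1 * s + - (d^-1 * (a + 2 * d))) +
  (- 1) * step (d^-1 * s + - (d^-1 * (b - 2 * d)))).
  by apply/funext => s; rewrite mulN1r.
by apply: smoothD; [|apply: smoothZ]; apply: smooth_affine1; exact: smooth_step.
Qed.

Lemma is_derive_step_aff c d s : is_derive s (1 : R)
  (fun s => step (d^-1 * s + - (d^-1 * c))) (delta_bump c d s).
Proof.
have AL (x v h : R) : d^-1 * (h *: v + x) + - (d^-1 * c) = h *: (d^-1 * v) + (d^-1 * x + - (d^-1 * c)).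
  by rewrite /GRing.scale /=; ring.
have ss := @smooth_step R.
apply: DeriveDef.
  have [_ h] := @derivable_affine R R R (fun x => d^-1 * x + - (d^-1 * c)) (fun v : R => d^-1 * v) AL step s 1.
  by apply: h; exact: smooth_derivable.
have := @derive_affine R R R (fun x => d^-1 * x + - (d^-1 * c)) (fun v : R => d^-1 * v) AL step s 1.
rewrite /comp => ->; have [_ ->] := is_derive_dir (d^-1 * 1) (is_derive_step (d^-1 * s + - (d^-1 * c))).
by rewrite mulr1.
Qed.

Lemma derive_cutoff a b d s : 'D_1 (cutoff a b d) s =
  delta_bump (a + 2 * d) d s - delta_bump (b - 2 * d) d s.
Proof.
by have [_ ->] := is_deriveB (is_derive_step_aff (a + 2 * d) d s) (is_derive_step_aff (b - 2 * d) d s).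
Qed.

Lemma step_aff_lt c d s : 0 < d -> s <= c - d -> step (d^-1 * s + - (d^-1 * c)) = 0.
Proof.
move=> d0 h; apply: step_lt; rewrite -mulrBr mulrC ler_pdivrMr//; lra.
Qed.

Lemma step_aff_gt c d s : 0 < d -> c + d <= s -> step (d^-1 * s + - (d^-1 * c)) = 1.
Proof.
move=> d0 h; apply: step_gt; rewrite -mulrBr mulrC ler_pdivlMr//; lra.
Qed.

Lemma cutoff_support a b d s : 0 < d -> 6 * d <= b - a -> cutoff a b d s != 0 ->
  a + d <= s <= b - d.
Proof.
move=> d0 ab; apply: contraNT; rewrite negb_and -!ltNge => /orP[h|h]; rewrite /cutoff.
  by rewrite !step_aff_lt ?subrr//; lra.
by rewrite !step_aff_gt ?subrr//; lra.
Qed.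

Lemma cutoff_range a b d s : 0 < d -> 6 * d <= b - a -> `|cutoff a b d s| <= 1.
Proof.
move=> d0 ab; rewrite /cutoff.
have /andP[? ?] := step_range (d^-1 * s + - (d^-1 * (a + 2 * d))).
have /andP[? ?] := step_range (d^-1 * s + - (d^-1 * (b - 2 * d))).
by rewrite ler_norml; apply/andP; split; lra.
Qed.

Lemma cutoff_1 a b d s : 0 < d -> a + 3 * d <= s -> s <= b - 3 * d -> cutoff a b d s = 1.
Proof.
move=> d0 h1 h2; rewrite /cutoff step_aff_gt//; last lra.
by rewrite step_aff_lt// ?subr0//; lra.
Qed.

(** The radius d may depend on t: this is continuity of the restriction of w to [0, T], at its
    endpoints included, with no condition outside. *)
Definition uniform_cont T w := forall t, 0 <= t <= T -> forall e, 0 < e ->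
  exists2 d, 0 < d & forall s, 0 <= s <= T -> `|s - t| < d -> `|w s - w t| <= e.

Lemma oo_in a b s : oo a b s = (a < s < b)%R%:R.
Proof.
rewrite indicE; congr (nat_of_bool _)%:R; apply/idP/idP; by rewrite inE /= in_itv.
Qed.

Lemma measurable_oo a b : mfun1 (oo a b).
Proof. by apply: measurable_indic; exact: measurable_itv. Qed.

Lemma Li_oo a b f : Li (leb R) f -> Li (leb R) (fun s => oo a b s * f s).
Proof.
move=> Lf; apply: (@Li_le _ _ R (leb R) (fun s => `|f s|)); last exact: Li_norm.
  by apply: measurable_funM; [exact: measurable_oo|exact: Li_measurable Lf].
by move=> s; rewrite normrM ler_piMl// oo_in; case: (_ < _ < _); rewrite ?normr1 ?normr0.
Qed.

Lemma window_left T a b c d s : 0 <= a -> b <= T -> 6 * d <= b - a -> d * 4 <= c ->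
  `|s - (a + 2 * d)| < d -> 0 <= s <= T /\ `|s - a| < c.
Proof.
rewrite !ltr_norml => *; have /andP[? ?] : - d < s - (a + 2 * d) < d by [].
by split; apply/andP; split; lra.
Qed.

Lemma window_right T a b c d s : 0 <= a -> b <= T -> 6 * d <= b - a -> d * 4 <= c ->
  `|s - (b - 2 * d)| < d -> 0 <= s <= T /\ `|s - b| < c.
Proof.
rewrite !ltr_norml => *; have /andP[? ?] : - d < s - (b - 2 * d) < d by [].
by split; apply/andP; split; lra.
Qed.

Lemma dist_of_balance e (p q P Q I : R) : `|P - p| <= e / 2 -> `|Q - q| <= e / 2 -> P - Q + I = 0 ->
  `|q - p - I| <= e.
Proof. by rewrite !ler_norml => /andP[? ?] /andP[? ?] ?; apply/andP; split; lra. Qed.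

(** Tests with [cutoff a b d] and lets d tend to 0. The derivative of the cut-off averages w near a
    and near b, which by continuity gives w a - w b; the cut-off itself tends to the indicator of
    the open interval. The endpoints 0 and T are reached because both averages are taken inside
    [a, b]. *)
Lemma weak_ode T w F : mfun1 w -> uniform_cont T w -> Li (leb R) F ->
  (forall psi d, smooth psi -> 0 < d -> (forall s, psi s != 0 -> d <= s <= T - d) ->
    \int[leb R]_s ('D_1 psi s * w s + psi s * F s) = 0) ->
  forall a b, 0 <= a -> a <= b -> b <= T ->
  w b - w a = \int[leb R]_s (oo a b s * F s).
Proof.
move=> mw cw LF H a b a0; rewrite le_eqVlt => /predU1P[<- _|ab bT].
  rewrite subrr -[LHS](@RI0 _ _ R (leb R)); apply: eq_RI => s.
  rewrite oo_in; have [/andP[h1 h2]|_] := boolP (a < s < a); last by rewrite mul0r.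
  by move: (lt_trans h1 h2); rewrite ltxx.
have at_ : 0 <= a <= T by apply/andP; split; lra.
have bt_ : 0 <= b <= T by apply/andP; split; lra.
(* A plateau of width d needs three times d at each end, hence at most a sixth of the interval. *)
pose d0 n : R := (b - a) / 6 * n.+1%:R^-1.
have ba6 : 0 < (b - a) / 6 by lra.
have d00 n : 0 < d0 n by rewrite /d0 mulr_gt0// invr_gt0.
have d06 n : 6 * d0 n <= b - a.
  have i1 : n.+1%:R^-1 <= 1 :> R by rewrite invf_le1 ?ltr0n// ler1n.
  have : d0 n <= (b - a) / 6 by rewrite /d0 ler_piMr// ltW.
  by lra.
have cd : d0 n @[n --> \oo] --> 0.
  rewrite -[X in _ --> X](mulr0 ((b - a) / 6)).
  by apply: cvgM; [exact: cvg_cst|exact: cvg_harmonic].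
have mF := Li_measurable LF.
have C1 : \int[leb R]_s (cutoff a b (d0 n) s * F s) @[n --> \oo] --> \int[leb R]_s (oo a b s * F s).
  have mc n : mfun1 (cutoff a b (d0 n)).
    by apply: continuous_measurable_fun; apply: smooth_continuous; exact: smooth_cutoff.
  have [] // := @Li_dct _ _ R (leb R) (fun n s => cutoff a b (d0 n) s * F s)
    (fun s => oo a b s * F s) (fun s => `|F s|).
  - by move=> n; exact: measurable_funM.
  - by apply: measurable_funM => //; exact: measurable_oo.
  - apply: nearW => s; apply: cvgM; last exact: cvg_cst.
    rewrite oo_in; have [/andP[h1 h2]|h] := boolP (a < s < b).
      have m0 : 0 < Num.min (s - a) (b - s) / 3 by rewrite divr_gt0// lt_min !subr_gt0 h1.
      apply: cvg_near_cst; apply: filterS (cvg0_le cd m0) => n.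
      rewrite ler_pdivlMr// le_min => /andP[k1 k2]; apply: cutoff_1 => //; lra.
    apply: cvg_near_cst; apply: nearW => n; apply/eqP.
    apply: contraNT h => /(cutoff_support (d00 n) (d06 n)) /andP[k1 k2].
    by have := d00 n; move=> ?; apply/andP; split; lra.
  - exact: Li_norm.
  - by apply: nearW => s n; rewrite normrM ler_piMl// cutoff_range.
have C2 : \int[leb R]_s (cutoff a b (d0 n) s * F s) @[n --> \oo] --> w b - w a.
  apply/cvgrPdist_le => e e0; have e2 : 0 < e / 2 by rewrite divr_gt0.
  have [da da0 ha] := cw a at_ _ e2; have [db db0 hb] := cw b bt_ _ e2.
  have m0 : 0 < Num.min da db / 4 by rewrite divr_gt0// lt_min da0.
  apply: filterS (cvg0_le cd m0) => n; rewrite ler_pdivlMr// le_min => /andP[k1 k2].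
  have dn := d00 n; have dn6 := d06 n; set d := d0 n in dn dn6 k1 k2 *.
  have [La Ia] : Li (leb R) (fun s => delta_bump (a + 2 * d) d s * w s) /\
      `|\int[leb R]_s (delta_bump (a + 2 * d) d s * w s) - w a| <= e / 2.
    apply: delta_bump_avg => // s hs.
    by have [h1 h2] := window_left a0 bT dn6 k1 hs; exact: ha.
  have [Lb Ib] : Li (leb R) (fun s => delta_bump (b - 2 * d) d s * w s) /\
      `|\int[leb R]_s (delta_bump (b - 2 * d) d s * w s) - w b| <= e / 2.
    apply: delta_bump_avg => // s hs.
    by have [h1 h2] := window_right a0 bT dn6 k2 hs; exact: hb.
  have LcF : Li (leb R) (fun s => cutoff a b d s * F s).
    apply: (@Li_le _ _ R (leb R) (fun s => `|F s|)); last exact: Li_norm.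
      apply: measurable_funM => //.
      by apply: continuous_measurable_fun; apply: smooth_continuous; exact: smooth_cutoff.
    by move=> s; rewrite normrM ler_piMl// cutoff_range.
  have sup s : cutoff a b d s != 0 -> d <= s <= T - d.
    move=> /(cutoff_support dn dn6) /andP[s1 s2]; apply/andP; split.
      by rewrite (le_trans _ s1)// lerDr.
    by rewrite (le_trans s2)// lerD2r.
  have := H _ d (smooth_cutoff a b d) dn sup.
  have -> : \int[leb R]_s ('D_1 (cutoff a b d) s * w s + cutoff a b d s * F s) =
      \int[leb R]_s (delta_bump (a + 2 * d) d s * w s) -
      \int[leb R]_s (delta_bump (b - 2 * d) d s * w s) + \int[leb R]_s (cutoff a b d s * F s).
    rewrite -RIB// -RID//; last exact: LiB.
    by apply: eq_RI => s; rewrite derive_cutoff mulrBl.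
  exact: dist_of_balance Ia Ib.
exact: (@cvg_unique _ (@norm_hausdorff _ _) _ _ _ _ C2 C1).
Qed.

Lemma ae_neq s : {ae leb R, forall t, t != s}.
Proof.
exists [set s]; split; [exact: measurable_set1|exact: lebesgue_measure_set1|].
by move=> t /= /negP; rewrite negbK => /eqP.
Qed.

(* Fubini on the triangle r < s: twice the integral of f(s) f(r) is the square
   of the integral of f. *)
Lemma triangle f : Li (leb R) f ->
  Li (leb R) (fun s => f s * \int[leb R]_r ((r < s)%R%:R * f r)) /\
  2 * \int[leb R]_s (f s * \int[leb R]_r ((r < s)%R%:R * f r)) = (\int[leb R]_s f s) ^+ 2.
Proof.
move=> Lf; have mf := Li_measurable Lf.
pose H (z : M * M) : R := (z.2 < z.1)%R%:R * (f z.1 * f z.2).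
have Lt s : Li (leb R) (fun r => (r < s)%R%:R * f r).
  apply: (@Li_le _ _ R (leb R) (fun r => `|f r|)); last exact: Li_norm.
    apply: measurable_funM => //.
    rewrite (_ : (fun r : R => _) = \1_(`]-oo, s[%classic)); first by apply: measurable_indic; exact: measurable_itv.
    apply/funext => r; rewrite indicE; congr (nat_of_bool _)%:R; apply/idP/idP; by rewrite inE /= in_itv.
  by move=> r; rewrite normrM ler_piMl//; case: (_ < _); rewrite ?normr1 ?normr0.
have LH : Li (product_measure1 (leb R) (leb R)) H.
  apply: (@Li_le _ _ R (product_measure1 (leb R) (leb R)) (fun z : M * M => `|f z.1 * f z.2|)).
  - apply: measurable_funM; last by apply: measurable_funM; exact: measurableT_comp.
    rewrite (_ : (fun z => _) = \1_[set z : M * M | z.2 < z.1]).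
      apply: measurable_indic.
      have h : measurable_fun setT (fun z : M * M => z.2 < z.1).
        by apply: measurable_fun_ltr; [exact: measurable_snd|exact: measurable_fst].
      have := h measurableT [set true] I; rewrite setTI.
      by have -> : (fun z : M * M => z.2 < z.1) @^-1` [set true] = [set z | z.2 < z.1] by apply/seteqP; split => z.
    by apply/funext => z; rewrite indicE; congr (nat_of_bool _)%:R; apply/idP/idP; rewrite inE.
  - by move=> z; rewrite normrM ler_piMl//; case: (_ < _); rewrite ?normr1 ?normr0.
  - by apply: Li_norm; exact: (@Li_tensor _ _ _ _ R (leb R) (leb R)).
have E1 s : \int[leb R]_r H (s, r) = f s * \int[leb R]_r ((r < s)%R%:R * f r).
  by rewrite -RIZ//; apply: eq_RI => r; rewrite /H /=; ring.
have L1 : Li (leb R) (fun s => f s * \int[leb R]_r ((r < s)%R%:R * f r)).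
  by apply: (@eq_Li _ _ R (leb R) _ _ (fun s => esym (E1 s))); exact: (@Li_RI1 _ _ _ _ R (leb R) (leb R) H).
split => //.
have Lt' s : Li (leb R) (fun r => (s < r)%R%:R * f r).
  apply: (@Li_le _ _ R (leb R) (fun r => `|f r|)); last exact: Li_norm.
    apply: measurable_funM => //.
    rewrite (_ : (fun r : R => _) = \1_(`]s, +oo[%classic)); first by apply: measurable_indic; exact: measurable_itv.
    apply/funext => r; rewrite indicE; congr (nat_of_bool _)%:R; apply/idP/idP; by rewrite inE /= in_itv /= andbT.
  by move=> r; rewrite normrM ler_piMl//; case: (_ < _); rewrite ?normr1 ?normr0.
have E2 s : \int[leb R]_r H (r, s) = f s * \int[leb R]_r ((s < r)%R%:R * f r).
  by rewrite -RIZ//; apply: eq_RI => r; rewrite /H /=; ring.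
have L2' : Li (leb R) (fun s => f s * \int[leb R]_r ((s < r)%R%:R * f r)).
  by apply: (@eq_Li _ _ R (leb R) _ _ (fun s => esym (E2 s))); exact: (@Li_RI2 _ _ _ _ R (leb R) (leb R) H).
have S : \int[leb R]_s (f s * \int[leb R]_r ((r < s)%R%:R * f r)) =
    \int[leb R]_s (f s * \int[leb R]_r ((s < r)%R%:R * f r)).
  transitivity (\int[leb R]_s \int[leb R]_r H (s, r)); first by apply: eq_RI => s; rewrite E1.
  rewrite (@RI_fubini _ _ _ _ R (leb R) (leb R) H LH).
  by apply: eq_RI => s; rewrite E2.
rewrite mulrDl mul1r [X in _ + X]S expr2.
apply: (etrans (esym (RID L1 L2'))); apply: (etrans _ (RIZr _ Lf)).
apply: eq_RI => s; rewrite -mulrDr; apply: (congr1 (fun q => f s * q)).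
apply: (etrans (esym (RID (Lt s) (Lt' s)))); apply: (RI_ae (LiD (Lt s) (Lt' s)) mf).
apply: (ae_imp (ae_neq s)) => r; rewrite neq_lt -mulrDl => /orP[h|h]; rewrite h ltNge (ltW h);
  by rewrite ?addr0 ?add0r mul1r.
Qed.

(** With I the integral of F over ]a, b[, w(s) is replaced under the integral by w(a) plus the
    integral of F from a to s. The double integral is I^2 / 2 by [triangle], and 2 w(a) I + I^2 is
    the difference of the squares. *)
Lemma chain_rule T w F : Li (leb R) F ->
  (forall a b, 0 <= a -> a <= b -> b <= T -> w b - w a = \int[leb R]_s (oo a b s * F s)) ->
  forall a b, 0 <= a -> a <= b -> b <= T ->
  Li (leb R) (fun s => oo a b s * (w s * F s)) /\
  w b ^+ 2 - w a ^+ 2 = 2 * \int[leb R]_s (oo a b s * (w s * F s)).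
Proof.
move=> LF H a b a0 ab bT; pose f s := oo a b s * F s.
have Lf : Li (leb R) f by exact: Li_oo.
have [Lt It] := triangle Lf.
have E s : oo a b s * (w s * F s) = w a * f s + f s * \int[leb R]_r ((r < s)%R%:R * f r).
  rewrite /f oo_in; have [/andP[h1 h2]|_] := boolP (a < s < b); last by rewrite !mul0r mulr0 add0r.
  have := H a s a0 (ltW h1) (le_trans (ltW h2) bT).
  have -> : \int[leb R]_r (oo a s r * F r) = \int[leb R]_r ((r < s)%R%:R * (oo a b r * F r)).
    apply: eq_RI => r; rewrite !oo_in mulrA -natrM mulnb; congr ((nat_of_bool _)%:R * _).
    by apply/idP/idP => [/andP[k1 k2]|/andP[k1 /andP[k2 k3]]]; rewrite ?k1 ?k2 ?k3//= (lt_trans k2).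
  move: (\int[leb R]_r _) => I /eqP; rewrite subr_eq => /eqP ->.
  by rewrite !mul1r; ring.
have L : Li (leb R) (fun s => oo a b s * (w s * F s)).
  by apply: (@eq_Li _ _ R (leb R) _ _ E); apply: LiD => //; exact: LiZ.
split => //; rewrite (@eq_RI _ _ R (leb R) _ _ E) RID//; last exact: LiZ.
rewrite RIZ// mulrDr It; have := H a b a0 ab bT; rewrite -/(f _).
move: (\int[leb R]_s f s) => I h; have -> : w b = w a + I by rewrite -h addrC subrK.
by ring.
Qed.

End weak_ode.

(** * Space-time slabs *)

Section space_time.
Context {R : realType}.
Implicit Types (x y : R3 R) (i j : 'I_3) (k : R3 R -> R) (s t a b c d e : R)
  (f g : R3 R * R -> R) (psi : R -> R).
Local Notation mu := (leb3 R).
Local Notation mut := (product_measure1 (sfleb3 R) (leb R)).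
Local Notation M := (measurableTypeR R).
Local Notation mfun1 f := (@measurable_fun _ _ M R setT f).
Local Notation mfun3 f := (@measurable_fun _ _ (M * M * M)%type R setT f).
Local Notation mfun4 f := (@measurable_fun _ _ (M * M * M * M)%type R setT f).
Local Notation oo a b := (\1_(`]a, b[%classic) : R -> R).

Definition slice f s : R3 R -> R := fun x => f (x, s).

Lemma measurable_slice f s : mfun4 f -> mfun3 (slice f s).
Proof. exact: (@measurable_pair2 _ _ _ _ R f s). Qed.

Lemma measurable_RIx f : mfun4 f -> mfun1 (fun s => \int[mu]_x f (x, s)).
Proof. exact: (@measurable_RI2 _ _ (M * M * M)%type M R (sfleb3 R) f). Qed.

Lemma RIx_fubini f : Li mut f -> \int[mu]_x \int[leb R]_s f (x, s) = \int[leb R]_s \int[mu]_x f (x, s).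
Proof. exact: (@RI_fubini _ _ (M * M * M)%type M R (sfleb3 R) (leb R) f). Qed.

Lemma RIx_fubini21 f : Li mut f -> \int[leb R]_s \int[mu]_x f (x, s) = \int[leb3t R]_z f z.
Proof. exact: (@RI_fubini21 _ _ (M * M * M)%type M R (sfleb3 R) (leb R) f). Qed.

Lemma Lix_tonelli f (B : R -> R) : mfun4 f -> (forall s, Li mu (slice f s)) ->
  Li (leb R) B -> (forall s, \int[mu]_x `|f (x, s)| <= B s) -> Li mut f.
Proof.
move=> mf Lf LB fB; apply: (@Li_tonelli2 _ _ (M * M * M)%type M R (sfleb3 R) (leb R) f) => //.
apply: (@Li_le _ _ R (leb R) B _ _ _ LB).
  by apply: (@measurable_RIx (fun z => `|f z|)); exact: measurableT_comp.
by move=> s; rewrite ger0_norm ?RI_ge0.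
Qed.

Lemma measurable_conv_slice k f : mfun3 k -> mfun4 f -> mfun4 (fun z => conv k (slice f z.2) z.1).
Proof.
move=> mk mf; apply: (@measurable_RI1 _ _ (M * M * M * M)%type (M * M * M)%type R (sfleb3 R)
  (fun p : (M * M * M * M) * (M * M * M) => k (p.1.1 - p.2) * f (p.2, p.1.2))).
apply: measurable_funM.
  apply: (measurableT_comp (measurable_sub3 mk) (f := fun z : R3 R * R3 R => k (z.1 - z.2))
   (g := fun p : (M * M * M * M) * (M * M * M) => (p.1.1, p.2))).
  apply: measurable_fun_pair; last exact: measurable_snd.
  by apply: (measurableT_comp measurable_fst); exact: measurable_fst.
apply: (measurableT_comp mf); apply: measurable_fun_pair; first exact: measurable_snd.
by apply: (measurableT_comp measurable_snd); exact: measurable_fst.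
Qed.

Lemma measurable_snd4 (h : R -> R) : mfun1 h -> mfun4 (fun z => h z.2).
Proof. by move=> mh; apply: (measurableT_comp mh); exact: measurable_snd. Qed.

Lemma measurable_fst4 k : mfun3 k -> mfun4 (fun z => k z.1).
Proof. by move=> mh; apply: (measurableT_comp mh); exact: measurable_fst. Qed.

Lemma smooth_fst4 k : smooth k -> smooth (fun z : R3 R * R => k z.1).
Proof.
move=> sk; apply: (@smooth_affine R (R3 R) (R3 R * R)%type fst fst) => //.
by move=> z; exact: cvg_fst.
Qed.

Lemma smooth_snd4 psi : smooth psi -> smooth (fun z : R3 R * R => psi z.2).
Proof.
move=> sk; apply: (@smooth_affine R R (R3 R * R)%type snd snd) => //.
by move=> z; exact: cvg_snd.
Qed.

Lemma derive_dir0 (V W : normedModType R) (h : V -> W) (p : V) : 'D_(0 : V) h p = 0.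
Proof.
rewrite /derive (_ : (fun _ => _) = fun=> 0); first by apply/cvg_lim => //; exact: cvg_cst.
by apply/funext => a /=; rewrite scaler0 add0r subrr scaler0.
Qed.

Lemma derive_tensor k psi (v : R3 R) (w : R) (z : R3 R * R) : smooth k -> smooth psi ->
  'D_((v, w) : R3 R * R) (fun z => k z.1 * psi z.2) z =
  k z.1 * 'D_w psi z.2 + psi z.2 * 'D_v k z.1.
Proof.
move=> sk sp; have s1 := smooth_fst4 sk; have s2 := smooth_snd4 sp.
have d1 : 'D_((v, w) : R3 R * R) (fun z => k z.1) z = 'D_v k z.1.
  by have := @derive_affine R (R3 R) (R3 R * R)%type fst fst (fun _ _ _ => erefl) k z (v, w).
have d2 : 'D_((v, w) : R3 R * R) (fun z => psi z.2) z = 'D_w psi z.2.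
  by have := @derive_affine R R (R3 R * R)%type snd snd (fun _ _ _ => erefl) psi z (v, w).
have h := @deriveM R (R3 R * R)%type (fun z => k z.1) (fun z => psi z.2) z (v, w)
  (smooth_derivable s1) (smooth_derivable s2).
by apply: (etrans h); rewrite d1 d2.
Qed.

Lemma d_x_tensor k psi j : smooth k -> smooth psi ->
  d_x j (fun z => k z.1 * psi z.2) = (fun z => pd j k z.1 * psi z.2).
Proof.
by move=> sk sp; apply/funext => z; rewrite /d_x derive_tensor// derive_dir0 mulr0 add0r mulrC.
Qed.

Lemma d_t_tensor k psi z : smooth k -> smooth psi ->
  d_t (fun z => k z.1 * psi z.2) z = k z.1 * 'D_1 psi z.2.
Proof.
by move=> sk sp; rewrite /d_t derive_tensor// derive_dir0 mulr0 addr0.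
Qed.

Lemma laplacian_tensor k psi z : smooth k -> smooth psi ->
  laplacian (fun z => k z.1 * psi z.2) z = (\sum_(j < 3) pd j (pd j k) z.1) * psi z.2.
Proof.
move=> sk sp; rewrite /laplacian mulr_suml; apply: eq_bigr => j _.
by rewrite (d_x_tensor j sk sp) (d_x_tensor j (smooth_derive (evec j) sk) sp).
Qed.

Lemma test_tensor T k psi d : tst k -> smooth psi -> 0 < d ->
  (forall s, psi s != 0 -> d <= s <= T - d) ->
  test_function (setT `*` `]0, T[) (fun z : R3 R * R => k z.1 * psi z.2).
Proof.
move=> [sk [r hr]] sp d0 hp; split.
  by apply: smoothM; [exact: smooth_fst4|exact: smooth_snd4].
exists (cube r `*` `[d, T - d]%classic); split.
- by apply: compact_setX; [exact: compact_cube|exact: segment_compact].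
- by move=> [x s] [/= _]; rewrite !in_itv /= => /andP[? ?]; split => //; apply/andP; split; lra.
- move=> [x s] /= h; have [->|p0] := eqVneq (psi s) 0; first by rewrite mulr0.
  have [rx|rx] := ltP r `|x|; first by rewrite hr ?mul0r.
  by case: h; split => //; rewrite /= in_itv /=; exact: hp.
Qed.

(** A side condition in [slab], where it keeps the integrands of the weak equation measurable. It is
    verified for the tensor products k(x) psi(t), the test functions from which the evolution is
    derived. *)
Definition measurable_test (phi : R3 R * R -> R) := [/\ mfun4 (fun z => d_t phi z),
  forall j, mfun4 (fun z => d_x j phi z) & mfun4 (fun z => laplacian phi z)].

Lemma measurable_tensor k psi : tst k -> smooth psi ->
  measurable_test (fun z : R3 R * R => k z.1 * psi z.2).
Proof.
move=> tk sp; have sk := tst_smooth tk.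
have m q (h : R -> R) : tst q -> smooth h -> mfun4 (fun z => q z.1 * h z.2).
  move=> tq sh; apply: measurable_funM; first by apply: measurable_fst4; exact: tst_measurable.
  by apply: measurable_snd4; apply: continuous_measurable_fun; exact: smooth_continuous.
split.
- have -> : (fun z => d_t (fun z : R3 R * R => k z.1 * psi z.2) z) = (fun z => k z.1 * 'D_1 psi z.2).
    by apply/funext => z; rewrite d_t_tensor.
  exact: (m k (fun s => 'D_1 psi s) tk (smooth_derive (1 : R) sp)).
- by move=> j; rewrite (d_x_tensor j sk sp); exact: (m _ _ (tst_pd j tk) sp).
- have -> : (fun z => laplacian (fun z : R3 R * R => k z.1 * psi z.2) z) =
      (fun z => \sum_(j < 3) pd j (pd j k) z.1 * psi z.2).
    by apply/funext => z; rewrite laplacian_tensor// mulr_suml.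
  by apply: measurable_sum => j; exact: (m _ _ (tst_pd j (tst_pd j tk)) sp).
Qed.

End space_time.

(** * Weak solutions cut to good times *)

Section slab.
Context {R : realType}.
Implicit Types (x y : R3 R) (i j : 'I_3) (k : R3 R -> R) (s t a b c d e : R)
  (f g P : R3 R * R -> R) (U V : 'I_3 -> R3 R * R -> R) (G : 'I_3 -> 'I_3 -> R3 R * R -> R)
  (psi B : R -> R) (nu T A : R).
Local Notation mu := (leb3 R).
Local Notation mut := (product_measure1 (sfleb3 R) (leb R)).
Local Notation M := (measurableTypeR R).
Local Notation mfun1 f := (@measurable_fun _ _ M R setT f).
Local Notation mfun3 f := (@measurable_fun _ _ (M * M * M)%type R setT f).
Local Notation mfun4 f := (@measurable_fun _ _ (M * M * M * M)%type R setT f).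
Local Notation oo a b := (\1_(`]a, b[%classic) : R -> R).

(* [V] is the velocity at all times of [0, T]; [U], [G] and [P] are velocity,
   gradient and pressure set to 0 outside ]0, T[ and on a null set of exceptional
   times, and [B] dominates their slices. *)
Record slab nu T A B V U G P : Prop := Slab {
  slab_A : 0 <= A;
  slab_B : Li (leb R) B;
  slab_B0 : forall s, 0 <= B s;
  slab_B1 : forall s, 0 < s < T -> 1 <= B s;
  slab_mV : forall i, mfun4 (V i);
  slab_mU : forall i, mfun4 (U i);
  slab_mP : mfun4 P;
  slab_V : forall s i, L2 mu (slice (V i) s) /\ N2 mu (slice (V i) s) <= A;
  slab_cont : forall i k, L2 mu k ->
    uniform_cont T (fun s => \int[mu]_y (k y * slice (V i) s y));
  slab_UV : forall s, (0 < s < T /\ forall i, slice (U i) s = slice (V i) s) \/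
    ((forall i, slice (U i) s = fun=> 0) /\ slice P s = fun=> 0);
  slab_ae : {ae leb R, forall s, forall i, slice (U i) s = slice (V i) s};
  slab_H1 : forall s i, H1 (slice (U i) s) (fun j => slice (G i j) s);
  slab_G : forall s i j, N2 mu (slice (G i j) s) ^+ 2 <= B s;
  slab_P : forall s, exists p1 p2,
    [/\ L12 (slice P s) p1 p2, \int[mu]_x `|p1 x| <= B s & N2 mu p2 <= B s];
  slab_NS : forall phi, test_function (setT `*` `]0, T[) phi -> measurable_test phi ->
    forall i,
    \int[leb3t R]_z (U i z * d_t phi z + \sum_(j < 3) U i z * U j z * d_x j phi z
      + nu * U i z * laplacian phi z + P z * d_x i phi z) = 0;
  slab_div : forall phi, test_function (setT `*` `]0, T[) phi -> measurable_test phi ->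
    \int[leb3t R]_z (\sum_(i < 3) U i z * d_x i phi z) = 0
}.

Lemma conv_0 k : conv k (fun=> 0) = fun=> 0.
Proof.
by apply/funext => x; rewrite /conv -[RHS](@RI0 _ _ R mu); apply: eq_RI => y; rewrite mulr0.
Qed.

Lemma L12_point k (b b1 b2 : R3 R -> R) c x : tst k -> (forall y, `|k y| <= c) -> L12 b b1 b2 ->
  Li mu (fun y => k (x - y) * b y) /\
  \int[mu]_y `|k (x - y) * b y| <= c * (\int[mu]_y `|b1 y|) + N2 mu k * N2 mu b2.
Proof.
move=> tk kc Lb; have Lx : Li mu (fun y => k (x - y) * b y).
  by apply: conv_Li; [exact: tst_Cc|exact: L12_Lloc Lb].
have [mb L1 L2' h] := Lb; split => //.
have Lk : L2 mu (fun y => k (x - y)) by apply: L2_refl; exact: tst_L2.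
have Nk : N2 mu (fun y => k (x - y)) = N2 mu k.
  by rewrite /N2; congr Num.sqrt; apply: (RI_refl (f := fun y => k y ^+ 2)); exact: L2_sq (tst_L2 tk).
have I1 := LiZ c (Li_norm L1); have I2 := Li_norm (L2M Lk L2').
apply: (@le_trans _ _ (\int[mu]_y (c * `|b1 y| + `|k (x - y) * b2 y|))).
  apply: RI_le_ae; [exact: Li_norm|exact: LiD|].
  apply: (ae_imp h) => y hy; rewrite !normrM.
  apply: (le_trans (ler_wpM2l (normr_ge0 _) hy)); rewrite mulrDr lerD2r.
  by rewrite ler_wpM2r.
rewrite RID// RIZ//; last exact: Li_norm.
by rewrite lerD2l -Nk; exact: CS_N2_abs.
Qed.

(* Slices controlled, uniformly up to the factor [B], in L^1 + L^2. *)
Definition dominated T B f := [/\ mfun4 f, forall x s, ~~ (0 < s < T) -> f (x, s) = 0 &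
  exists2 c, 0 <= c & forall s, exists p1 p2,
  [/\ L12 (slice f s) p1 p2, \int[mu]_x `|p1 x| <= c * B s & N2 mu p2 <= c * B s]].

Lemma dominated_term T B f k psi x : Li (leb R) B -> (forall s, 0 <= B s) -> dominated T B f ->
  tst k -> continuous psi ->
  [/\ Li mut (fun z => k (x - z.1) * f z * psi z.2),
   Li (leb R) (fun s => psi s * conv k (slice f s) x) &
   \int[leb3t R]_z (k (x - z.1) * f z * psi z.2) =
   \int[leb R]_s (psi s * conv k (slice f s) x)].
Proof.
move=> LB B0 [mf f0 [c c0 fc]] tk cpsi.
have [r [r0 hr]] := tst_bounded tk.
have [q q0 hq] : exists2 q, 0 <= q & forall s, 0 < s < T -> `|psi s| <= q.
  have [q [_ hq]] := compact_bounded (continuous_compact (continuous_subspaceT cpsi) (@segment_compact _ 0 T)).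
  exists (`|q| + 1); first by rewrite addr_ge0.
  move=> s /andP[s0 s1]; apply: hq; first by rewrite (le_lt_trans (ler_norm q))// ltrDl.
  by exists s => //; rewrite /= in_itv /= !ltW.
pose D s := q * ((r + N2 mu k) * c * B s).
have LD : Li (leb R) D by apply: LiZ; exact: LiZ.
have mk := tst_measurable tk.
have L : Li mut (fun z => k (x - z.1) * f z * psi z.2).
  apply: (@Lix_tonelli R _ D) => //.
  - apply: measurable_funM; last by apply: measurable_snd4; exact: continuous_measurable_fun.
    by apply: measurable_funM => //; apply: (@measurable_fst4 R (fun y => k (x - y))); exact: measurable_refl.
  - move=> s; have [p1 [p2 [Lp _ _]]] := fc s.
    by have [h _] := L12_point x tk hr Lp; exact: (LiZr (psi s) h).
  - move=> s; have [s1|s1] := boolP (0 < s < T); last first.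
      rewrite (_ : (fun y => _) = fun=> 0); last by apply/funext => y; rewrite f0// mulr0 mul0r normr0.
      by rewrite RI0 mulr_ge0// mulr_ge0// mulr_ge0// addr_ge0 ?(ltW r0) ?N2_ge0.
    have [p1 [p2 [Lp h1 h2]]] := fc s; have [Lx Ix] := L12_point x tk hr Lp.
    have -> : \int[mu]_y `|k (x - y) * f (y, s) * psi s| = `|psi s| * \int[mu]_y `|k (x - y) * f (y, s)|.
      by rewrite -RIZ; [apply: eq_RI => y; rewrite normrM mulrC|exact: (Li_norm Lx)].
    apply: ler_pM => //; [exact: RI_ge0|exact: hq|].
    apply: (le_trans Ix); rewrite -mulrA mulrDl; apply: lerD.
      by rewrite ler_wpM2l// ltW.
    by rewrite ler_wpM2l// N2_ge0.
have E s : \int[mu]_y (k (x - y) * f (y, s) * psi s) = psi s * conv k (slice f s) x.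
  have [p1 [p2 [Lp _ _]]] := fc s; have [Lx _] := L12_point x tk hr Lp.
  by rewrite /conv -RIZ//; apply: eq_RI => y; rewrite mulrC.
split => //.
  apply: (@eq_Li _ _ R (leb R) _ _ (fun s => esym (E s))).
  exact: (@Li_RI2 _ _ _ _ R (sfleb3 R) (leb R) _ L).
by rewrite -RIx_fubini21//; apply: eq_RI => s; rewrite E.
Qed.

Section slab_lemmas.
Context nu T A B V U G P (H : slab nu T A B V U G P).

Lemma slab_U s i : L2 mu (slice (U i) s) /\ N2 mu (slice (U i) s) <= A.
Proof.
have [[_ ->]|[-> _]] := slab_UV H s; first exact: (slab_V H).
by rewrite N2_0; split; [exact: L2_0|exact: slab_A H].
Qed.

Lemma slab_out s : ~~ (0 < s < T) -> (forall i, slice (U i) s = fun=> 0) /\ slice P s = fun=> 0.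
Proof. by move=> h; case: (slab_UV H s) => // -[h']; rewrite h' in h. Qed.

Lemma dominated_U i : dominated T B (U i).
Proof.
split; first exact: (slab_mU H).
  by move=> x s /slab_out[/(_ i) h _]; have := congr1 (fun q : R3 R -> R => q x) h.
exists A; first exact: (slab_A H).
move=> s; have [L N] := slab_U s i; have B0 := slab_B0 H s; have A0 := slab_A H.
exists (fun=> 0), (slice (U i) s); split; first exact: L2_L12.
  have -> : \int[mu]_x `|(fun=> 0 : R) x| = 0 :> R.
    by rewrite -[RHS](@RI0 _ _ R mu); apply: eq_RI => x; rewrite normr0.
  exact: mulr_ge0.
have [s1|/slab_out[-> _]] := boolP (0 < s < T); last by rewrite N2_0; exact: mulr_ge0.
by rewrite (le_trans N)// ler_peMr//; exact: (slab_B1 H).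
Qed.

Lemma dominated_UU i j : dominated T B (fun z => U i z * U j z).
Proof.
split; first by apply: measurable_funM; exact: (slab_mU H).
  move=> x s /slab_out[/(_ i) h _]; have := congr1 (fun q : R3 R -> R => q x) h.
  by rewrite /slice => ->; rewrite mul0r.
exists (A ^+ 2); first exact: sqr_ge0.
move=> s; have B0 := slab_B0 H s; have A0 := slab_A H.
have [Li_ Ni] := slab_U s i; have [Lj Nj] := slab_U s j.
have LL := L2M Li_ Lj.
exists (fun x => slice (U i) s x * slice (U j) s x), (fun=> 0); split; first exact: Li_L12.
  have [s1|/slab_out[hU _]] := boolP (0 < s < T).
    rewrite (le_trans (CS_N2_abs Li_ Lj))// (@le_trans _ _ (A ^+ 2))//.
      by rewrite expr2; apply: ler_pM => //; exact: N2_ge0.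
    by rewrite ler_peMr ?sqr_ge0//; exact: (slab_B1 H).
  have -> : \int[mu]_x `|slice (U i) s x * slice (U j) s x| = 0.
    by rewrite -[RHS](@RI0 _ _ R mu); apply: eq_RI => x; rewrite hU mul0r normr0.
  by rewrite mulr_ge0// sqr_ge0.
by rewrite N2_0 mulr_ge0// sqr_ge0.
Qed.

Lemma dominated_P : dominated T B P.
Proof.
split; first exact: (slab_mP H).
  by move=> x s /slab_out[_ h]; have := congr1 (fun q : R3 R -> R => q x) h.
exists 1 => // s; have [p1 [p2 [L h1 h2]]] := slab_P H s.
by exists p1, p2; rewrite mul1r.
Qed.

Lemma pd_pd_refl k j x : tst k ->
  pd j (pd j (fun y => k (x - y))) = fun y => pd j (pd j k) (x - y).
Proof.
move=> tk; rewrite pd_refl; last exact: tst_smooth.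
have st := tst_smooth (tst_refl x (tst_pd j tk)); apply/funext => y.
have := @deriveN _ _ _ (fun y => pd j k (x - y)) y (evec j) (smooth_derivable st).
move=> h; apply: (etrans h).
have := congr1 (fun q : R3 R -> R => q y) (@pd_refl R j x (pd j k) (tst_smooth (tst_pd j tk))).
by rewrite /pd => ->; rewrite opprK.
Qed.

Definition mollified_velocity k i s x := conv k (slice (U i) s) x.
Definition mollified_force k i s x := force nu k (fun j => slice (U j) s) (slice P s) i x.

(** With x fixed, the weak equation tested with k(x - y) psi(s) says that [mollified_velocity] at x
    has the weak time derivative [mollified_force]. A first derivative of the test function brings a
    sign from the reflection, a second one none. *)
Lemma slab_equation k i x psi d : tst k -> smooth psi -> 0 < d ->
  (forall s, psi s != 0 -> d <= s <= T - d) ->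
  Li (leb R) (fun s => 'D_1 psi s * mollified_velocity k i s x) /\
  \int[leb R]_s ('D_1 psi s * mollified_velocity k i s x + psi s * mollified_force k i s x) = 0.
Proof.
move=> tk sp d0 hp; have tx := tst_refl x tk; have sk := tst_smooth tk; have sx := tst_smooth tx.
have tp j := tst_pd j tk; have tpp j := tst_pd j (tp j).
have LB := slab_B H; have B0 := slab_B0 H.
have cp := smooth_continuous sp; have cp' := smooth_continuous (smooth_derive (1 : R) sp).
have [a1 a2 a3] := dominated_term x LB B0 (dominated_U i) tk cp'.
have b1 j := dominated_term x LB B0 (dominated_UU i j) (tp j) cp.
have c1 j := dominated_term x LB B0 (dominated_U i) (tpp j) cp.
have [d1 d2 d3] := dominated_term x LB B0 dominated_P (tp i) cp.
have bL j : Li (leb3t R) (fun z : R3 R * R => pd j k (x - z.1) * (U i z * U j z) * psi z.2) by have [] := b1 j.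
have cL j : Li (leb3t R) (fun z : R3 R * R => pd j (pd j k) (x - z.1) * U i z * psi z.2) by have [] := c1 j.
have bl j : Li (leb R) (fun s => psi s * conv (pd j k) (slice (fun z => U i z * U j z) s) x) by have [] := b1 j.
have cl j : Li (leb R) (fun s => psi s * conv (pd j (pd j k)) (slice (U i) s) x) by have [] := c1 j.
split => //; have := slab_NS H (test_tensor tx sp d0 hp) (measurable_tensor tx sp) i => h; apply: etrans h.
apply: (@etrans _ _ (\int[leb3t R]_z (k (x - z.1) * U i z * 'D_1 psi z.2 +
  (- (\sum_(j < 3) pd j k (x - z.1) * (U i z * U j z) * psi z.2)
   + nu * (\sum_(j < 3) pd j (pd j k) (x - z.1) * U i z * psi z.2)
   - pd i k (x - z.1) * P z * psi z.2)))); last first.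
  pose phi (z : R3 R * R) := k (x - z.1) * psi z.2.
  have dt z : d_t phi z = k (x - z.1) * 'D_1 psi z.2 by exact: (d_t_tensor z sx sp).
  have dx j z : d_x j phi z = - pd j k (x - z.1) * psi z.2.
    have := congr1 (fun q : R3 R * R -> R => q z) (d_x_tensor j sx sp).
    by rewrite pd_refl//= => ->.
  have lap z : laplacian phi z = (\sum_(j < 3) pd j (pd j k) (x - z.1)) * psi z.2.
    have lt := laplacian_tensor z sx sp.
    have E : \sum_(j < 3) pd j (pd j (fun y => k (x - y))) z.1 = \sum_(j < 3) pd j (pd j k) (x - z.1).
      by apply: eq_bigr => j _; rewrite pd_pd_refl.
    rewrite E in lt; exact: lt.
  apply: eq_RI => z; rewrite -/(phi) dt lap dx.
  under [in RHS]eq_bigr do rewrite dx.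
  have -> : \sum_(j < 3) U i z * U j z * (- pd j k (x - z.1) * psi z.2) =
      - \sum_(j < 3) pd j k (x - z.1) * (U i z * U j z) * psi z.2.
    by rewrite -sumrN; apply: eq_bigr => j _; ring.
  have -> : \sum_(j < 3) pd j (pd j k) (x - z.1) * U i z * psi z.2 =
      (\sum_(j < 3) pd j (pd j k) (x - z.1)) * (U i z * psi z.2).
    by rewrite mulr_suml; apply: eq_bigr => j _; rewrite mulrA.
  by move: (\sum_(j < 3) _) (\sum_(j < 3) _) => p q; ring.
have Lc : Li (leb3t R) (fun z : R3 R * R =>
   - (\sum_(j < 3) pd j k (x - z.1) * (U i z * U j z) * psi z.2)
   + nu * (\sum_(j < 3) pd j (pd j k) (x - z.1) * U i z * psi z.2)
   - pd i k (x - z.1) * P z * psi z.2).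
  by apply: LiB => //; apply: LiD; [apply: LiN|apply: LiZ]; exact: Li_sum.
have lc : Li (leb R) (fun s => - (\sum_(j < 3) psi s * conv (pd j k) (slice (fun z => U i z * U j z) s) x)
   + nu * (\sum_(j < 3) psi s * conv (pd j (pd j k)) (slice (U i) s) x)
   - psi s * conv (pd i k) (slice P s) x).
  by apply: LiB => //; apply: LiD; [apply: LiN|apply: LiZ]; exact: Li_sum.
have E1 := RI_combination nu bL cL d1; have E2 := RI_combination nu bl cl d2.
apply: (etrans _ (esym (RID a1 Lc))).
apply: (@etrans _ _ (\int[leb R]_s ('D_1 psi s * mollified_velocity k i s x) + \int[leb R]_s
   (- (\sum_(j < 3) psi s * conv (pd j k) (slice (fun z => U i z * U j z) s) x)
   + nu * (\sum_(j < 3) psi s * conv (pd j (pd j k)) (slice (U i) s) x)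
   - psi s * conv (pd i k) (slice P s) x))); last first.
  apply: (congr2 +%R); first exact: (esym a3).
  apply: (etrans E2); apply: (etrans _ (esym E1)); apply: (congr2 (fun p q => p - q)); last exact: (esym d3).
  apply: (congr2 (fun p q => - p + nu * q)); apply: eq_bigr => j _.
    by have [_ _ h] := b1 j; exact: (esym h).
  by have [_ _ h] := c1 j; exact: (esym h).
rewrite -RID//; apply: eq_RI => s.
rewrite /mollified_force /force /mollified_velocity -!mulr_sumr; congr (_ + _).
rewrite !mulrDr !mulrN; congr (_ + _ - _); by rewrite mulrCA.
Qed.

End slab_lemmas.
End slab.

(** * The energy balance of the mollified velocity *)

Section slab_energy.
Context {R : realType}.
Implicit Types (x y : R3 R) (i j : 'I_3) (k : R3 R -> R) (s t a b c d e : R) (psi : R -> R).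
Local Notation mu := (leb3 R).
Local Notation mut := (product_measure1 (sfleb3 R) (leb R)).
Local Notation M := (measurableTypeR R).
Local Notation mfun1 f := (@measurable_fun _ _ M R setT f).
Local Notation mfun3 f := (@measurable_fun _ _ (M * M * M)%type R setT f).
Local Notation mfun4 f := (@measurable_fun _ _ (M * M * M * M)%type R setT f).
Local Notation oo a b := (\1_(`]a, b[%classic) : R -> R).
Context (nu T A : R) (B : R -> R) (V U : 'I_3 -> R3 R * R -> R)
  (G : 'I_3 -> 'I_3 -> R3 R * R -> R) (P : R3 R * R -> R) (H : slab nu T A B V U G P).
Local Notation wU := (mollified_velocity U).
Local Notation wF := (mollified_force nu U P).

Lemma measurable_wU k i : tst k -> mfun4 (fun z => wU k i z.2 z.1).
Proof. by move=> tk; apply: measurable_conv_slice; [exact: tst_measurable|exact: slab_mU H i]. Qed.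

Lemma measurable_wF k i : tst k -> mfun4 (fun z => wF k i z.2 z.1).
Proof.
move=> tk; have tp j := tst_pd j tk; have tpp j := tst_pd j (tp j).
have mU := slab_mU H; apply: measurable_funB; first apply: measurable_funD.
- apply: measurableT_comp => //; apply: measurable_sum => j.
  apply: (@measurable_conv_slice R (pd j k) (fun z => U i z * U j z)); first exact: tst_measurable.
  exact: measurable_funM.
- apply: measurable_funM => //; apply: measurable_sum => j.
  by apply: (@measurable_conv_slice R (pd j (pd j k)) (U i)) => //; exact: tst_measurable.
- by apply: (@measurable_conv_slice R (pd i k) P); [exact: tst_measurable|exact: slab_mP H].
Qed.

Lemma wF_Li k i x psi : tst k -> continuous psi -> Li (leb R) (fun s => psi s * wF k i s x).
Proof.
move=> tk cp; have tp j := tst_pd j tk; have tpp j := tst_pd j (tp j).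
have LB := slab_B H; have B0 := slab_B0 H.
have bl j : Li (leb R) (fun s => psi s * conv (pd j k) (slice (fun z => U i z * U j z) s) x).
  by have [] := dominated_term x LB B0 (dominated_UU H i j) (tp j) cp.
have cl j : Li (leb R) (fun s => psi s * conv (pd j (pd j k)) (slice (U i) s) x).
  by have [] := dominated_term x LB B0 (dominated_U H i) (tpp j) cp.
have [_ d2 _] := dominated_term x LB B0 (dominated_P H) (tp i) cp.
have lc : Li (leb R) (fun s => - (\sum_(j < 3) psi s * conv (pd j k) (slice (fun z => U i z * U j z) s) x)
   + nu * (\sum_(j < 3) psi s * conv (pd j (pd j k)) (slice (U i) s) x)
   - psi s * conv (pd i k) (slice P s) x).
  by apply: LiB => //; apply: LiD; [apply: LiN|apply: LiZ]; exact: Li_sum.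
apply: (@eq_Li _ _ R (leb R) _ _ _ lc) => s.
rewrite /force -!mulr_sumr.
rewrite !mulrDr !mulrN; congr (_ + _ - _); by rewrite mulrCA.
Qed.

Lemma uniform_cont_conv k i x : tst k -> uniform_cont T (fun s => conv k (slice (V i) s) x).
Proof. by move=> tk; apply: (slab_cont H i); apply: L2_refl; exact: tst_L2. Qed.

Lemma measurable_conv_V k i x : tst k -> mfun1 (fun s => conv k (slice (V i) s) x).
Proof.
move=> tk; apply: (@measurable_pair1 _ _ (M * M * M)%type M R (fun z => conv k (slice (V i) z.2) z.1) x).
by apply: measurable_conv_slice; [exact: tst_measurable|exact: slab_mV H i].
Qed.

(** The weak equation is known for [U], continuity in time for [V]. They agree at almost every time,
    so the values of [V] at every time evolve by the force computed from [U]. *)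
Lemma conv_evolution k i x : tst k -> forall a b, 0 <= a -> a <= b -> b <= T ->
  conv k (slice (V i) b) x - conv k (slice (V i) a) x = \int[leb R]_s (oo a b s * wF k i s x).
Proof.
move=> tk; apply: weak_ode.
- exact: measurable_conv_V.
- exact: uniform_cont_conv.
- have c1 : continuous (fun _ : R => 1 : R) by move=> s; exact: cvg_cst.
  by apply: (@eq_Li _ _ R (leb R) _ _ _ (wF_Li i x tk c1)) => s; rewrite mul1r.
move=> psi d sp d0 hp; have [L1 E] := slab_equation H i x tk sp d0 hp.
have L2 := wF_Li i x tk (smooth_continuous sp).
rewrite -[RHS]E; symmetry; apply: RI_ae; first exact: LiD.
  apply: measurable_funD; last exact: Li_measurable L2.
  apply: measurable_funM; last exact: measurable_conv_V.
  by apply: continuous_measurable_fun; exact: smooth_continuous (smooth_derive (1 : R) sp).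
by apply: (ae_imp (slab_ae H)) => s hs; rewrite /mollified_velocity hs.
Qed.

Lemma wF_out k i s x : (forall j, slice (U j) s = fun=> 0) -> slice P s = (fun=> 0) -> wF k i s x = 0.
Proof.
move=> hU hP; rewrite /mollified_force /force hP conv_0 subr0.
rewrite big1 => [|j _]; last first.
  rewrite hU (_ : (fun y => _) = fun=> 0) ?conv_0//.
  by apply/funext => y; rewrite mul0r.
rewrite big1 => [|j _]; last by rewrite hU conv_0.
by rewrite mulr0 oppr0 addr0.
Qed.

Lemma conv_square_evolution k i x a b : tst k -> 0 <= a -> a <= b -> b <= T ->
  conv k (slice (V i) b) x ^+ 2 - conv k (slice (V i) a) x ^+ 2 =
  2 * \int[leb R]_s (oo a b s * (wU k i s x * wF k i s x)).
Proof.
move=> tk a0 ab bT; have c1 : continuous (fun _ : R => 1 : R) by move=> s; exact: cvg_cst.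
have LF : Li (leb R) (fun s => wF k i s x).
  by apply: (@eq_Li _ _ R (leb R) _ _ _ (wF_Li i x tk c1)) => s; rewrite mul1r.
have [_ ->] := chain_rule LF (conv_evolution i x tk) a0 ab bT.
apply: (congr1 (fun q => 2 * q)); apply: eq_RI => s; apply: (congr1 (fun q => oo a b s * q)).
have [[_ h]|[h1 h2]] := slab_UV H s; first by rewrite /mollified_velocity h.
by rewrite wF_out// !mulr0.
Qed.

(** The joint integrability under which the evolution at fixed x can be integrated over x and the
    order of integration exchanged. *)
Lemma energy_integrand_Li k i a b : tst k -> 0 <= a -> b <= T ->
  Li mut (fun z => oo a b z.2 * (wU k i z.2 z.1 * wF k i z.2 z.1)).
Proof.
move=> tk a0 bT; have [K K0 hK] := force_bound nu tk.
have A0 := slab_A H; have B0 := slab_B0 H.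
have hF s : L2 mu (wF k i s) /\ N2 mu (wF k i s) <= K * (A ^+ 2 + A + B s).
  have [p1 [p2 [Lp h1 h2]]] := slab_P H s.
  apply: (hK (fun j => slice (U j) s) (slice P s) p1 p2 A (B s) i) => //.
  - by move=> j; have [] := slab_U H s j.
  - by move=> j; have [] := slab_U H s j.
have hW s : L2 mu (wU k i s) /\ N2 mu (wU k i s) <= (\int[mu]_x `|k x|) * A.
  have [LU NU] := slab_U H s i; have [L N] := tst_conv_L2 tk LU; split => //.
  by rewrite (le_trans N)// ler_wpM2l// RI_ge0.
have k0 : 0 <= \int[mu]_x `|k x| by exact: RI_ge0.
(* As B >= 1 on ]0, T[, the bound A^2 + A + B from [force_bound] is at most (A^2 + A + 1) B, a
   multiple of an integrable function. *)
pose D s := (\int[mu]_x `|k x|) * A * (K * ((A ^+ 2 + A + 1) * B s)).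
have LD : Li (leb R) D by do 3 apply: LiZ; exact: slab_B H.
apply: (@Lix_tonelli R _ D) => //.
- apply: measurable_funM; first by apply: measurable_snd4; exact: measurable_oo.
  by apply: measurable_funM; [exact: measurable_wU|exact: measurable_wF].
- move=> s; have [LW _] := hW s; have [LF _] := hF s.
  exact: (LiZ (oo a b s) (L2M LW LF)).
- move=> s; have [LW NW] := hW s; have [LF NF] := hF s.
  have -> : \int[mu]_x `|oo a b s * (wU k i s x * wF k i s x)| =
      oo a b s * \int[mu]_x `|wU k i s x * wF k i s x|.
    rewrite -RIZ; last exact: Li_norm (L2M LW LF).
    by apply: eq_RI => x; rewrite normrM [X in X * _]ger0_norm// indicE.
  rewrite oo_in; have [/andP[s1 s2]|_] := boolP (a < s < b); last first.
    rewrite mul0r /D; apply: mulr_ge0; first exact: mulr_ge0.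
    by apply: mulr_ge0 => //; apply: mulr_ge0 => //; rewrite !addr_ge0// sqr_ge0.
  rewrite mul1r (le_trans (CS_N2_abs LW LF))//.
  have B1 : 1 <= B s by apply: (slab_B1 H); rewrite (le_lt_trans a0 s1) (lt_le_trans s2 bT).
  apply: ler_pM => //; [exact: N2_ge0|exact: N2_ge0|].
  apply: (le_trans NF); apply: ler_wpM2l => //.
  rewrite [leRHS]mulrDl mul1r lerD2r mulrDl; apply: lerD; apply: ler_peMr => //.
  exact: sqr_ge0.
Qed.

Lemma N2_sqrB (f g : R3 R -> R) : L2 mu f -> L2 mu g ->
  N2 mu f ^+ 2 - N2 mu g ^+ 2 = \int[mu]_x (f x ^+ 2 - g x ^+ 2).
Proof. by move=> Lf Lg; rewrite (N2_sqr mu f) (N2_sqr mu g) RIB//; exact: L2_sq. Qed.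

Lemma window_center s q d r : 2 * q <= d -> 2 * q <= s -> 2 * q <= T - s -> `|r - s| < q ->
  0 <= r <= T /\ `|r - s| < d.
Proof.
rewrite !ltr_norml => *; have /andP[? ?] : - q < r - s < q by [].
by split; apply/andP; split; lra.
Qed.

Lemma window_center_support s q r : 2 * q <= s -> 2 * q <= T - s -> `|r - s| < q ->
  q <= r <= T - q.
Proof. by rewrite ltr_norml => ? ? /andP[? ?]; apply/andP; split; lra. Qed.

Lemma sum3_third e : \sum_(i < 3) e / 3 = e.
Proof. by rewrite !big_ord_recl big_ord0; lra. Qed.

(** The divergence condition holds in the sense of distributions on space-time. At a given time s it
    follows because the pairing [h] is continuous in time and its averages against approximate
    identities at s vanish. *)
Lemma slab_divergence s phi : tst phi ->
  \int[mu]_x (\sum_(i < 3) slice (U i) s x * pd i phi x) = 0.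
Proof.
move=> tphi; have tp i := tst_pd i tphi.
have [[/andP[s0 sT] hU]|[hU _]] := slab_UV H s; last first.
  rewrite -[RHS](@RI0 _ _ R mu); apply: eq_RI => x; rewrite big1// => i _.
  by rewrite hU mul0r.
pose h t := \int[mu]_x (\sum_(i < 3) slice (V i) t x * pd i phi x).
have LV t i : L2 mu (slice (V i) t) by have [] := slab_V H t i.
have hE t : h t = \sum_(i < 3) \int[mu]_x (pd i phi x * slice (V i) t x).
  rewrite /h RI_sum; last by move=> i; apply: L2M => //; exact: tst_L2.
  by apply: eq_bigr => i _; apply: eq_RI => x; rewrite mulrC.
have ch : uniform_cont T h.
  move=> t ht e e0; have e3 : 0 < e / 3 by rewrite divr_gt0.
  have hc i := slab_cont H i (tst_L2 (tp i)) ht e3.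
  have [da da0 ha] := hc 0; have [db db0 hb] := hc 1; have [dc dc0 hd] := hc 2%:R.
  exists (Num.min da (Num.min db dc)); first by rewrite !lt_min da0 db0.
  move=> r hr; rewrite !lt_min => /andP[r0 /andP[r1 r2]].
  rewrite !hE -sumrB (le_trans (ler_norm_sum _ _ _))//.
  rewrite -(sum3_third e).
  apply: ler_sum => -[[|[|[|//]]] p] _.
  - by have -> : Ordinal p = 0 by [exact: val_inj]; exact: ha.
  - by have -> : Ordinal p = 1 by [exact: val_inj]; exact: hb.
  - by have -> : Ordinal p = 2%:R by [exact: val_inj]; exact: hd.
have mh : mfun1 h.
  apply: (@measurable_RIx R (fun z => \sum_(i < 3) V i z * pd i phi z.1)).
  apply: measurable_sum => i; apply: measurable_funM; first exact: (slab_mV H).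
  by apply: measurable_fst4; exact: tst_measurable.
have -> : \int[mu]_x (\sum_(i < 3) slice (U i) s x * pd i phi x) = h s.
  by apply: eq_RI => x; apply: eq_bigr => i _; rewrite hU.
apply/eqP; rewrite -normr_le0; apply/ler_addgt0Pr => e e0; rewrite add0r.
have st : 0 <= s <= T by rewrite !ltW.
have [d d0 hd] := ch s st e e0.
pose q := Num.min d (Num.min s (T - s)) / 2.
have q0 : 0 < q by rewrite divr_gt0// !lt_min d0 s0 subr_gt0.
have /andP[qd /andP[qs qT]] : (2 * q <= d) && ((2 * q <= s) && (2 * q <= T - s)).
  by rewrite /q mulrC mulfVK// -!le_min.
have [L I] : Li (leb R) (fun r => delta_bump s q r * h r) /\
    `|\int[leb R]_r (delta_bump s q r * h r) - h s| <= e.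
  apply: delta_bump_avg => // r hr.
  by have [h1 h2] := window_center qd qs qT hr; exact: hd.
suff Z : \int[leb R]_r (delta_bump s q r * h r) = 0 by move: I; rewrite Z sub0r normrN.
have sb : smooth (delta_bump s q).
  by apply: smoothZ; apply: smooth_affine1; exact: smooth_bump.
have sup r : delta_bump s q r != 0 -> q <= r <= T - q.
  by move=> /(delta_bump_support q0); exact: window_center_support qs qT.
have LB := slab_B H; have B0 := slab_B0 H.
have test := slab_div H (test_tensor tphi sb q0 sup) (measurable_tensor tphi sb).
(* For the reflected kernel at the point x = 0 the convolution is the plain pairing with
   [pd i phi]. *)
have D i := dominated_term 0 LB B0 (dominated_U H i) (tst_refl 0 (tp i)) (smooth_continuous sb).
have D1 i : Li (leb3t R) (fun z : R3 R * R => pd i phi (0 - (0 - z.1)) * U i z * delta_bump s q z.2) by have [] := D i.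
have D2 i : Li (leb R) (fun r => delta_bump s q r * conv (fun y => pd i phi (0 - y)) (slice (U i) r) 0) by have [] := D i.
have cE i r : conv (fun y => pd i phi (0 - y)) (slice (U i) r) 0 = \int[mu]_x (slice (U i) r x * pd i phi x).
  by apply: eq_RI => x; rewrite subKr mulrC.
have LU t i : L2 mu (slice (U i) t) by have [] := slab_U H t i.
apply: (@etrans _ _ (\int[leb R]_r (\sum_(i < 3) delta_bump s q r * conv (fun y => pd i phi (0 - y)) (slice (U i) r) 0))).
  symmetry; apply: RI_ae; [exact: Li_sum|exact: Li_measurable L|].
  apply: (ae_imp (slab_ae H)) => r hr; rewrite -mulr_sumr; congr (_ * _).
  under eq_bigr do rewrite cE; rewrite -RI_sum; last by move=> i; apply: L2M => //; exact: tst_L2.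
  by apply: eq_RI => x; apply: eq_bigr => i _; rewrite hr.
apply: (etrans _ test); rewrite RI_sum//.
apply: (@etrans _ _ (\int[leb3t R]_z (\sum_(i < 3) pd i phi (0 - (0 - z.1)) * U i z * delta_bump s q z.2))).
  by rewrite RI_sum//; apply: eq_bigr => i _; have [_ _ h'] := D i; exact: (esym h').
apply: eq_RI => z; apply: eq_bigr => i _.
have := congr1 (fun g : R3 R * R -> R => g z) (d_x_tensor i (tst_smooth tphi) sb) => /= ->.
by rewrite subKr mulrA [U i z * _]mulrC.
Qed.

(** For each x the squares evolve by [conv_square_evolution]. Integrated over x and with the
    integrals exchanged, the right side is at each time the pairing of the mollified velocity with
    its force, to which [mollified_balance] applies. *)
Lemma mollified_energy k a b : tst k -> 0 <= a -> a <= b -> b <= T ->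
  Li (leb R) (fun s => oo a b s * (flux k (fun i => slice (U i) s) (fun i j => slice (G i j) s) -
    nu * enstrophy k (fun i j => slice (G i j) s))) /\
  \sum_(i < 3) N2 mu (conv k (slice (V i) b)) ^+ 2 - \sum_(i < 3) N2 mu (conv k (slice (V i) a)) ^+ 2 =
  2 * \int[leb R]_s (oo a b s * (flux k (fun i => slice (U i) s) (fun i j => slice (G i j) s) -
    nu * enstrophy k (fun i j => slice (G i j) s))).
Proof.
move=> tk a0 ab bT.
have L i := energy_integrand_Li i tk a0 bT.
have LWF s i : Li mu (fun x => wU k i s x * wF k i s x).
  have [K K0 hK] := force_bound nu tk; have [p1 [p2 [Lp h1 h2]]] := slab_P H s.
  have LU j : L2 mu (slice (U j) s) by have [] := slab_U H s j.
  have NU j : N2 mu (slice (U j) s) <= A by have [] := slab_U H s j.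
  have [LF _] := hK (fun j => slice (U j) s) (slice P s) p1 p2 A (B s) i LU Lp (slab_A H) (slab_B0 H s) NU h1 h2.
  by have [LW _] := tst_conv_L2 tk (LU i); exact: L2M.
have E s : oo a b s * (flux k (fun i => slice (U i) s) (fun i j => slice (G i j) s) -
    nu * enstrophy k (fun i j => slice (G i j) s)) =
    \sum_(i < 3) \int[mu]_x (oo a b s * (wU k i s x * wF k i s x)).
  have [p1 [p2 [Lp _ _]]] := slab_P H s.
  rewrite -(mollified_balance nu tk (slab_H1 H s) (slab_divergence s) Lp) mulr_sumr.
  by apply: eq_bigr => i _; rewrite (RIZ _ (LWF s i)).
have Ls i : Li (leb R) (fun s => \int[mu]_x (oo a b s * (wU k i s x * wF k i s x))).
  exact: (@Li_RI2 _ _ _ _ R (sfleb3 R) (leb R) _ (L i)).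
have LS : Li (leb R) (fun s => \sum_(i < 3) \int[mu]_x (oo a b s * (wU k i s x * wF k i s x))) by exact: Li_sum.
split; first exact: (@eq_Li _ _ R (leb R) _ _ E LS).
rewrite (@eq_RI _ _ R (leb R) _ _ E) RI_sum// mulr_sumr -sumrB; apply: eq_bigr => i _.
have Lc t : L2 mu (conv k (slice (V i) t)).
  by have [LV _] := slab_V H t i; have [] := tst_conv_L2 tk LV.
apply: (etrans (N2_sqrB (Lc b) (Lc a))).
rewrite -(RIx_fubini (L i)) -RIZ; last exact: (@Li_RI1 _ _ _ _ R (sfleb3 R) (leb R) _ (L i)).
by apply: eq_RI => x; exact: conv_square_evolution.
Qed.

End slab_energy.

(** * Vanishing mollification *)

Section vanishing_mollification.
Context {R : realType}.
Implicit Types (x y : R3 R) (i j : 'I_3) (f : R3 R -> R) (s t a b c d e : R)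
  (u : 'I_3 -> R3 R -> R) (G : 'I_3 -> 'I_3 -> R3 R -> R).
Local Notation mu := (leb3 R).

Lemma conv_eta_seq f : L2 mu f ->
  N2 mu (fun x => conv (eta n.+1%:R^-1) f x - f x) @[n --> \oo] --> 0.
Proof.
move=> Lf; apply/cvgrPdist_le => d d0; have [e0 e00 h] := conv_eta_cvg Lf d0.
apply: filterS (cvg0_le (@cvg_harmonic R) e00) => n hn.
by rewrite sub0r normrN ger0_norm ?N2_ge0//; apply: h; rewrite invr_gt0 ltr0n hn.
Qed.

Lemma conv_eta_seq_L2 f n : L2 mu f -> L2 mu (conv (eta n.+1%:R^-1) f) /\
  N2 mu (conv (eta n.+1%:R^-1) f) <= N2 mu f.
Proof. by move=> Lf; apply: conv_eta_L2. Qed.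

Lemma cvg_conv_eta_N2 f : L2 mu f ->
  N2 mu (conv (eta n.+1%:R^-1) f) ^+ 2 @[n --> \oo] --> N2 mu f ^+ 2.
Proof.
move=> Lf; rewrite [X in _ --> X]expr2.
rewrite (_ : (fun n => _) = (fun n => N2 mu (conv (eta n.+1%:R^-1) f) * N2 mu (conv (eta n.+1%:R^-1) f))); last first.
  by apply/funext => n; rewrite expr2.
have h : N2 mu (conv (eta n.+1%:R^-1) f) @[n --> \oo] --> N2 mu f.
  by apply: cvg_N2 => //; [move=> n; have [] := conv_eta_seq_L2 n Lf|exact: conv_eta_seq].
by apply: cvgM.
Qed.

Lemma enstrophy_N2 k G : enstrophy k G = \sum_(i < 3) \sum_(j < 3) N2 mu (conv k (G i j)) ^+ 2.
Proof. by apply: eq_bigr => i _; apply: eq_bigr => j _; rewrite N2_sqr. Qed.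

Lemma enstrophy_bounds e G : 0 < e -> (forall i j, L2 mu (G i j)) ->
  0 <= enstrophy (eta e) G <= \sum_(i < 3) \sum_(j < 3) N2 mu (G i j) ^+ 2.
Proof.
move=> e0 LG; rewrite enstrophy_N2; apply/andP; split.
  by apply: sumr_ge0 => i _; apply: sumr_ge0 => j _; exact: sqr_ge0.
apply: ler_sum => i _; apply: ler_sum => j _; have [_ h] := conv_eta_L2 e0 (LG i j).
by rewrite ler_pXn2r ?nnegrE ?N2_ge0.
Qed.

Lemma enstrophy_cvg G : (forall i j, L2 mu (G i j)) ->
  enstrophy (eta n.+1%:R^-1) G @[n --> \oo] --> \sum_(i < 3) \sum_(j < 3) N2 mu (G i j) ^+ 2.
Proof.
move=> LG; rewrite (_ : (fun n => _) = (fun n => \sum_(i < 3) \sum_(j < 3)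
  N2 mu (conv (eta n.+1%:R^-1) (G i j)) ^+ 2)); last by apply/funext => n; rewrite enstrophy_N2.
apply: (@cvg_sum3 R (fun i n => \sum_(j < 3) N2 mu (conv (eta n.+1%:R^-1) (G i j)) ^+ 2)) => i.
apply: (@cvg_sum3 R (fun j n => N2 mu (conv (eta n.+1%:R^-1) (G i j)) ^+ 2)) => j.
exact: cvg_conv_eta_N2.
Qed.

Lemma flux_le k u G (g q : 'I_3 -> 'I_3 -> R) :
  (forall i j, L2 mu (conv k (G i j)) /\ N2 mu (conv k (G i j)) <= g i j) ->
  (forall i j, L2 mu (conv k (fun y => u i y * u j y)) /\
    N2 mu (conv k (fun y => u i y * u j y)) <= q i j) ->
  `|flux k u G| <= \sum_(i < 3) \sum_(j < 3) g i j * q i j.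
Proof.
move=> hG hu; apply: (le_trans (ler_norm_sum _ _ _)); apply: ler_sum => i _.
apply: (le_trans (ler_norm_sum _ _ _)); apply: ler_sum => j _.
have [L1 N1] := hG i j; have [L2' N2'] := hu i j.
by apply: (le_trans (CS_N2 L1 L2')); apply: ler_pM => //; exact: N2_ge0.
Qed.

Lemma flux_cvg u G : (forall i j, L2 mu (G i j)) -> (forall i j, L2 mu (fun x => u i x * u j x)) ->
  flux (eta n.+1%:R^-1) u G @[n --> \oo] -->
  \sum_(i < 3) \sum_(j < 3) \int[mu]_x (G i j x * (u i x * u j x)).
Proof.
move=> LG Lu.
apply: (@cvg_sum3 R (fun i n => \sum_(j < 3) \int[mu]_x (conv (eta n.+1%:R^-1) (G i j) x *
  conv (eta n.+1%:R^-1) (fun y => u i y * u j y) x))) => i.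
apply: (@cvg_sum3 R (fun j n => \int[mu]_x (conv (eta n.+1%:R^-1) (G i j) x *
  conv (eta n.+1%:R^-1) (fun y => u i y * u j y) x))) => j.
have L1 n : L2 mu (conv (eta n.+1%:R^-1) (G i j)) by have [] := conv_eta_seq_L2 n (LG i j).
have L2' n : L2 mu (conv (eta n.+1%:R^-1) (fun y => u i y * u j y)) by have [] := conv_eta_seq_L2 n (Lu i j).
apply: cvg_RI; [by move=> n; exact: L2M|exact: L2M|].
by apply: cvg_L2M => //; exact: conv_eta_seq.
Qed.

End vanishing_mollification.

(** * The energy identity for multipliers *)

Section slab_limit.
Context {R : realType}.
Implicit Types (x y : R3 R) (i j : 'I_3) (s t a b c d e : R).
Local Notation mu := (leb3 R).
Local Notation oo a b := (\1_(`]a, b[%classic) : R -> R).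

Definition kin (V : 'I_3 -> R3 R * R -> R) t := \sum_(i < 3) N2 mu (slice (V i) t) ^+ 2.
Definition diss (G : 'I_3 -> 'I_3 -> R3 R * R -> R) s :=
  \sum_(i < 3) \sum_(j < 3) N2 mu (slice (G i j) s) ^+ 2.

Lemma diss_ge0 G s : 0 <= diss G s.
Proof. by apply: sumr_ge0 => i _; apply: sumr_ge0 => j _; exact: sqr_ge0. Qed.

Lemma le_of_sqr (g b : R) : 1 <= b -> g ^+ 2 <= b -> g <= b.
Proof. by move=> b1 gb; have [|g1] := leP g 1; [exact: (fun h => le_trans h b1)|nra]. Qed.

Lemma mul_le_of_sqr (g g' b : R) : g ^+ 2 <= b -> g' ^+ 2 <= b -> g * g' <= b.
Proof. by have := sqr_ge0 (g - g'); nra. Qed.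

Lemma sum33_const c : \sum_(i < 3) \sum_(j < 3) c = 9 * c.
Proof. by rewrite !big_ord_recl !big_ord0; ring. Qed.

Context (nu T A : R) (B : R -> R) (V U : 'I_3 -> R3 R * R -> R)
  (G : 'I_3 -> 'I_3 -> R3 R * R -> R) (P : R3 R * R -> R) (H : slab nu T A B V U G P).
Hypothesis LD : Li (leb R) (diss G).

Lemma slab_LG s i j : L2 mu (slice (G i j) s).
Proof. by have [_ + _] := slab_H1 H s i; apply. Qed.

Lemma diss_le s : diss G s <= 9 * B s.
Proof.
rewrite -sum33_const; apply: ler_sum => i _; apply: ler_sum => j _; exact: (slab_G H).
Qed.

(** By the multiplier bound the product is at most quadratic in the gradient norms, whose squares
    are at most [B]. This makes the flux dominated in time, uniformly in the mollification scale. *)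
Lemma slab_product Mc s i j : 0 <= Mc -> 1 <= B s -> (forall l, mult Mc (slice (U l) s)) ->
  L2 mu (fun x => slice (U i) s x * slice (U j) s x) /\
  N2 mu (slice (G i j) s) * N2 mu (fun x => slice (U i) s x * slice (U j) s x) <=
  Mc * ((A + 3) * B s).
Proof.
move=> M0 B1 hM; have [Lu Nu] := slab_U H s i; have [_ Nj] := slab_U H s j.
have [L N] := mult_H1 M0 Lu (hM i) (slab_H1 H s j); split => //.
have g0 := N2_ge0 mu (slice (G i j) s).
apply: (le_trans (ler_wpM2l g0 N)); rewrite mulrCA; apply: ler_wpM2l => //.
rewrite mulrDr mulrDl; apply: lerD.
  rewrite mulrC; apply: ler_pM => //; first exact: N2_ge0.
  exact: le_of_sqr B1 (slab_G H s i j).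
rewrite mulr_sumr; apply: (@le_trans _ _ (\sum_(l < 3) B s)).
  by apply: ler_sum => l _; apply: mul_le_of_sqr; exact: (slab_G H).
by rewrite sumr_const card_ord mulr_natl.
Qed.

Lemma energy_identity a b Mc : 0 <= a -> a <= b -> b <= T -> 0 <= Mc ->
  (forall s, a < s < b -> forall i, mult Mc (slice (U i) s)) ->
  kin V b - kin V a = - (2 * nu * \int[leb R]_s (oo a b s * diss G s)).
Proof.
move=> a0 ab bT M0 hM.
have te n : tst (eta n.+1%:R^-1 : R3 R -> R) by apply: tst_eta.
have ME n := mollified_energy H (te n) a0 ab bT.
pose rate n s := flux (eta n.+1%:R^-1) (fun i => slice (U i) s) (fun i j => slice (G i j) s) -
    nu * enstrophy (eta n.+1%:R^-1) (fun i j => slice (G i j) s).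
have B1 s : a < s < b -> 1 <= B s.
  by move=> /andP[s1 s2]; apply: (slab_B1 H); rewrite (le_lt_trans a0 s1) (lt_le_trans s2 bT).
have CL : \sum_(i < 3) N2 mu (conv (eta n.+1%:R^-1) (slice (V i) b)) ^+ 2 -
    \sum_(i < 3) N2 mu (conv (eta n.+1%:R^-1) (slice (V i) a)) ^+ 2 @[n --> \oo] -->
    kin V b - kin V a.
  have C t : \sum_(i < 3) N2 mu (conv (eta n.+1%:R^-1) (slice (V i) t)) ^+ 2 @[n --> \oo] --> kin V t.
    apply: (@cvg_sum3 R (fun i n => N2 mu (conv (eta n.+1%:R^-1) (slice (V i) t)) ^+ 2)) => i.
    by apply: cvg_conv_eta_N2; have [] := slab_V H t i.
  by apply: cvgB; exact: C.
have [_ CR] : Li (leb R) (fun s => oo a b s * (- nu * diss G s)) /\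
   (\int[leb R]_s (oo a b s * rate n s) @[n --> \oo] --> \int[leb R]_s (oo a b s * (- nu * diss G s))).
  apply: (@Li_dct _ _ R (leb R) (fun n s => oo a b s * rate n s) _
    (* Nine entries of the flux, each bounded through [slab_product], and nine entries of the
       enstrophy, each at most [B]; mollification increases none of these norms. *)
    (fun s => (9 * (Mc * (A + 3)) + `|nu| * 9) * B s)).
  - by move=> n; have [L _] := ME n; exact: Li_measurable L.
  - exact: Li_measurable (Li_oo a b (LiZ (- nu) LD)).
  - apply: nearW => s; rewrite oo_in; have [hs|_] := boolP (a < s < b); last first.
      apply: cvg_near_cst; apply: nearW => n; by rewrite !mul0r.
    have [Luu Z] := cancellation M0 (hM s hs) (slab_H1 H s) (slab_divergence H s).
    have F := flux_cvg (slab_LG s) Luu; have E := enstrophy_cvg (slab_LG s).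
    apply: cvgM; first exact: cvg_cst.
    have -> : - nu * diss G s = 0 - nu * diss G s by rewrite sub0r mulNr.
    apply: cvgB; last by apply: cvgM; [exact: cvg_cst|exact: E].
    by apply: cvg_trans F _; rewrite Z.
  - by apply: LiZ; exact: slab_B H.
  - apply: nearW => s n; rewrite oo_in; have [hs|_] := boolP (a < s < b); last first.
      rewrite mul0r normr0 mulr_ge0//; last exact: (slab_B0 H).
      by rewrite addr_ge0 ?mulr_ge0// addr_ge0//; exact: slab_A H.
    rewrite mul1r /rate mulrDl; apply: (le_trans (ler_normB _ _)); apply: lerD.
      apply: (@le_trans _ _ (\sum_(i < 3) \sum_(j < 3) Mc * ((A + 3) * B s))); last first.
        by rewrite sum33_const !mulrA.
      have SP i j := slab_product i j M0 (B1 s hs) (hM s hs).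
      apply: (@le_trans _ _ (\sum_(i < 3) \sum_(j < 3) N2 mu (slice (G i j) s) *
          N2 mu (fun x => slice (U i) s x * slice (U j) s x))).
        apply: (@flux_le R _ (fun i => slice (U i) s) (fun i j => slice (G i j) s)) => i j.
          by apply: conv_eta_seq_L2; exact: slab_LG.
        by have [L _] := SP i j; apply: conv_eta_seq_L2.
      by apply: ler_sum => i _; apply: ler_sum => j _; have [] := SP i j.
    have en0 : 0 < (n.+1%:R^-1 : R) by rewrite invr_gt0.
    have /andP[E0 E1] := enstrophy_bounds en0 (slab_LG s).
    rewrite normrM -mulrA; apply: ler_wpM2l => //; rewrite (ger0_norm E0).
    exact: le_trans E1 (diss_le s).
have CR2 : 2 * \int[leb R]_s (oo a b s * rate n s) @[n --> \oo] -->
    2 * \int[leb R]_s (oo a b s * (- nu * diss G s)).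
  by apply: cvgM; [exact: cvg_cst|exact: CR].
have EQ : (fun n => \sum_(i < 3) N2 mu (conv (eta n.+1%:R^-1) (slice (V i) b)) ^+ 2 -
    \sum_(i < 3) N2 mu (conv (eta n.+1%:R^-1) (slice (V i) a)) ^+ 2) =
    (fun n => 2 * \int[leb R]_s (oo a b s * rate n s)).
  by apply/funext => n; have [_ h] := ME n; exact: h.
rewrite EQ in CL.
have -> : - (2 * nu * \int[leb R]_s (oo a b s * diss G s)) =
    2 * \int[leb R]_s (oo a b s * (- nu * diss G s)).
  rewrite -mulrA -mulrN -mulNr -RIZ; last exact: Li_oo.
  by congr (2 * _); apply: eq_RI => s; rewrite mulrCA.
exact: (@cvg_unique _ (@norm_hausdorff _ _) _ _ _ _ CL CR2).
Qed.

End slab_limit.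

(** * The blowup time *)

Section inverse_sqrt.
Context {R : realType}.
Implicit Types (s t T h a b : R).
Local Notation M := (measurableTypeR R).
Local Notation mfun1 f := (@measurable_fun _ _ M R setT f).
Local Notation oo a b := (\1_(`]a, b[%classic) : R -> R).

Lemma is_derive_sqrt_sub T s : s < T ->
  is_derive s (1 : R) (fun s => - 2 * Num.sqrt (T - s)) (Num.sqrt (T - s))^-1.
Proof.
move=> sT; have p0 : 0 < T - s by rewrite subr_gt0.
have q0 : Num.sqrt (T - s) != 0 by rewrite gt_eqF// sqrtr_gt0.
have d1 : is_derive s (1 : R) (fun s => T - s) (0 - 1) by apply: is_deriveB.
have d2 := @is_derive1_comp _ (@Num.sqrt R) (fun s => T - s) s _ _ (is_derive1_sqrt p0) d1.
have d3 := is_deriveZ (- 2) d2.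
apply: (is_derive_eq d3); rewrite /GRing.scale /=.
by field.
Qed.

Lemma measurable_inv_sqrt T : mfun1 (fun s => (Num.sqrt (T - s))^-1).
Proof.
apply: measurable_inv.
apply: continuous_measurable_fun => s; apply: continuous_comp; last exact: sqrt_continuous.
by apply: cvgB; [exact: cvg_cst|exact: cvg_id].
Qed.

Lemma RI_inv_sqrt_cc T a b : a < b -> b < T ->
  Li (leb R) (fun s => \1_(`[a, b]%classic) s * (Num.sqrt (T - s))^-1) /\
  \int[leb R]_s (\1_(`[a, b]%classic) s * (Num.sqrt (T - s))^-1) =
  2 * Num.sqrt (T - a) - 2 * Num.sqrt (T - b).
Proof.
move=> ab bT.
have lt s : s <= b -> s < T by move=> h; exact: le_lt_trans h bT.
have cF s : s <= b -> {for s, continuous (fun s => - 2 * Num.sqrt (T - s))}.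
  move=> /lt sT; apply: differentiable_continuous; apply/derivable1_diffP.
  by have [] := is_derive_sqrt_sub sT.
have cf s : s <= b -> {for s, continuous (fun s => (Num.sqrt (T - s))^-1)}.
  move=> /lt sT; apply: cvgV; first by rewrite gt_eqF// sqrtr_gt0 subr_gt0.
  apply: continuous_comp; last exact: sqrt_continuous.
  by apply: cvgB; [exact: cvg_cst|exact: cvg_id].
have E : (\int[leb R]_(s in `[a, b]) ((Num.sqrt (T - s))^-1)%:E =
   (- 2 * Num.sqrt (T - b))%:E - (- 2 * Num.sqrt (T - a))%:E)%E.
  apply: (@continuous_FTC2 R (fun s => (Num.sqrt (T - s))^-1) (fun s => - 2 * Num.sqrt (T - s))) => //.
  - apply/continuous_within_itvP => //; split.
    + by move=> s; rewrite in_itv /= => /andP[_ /ltW]; exact: cf.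
    + by apply: cvg_at_right_filter; exact: cf (ltW ab).
    + by apply: cvg_at_left_filter; exact: cf.
  - split.
    + by move=> s; rewrite in_itv /= => /andP[_ /ltW /lt sT]; have [] := is_derive_sqrt_sub sT.
    + by apply: cvg_at_right_filter; exact: cF (ltW ab).
    + by apply: cvg_at_left_filter; exact: cF.
  - move=> s; rewrite in_itv /= => /andP[_ /ltW /lt sT]; rewrite derive1E.
    by have [] := is_derive_sqrt_sub sT.
have E' : (\int[leb R]_s (\1_(`[a, b]%classic) s * (Num.sqrt (T - s))^-1)%:E =
   (2 * Num.sqrt (T - a) - 2 * Num.sqrt (T - b))%:E)%E.
  transitivity (\int[leb R]_(s in `[a, b]) ((Num.sqrt (T - s))^-1)%:E)%E.
    rewrite [RHS]integral_mkcond epatch_indic; apply: eq_integral => s _ /=.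
    by rewrite EFinM muleC.
  by rewrite E -EFinB; congr EFin; ring.
have L : Li (leb R) (fun s => \1_(`[a, b]%classic) s * (Num.sqrt (T - s))^-1).
  apply: Li_ge0_lty; last by rewrite E' ltry.
    by apply: measurable_funM; [apply: measurable_indic; exact: measurable_itv|exact: measurable_inv_sqrt].
  by move=> s; rewrite mulr_ge0// ?invr_ge0 ?sqrtr_ge0// indicE.
by split => //; apply: EFin_inj; rewrite -RI_E.
Qed.

(** The primitive -2 sqrt(T - s) is not differentiable at T, so the fundamental theorem is applied
    up to T - d and Fatou's lemma lets d tend to 0. *)
Lemma RI_inv_sqrt T h : 0 < h ->
  Li (leb R) (fun s => oo (T - h) T s * (Num.sqrt (T - s))^-1) /\
  \int[leb R]_s (oo (T - h) T s * (Num.sqrt (T - s))^-1) <= 2 * Num.sqrt h.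
Proof.
move=> h0.
(* Starting at 2 keeps d strictly below h, so that the interval from T - h to T - d is never a
   point. *)
pose d n : R := h * n.+2%:R^-1.
have d0 n : 0 < d n by rewrite mulr_gt0// invr_gt0.
have dh n : d n < h by rewrite /d gtr_pMr// invf_lt1// ltr1n.
have cd : d n @[n --> \oo] --> 0.
  rewrite -[X in _ --> X](mulr0 h); apply: cvgM; first exact: cvg_cst.
  by have := @cvg_harmonic R; rewrite -(cvg_shiftS (@harmonic R)).
pose g n s := \1_(`[T - h, T - d n]%classic) s * (Num.sqrt (T - s))^-1.
have G n : Li (leb R) (g n) /\ \int[leb R]_s g n s = 2 * Num.sqrt h - 2 * Num.sqrt (d n).
  have p1 : T - h < T - d n by rewrite ltrD2l ltrN2.
  have p2 : T - d n < T by rewrite ltrBlDr ltrDl.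
  have [L ->] := RI_inv_sqrt_cc p1 p2; split; first exact: L.
  by congr (2 * Num.sqrt _ - 2 * Num.sqrt _); rewrite subKr.
have [L I] : Li (leb R) (fun s => \1_(`[T - h, T[%classic) s * (Num.sqrt (T - s))^-1) /\
    \int[leb R]_s (\1_(`[T - h, T[%classic) s * (Num.sqrt (T - s))^-1) <= 2 * Num.sqrt h.
  apply: (@RI_fatou _ _ R (leb R) g).
  - by move=> n; have [] := G n.
  - by apply: measurable_funM; [apply: measurable_indic; exact: measurable_itv|exact: measurable_inv_sqrt].
  - by move=> n s; rewrite mulr_ge0// ?invr_ge0 ?sqrtr_ge0// indicE.
  - move=> s; apply: cvgM; last exact: cvg_cst.
    have [sT|sT] := ltP s T; last first.
      apply: cvg_near_cst; apply: nearW => n; rewrite !indicE !memNset//=; rewrite in_itv /=.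
        by move=> /andP[_]; rewrite ltNge sT.
      by move=> /andP[_ h1]; have := d0 n; move: h1 sT; lra.
    have p0 : 0 < T - s by rewrite subr_gt0.
    apply: cvg_near_cst; apply: filterS (cvg0_le cd p0) => n hn; rewrite !indicE.
    congr (nat_of_bool _)%:R; apply/idP/idP; rewrite !inE /= !in_itv /= => /andP[h1 h2];
      by rewrite h1 /=; lra.
  - by move=> n; have [_ ->] := G n; rewrite gerBl mulr_ge0// sqrtr_ge0.
have le1 s : oo (T - h) T s <= \1_(`[T - h, T[%classic) s :> R.
  rewrite oo_in indicE; have [/andP[h1 h2]|_] := boolP (T - h < s < T) => //.
  by rewrite mem_set//= in_itv /= (ltW h1) h2.
have r0 s : 0 <= (Num.sqrt (T - s))^-1 by rewrite invr_ge0 sqrtr_ge0.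
have L' : Li (leb R) (fun s => oo (T - h) T s * (Num.sqrt (T - s))^-1).
  apply: (@Li_le _ _ R (leb R) _ _ _ _ L).
    by apply: measurable_funM; [exact: measurable_oo|exact: measurable_inv_sqrt].
  by move=> s; rewrite ger0_norm; [exact: ler_wpM2r|rewrite mulr_ge0// oo_in].
split => //; apply: le_trans I; apply: RI_le => // s; exact: ler_wpM2r.
Qed.

End inverse_sqrt.

(** * No energy loss at the blowup time *)

Section endpoint.
Context {R : realType}.
Implicit Types (x y : R3 R) (i j : 'I_3) (s t a b c d e : R).
Local Notation mu := (leb3 R).
Local Notation M := (measurableTypeR R).
Local Notation oo a b := (\1_(`]a, b[%classic) : R -> R).

Lemma sqr_diff_le (p q r A : R) : 0 <= p -> 0 <= q -> q <= p -> p <= A -> p <= q + r ->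
  p ^+ 2 - q ^+ 2 <= 2 * A * r.
Proof. by move=> *; rewrite subr_sqr; nra. Qed.

Lemma oo_split a b c s : a <= b -> b <= c -> oo a b s + oo b c s <= oo a c s.
Proof.
move=> ab bc; rewrite !oo_in.
have [/andP[h1 h2]|_] := boolP (a < s < b).
  have -> : (b < s < c) = false by apply/negbTE/negP => /andP[h3 _]; lra.
  by rewrite addr0 h1 (lt_le_trans h2 bc).
have [/andP[h1 h2]|_] := boolP (b < s < c); last by rewrite add0r.
by rewrite add0r h2 (le_lt_trans ab h1).
Qed.

Lemma endpoint_lt (a K : R) : 0 < a -> 0 <= K -> K * a + K * a < a * (2 * K + 1) * 2.
Proof.
move=> a0 K0; have p := mulr_ge0 K0 (ltW a0).
have -> : a * (2 * K + 1) * 2 = 4 * (K * a) + 2 * a by ring.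
by move: (K * a) p => q; lra.
Qed.

(** The arithmetic of [endpoint_step]: [k0], [ks], [kT] are the energies at 0, s, T; [m1], [m2] the
    mollified energies at T, s; [d1], [d2], [d3] the dissipation integrals on ]0, s[, ]s, T[, ]0,
    T[; [W] is the mollified rate integrated over ]s, T[, [J] the integral of (T - r)^(-1/2) there,
    q = sqrt(T - s) and [ei] the inverse of e. *)
Lemma endpoint_arith (nu A c1 c e k0 ks kT m1 m2 J d1 d2 d3 W q ei : R) :
  ks - k0 = - (2 * nu * d1) -> m1 <= kT -> ks - m2 <= 18 * A * e * c -> m1 - m2 = 2 * W ->
  J <= 2 * q -> - (c1 * ei * J) - nu * d2 <= W -> d1 + d2 <= d3 -> 0 <= J -> 0 < e -> 0 < ei ->
  0 <= q -> 0 <= c -> 0 <= c1 -> 0 <= A -> 0 <= nu ->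
  k0 - 2 * nu * d3 - kT <= (18 * A + 4 * c1) * (e * c) + (18 * A + 4 * c1) * (q * ei).
Proof.
move=> h1 h2 h3 h4 h5 h6 h7 J0 e0 ei0 q0 c0 c10 A0 nu0.
have p1 : c1 * ei * J <= c1 * ei * (2 * q) by apply: ler_wpM2l => //; rewrite mulr_ge0// ltW.
have p2 : nu * (d1 + d2) <= nu * d3 by exact: ler_wpM2l.
have p3 : 0 <= c1 * (e * c) by rewrite mulr_ge0// mulr_ge0// ltW.
have p4 : 0 <= A * (q * ei) by rewrite mulr_ge0// mulr_ge0// ltW.
have -> : (18 * A + 4 * c1) * (e * c) + (18 * A + 4 * c1) * (q * ei) =
  18 * A * e * c + 4 * (c1 * (e * c)) + 18 * (A * (q * ei)) + 2 * (c1 * ei * (2 * q)) by ring.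
rewrite mulrDr in p2; lra.
Qed.

Context (nu T A : R) (B : R -> R) (V U : 'I_3 -> R3 R * R -> R)
  (G : 'I_3 -> 'I_3 -> R3 R * R -> R) (P : R3 R * R -> R) (H : slab nu T A B V U G P).
Hypothesis LD : Li (leb R) (diss G).
Context (Cs : R) (Cs0 : 0 <= Cs) (nu0 : 0 <= nu) (T0 : 0 < T).
Hypothesis hC : forall s, 0 < s < T -> forall i,
  {ae mu, forall x, `|slice (U i) s x| <= Cs / Num.sqrt (T - s)}.

Let rt0 s : 0 <= Cs / Num.sqrt (T - s).
Proof. by rewrite mulr_ge0// invr_ge0 sqrtr_ge0. Qed.

Lemma type_I_product s i j : 0 < s < T ->
  L2 mu (fun x => slice (U i) s x * slice (U j) s x) /\
  N2 mu (fun x => slice (U i) s x * slice (U j) s x) <= Cs / Num.sqrt (T - s) * A.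
Proof.
move=> hs; have [Lu _] := slab_U H s i; have [Lv Nv] := slab_U H s j.
have h : {ae mu, forall x, `|slice (U i) s x * slice (U j) s x| <=
    `|Cs / Num.sqrt (T - s) * slice (U j) s x|}.
  apply: (ae_imp (hC hs i)) => x hx; rewrite normrM [leRHS]normrM (ger0_norm (rt0 s)).
  exact: ler_wpM2r.
have LZ := L2Z (Cs / Num.sqrt (T - s)) Lv.
have L : L2 mu (fun x => slice (U i) s x * slice (U j) s x).
  by apply: (L2_le_ae _ h LZ); apply: measurable_funM; [exact: L2_measurable Lu|exact: L2_measurable Lv].
split => //; apply: (le_trans (N2_le_ae L LZ h)).
by rewrite N2Z// (ger0_norm (rt0 s)); apply: ler_wpM2l.
Qed.

(** The gradient in the flux is moved onto the mollifier at the price 1/e, so that only the bounded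
    L^2 norm of u enters; the pointwise bound on one factor of u_i u_j supplies the inverse square
    root. *)
Lemma type_I_flux : exists2 c, 0 <= c & forall e s, 0 < e -> 0 < s < T ->
  `|flux (eta e) (fun i => slice (U i) s) (fun i j => slice (G i j) s)| <=
  c / e * (Num.sqrt (T - s))^-1.
Proof.
have [C1 C10 hC1] := @eta_pd_L1 R; have A0 := slab_A H.
exists (9 * (C1 * A * (Cs * A))); first by rewrite !mulr_ge0.
move=> e s e0 hs; have te := tst_eta e0.
have -> : 9 * (C1 * A * (Cs * A)) / e * (Num.sqrt (T - s))^-1 =
    \sum_(i < 3) \sum_(j < 3) (C1 / e * A) * (Cs / Num.sqrt (T - s) * A).
  by rewrite sum33_const; move: (e^-1) (_^-1) => p q; ring.
apply: (@flux_le R _ (fun i => slice (U i) s) (fun i j => slice (G i j) s)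
  (fun _ _ => C1 / e * A) (fun _ _ => Cs / Num.sqrt (T - s) * A)) => i j.
  have [LU NU] := slab_U H s i.
  rewrite -(conv_pd j te (slab_H1 H s i)); have [L N] := tst_conv_L2 (tst_pd j te) LU.
  split => //; apply: (le_trans N); apply: ler_pM => //; [exact: RI_ge0|exact: N2_ge0|exact: hC1].
have [L N] := type_I_product i j hs; have [L' N'] := conv_eta_L2 e0 L.
by split => //; exact: le_trans N' N.
Qed.

Lemma mollified_kin e t : 0 < e -> \sum_(i < 3) N2 mu (conv (eta e) (slice (V i) t)) ^+ 2 <= kin V t.
Proof.
move=> e0; apply: ler_sum => i _; have [L _] := slab_V H t i; have [_ h] := conv_eta_L2 e0 L.
by rewrite ler_pXn2r ?nnegrE ?N2_ge0.
Qed.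

(** For norms bounded by A, a difference of squares is at most 2 A times the difference, which
    [H1_conv_eta] bounds by e times three gradient norms; 18 = 3 * 2 * 3 over the three
    components. *)
Lemma mollified_kin_defect e t c : 0 < e -> (forall i, slice (U i) t = slice (V i) t) ->
  (forall i j, N2 mu (slice (G i j) t) <= c) ->
  kin V t - \sum_(i < 3) N2 mu (conv (eta e) (slice (V i) t)) ^+ 2 <= 18 * A * e * c.
Proof.
move=> e0 UV Gc; rewrite /kin -sumrB.
have -> : 18 * A * e * c = \sum_(i < 3) 2 * A * (e * (3 * c)).
  by rewrite !big_ord_recl !big_ord0; ring.
apply: ler_sum => i _; have [L N] := slab_V H t i; have [Lc h] := conv_eta_L2 e0 L.
apply: sqr_diff_le => //; [exact: N2_ge0|exact: N2_ge0|].
have LB' := L2B Lc L.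
apply: (@le_trans _ _ (N2 mu (conv (eta e) (slice (V i) t)) +
  N2 mu (fun x => conv (eta e) (slice (V i) t) x - slice (V i) t x))).
  apply: (le_trans _ (N2B Lc LB')); rewrite le_eqVlt; apply/orP; left; apply/eqP.
  by apply: eq_N2 => x; rewrite subKr.
rewrite lerD2l; have hH := slab_H1 H t i; rewrite UV in hH.
apply: (le_trans (H1_conv_eta e0 hH)); rewrite ler_wpM2l ?(ltW e0)//.
apply: (@le_trans _ _ (\sum_(j < 3) c)); first by apply: ler_sum => j _; exact: Gc.
by rewrite sumr_const card_ord mulr_natl.
Qed.

Lemma type_I_mult s t : 0 <= s -> s < t -> t < T -> forall r, s < r < t -> forall i,
  mult (Cs / Num.sqrt (T - t)) (slice (U i) r).
Proof.
move=> s0 st tT r /andP[sr rt_] i.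
have rT : 0 < r < T by apply/andP; split; lra.
have [LU _] := slab_U H r i; apply: mult_bounded => //.
apply: (ae_imp (hC rT i)) => x /le_trans; apply; apply: ler_wpM2l => //.
have p0 : 0 < Num.sqrt (T - t) by rewrite sqrtr_gt0; lra.
have p1 : Num.sqrt (T - t) <= Num.sqrt (T - r) by rewrite ler_sqrt; lra.
by rewrite lef_pV2// posrE (lt_le_trans p0).
Qed.

Lemma type_I_identity t : 0 <= t -> t < T ->
  kin V t - kin V 0 = - (2 * nu * \int[leb R]_s (oo 0 t s * diss G s)).
Proof.
rewrite le_eqVlt => /predU1P[<- _|t0 tT].
  apply: (energy_identity H LD (Mc := 0)) => // [|s /andP[h1 h2]]; first exact: ltW.
  by have := lt_trans h1 h2; rewrite ltxx.
by apply: (energy_identity H LD (Mc := Cs / Num.sqrt (T - t))) => //; [exact: ltW|exact: ltW|exact: type_I_mult].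
Qed.

(** The exact identity up to s is continued on [s, T] by the mollified balance. The time s, the
    scale e and the gradient bound c at s remain free, and K depends on none of them. *)
Lemma endpoint_step : exists2 K, 0 <= K & forall s e c, 0 < s -> s < T -> 0 < e ->
  (forall i, slice (U i) s = slice (V i) s) -> (forall i j, N2 mu (slice (G i j) s) <= c) ->
  kin V 0 - 2 * nu * \int[leb R]_r (oo 0 T r * diss G r) - kin V T <=
  K * (e * c) + K * (Num.sqrt (T - s) / e).
Proof.
have [c1 c10 hf] := type_I_flux; have A0 := slab_A H.
exists (18 * A + 4 * c1); first by rewrite addr_ge0// mulr_ge0.
move=> s e c s0 sT e0 UV Gc.
have c0 : 0 <= c by exact: le_trans (N2_ge0 _ _) (Gc 0 0).
have I1 := type_I_identity (ltW s0) sT.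
have I2 := mollified_kin T e0; have I3 := mollified_kin_defect e0 UV Gc.
have [LM EM] := mollified_energy H (tst_eta e0) (ltW s0) (ltW sT) (lexx T).
have h0 : 0 < T - s by rewrite subr_gt0.
have [LS IS] := RI_inv_sqrt T h0; rewrite subKr in LS IS.
have L0 := Li_oo 0 T LD; have L1 := Li_oo 0 s LD; have L2' := Li_oo s T LD.
have I4 : - (c1 / e * \int[leb R]_r (oo s T r * (Num.sqrt (T - r))^-1)) - nu * \int[leb R]_r (oo s T r * diss G r)
    <= \int[leb R]_r (oo s T r * (flux (eta e) (fun i => slice (U i) r) (fun i j => slice (G i j) r) -
    nu * enstrophy (eta e) (fun i j => slice (G i j) r))).
  have La := LiZ (c1 / e) LS; have Lb := LiZ nu L2'.
  rewrite -RIZ// -RIZ// -RIN// -RIB//; last exact: LiN.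
  apply: RI_le => //; first by apply: LiB => //; exact: LiN.
  move=> r; rewrite oo_in; have [/andP[h1 h2]|_] := boolP (s < r < T); last by rewrite !mul0r !mulr0 oppr0 addr0.
  rewrite !mul1r; have hr : 0 < r < T by rewrite (lt_trans s0 h1).
  have := hf e r e0 hr; rewrite ler_norml => /andP[h _]; apply: lerB => //.
  have /andP[_ E1] := enstrophy_bounds e0 (slab_LG H r).
  exact: ler_wpM2l.
have I5 : \int[leb R]_r (oo 0 s r * diss G r) + \int[leb R]_r (oo s T r * diss G r) <=
    \int[leb R]_r (oo 0 T r * diss G r).
  rewrite -RID//; apply: RI_le => //; first exact: LiD.
  move=> r; rewrite -mulrDl; apply: ler_wpM2r; first exact: diss_ge0.
  by apply: oo_split; exact: ltW.
have IS0 : 0 <= \int[leb R]_r (oo s T r * (Num.sqrt (T - r))^-1).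
  by apply: RI_ge0 => r; rewrite mulr_ge0 ?invr_ge0 ?sqrtr_ge0// oo_in.
have e0' : 0 < e^-1 by rewrite invr_gt0.
have q0 := sqrtr_ge0 (T - s).
exact: (endpoint_arith I1 I2 I3 EM IS I4 I5 IS0 e0 e0' q0 c0 c10 A0 nu0).
Qed.

Lemma RI_oo a b : a <= b -> Li (leb R) (oo a b) /\ \int[leb R]_s oo a b s = b - a.
Proof.
move=> ab.
have E : (\int[leb R]_s (oo a b s)%:E = (b - a)%:E)%E.
  rewrite integral_indic//.
  rewrite setIT; have h := @lebesgue_measure_itv R `]a, b[; rewrite /= lte_fin in h.
  apply: (etrans h); move: ab; by rewrite le_eqVlt => /predU1P[->|->]; rewrite ?ltxx ?subrr// -EFinB.
have L : Li (leb R) (oo a b).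
  apply: Li_ge0_lty; [exact: measurable_oo|by move=> s; rewrite oo_in|].
  by rewrite E ltry.
by split => //; apply: EFin_inj; rewrite -RI_E.
Qed.

Lemma small_tail d : 0 < d -> exists h, [/\ 0 < h, h < T &
  \int[leb R]_s (oo (T - h) T s * diss G s) + h <= d].
Proof.
move=> d0; pose h n : R := T * n.+2%:R^-1.
have h0 n : 0 < h n by rewrite mulr_gt0// invr_gt0.
have hT n : h n < T by rewrite /h gtr_pMr// invf_lt1// ltr1n.
have ch : h n @[n --> \oo] --> 0.
  rewrite -[X in _ --> X](mulr0 T); apply: cvgM; first exact: cvg_cst.
  by have := @cvg_harmonic R; rewrite -(cvg_shiftS (@harmonic R)).
have [_ C] : Li (leb R) (fun _ : R => 0 : R) /\
   (\int[leb R]_s (oo (T - h n) T s * diss G s) @[n --> \oo] --> \int[leb R]_s ((fun=> 0) s : R)).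
  apply: (@Li_dct _ _ R (leb R) (fun n s => oo (T - h n) T s * diss G s) _ (diss G)) => //.
  - by move=> n; exact: Li_measurable (Li_oo _ _ LD).
  - apply: nearW => s; have [sT|sT] := ltP s T; last first.
      apply: cvg_near_cst; apply: nearW => n; rewrite oo_in.
      by have -> : (T - h n < s < T) = false by [apply/negbTE/negP => /andP[_]; rewrite ltNge sT]; rewrite mul0r.
    have p0 : 0 < T - s by rewrite subr_gt0.
    apply: cvg_near_cst; apply: filterS (cvg0_le ch p0) => n hn; rewrite oo_in.
    have -> : (T - h n < s < T) = false by apply/negbTE/negP => /andP[h1 _]; lra.
    by rewrite mul0r.
  - apply: nearW => s n; rewrite normrM (ger0_norm (diss_ge0 G s)) ler_piMl ?diss_ge0// oo_in.
    by case: (_ < _ < _); rewrite ?normr1 ?normr0.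
have d2 : 0 < d / 2 by rewrite divr_gt0.
rewrite RI0 in C.
have [n [hn1 hn2]] : exists n, \int[leb R]_s (oo (T - h n) T s * diss G s) <= d / 2 /\ h n <= d / 2.
  have : \forall n \near \oo, \int[leb R]_s (oo (T - h n) T s * diss G s) <= d / 2 /\ h n <= d / 2.
    by apply: filterS2 (cvg0_le C d2) (cvg0_le ch d2).
  by move=> [N _ hN]; exists N; apply: hN => /=.
by exists (h n); split => //; rewrite (splitr d) lerD.
Qed.

(** Were the dissipation rate at least K = (D + h) / h at almost every time of the interval, its
    integral would be at least D + h > D. The added h makes this strict also when D = 0, and the
    almost everywhere form allows s to avoid the exceptional times. *)
Lemma good_time h : 0 < h -> h < T -> exists s, [/\ T - h < s, s < T,
  forall i, slice (U i) s = slice (V i) s & forall i j, N2 mu (slice (G i j) s) <=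
   Num.sqrt ((\int[leb R]_r (oo (T - h) T r * diss G r) + h) / h)].
Proof.
move=> h0 hT; set D := \int[leb R]_r _; pose K := (D + h) / h.
have [s [h1 h2 UV sK]] : exists s, [/\ T - h < s, s < T, forall i, slice (U i) s = slice (V i) s & diss G s <= K].
  apply: contrapT => N; have TT : T - h <= T by rewrite gerBl ltW.
  have [Lo Io] := RI_oo TT; have LK := LiZ K Lo; have LG := Li_oo (T - h) T LD.
  have : \int[leb R]_r (K * oo (T - h) T r) <= D.
    apply: RI_le_ae => //; apply: (ae_imp (slab_ae H)) => s hs; rewrite oo_in.
    have [/andP[h1 h2]|_] := boolP (T - h < s < T); last by rewrite mulr0 mul0r.
    rewrite mulr1 mul1r leNgt; apply/negP => h3; apply: N; exists s; split => //.
    exact: ltW.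
  rewrite RIZ// Io subKr /K mulfVK ?gt_eqF//.
  by rewrite gerDl leNgt h0.
exists s; split => // i j; rewrite -/K -[leLHS]ger0_norm ?N2_ge0// -sqrtr_sqr ler_wsqrtr//.
apply: le_trans sK; rewrite /diss (bigD1 i)//= (bigD1 j)//= -addrA lerDl.
by apply: addr_ge0; apply: sumr_ge0 => l _; [exact: sqr_ge0|apply: sumr_ge0 => m _; exact: sqr_ge0].
Qed.

Lemma endpoint_inequality : kin V 0 - 2 * nu * \int[leb R]_r (oo 0 T r * diss G r) <= kin V T.
Proof.
have [K K0 hK] := endpoint_step; rewrite -subr_le0.
move: (kin V 0 - _ - _) hK => X hK; rewrite leNgt; apply/negP => X0.
(* A positive deficit X is refuted by this a: once both error terms are at most a, they contribute 2
   K a < X. *)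
pose a := X / (2 * K + 1) / 2.
have k1 : 0 < 2 * K + 1 by rewrite ltr_wpDl// mulr_ge0.
have a0 : 0 < a by rewrite !divr_gt0.
(* With D + h <= a^4 and e = sqrt(h) / a, the mollification error is e sqrt((D + h) / h) = sqrt(D +
   h) / a <= a, and the flux error is sqrt(T - s) / e <= a because T - s < h. *)
have [h [h0 hT hD]] := small_tail (exprn_gt0 4 a0).
have [s [h1 h2 UV Gs]] := good_time h0 hT.
have D0 : 0 <= \int[leb R]_r (oo (T - h) T r * diss G r).
  by apply: RI_ge0 => r; rewrite mulr_ge0 ?diss_ge0// oo_in.
move: hD Gs D0; move: (\int[leb R]_r _) => D hD Gs D0.
have s0 : 0 < s by rewrite (lt_trans _ h1)// subr_gt0.
have q0 : 0 < Num.sqrt h by rewrite sqrtr_gt0.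
have e0 : 0 < Num.sqrt h / a by rewrite divr_gt0.
have := hK s (Num.sqrt h / a) _ s0 h2 e0 UV Gs.
have -> : Num.sqrt h / a * Num.sqrt ((D + h) / h) = Num.sqrt (D + h) / a.
  rewrite sqrtrM; last by rewrite addr_ge0// ltW.
  rewrite sqrtrV ?ltW//; field; by rewrite !gt_eqF.
have b1 : Num.sqrt (D + h) / a <= a.
  rewrite ler_pdivrMr// -expr2 -[leRHS]ger0_norm ?sqr_ge0// -sqrtr_sqr ler_wsqrtr//.
  by rewrite -exprM.
have b2 : Num.sqrt (T - s) / (Num.sqrt h / a) <= a.
  rewrite ler_pdivrMr// mulrCA mulfV ?gt_eqF// mulr1 ler_wsqrtr//; lra.
move=> /le_trans /(_ (lerD (ler_wpM2l K0 b1) (ler_wpM2l K0 b2))).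
have aE : a * (2 * K + 1) * 2 = X by rewrite /a; field; rewrite gt_eqF.
by rewrite -aE leNgt (endpoint_lt a0 K0).
Qed.

End endpoint.

(** * Leray-Hopf solutions *)

Section zero_extension.
Context {R : realType}.
Implicit Types (x y : R3 R) (i j : 'I_3) (s t T : R) (f : R3 R * R -> R).
Local Notation mu := (leb3 R).
Local Notation M := (measurableTypeR R).
Local Notation mfun1 f := (@measurable_fun _ _ M R setT f).
Local Notation mfun3 f := (@measurable_fun _ _ (M * M * M)%type R setT f).
Local Notation mfun4 f := (@measurable_fun _ _ (M * M * M * M)%type R setT f).

Definition cut (S : set R) f : R3 R * R -> R := fun z => \1_S z.2 * f z.

Lemma slice_cut_in (S : set R) f s : S s -> slice (cut S f) s = slice f s.
Proof. by move=> Ss; apply/funext => x; rewrite /slice /cut /= indicE mem_set// mul1r. Qed.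

Lemma slice_cut_out (S : set R) f s : ~ S s -> slice (cut S f) s = fun=> 0.
Proof. by move=> Ss; apply/funext => x; rewrite /slice /cut /= indicE memNset// mul0r. Qed.

Lemma measurable_cut (S : set M) f : measurable S ->
  measurable_fun (setT `*` S : set (M * M * M * M)) f -> mfun4 (cut S f).
Proof.
move=> mS mf; have mD : measurable (setT `*` S : set (M * M * M * M)) by exact: measurableX.
have := (measurable_restrictT f mD).1 mf; congr measurable_fun; apply/funext => z.
rewrite patchE /cut indicE; have [h|h] := boolP (z \in _).
  by move: h; rewrite inE => -[_ h]; rewrite mem_set// mul1r.
rewrite memNset ?mul0r// => h'; move: h; rewrite notin_setE; apply; by split.
Qed.

Lemma measurable_cutT (S : set M) f : measurable S -> mfun4 f -> mfun4 (cut S f).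
Proof. by move=> mS mf; apply: measurable_cut => //; exact: measurable_funTS. Qed.

Lemma measurable_comp3 i : mfun3 (@comp3 R i).
Proof. by apply: continuous_measurable3; exact: comp3_continuous. Qed.

Lemma L2_field_comp3 (v : R3 R -> R3 R) i : L2_field v -> L2 mu (fun x => comp3 i (v x)).
Proof.
move=> [mv Lv]; have mi l : mfun3 (fun x => comp3 l (v x)).
  exact: (measurableT_comp (measurable_comp3 l) mv).
apply: N2_lty => //; apply: le_lt_trans Lv; apply: ge0_le_integral => //.
- by move=> x _; rewrite lee_fin sqr_ge0.
- by apply/measurable_EFinP; exact: measurable_funX.
- apply/measurable_EFinP; under eq_fun do rewrite enorm_sqr nsqE.
  by apply: measurable_sum => l; exact: measurable_funX.
- move=> x _; rewrite lee_fin enorm_sqr nsqE (bigD1 i)//= lerDl.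
  by apply: sumr_ge0 => l _; exact: sqr_ge0.
Qed.

Lemma L2_field_energy (v : R3 R -> R3 R) : L2_field v ->
  (\int[mu]_x ((enorm (v x)) ^+ 2)%:E = (\sum_(i < 3) N2 mu (fun x => comp3 i (v x)) ^+ 2)%:E)%E.
Proof.
move=> Lv; have L i := L2_sq (L2_field_comp3 i Lv).
under eq_integral do rewrite enorm_sqr nsqE.
rewrite RI_E; last exact: Li_sum.
by rewrite RI_sum//; congr EFin; apply: eq_bigr => i _; rewrite N2_sqr.
Qed.

Lemma comp3Z i (h : R) x : comp3 i (h *: x) = h * comp3 i x.
Proof. by case: i => -[|[|[|//]]] ?. Qed.

Lemma L2_field_scale k i : L2 mu k -> L2_field (fun y => k y *: (evec i : R3 R)).
Proof.
move=> [mk Lk]; split.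
  have e : (fun y => k y *: (evec i : R3 R)) = (fun y =>
     (k y * (i == 0%N :> nat)%:R, k y * (i == 1%N :> nat)%:R, k y * (i == 2%N :> nat)%:R)).
    by apply/funext.
  rewrite e; apply: measurable_fun_pair; [apply: measurable_fun_pair|]; exact: measurable_funM.
have -> : (\int[mu]_x ((enorm (k x *: (evec i : R3 R))) ^+ 2)%:E = \int[mu]_x (k x ^+ 2)%:E)%E.
  apply: eq_integral => x _; congr EFin; rewrite enorm_sqr nsqE.
  rewrite (bigD1 i)//= big1 ?addr0 => [|j ji].
    by rewrite comp3Z comp3_evec eqxx mulr1.
  by rewrite comp3Z comp3_evec (negbTE ji) mulr0 expr0n.
by rewrite RI_E// ltry.
Qed.

Lemma H1_0 : H1 (fun=> 0 : R) (fun _ _ => 0).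
Proof.
split; [exact: L2_0|by move=> j; exact: L2_0|].
move=> j psi tpsi; rewrite (_ : (fun x => _) = fun=> 0); last by apply/funext => x; rewrite mul0r.
rewrite [in RHS](_ : (fun x => _) = fun=> 0); last by apply/funext => x; rewrite mul0r.
by rewrite RI0 oppr0.
Qed.

Lemma uniform_cont_within T (g w : R -> R) : {within `[0, T], continuous g} ->
  (forall s, 0 <= s <= T -> w s = g s) -> uniform_cont T w.
Proof.
move=> /subspace_continuousP cg wg t ht e e0.
have ht' : `[0, T]%classic t by rewrite /= in_itv.
have /cvgrPdist_le /(_ e e0) := cg t ht'; rewrite near_withinE => -[d /= d0 hd].
exists d => // s hs st; rewrite !wg// distrC; apply: hd => //=.
by rewrite distrC.
Qed.

End zero_extension.

Section leray_hopf_slab.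
Context {R : realType}.
Implicit Types (x y : R3 R) (i j : 'I_3) (s t a b : R) (f F : R3 R * R -> R) (S N : set R).
Local Notation mu := (leb3 R).
Local Notation M := (measurableTypeR R).
Local Notation mfun1 f := (@measurable_fun _ _ M R setT f).
Local Notation mfun3 f := (@measurable_fun _ _ (M * M * M)%type R setT f).
Local Notation mfun4 f := (@measurable_fun _ _ (M * M * M * M)%type R setT f).
Local Notation oo a b := (\1_(`]a, b[%classic) : R -> R).

Lemma ae_snd (N : set M) : measurable N -> leb R N = 0%E -> {ae leb3t R, forall z, ~ N z.2}.
Proof.
move=> mN N0; exists (setT `*` N); split.
- exact: (@measurableX _ _ (M * M * M)%type M).
- apply: (etrans (@product_measure1E _ _ (M * M * M)%type M R (sfleb3 R) (leb R) setT N measurableT mN)).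
  by apply: (@etrans _ _ (sfleb3 R setT * 0)%E); [congr (_ * _)%E; exact: N0|exact: mule0].
- by move=> z /= h; split => //; apply: contrapT => h'; apply: h => h2; exact: h'.
Qed.

(** Discarding a null set of times changes no space-time integral, so the weak equation on ]0, T[
    carries over to functions set to 0 off [S] and integrated over all times. *)
Lemma RI_transfer T (S N : set M) f F : measurable S -> measurable N -> leb R N = 0%E ->
  S = `]0, T[%classic `\` N -> mfun4 F -> (forall z, 0 < z.2 < T -> f z = F z) ->
  \int[leb3t R]_(z in setT `*` `]0, T[) f z = \int[leb3t R]_z cut S F z.
Proof.
move=> mS mN N0 SE mF fF.
have E : (EFin \o f) \_ (setT `*` `]0, T[%classic) = EFin \o cut `]0, T[%classic F.
  apply/funext => z; rewrite patchE /cut /= indicE; have [h|h] := boolP (z \in _).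
    move: h; rewrite inE => -[_ /= h]; by rewrite mem_set// mul1r /= fF.
  rewrite memNset ?mul0r// => h'; move: h; rewrite notin_setE; apply; by split.
rewrite /Rintegral integral_mkcond; congr fine; rewrite E.
apply: ae_eq_integral => //.
- apply/measurable_EFinP; apply: measurable_cutT => //; exact: measurable_itv.
- by apply/measurable_EFinP; exact: measurable_cutT.
- apply: (ae_imp (ae_snd mN N0)) => z hz _; rewrite /cut /= SE; congr (_ * _)%:E.
  rewrite !indicE; congr (nat_of_bool _)%:R; apply/idP/idP; rewrite !inE //=.
  by case.
Qed.

Context (nu T : R) (u : R -> R3 R -> R3 R) (Du : R -> R3 R -> 'M[R]_3) (p : R -> R3 R -> R).
Context (T0 : 0 < T) (nu0 : 0 < nu) (lh : leray_hopf nu T u Du p).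

(** Nothing is known of the solution outside [0, T]. The value 0 there makes the components
    measurable on all of space-time and every slice square integrable. *)
Definition velocity i := cut `[0, T]%classic (fun z => comp3 i (u z.2 z.1)).
Definition gradient i j := cut `[0, T]%classic (fun z => Du z.2 z.1 i j).
Definition pressure := cut `[0, T]%classic (fun z => p z.2 z.1).

Lemma measurable_velocity i : mfun4 (velocity i).
Proof.
apply: (@measurable_cut R); first exact: measurable_itv.
exact: (measurableT_comp (@measurable_comp3 R i) (lh_measurable lh)).
Qed.

Lemma measurable_gradient i j : mfun4 (gradient i j).
Proof.
apply: (@measurable_cut R); first exact: measurable_itv.
by have [h _ _] := lh_L2_H1 lh; exact: h.
Qed.

Lemma measurable_pressure : mfun4 pressure.
Proof.
by apply: (@measurable_cut R); [exact: measurable_itv|exact: (lh_measurable_pressure lh)].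
Qed.

Lemma in_time s : 0 <= s <= T -> `[0, T]%classic s.
Proof. by rewrite /= in_itv. Qed.

Lemma velocityE i s : 0 <= s <= T -> slice (velocity i) s = fun x => comp3 i (u s x).
Proof. by move=> /in_time hs; rewrite /velocity slice_cut_in. Qed.

Lemma velocity_out i s : ~~ (0 <= s <= T) -> slice (velocity i) s = fun=> 0.
Proof. by move=> hs; rewrite /velocity slice_cut_out//= in_itv /=; exact/negP. Qed.

Lemma velocity_field s : 0 <= s <= T -> L2_field (u s).
Proof. by have [h _] := lh_weakly_continuous lh; exact: h. Qed.

Lemma velocity_L2 i s : L2 mu (slice (velocity i) s).
Proof.
have [h|h] := boolP (0 <= s <= T); last by rewrite velocity_out//; exact: L2_0.
by rewrite velocityE//; apply: L2_field_comp3; exact: velocity_field.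
Qed.

Lemma energyE t : 0 <= t <= T -> energy u t = (kin velocity t)%:E.
Proof.
move=> ht; rewrite /energy L2_field_energy; last exact: velocity_field.
by congr EFin; apply: eq_bigr => i _; rewrite velocityE.
Qed.

Lemma dissipation_ge0 a b : (0 <= dissipation Du a b)%E.
Proof. by apply: integral_ge0 => s _; apply: integral_ge0 => x _; rewrite lee_fin sqr_ge0. Qed.

(** The energy inequality from time 0 bounds the energy at every time, as a slab requires, and not
    just at almost every time. *)
Lemma kin_le t : 0 <= t <= T -> kin velocity t <= kin velocity 0.
Proof.
move=> /andP[t0 tT]; move: t0; rewrite le_eqVlt => /predU1P[<-//|t0].
have h0 : (0 : R) <= 0 <= T by rewrite lexx ltW.
have ht : 0 <= t <= T by rewrite (ltW t0).
have := lh_energy0 lh; move=> /(_ t); rewrite t0 tT => /(_ isT).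
rewrite /energy_inequality !energyE// => h; rewrite -lee_fin (le_trans h)//.
rewrite -[leRHS]adde0 leeD2l// oppe_le0 mule_ge0 ?dissipation_ge0// lee_fin.
by rewrite mulr_ge0// ltW.
Qed.

Lemma velocity_N2 i s : N2 mu (slice (velocity i) s) <= Num.sqrt (kin velocity 0).
Proof.
have k0 t : 0 <= kin velocity t by apply: sumr_ge0 => l _; exact: sqr_ge0.
have [h|h] := boolP (0 <= s <= T); last by rewrite velocity_out// N2_0 sqrtr_ge0.
rewrite -[leLHS]ger0_norm ?N2_ge0// -sqrtr_sqr ler_wsqrtr// (le_trans _ (kin_le h))//.
by rewrite /kin (bigD1 i)//= lerDl; apply: sumr_ge0 => l _; exact: sqr_ge0.
Qed.

Lemma velocity_uniform_cont i k : L2 mu k ->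
  uniform_cont T (fun s => \int[mu]_y (k y * slice (velocity i) s y)).
Proof.
move=> Lk; have [_ wc] := lh_weakly_continuous lh.
apply: (uniform_cont_within (wc _ (L2_field_scale i Lk))) => s hs.
apply: eq_RI => y; rewrite velocityE// /dot (bigD1 i)//= big1 ?addr0 => [|j ji].
  by rewrite comp3Z comp3_evec eqxx mulr1 mulrC.
by rewrite comp3Z comp3_evec (negbTE ji) !mulr0.
Qed.

Definition gradient_density s : \bar R :=
  (\int[mu]_x (\sum_(i < 3) \sum_(j < 3) gradient i j (x, s) ^+ 2)%:E)%E.

Lemma frobenius_sqr (X : 'M[R]_3) : frobenius X ^+ 2 = \sum_(i < 3) \sum_(j < 3) X i j ^+ 2.
Proof.
by rewrite sqr_sqrtr//; apply: sumr_ge0 => i _; apply: sumr_ge0 => j _; exact: sqr_ge0.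
Qed.

Lemma gradient_densityE s : 0 <= s <= T ->
  (\int[mu]_x ((frobenius (Du s x)) ^+ 2)%:E = gradient_density s)%E.
Proof.
move=> hs; apply: eq_integral => x _; rewrite frobenius_sqr; congr EFin.
apply: eq_bigr => i _; apply: eq_bigr => j _.
by rewrite /gradient /cut /= indicE mem_set ?mul1r//; exact: in_time.
Qed.

Lemma measurable_gradient_density :
  @measurable_fun _ _ M (\bar R) setT gradient_density.
Proof.
apply: (@measurable_fun_fubini_tonelli_G _ _ (M * M * M)%type M R (sfleb3 R)
  (fun z => (\sum_(i < 3) \sum_(j < 3) gradient i j z ^+ 2)%:E)) => [|z].
  apply/measurable_EFinP; apply: measurable_sum => i; apply: measurable_sum => j.
  by apply: measurable_funX; exact: measurable_gradient.
by rewrite lee_fin; apply: sumr_ge0 => i _; apply: sumr_ge0 => j _; exact: sqr_ge0.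
Qed.

Lemma gradient_density_ge0 s : (0 <= gradient_density s)%E.
Proof.
apply: integral_ge0 => x _; rewrite lee_fin.
by apply: sumr_ge0 => i _; apply: sumr_ge0 => j _; exact: sqr_ge0.
Qed.

Lemma dissipationE a b : 0 <= a -> b <= T ->
  (dissipation Du a b = \int[leb R]_(s in `[a, b]) gradient_density s)%E.
Proof.
move=> a0 bT; apply: eq_integral => s; rewrite inE /= in_itv /= => /andP[h1 h2].
by apply: gradient_densityE; rewrite (le_trans a0 h1) (le_trans h2 bT).
Qed.

Lemma gradient_density_out s : ~~ (0 <= s <= T) -> gradient_density s = 0%E.
Proof.
move=> hs; rewrite /gradient_density integral0_eq// => x _; congr EFin.
rewrite big1// => i _; rewrite big1// => j _.
by rewrite /gradient /cut /= indicE memNset ?mul0r ?expr0n//= in_itv /=; exact/negP.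
Qed.

Lemma gradient_density_lty : (\int[leb R]_s gradient_density s < +oo)%E.
Proof.
have [_ _ h] := lh_L2_H1 lh; move: h; rewrite dissipationE// integral_mkcond.
congr (_ < _)%E; apply: eq_integral => s _; rewrite patchE.
have [//|h] := boolP (s \in _); rewrite gradient_density_out//.
by apply/negP => h'; move: h; rewrite notin_setE; apply; exact: in_time.
Qed.

Definition good_slice s := [/\ 0 <= s <= T -> weak_gradient (u s) (Du s),
  0 <= s <= T -> is_pressure (u s) (p s) & (gradient_density s < +oo)%E].

Lemma good_slices : exists N : set M, [/\ measurable N, leb R N = 0%E & forall s, ~ N s -> good_slice s].
Proof.
have [_ h1 _] := lh_L2_H1 lh; have h2 := lh_pressure lh.
have h3 : {ae leb R, forall s, (gradient_density s < +oo)%E}.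
  have Igd : (leb R).-integrable setT gradient_density.
    apply/integrableP; split; first exact: measurable_gradient_density.
    apply: le_lt_trans gradient_density_lty; rewrite le_eqVlt; apply/orP; left; apply/eqP.
    by apply: eq_integral => s _; rewrite gee0_abs ?gradient_density_ge0.
  have := integrable_ae measurableT Igd; apply: filterS => s /(_ I) h.
  by rewrite ltey; apply/eqP => e; move: h; rewrite e.
have h : {ae leb R, forall s, good_slice s}.
  have h12 := ae_imp2 h1 h2 (fun _ hw hp => conj hw hp).
  by apply: (ae_imp2 h12 h3) => s [hw hp] hd; split.
have [N [mN N0 sN]] := h; exists N; split => // s Ns.
by apply: contrapT => h'; apply: Ns; exact: sN.
Qed.

Lemma le_weighted (q a b D : R) : 0 <= q -> 0 <= a -> 0 <= b -> 0 <= D -> D <= q * a + (1 + b) * D.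
Proof.
move=> q0 a0 b0 D0; have h1 := mulr_ge0 q0 a0; have h2 := mulr_ge0 b0 D0.
by rewrite mulrDl mul1r; move: (q * a) (b * D) h1 h2 => c d; lra.
Qed.

Lemma le_1_sqr (g : R) : g <= 1 + g ^+ 2.
Proof. by have := sqr_ge0 (g - 1); have := sqr_ge0 (g + 1); nra. Qed.

(** For [pressure_bound]: [S1] is the sum of three velocity norms, each at most A, and [S2] the sum
    of nine gradient norms g, each at most 1 + g^2, so that S2 <= 9 + D with D the dissipation
    rate. *)
Lemma pressure_arith (C A D S1 S2 : R) : 0 <= C -> 0 <= A -> 0 <= D -> 0 <= S1 -> 0 <= S2 -> S1 <= 3 * A ->
  S2 <= 9 + D -> C * (S1 * S2) <= 1 + 27 * A * C + (1 + 3 * A * C) * D.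
Proof.
move=> C0 A0 D0 p1 p2 h1 h2; have h3 : C * (S1 * S2) <= C * (3 * A * (9 + D)).
  by apply: ler_wpM2l => //; apply: ler_pM.
apply: (le_trans h3); rewrite -subr_ge0.
have -> : 1 + 27 * A * C + (1 + 3 * A * C) * D - C * (3 * A * (9 + D)) = 1 + D by ring.
by rewrite addr_ge0.
Qed.

(* The slices at the exceptional times, where the gradient or the pressure may
   be meaningless, are replaced by 0. *)
Lemma slab_of_leray_hopf : exists (A : R) (B : R -> R) (U : 'I_3 -> R3 R * R -> R)
  (G : 'I_3 -> 'I_3 -> R3 R * R -> R) (P : R3 R * R -> R),
  [/\ slab nu T A B velocity U G P, Li (leb R) (diss G) &
   forall a b, 0 <= a -> a <= b -> b <= T ->
   dissipation Du a b = (\int[leb R]_s (oo a b s * diss G s))%:E].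
Proof.
have [N [mN N0 hN]] := good_slices; pose S : set M := `]0, T[%classic `\` N.
have mS : measurable S by apply: measurableD => //; exact: measurable_itv.
pose U i := cut S (velocity i); pose G i j := cut S (gradient i j); pose P := cut S pressure.
have St s : S s -> 0 < s < T by move=> [/= h _]; move: h; rewrite in_itv.
have St' s : S s -> 0 <= s <= T by move=> /St /andP[? ?]; rewrite !ltW.
have mU i : mfun4 (U i) by apply: measurable_cutT => //; exact: measurable_velocity.
have mG i j : mfun4 (G i j) by apply: measurable_cutT => //; exact: measurable_gradient.
have mP : mfun4 P by apply: measurable_cutT => //; exact: measurable_pressure.
have Uin s i : S s -> slice (U i) s = slice (velocity i) s by exact: slice_cut_in.
have Gin s i j : S s -> slice (G i j) s = slice (gradient i j) s by exact: slice_cut_in.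
have Pin s : S s -> slice P s = slice pressure s by exact: slice_cut_in.
have Uout s i : ~ S s -> slice (U i) s = fun=> 0 by exact: slice_cut_out.
have Gout s i j : ~ S s -> slice (G i j) s = fun=> 0 by exact: slice_cut_out.
have Pout s : ~ S s -> slice P s = fun=> 0 by exact: slice_cut_out.
have LG s i j : L2 mu (slice (G i j) s).
  have [Ss|Ss] := pselect (S s); last by rewrite Gout//; exact: L2_0.
  have [_ _ hd] := hN s (proj2 Ss); apply: N2_lty; first exact: measurable_slice.
  apply: le_lt_trans hd; apply: ge0_le_integral => //.
  - by move=> x _; rewrite lee_fin sqr_ge0.
  - by apply/measurable_EFinP; apply: measurable_funX; exact: measurable_slice.
  - apply/measurable_EFinP; apply: measurable_sum => k; apply: measurable_sum => l.
    by apply: measurable_funX; apply: (@measurable_slice R); exact: measurable_gradient.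
  - move=> x _; rewrite lee_fin Gin// (bigD1 i)//= (bigD1 j)//= -addrA lerDl.
    by apply: addr_ge0; apply: sumr_ge0 => l _; [exact: sqr_ge0|apply: sumr_ge0 => m _; exact: sqr_ge0].
have dissE s : S s -> (diss G s)%:E = gradient_density s.
  move=> Ss; rewrite /gradient_density.
  have Lg i j : Li mu (fun x => gradient i j (x, s) ^+ 2).
    by have := L2_sq (LG s i j); rewrite Gin.
  rewrite RI_E; last by apply: Li_sum => i; exact: Li_sum.
  congr EFin; rewrite RI_sum; last by move=> i; exact: Li_sum.
  apply: eq_bigr => i _; rewrite RI_sum//; apply: eq_bigr => j _.
  by rewrite N2_sqr Gin.
have diss0 s : ~ S s -> diss G s = 0.
  by move=> Ss; rewrite /diss big1// => i _; rewrite big1// => j _; rewrite Gout// N2_0 expr0n.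
have mdiss : mfun1 (diss G).
  apply: measurable_sum => i; apply: measurable_sum => j; under eq_fun do rewrite N2_sqr.
  by apply: (@measurable_RIx R (fun z => G i j z ^+ 2)); exact: measurable_funX.
have LD : Li (leb R) (diss G).
  apply: Li_ge0_lty => //; first by move=> s; exact: diss_ge0.
  apply: le_lt_trans gradient_density_lty; apply: ge0_le_integral => //.
  - by move=> s _; rewrite lee_fin diss_ge0.
  - exact/measurable_EFinP.
  - exact: measurable_gradient_density.
  - move=> s _; have [Ss|Ss] := pselect (S s); first by rewrite dissE.
    by rewrite diss0// gradient_density_ge0.
have [Cp Cp0 hp] := @pressure_bound R.
pose A := Num.sqrt (kin velocity 0); have A0 : 0 <= A by exact: sqrtr_ge0.
have c10 : 0 <= 1 + 27 * A * Cp by rewrite addr_ge0// !mulr_ge0.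
have c20 : 0 <= 3 * A * Cp by rewrite !mulr_ge0.
(* One integrable function must dominate the constant 1 on ]0, T[, the squared gradient norms and
   the pressure norms; the coefficients are those of [pressure_arith]. *)
pose B s := oo 0 T s * (1 + 27 * A * Cp) + (1 + 3 * A * Cp) * diss G s.
have dB s : diss G s <= B s.
  by apply: (le_weighted _ c10 c20 (diss_ge0 G s)); rewrite oo_in.
have B0 s : 0 <= B s by apply: le_trans (dB s); exact: diss_ge0.
have hH1 s i : H1 (slice (U i) s) (fun j => slice (G i j) s).
  have [Ss|Ss] := pselect (S s); last first.
    rewrite Uout// (_ : (fun j => _) = fun _ _ => 0); first exact: H1_0.
    by apply/funext => j; rewrite Gout.
  split; first by rewrite Uin//; exact: velocity_L2.
    by move=> j; exact: LG.
  have [wg _ _] := hN s (proj2 Ss) => j psi tpsi.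
  have := wg (St' s Ss) i j psi (tst_test tpsi); rewrite Uin// velocityE ?St'// Gin//.
  move=> h; apply: (etrans h); congr (- _); apply: eq_RI => x.
  by rewrite /slice /gradient /cut /= indicE mem_set ?mul1r//; exact: in_time (St' s Ss).
have neq0 s : ~ N s -> s != 0 -> s != T -> forall i, slice (U i) s = slice (velocity i) s.
  move=> Ns s0 sT i; have [h|h] := boolP (0 <= s <= T).
    apply: Uin; split => //=; rewrite in_itv /= !lt_neqAle sT eq_sym s0 /=.
    by move: h => /andP[-> ->].
  by rewrite velocity_out// Uout// => /St'; exact/negP.
have aeN : {ae leb R, forall s, ~ N s}.
  by exists N; split => // s /= h; apply: contrapT => h'; exact: h.
exists A, B, U, G, P; split => //; last first.
  move=> a b a0 ab bT; rewrite dissipationE//.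
  have Lo := Li_oo a b LD; rewrite -RI_E// [LHS]integral_mkcond.
  apply: ae_eq_integral => //.
  - apply/(measurable_restrictT _ _).1; first exact: measurable_itv.
    exact: measurable_funTS measurable_gradient_density.
  - by apply/measurable_EFinP; exact: Li_measurable Lo.
  - apply: (ae_imp2 aeN (ae_imp2 (ae_neq a) (ae_neq b) (fun _ h1 h2 => conj h1 h2))) => s Ns [sa sb] _.
    rewrite patchE oo_in; have [h|h] := boolP (s \in _).
      move: h; rewrite inE /= in_itv /= => /andP[h1 h2].
      have -> : a < s < b by rewrite !lt_neqAle sb h1 h2 eq_sym sa.
      rewrite mul1r dissE//; split => //=; rewrite in_itv /=.
      have as_ : a < s by rewrite lt_neqAle eq_sym sa.
      have sb_ : s < b by rewrite lt_neqAle sb.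
      by rewrite (le_lt_trans a0 as_) (lt_le_trans sb_ bT).
    have -> : (a < s < b) = false.
      apply/negbTE/negP => /andP[h1 h2]; move: h; rewrite notin_setE; apply.
      by rewrite /= in_itv /= !ltW.
    by rewrite mul0r.
split => //.
- by apply: LiD; [apply: LiZr; exact: (RI_oo (ltW T0)).1|exact: LiZ].
- move=> s hs; rewrite /B oo_in hs mul1r -addrA lerDl addr_ge0//; first by rewrite !mulr_ge0.
  by rewrite mulr_ge0 ?diss_ge0// addr_ge0.
- exact: measurable_velocity.
- by move=> s i; split; [exact: velocity_L2|exact: velocity_N2].
- exact: velocity_uniform_cont.
- move=> s; have [Ss|Ss] := pselect (S s); [left|right].
    by split; [exact: St|move=> i; exact: Uin].
  by split; [move=> i; exact: Uout|exact: Pout].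
- apply: (ae_imp2 aeN (ae_imp2 (ae_neq 0) (ae_neq T) (fun _ h1 h2 => conj h1 h2))) => s Ns [s0 sT].
  exact: neq0.
- move=> s i j; apply: le_trans (dB s); rewrite /diss (bigD1 i)//= (bigD1 j)//= -addrA lerDl.
  by apply: addr_ge0; apply: sumr_ge0 => l _; [exact: sqr_ge0|apply: sumr_ge0 => m _; exact: sqr_ge0].
- move=> s; have [Ss|Ss] := pselect (S s); last first.
    rewrite Pout//; exists (fun=> 0), (fun=> 0); split => //.
    + exact: L2_L12 (L2_0 _).
    + rewrite (_ : (fun x => _) = fun=> 0) ?RI0//; by apply/funext => x; rewrite normr0.
    + by rewrite N2_0.
  have [_ pr _] := hN s (proj2 Ss).
  have hv i : H1 (fun x => comp3 i (u s x)) (fun j => slice (G i j) s).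
    by have := hH1 s i; rewrite Uin// velocityE// St'.
  have ps : slice P s = p s.
    by rewrite Pin// /pressure slice_cut_in//; exact: in_time (St' s Ss).
  have [p1 [p2 [L [h1 h2]]]] := hp (u s) (fun i j => slice (G i j) s) (slice P s) hv
    (measurable_slice s mP) (eq_ind_r (fun q => is_pressure (u s) q) (pr (St' s Ss)) ps).
  have bnd : Cp * ((\sum_(i < 3) N2 mu (fun x => comp3 i (u s x))) *
      (\sum_(i < 3) \sum_(j < 3) N2 mu (slice (G i j) s))) <= B s.
    rewrite /B oo_in St// mul1r; apply: pressure_arith => //.
    + exact: diss_ge0.
    + by apply: sumr_ge0 => i _; exact: N2_ge0.
    + by apply: sumr_ge0 => i _; apply: sumr_ge0 => j _; exact: N2_ge0.
    + apply: (@le_trans _ _ (\sum_(i < 3) A)); last by rewrite sumr_const card_ord mulr_natl.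
      by apply: ler_sum => i _; have := velocity_N2 i s; rewrite velocityE// St'.
    + apply: (@le_trans _ _ (\sum_(i < 3) \sum_(j < 3) (1 + N2 mu (slice (G i j) s) ^+ 2))).
        by apply: ler_sum => i _; apply: ler_sum => j _; exact: le_1_sqr.
      under eq_bigr do rewrite big_split /=.
      by rewrite big_split /= sum33_const mulr1.
  by exists p1, p2; split => //; [exact: le_trans h1 bnd|exact: le_trans h2 bnd].
- move=> phi tphi [m1 m2 m3] i; have [/(_ i) NS _] := lh_equation lh tphi.
  pose F z := velocity i z * d_t phi z + \sum_(j < 3) velocity i z * velocity j z * d_x j phi z
      + nu * velocity i z * laplacian phi z + pressure z * d_x i phi z.
  have mF : mfun4 F.
    have mv := measurable_velocity; have mp := measurable_pressure.
    apply: measurable_funD; first apply: measurable_funD; first apply: measurable_funD.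
    - exact: (measurable_funM (mv i) m1).
    - by apply: measurable_sum => j; exact: (measurable_funM (measurable_funM (mv i) (mv j)) (m2 j)).
    - exact: (measurable_funM (measurable_funM (measurable_cst nu) (mv i)) m3).
    - exact: (measurable_funM mp (m2 i)).
  rewrite -[RHS]NS (@RI_transfer T S N _ F)//; last first.
    move=> z hz; rewrite /F /velocity /pressure /cut.
    have -> : \1_(`[0, T]%classic) z.2 = 1 :> R.
      by rewrite indicE mem_set//=; apply: in_time; move: hz => /andP[? ?]; rewrite !ltW.
    by rewrite !mul1r; under [in RHS]eq_bigr do rewrite !mul1r.
  apply: eq_RI => z; rewrite /F /U /P /cut indicE; case: (_ \in _).
    by rewrite !mul1r; under eq_bigr do rewrite !mul1r.
  by rewrite !mul0r mulr0 mul0r !addr0 big1 ?addr0// => j _; rewrite !mul0r.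
- move=> phi tphi [_ m2 _]; have [_ NS] := lh_equation lh tphi.
  pose F z := \sum_(i < 3) velocity i z * d_x i phi z.
  have mF : mfun4 F.
    by apply: measurable_sum => j; exact: (measurable_funM (measurable_velocity j) (m2 j)).
  rewrite -[RHS]NS (@RI_transfer T S N _ F)//; last first.
    move=> z hz; apply: eq_bigr => i _; rewrite /velocity /cut.
    by rewrite indicE mem_set ?mul1r//=; apply: in_time; move: hz => /andP[? ?]; rewrite !ltW.
  apply: eq_RI => z; rewrite /F /U /cut indicE; case: (_ \in _).
    by rewrite mul1r; apply: eq_bigr => i _; rewrite mul1r.
  by rewrite mul0r big1// => i _; rewrite !mul0r.
Qed.

End leray_hopf_slab.

(** * Energy equality *)

Section energy_equality.
Context {R : realType}.
Implicit Types (x : R3 R) (i : 'I_3) (s t a b c : R).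
Local Notation mu := (leb3 R).
Local Notation oo a b := (\1_(`]a, b[%classic) : R -> R).

Lemma comp3_enorm i x : `|comp3 i x| <= enorm x.
Proof.
rewrite -[leRHS]ger0_norm ?sqrtr_ge0// -ler_sqr ?nnegrE//.
rewrite -!normrX !ger0_norm ?sqr_ge0// enorm_sqr nsqE (bigD1 i)//= lerDl.
by apply: sumr_ge0 => j _; exact: sqr_ge0.
Qed.

Lemma RI_oo_split (D : R -> R) a b c : Li (leb R) D -> a <= b -> b <= c ->
  \int[leb R]_s (oo a b s * D s) + \int[leb R]_s (oo b c s * D s) = \int[leb R]_s (oo a c s * D s).
Proof.
move=> LD ab bc; have L1 := Li_oo a b LD; have L2' := Li_oo b c LD; have L3 := Li_oo a c LD.
rewrite -RID//; apply: RI_ae; [exact: LiD|exact: Li_measurable L3|].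
apply: (ae_imp (ae_neq b)) => s; rewrite -mulrDl neq_lt => sb; congr (_ * _).
rewrite !oo_in; case/orP: sb => h.
  have -> : (b < s) = false by rewrite ltNge ltW.
  by rewrite h (lt_le_trans h bc) addr0.
have -> : (s < b) = false by rewrite ltNge ltW.
by rewrite h (le_lt_trans ab h) add0r.
Qed.

Context (nu T : R) (u : R -> R3 R -> R3 R) (Du : R -> R3 R -> 'M[R]_3) (p : R -> R3 R -> R).
Context (nu0 : 0 < nu) (T0 : 0 < T) (lh : leray_hopf nu T u Du p).
Local Notation V := (velocity T u).
Context (A : R) (B : R -> R) (U : 'I_3 -> R3 R * R -> R)
  (G : 'I_3 -> 'I_3 -> R3 R * R -> R) (P : R3 R * R -> R).
Context (H : slab nu T A B V U G P) (LD : Li (leb R) (diss G)).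
Hypothesis dissG : forall a b, 0 <= a -> a <= b -> b <= T ->
   dissipation Du a b = (\int[leb R]_s (oo a b s * diss G s))%:E.

Lemma energy_equality_kin :
  (forall a b, 0 <= a -> a <= b -> b <= T ->
    kin V b - kin V a = - (2 * nu * \int[leb R]_s (oo a b s * diss G s))) ->
  energy_equality nu T u Du.
Proof.
move=> h a b a0 ab bT; rewrite dissG// !(energyE lh) -?EFinB ?h ?EFinM//.
  by rewrite a0 (le_trans ab).
by rewrite (le_trans a0).
Qed.

Lemma slab_velocity s : 0 < s < T -> (forall i, slice (U i) s = fun x => comp3 i (u s x)) \/
  (forall i, slice (U i) s = fun=> 0).
Proof.
move=> /andP[s0 sT]; have [[_ h]|[h _]] := slab_UV H s; [left => i|by right].
by rewrite h velocityE// !ltW.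
Qed.

Lemma slab_velocity_bound (b : R3 R -> R) s : 0 < s < T -> (forall x, 0 <= b x) ->
  {ae mu, forall x, x != 0 -> enorm (u s x) <= b x} -> forall i,
  {ae mu, forall x, x != 0 -> `|slice (U i) s x| <= b x}.
Proof.
move=> hs b0 ub i; apply: (ae_imp ub) => x h x0; have [->|->] := slab_velocity hs.
  by apply: le_trans (h x0); exact: comp3_enorm.
by rewrite normr0.
Qed.

Lemma energy_equality_type_I_space : type_I_space T u -> energy_equality nu T u Du.
Proof.
move=> [C hC]; apply: energy_equality_kin => a b a0 ab bT.
(* The constant of [mult_hardy], with |C| because the sign of C is not prescribed. *)
apply: (energy_identity H LD a0 ab bT (Mc := 2 * `|C|)); first by rewrite mulr_ge0.
move=> s /andP[as_ sb] i; have [LU _] := slab_U H s i; apply: mult_hardy => //.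
have hs : 0 < s < T by rewrite (le_lt_trans a0 as_) (lt_le_trans sb bT).
apply: (slab_velocity_bound hs) => [x|].
  by rewrite mulr_ge0// invr_ge0 sqrtr_ge0.
apply: (ae_imp (hC s hs)) => x h x0; apply: (le_trans (h x0)).
by rewrite ler_wpM2r ?invr_ge0 ?sqrtr_ge0// ler_norm.
Qed.

Lemma energy_equality_type_I_time : type_I_time T u -> energy_equality nu T u Du.
Proof.
move=> [C hC].
have hU s : 0 < s < T -> forall i, {ae mu, forall x, `|slice (U i) s x| <= `|C| / Num.sqrt (T - s)}.
  move=> hs i.
  have h0 : 0 <= `|C| / Num.sqrt (T - s) by rewrite mulr_ge0// invr_ge0 sqrtr_ge0.
  have h1 : {ae mu, forall x, x != 0 -> enorm (u s x) <= `|C| / Num.sqrt (T - s)}.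
    apply: (ae_imp (hC s hs)) => x h _; apply: (le_trans h).
    by rewrite ler_wpM2r ?invr_ge0 ?sqrtr_ge0// ler_norm.
  have h2 := slab_velocity_bound hs (fun=> h0) h1 i.
  by apply: (ae_imp2 h2 (@ae_neq0 R)) => x h3 h4; exact: h3.
have C0 := normr_ge0 C; have nu0' := ltW nu0.
have I0 t : 0 <= t -> t < T -> kin V t - kin V 0 = - (2 * nu * \int[leb R]_s (oo 0 t s * diss G s)).
  exact: (type_I_identity H LD C0 T0 hU).
have IT : kin V T - kin V 0 = - (2 * nu * \int[leb R]_s (oo 0 T s * diss G s)).
  have E1 := endpoint_inequality H LD C0 nu0' T0 hU.
  have E2 : kin V T <= kin V 0 - 2 * nu * \int[leb R]_s (oo 0 T s * diss G s).
    have := lh_energy0 lh; move=> /(_ T); rewrite T0 lexx => /(_ isT).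
    have h0 : (0 : R) <= 0 <= T by rewrite lexx ltW.
    have hT : 0 <= T <= T by rewrite lexx ltW.
    rewrite /energy_inequality (dissG (lexx 0) (ltW T0) (lexx T)) (energyE lh hT) (energyE lh h0).
    by rewrite -EFinM -EFinB lee_fin.
  apply/eqP; rewrite subr_eq addrC; apply/eqP/le_anti; rewrite E2; exact: E1.
(* The identities on [0, t], now also for t = T, give the one on any [a, b] by subtraction. *)
have I t : 0 <= t -> t <= T -> kin V t = kin V 0 - 2 * nu * \int[leb R]_s (oo 0 t s * diss G s).
  move=> t0; rewrite le_eqVlt => /predU1P[->|tT].
    by apply/eqP; rewrite -subr_eq0 opprB addrA subr_eq0 -subr_eq0 addrAC IT addNr.
  by apply/eqP; rewrite -subr_eq0 opprB addrA subr_eq0 -subr_eq0 addrAC I0// addNr.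
apply: energy_equality_kin => a b a0 ab bT; rewrite I ?(le_trans a0)// [kin V a]I ?(le_trans ab)//.
rewrite -(RI_oo_split LD a0 ab); move: (kin V 0) (\int[leb R]_s _) (\int[leb R]_s _) => k d1 d2; ring.
Qed.

End energy_equality.

Theorem theorem1p2 (R : realType) (nu T : R)
    (u : R -> R3 R -> R3 R) (Du : R -> R3 R -> 'M[R]_3) (p : R -> R3 R -> R)
    (nu_gt0 : 0 < nu) (T_gt0 : 0 < T)
    (u_lh : leray_hopf nu T u Du p)
    (u_reg : regular_before T u) :
  (type_I_space T u -> energy_equality nu T u Du) /\
  (type_I_time T u -> (hausdorff_dim (singular_set_final T u) < 1%:E)%E ->
     energy_equality nu T u Du).
Proof.
have [A [B [U [G [P [H LD dissG]]]]]] := slab_of_leray_hopf T_gt0 nu_gt0 u_lh.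
split; first exact: (energy_equality_type_I_space u_lh H LD dissG).
by move=> h _; exact: (energy_equality_type_I_time nu_gt0 T_gt0 u_lh H LD dissG h).
Qed.
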